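(* Let $g\geq1$, let $X$ be the genus $g$ hyperelliptic Riemann surface $y^2=p(x)$, where $p$ is a polynomial without multiple zeros, $\deg p=n$ with $n=2g+1$ or $n=2g+2$, and let $\mathcal{F}$ be the bundle of holomorphic fields of a meromorphic conformal field theory on $X$ with Virasoro field $T$ and central charge $c$. For $N\in\mathbb{N}$ let $S(x_1,\ldots,x_N)$ be the set of oriented graphs with vertices $x_1,\ldots,x_N$ (not necessarily connected, without edges from a vertex to itself), subject to the condition that every vertex has at most one ingoing and at most one outgoing line. Given a state $\langle\quad\rangle$ on $X$, there is a multilinear map $$\langle\quad\rangle_r:\ S_*(\mathcal{F})\to\mathbb{C},$$ normalised such that $\langle 1\rangle_r=\langle 1\rangle$, with the following properties: 1. For all $k\in\mathbb{N}$, $k\geq2$, and any $\varphi_2,\ldots,\varphi_k\in\{1,T\}$, $$\langle 1\,\varphi_2(z_2)\ldots\varphi_k(z_k)\rangle_r=\langle\varphi_2(z_2)\ldots\varphi_k(z_k)\rangle_r.$$ 2. For all $k\in\mathbb{N}$, $\langle\vartheta(x_1)\ldots\vartheta(x_k)\rangle_r$ is a polynomial in $x_1,\ldots,x_k$ and $y_1,\ldots,y_k$, where $$\vartheta(x):=T(x)\,p(x)-\frac{c}{32}\frac{[p'(x)]^2}{p(x)}\cdot1.$$ 3. For all $N\in\mathbb{N}$, writing $p_i=p(x_i)$, $$\langle T(x_1)\ldots T(x_N)\rangle\,p_1\ldots p_N=\sum_{\Gamma\in S(x_1,\ldots,x_N)}F(\Gamma),$$ where for $\Gamma\in S(x_1,\ldots,x_N)$,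 $$F(\Gamma):=\left(\frac{c}{2}\right)^{\sharp\text{loops}}\prod_{(x_i,x_j)\in\Gamma}\left(\frac14 f(x_i,x_j)\right)\left\langle\bigotimes_{k\in A_N\cap E_N^c}\vartheta(x_k)\bigotimes_{\ell\in(A_N\cup E_N)^c}T(x_\ell)p_\ell\right\rangle_r.$$ Here, for any oriented edge $(x_i,x_j)\in\Gamma$, $$f(x_i,x_j):=\left(\frac{y_i+y_j}{x_i-x_j}\right)^2,$$ $\sharp\text{loops}$ is the number of closed loops (oriented cycles) of $\Gamma$, and $A_N,E_N\subset\{1,\ldots,N\}$ are the subsets $$A_N:=\{i\,|\,\exists\, j\text{ such that }(x_i,x_j)\in\Gamma\},\qquad E_N:=\{j\,|\,\exists\, i\text{ such that }(x_i,x_j)\in\Gamma\},$$ and $(\ldots)^c$ denotes the complement in $\{1,\ldots,N\}$.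
   Context: **Conformal field theory setting.** A meromorphic conformal field theory consists of a graded complex vector space $F=\bigoplus_{h\in\mathbb{N}_0}F(h)$ of holomorphic fields, each $F(h)$ finite dimensional, $F(0)=\mathbb{C}\cdot 1$ spanned by the identity field $1$ (elements of $F(h)$ have dimension $h$), together with linear maps $N_m:F\otimes F\to F$, $m\in\mathbb{Z}$, of degree $m$ (i.e. $N_m(\varphi_1,\varphi_2)$ has dimension $m+h(\varphi_1)+h(\varphi_2)$), with $N_m(\varphi,1)=0$ for $m<0$, and $\partial\varphi:=N_1(\varphi,1)$. For every Riemann surface $X$ the fields form a vector bundle $\mathcal{F}$ over $X$ with fibre $F$, trivialised over every chart $(U,z)$; $\varphi(z)$ is the field $\varphi\in F$ at a point of $U$ in the trivialisation given by $z$. $S_*(\mathcal{F})$ denotes the restriction of the symmetric algebra of $\mathcal{F}$ (formed with external products $\boxtimes$ over $X^N$, $N\in\mathbb{N}$) to fibres away from the partial diagonals $\Delta_N=\{(z_1,\ldots,z_N)\in X^N\,|\,z_i=z_j\text{ for some }i\neq j\}$; i.e. its elements are symmetrised tensor products of fields at pairwise distinct points. A state on $X$ is a multilinear map $\langle\quad\rangle:S_*(\mathcal{F})\to\mathbb{C}$ such that (i) in any chart the $N$-point function $\langle\varphi_1(z_1)\ldots\varphi_N(z_N)\rangle$ is holomorphic in $(z_1,\ldots,z_N)$ off the partial diagonals; (ii) factors equal to the identity field can be omitted; (iii) it is compatible with the operator product expansion (OPE): for all $N\ge2$, $\langle\varphi_1(z_1)\varphi_2(z_2)\ldots\varphi_N(z_N)\rangle=\sum_{m\geq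 m_0}(z_1-z_2)^m\langle N_m(\varphi_1,\varphi_2)(z_2)\varphi_3(z_3)\ldots\varphi_N(z_N)\rangle$ as Laurent series about $z_1=z_2$, for some $m_0\in\mathbb{Z}$; and $\langle\partial\varphi(z)\ldots\rangle=\partial_z\langle\varphi(z)\ldots\rangle$. $\langle 1\rangle\in\mathbb{C}$ is the zero-point function. There is a Virasoro field $T\in F(2)$ with $N_{-1}(T,\varphi)=\partial\varphi$ for all $\varphi$; its OPE is, in any local coordinate, $$T(z)T(w)\mapsto\frac{c/2}{(z-w)^4}\,1+\frac{1}{(z-w)^2}(T(z)+T(w))+\Phi(w)+O(z-w),$$ where $c\in\mathbb{C}$ is the central charge and $\Phi=N_0(T,T)-\frac12\partial^2T$. Under a change of local coordinate $x\mapsto\hat x(x)$, the Virasoro field transforms (inside any $N$-point function) as $$\hat T(\hat x)\left[\frac{d\hat x}{dx}\right]^2=T(x)-\frac{c}{12}S(\hat x)\,1,\qquad S(f)=\frac{f'''}{f'}-\frac{3[f'']^2}{2[f']^2}.$$ **Hyperelliptic surface.** $X$ is compact, including the point(s) at $x=\infty$. The function $x$ is a local coordinate at finite points where $p\neq0$, $y$ is a local coordinate where $p'\neq0$; at infinity a local coordinate is $1/x$ if $n$ is even and $x^{-1/2}$ if $n$ is odd. $T(x)$ denotes the Virasoro field in the coordinate $x$; $\langle T(x_1)\ldots T(x_N)\rangle$ is a function of the points $(x_i,y_i)\in X$ with $y_i^2=p(x_i)$. The expressions $\langle\ldots\rangle_r$ involving $\vartheta(x)$ are expanded by multilinearity into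 those involving only $T$ and $1$. *)

(* Defs.v *)
(* MathComp / MathComp-Analysis. *)
From HB Require Import structures.
From mathcomp Require Export all_boot all_order all_algebra perm.
From mathcomp Require Export complex.
From mathcomp Require Export all_classical all_reals all_analysis.
From mathcomp Require mpoly.

Set Implicit Arguments.
Unset Strict Implicit.
Unset Printing Implicit Defensive.

Export Order.TTheory GRing.Theory Num.Theory.
Export numFieldNormedType.Exports.

Local Open Scope classical_set_scope.
Local Open Scope ring_scope.

(* R[i] packed as a numClosedFieldType, so that the topology and the normed
   module structure of numeric fields apply to it.  Derivatives of functions
   on [Cx R] are therefore complex derivatives. *)
Definition Cx (R : realType) : numClosedFieldType := R[i]%C.

Definition fcons (A : Type) (n : nat) (a : A) (f : 'I_n -> A) : 'I_n.+1 -> A :=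
  fun i => oapp f a (unlift ord0 i).

(* The space of fields with its operator product expansion. *)

Record meromorphicCFT (R : realType) := MeromorphicCFT {
  field_space :> lmodType (Cx R);
  homog : nat -> set field_space;        (* homog h = F(h) *)
  opeN : int -> field_space -> field_space -> field_space;
  one_field : field_space;
  virT : field_space;
  central_charge : Cx R;
  homog0 : forall h, homog h 0;
  homogP : forall h a u v, homog h u -> homog h v -> homog h (a *: u + v);
  homog_fin : forall h, exists (n : nat) (b : 'I_n -> field_space),
    (forall i, homog h (b i)) /\
    (forall u, homog h u -> exists a : 'I_n -> Cx R, u = \sum_i a i *: b i);
  homog_sum : forall u, exists (n : nat) (f : nat -> field_space),
    (forall h, homog h (f h)) /\ u = \sum_(h < n) f h;
  homog_direct : forall (n : nat) (f : nat -> field_space),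
    (forall h, homog h (f h)) -> \sum_(h < n) f h = 0 ->
    forall h, (h < n)%N -> f h = 0;
  one_neq0 : one_field <> 0;
  homog_0 : forall u, homog 0%N u <-> exists a, u = a *: one_field;
  opeN_linearl : forall m v, linear (fun u => opeN m u v);
  opeN_linearr : forall m u, linear (opeN m u);
  (* F(h) = 0 for h < 0 *)
  opeN_degree : forall (m : int) (h1 h2 : nat) u v, homog h1 u -> homog h2 v ->
    match (m + h1%:Z + h2%:Z)%R with
    | Posz h => homog h (opeN m u v)
    | Negz _ => opeN m u v = 0
    end;
  opeN_one : forall (m : int) u, m < 0 -> opeN m u one_field = 0;
  virT_homog : homog 2%N virT;
  virT_der : forall u, opeN (-1) virT u = opeN 1 u one_field;
  (* The coefficients of (z-w)^m, m < 0, in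
       c/2 (z-w)^-4 + (z-w)^-2 (T(z) + T(w)) + Phi(w) + O(z-w),
     with T(z) expanded at w.  The coefficient of (z-w)^0 is
     (1/2) d^2 T + Phi, which defines Phi. *)
  virT_ope_lt : forall m : int, m < -4 -> opeN m virT virT = 0;
  virT_ope4 : opeN (-4) virT virT = (central_charge / 2) *: one_field;
  virT_ope3 : opeN (-3) virT virT = 0;
  virT_ope2 : opeN (-2) virT virT = 2 *: virT;
  virT_ope1 : opeN (-1) virT virT = opeN 1 virT one_field }.

Definition fder (R : realType) (V : meromorphicCFT R) (u : V) : V :=
  opeN 1 u (one_field V).

(* The compact hyperelliptic surface y^2 = p(x), deg p = 2g+1 or 2g+2.  With
   u = 1/x and v = y / x^(g+1) the neighbourhood of infinity is the smooth
   affine curve v^2 = u^(2g+2) p(1/u), so that the points at infinity are the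
   v with v^2 = p_(2g+2): one point if deg p is odd, two if it is even. *)

Variant hpoint (R : realType) (g : nat) (p : {poly Cx R}) :=
| Finite (x y : Cx R) of y ^+ 2 == p.[x]
| Infinite (v : Cx R) of v ^+ 2 == p`_(2 * g + 2)%N.

Section Coordinates.
Context (R : realType) (g : nat) (p : {poly Cx R}).
Implicit Type P : hpoint g p.

Definition is_finite P := if P is Finite _ _ _ then true else false.

(* The values at infinity of xc and yc, and those of uc and vc over x = 0,
   are not used. *)
Definition xc P : Cx R := if P is Finite x _ _ then x else 0.
Definition yc P : Cx R := if P is Finite _ y _ then y else 0.
Definition uc P : Cx R := if P is Finite x _ _ then x^-1 else 0.
Definition vc P : Cx R :=
  match P with Finite x y _ => y / x ^+ g.+1 | Infinite v _ => v end.

(* The curves in the (x,y)- and (u,v)-planes are smooth, so a map into one of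
   them is holomorphic iff its two coordinates are. *)
Definition holo_at (f : Cx R -> hpoint g p) (z : Cx R) : Prop :=
  [/\ \forall w \near z, is_finite (f w),
      derivable (fun w => xc (f w)) z 1 &
      derivable (fun w => yc (f w)) z 1]
  \/
  [/\ \forall w \near z, is_finite (f w) -> xc (f w) != 0,
      derivable (fun w => uc (f w)) z 1 &
      derivable (fun w => vc (f w)) z 1].

(* A chart (U, z) is given by the inverse of its coordinate z, an injective
   holomorphic map from the open set z(U) of C onto U. *)
Record chart := Chart {
  dom : set (Cx R);
  param :> Cx R -> hpoint g p;
  dom_open : open dom;
  param_inj : forall z w, dom z -> dom w -> param z = param w -> z = w;
  param_holo : forall z, dom z -> holo_at param z }.

Definition x_chart (c : chart) : Prop :=
  forall z, dom c z -> is_finite (c z) /\ xc (c z) = z.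

(* Coordinates of N pairwise distinct points, the i-th one in the chart c i. *)
Definition admissible N (c : 'I_N -> chart) (z : 'I_N -> Cx R) : Prop :=
  (forall i, dom (c i) (z i)) /\ injective (fun i => c i (z i)).

End Coordinates.

(* [triv c P] is the isomorphism of F with the fibre at P given by the chart
   c; it is meaningful for P in the image of c. *)
Record field_bundle (R : realType) (V : meromorphicCFT R)
    (g : nat) (p : {poly Cx R}) := FieldBundle {
  fib : hpoint g p -> lmodType (Cx R);
  triv : chart g p -> forall P, V -> fib P;
  triv_linear : forall c z, dom c z -> linear (triv c (c z));
  triv_bij : forall c z, dom c z -> bijective (triv c (c z));
  (* The trivialisation only depends on the coordinate: it is compatible with
     restriction of charts. *)
  triv_local : forall c c' z, dom c z -> dom c' z ->
    (\forall w \near z, c w = c' w) -> triv c (c z) =1 triv c' (c z);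
  triv_transition : forall c c' z z' (phi : V),
    dom c z -> dom c' z' -> c z = c' z' ->
    exists (n : nat) (psi : 'I_n -> V) (a : 'I_n -> Cx R -> Cx R),
      \forall w \near z, (forall i, derivable (a i) w 1) /\
        triv c (c w) phi = \sum_i a i w *: triv c' (c w) (psi i);
  (* The identity field is a global section. *)
  triv_one : forall c c' z z', dom c z -> dom c' z' -> c z = c' z' ->
    triv c (c z) (one_field V) = triv c' (c z) (one_field V) }.

Section Correlators.
Context (R : realType) (V : meromorphicCFT R) (g : nat) (p : {poly Cx R}).
Context (B : field_bundle V g p).

(* Multilinear maps on S_*(F).  [corr] is only constrained on tuples P of
   pairwise distinct points; the value at N = 0 is the zero-point function. *)
Record correlator := Correlator {
  corr :> forall N (P : 'I_N -> hpoint g p), (forall i, fib B (P i)) -> Cx R;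
  corr_sym : forall N (P : 'I_N -> hpoint g p) v (s : 'S_N), injective P ->
    @corr N (fun i => P (s i)) (fun i => v (s i)) = @corr N P v;
  corr_linear : forall N (P : 'I_N -> hpoint g p) v i a u w, injective P ->
    @corr N P (dfwith v i (a *: u + w)) =
      a * @corr N P (dfwith v i u) + @corr N P (dfwith v i w) }.

(* <phi_1(z_1) ... phi_N(z_N)>, where phi_i(z_i) is taken in the chart c i *)
Definition npoint (s : correlator) N (c : 'I_N -> chart g p)
    (phi : 'I_N -> V) (z : 'I_N -> Cx R) : Cx R :=
  s N (fun i => c i (z i)) (fun i => triv B (c i) (c i (z i)) (phi i)).

Record state := State {
  state_corr :> correlator;
  state_holo : forall N c phi z, @admissible R g p N c z ->
    differentiable
      (fun w : 'rV[Cx R]_N => npoint state_corr c phi (fun i => w ord0 i))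
      (\row_i z i);
  state_one : forall N c z (cs : 'I_N -> chart g p) phis zs,
    admissible (fcons c cs) (fcons z zs) ->
    npoint state_corr (fcons c cs) (fcons (one_field V) phis) (fcons z zs) =
      npoint state_corr cs phis zs;
  (* w and z are the coordinates z_1 and z_2 of the first two points. *)
  state_ope : forall N c z phi1 phi2 (cs : 'I_N -> chart g p) phis zs,
    admissible (fcons c cs) (fcons z zs) ->
    exists m0 : int,
      (forall m : int, m < m0 -> opeN m phi1 phi2 = 0) /\
      \forall w \near z^',
        series (fun k : nat => (w - z) ^ (m0 + k%:Z) *
          npoint state_corr (fcons c cs)
            (fcons (opeN (m0 + k%:Z) phi1 phi2) phis) (fcons z zs)) @ \oo -->
        npoint state_corr (fcons c (fcons c cs))
          (fcons phi1 (fcons phi2 phis)) (fcons w (fcons z zs));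
  state_der : forall N c z phi (cs : 'I_N -> chart g p) phis zs,
    admissible (fcons c cs) (fcons z zs) ->
    is_derive z 1
      (fun w => npoint state_corr (fcons c cs) (fcons phi phis) (fcons w zs))
      (npoint state_corr (fcons c cs) (fcons (fder phi) phis) (fcons z zs)) }.

Definition schwarzian (f : Cx R -> Cx R) (x : Cx R) : Cx R :=
  derive1n 3 f x / derive1 f x
  - 3 * (derive1n 2 f x) ^+ 2 / (2 * (derive1 f x) ^+ 2).

(* f is the change of coordinates from the chart c to the chart c'. *)
Definition virasoro_covariant : Prop :=
  forall (s : state) (c c' : chart g p) (f : Cx R -> Cx R) (z : Cx R)
    N (cs : 'I_N -> chart g p) (phis : 'I_N -> V) (zs : 'I_N -> Cx R),
  admissible (fcons c cs) (fcons z zs) ->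
  (\forall w \near z, dom c' (f w) /\ c' (f w) = c w) ->
  npoint s (fcons c' cs) (fcons (virT V) phis) (fcons (f z) zs)
    * (derive1 f z) ^+ 2 =
  npoint s (fcons c cs) (fcons (virT V) phis) (fcons z zs)
    - central_charge V / 12 * schwarzian f z *
      npoint s (fcons c cs) (fcons (one_field V) phis) (fcons z zs).

(* T(x) p(x) and vartheta(x) = T(x) p(x) - c/32 p'(x)^2 / p(x) 1, as elements
   of the fibre, in an x-chart c; p(x) <> 0 holds in the domain of c. *)
Definition Tp (c : chart g p) (x : Cx R) : fib B (c x) :=
  p.[x] *: triv B c (c x) (virT V).

Definition vartheta (c : chart g p) (x : Cx R) : fib B (c x) :=
  Tp c x - (central_charge V / 32 * (p^`()).[x] ^+ 2 / p.[x]) *: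
             triv B c (c x) (one_field V).

(* f = ((y1 + y2) / (x1 - x2))^2.  At the two points (x, y), (x, -y) over the
   same x this is 0/0, and f has the limit given in the first branch, since
   (y1 + y2) / (x1 - x2) = (p(x1) - p(x2)) / ((x1 - x2) (y1 - y2)). *)
Definition edge_fun (P Q : hpoint g p) : Cx R :=
  if xc P == xc Q then ((p^`()).[xc P] / (yc P - yc Q)) ^+ 2
  else ((yc P + yc Q) / (xc P - xc Q)) ^+ 2.

End Correlators.

Section Graphs.
Local Open Scope nat_scope.
Context (N : nat).
Implicit Type G : {set 'I_N * 'I_N}.

Definition admissible_graphs : {set {set 'I_N * 'I_N}} :=
  [set G : {set 'I_N * 'I_N} |
    [&& [forall i, (i, i) \notin G],
        [forall i, #|[set j | (i, j) \in G]%SET| <= 1] &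
        [forall j, #|[set i | (i, j) \in G]%SET| <= 1]]]%SET.

Definition tails G : {set 'I_N} := [set i | [exists j, (i, j) \in G]]%SET.
Definition heads G : {set 'I_N} := [set j | [exists i, (i, j) \in G]]%SET.

(* An oriented cycle is identified with its set of edges. *)
Definition nloops G : nat :=
  #|[set L : {set 'I_N * 'I_N} |
      `[< exists s : seq 'I_N,
          [/\ s != [::], ucycle (fun i j => (i, j) \in G) s
            & L = [set (i, next s i) | i in s]%SET] >]]%SET|.

End Graphs.

Definition graph_term (R : realType) (V : meromorphicCFT R) (g : nat)
    (p : {poly Cx R}) (B : field_bundle V g p) (r : correlator B)
    (N : nat) (c : 'I_N -> chart g p) (x : 'I_N -> Cx R)
    (G : {set 'I_N * 'I_N}) : Cx R :=
  let A := tails G in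
  let E := heads G in
  let K := ((A :&: ~: E) :|: ~: (A :|: E))%SET in
  let k_ := fun k : 'I_#|K| => enum_val k in
  (central_charge V / 2) ^+ nloops G
  * (\prod_(e in G) (4^-1 * edge_fun (c e.1 (x e.1)) (c e.2 (x e.2))))
  * r #|K| (fun k => c (k_ k) (x (k_ k)))
      (fun k => if k_ k \in (A :&: ~: E)%SET
                then vartheta B (c (k_ k)) (x (k_ k))
                else Tp B (c (k_ k)) (x (k_ k))).

(* Main.v *)
(** Property 3 is an inversion formula.  If graphs are allowed to have loops from a
    vertex to itself, weighted by p'^2 / (16 p), then every [T p] may be replaced by
    [vartheta], and the formula expresses W = <T...T> p...p as the sum, over all partial
    injections G of the points, of (c/2)^cycles times the edge weights times
    <vartheta...vartheta>_r on the points that are not heads of G.  The empty graph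
    contributes <vartheta...vartheta>_r itself, which is therefore defined by recursion;
    <...>_r is then fixed on each fibre by two linear forms dual to 1 and [vartheta].

    It remains to see that H = <vartheta...vartheta>_r is polynomial.  As a function of
    one point it is holomorphic away from the others and from the branch points.  Cutting
    the graphs at the edges between two points a, b shows that the double poles of W at
    a = b cancel, because in_a out_b + in_b out_a - in_a out_a - in_b out_b is a product of
    two differences.  Near a branch point, W minus its loop term is bounded by the
    transformation law of T in the coordinate y, and near infinity T is bounded.  By
    Liouville's theorem, applied to the sums of H and y H over the two sheets,
    H = a(x) + y b(x) with polynomials a, b of uniformly bounded degree, and interpolation
    makes this joint in all the points. *)

(* The main obstacle is local: [H] has to be bounded at every point before a global argument
   applies, also where two arguments meet and the recursion has poles of order up to four. The pole
   of order four, with coefficient c/2, is matched by the 2-cycle on the two points. The pole of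
   order two, with coefficient T(z) + T(w), is matched by the single edges in both directions, whose
   contraction yields W with one point fewer. The loop weights p'^2/(16 p) cancel what the 2-cycle
   leaves in order two. The constant c/32 is c/12 times 3/8, since 3/(8 t^2) is the Schwarzian of
   the square root. Holomorphy enters only as an expansion of order two with bounded remainder
   ([T2]). The OPE with the identity field provides it for N-point functions, and the maximum
   argument behind the Liouville theorem uses just this much; at exceptional points boundedness
   suffices. If T = 0, then c = 0 and [vartheta] is zero, so no linear form can be 1 on it; there
   the recursion itself gives zero for every nonempty set of points. *)
Require Import Defs.
From mathcomp Require Import ring lra zify.

Set Implicit Arguments.
Unset Strict Implicit.
Unset Printing Implicit Defensive.
Local Open Scope ring_scope.

(** * Cycles of partial injections *)

Module Graph.
Local Open Scope set_scope.
Local Open Scope nat_scope.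
Import mathcomp.boot.fintype mathcomp.boot.finset.

Section Graph.
Context {T : finType}.
Implicit Types (s t : {set T * T}) (A B I : {set T}).

(** Both degree bounds of a vertex in one symmetric condition, so that ingoing and outgoing edges
    are handled by a single hypothesis. *)
Definition pinj s :=
  [forall e in s, [forall e' in s, (e.1 == e'.1) == (e.2 == e'.2)]].

Lemma pinjP s : reflect (forall i j i' j', (i, j) \in s -> (i', j') \in s ->
  (i == i') = (j == j')) (pinj s).
Proof.
apply: (iffP idP) => [H i j i' j' h h'|H].
  by move/forall_inP/(_ _ h)/forall_inP/(_ _ h')/eqP: H.
apply/forall_inP => -[i j] h; apply/forall_inP => -[i' j'] h' /=.
by rewrite (H _ _ _ _ h h').
Qed.

Lemma pinj_fun s i j j' : pinj s -> (i, j) \in s -> (i, j') \in s -> j = j'.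
Proof. by move=> /pinjP H h h'; apply/eqP; rewrite -(H _ _ _ _ h h') eqxx. Qed.

Lemma pinj_inj s i i' j : pinj s -> (i, j) \in s -> (i', j) \in s -> i = i'.
Proof. by move=> /pinjP H h h'; apply/eqP; rewrite (H _ _ _ _ h h') eqxx. Qed.

Lemma pinj_sub s t : s \subset t -> pinj t -> pinj s.
Proof.
move=> /subsetP st /pinjP H; apply/pinjP => i j i' j' h h'.
by apply: H; apply: st.
Qed.

Definition hds s : {set T} := [set e.2 | e in s].
Definition tls s : {set T} := [set e.1 | e in s].

Lemma hdsP s j : reflect (exists i, (i, j) \in s) (j \in hds s).
Proof.
apply: (iffP imsetP) => [[[i j'] h -> /=]|[i h]]; first by exists i.
by exists (i, j).
Qed.

Lemma tlsP s i : reflect (exists j, (i, j) \in s) (i \in tls s).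
Proof.
apply: (iffP imsetP) => [[[i' j] h -> /=]|[j h]]; first by exists j.
by exists (i, j).
Qed.

Definition partial_inj I s := pinj s && (s \subset setX I I).

Lemma partial_inj_mem I s i j : partial_inj I s -> (i, j) \in s -> i \in I /\ j \in I.
Proof. by case/andP => _ /subsetP H /H; rewrite in_setX => /andP. Qed.

Lemma partial_injP I s : reflect (pinj s /\ forall i j, (i, j) \in s -> i \in I /\ j \in I)
  (partial_inj I s).
Proof.
apply: (iffP andP) => -[ps H]; split=> //.
  by move=> i j /(subsetP H); rewrite in_setX => /andP.
by apply/subsetP => -[i j] /H[h1 h2]; rewrite in_setX h1.
Qed.

(** In a partial injection these are the nonempty unions of vertex sets of cycles. Working with
    vertex sets avoids cyclic sequences, which are only determined up to rotation. *)
Definition balanced s B :=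
  (B != set0) && [forall i in B, [exists j in B, (i, j) \in s] && [exists j in B, (j, i) \in s]].

Lemma balancedP s B : reflect [/\ B != set0,
   forall i, i \in B -> exists2 j, j \in B & (i, j) \in s &
   forall i, i \in B -> exists2 j, j \in B & (j, i) \in s] (balanced s B).
Proof.
apply: (iffP andP) => [[B0 /forall_inP H]|[B0 H1 H2]]; split=> //.
- by move=> i /H/andP[/exists_inP[j jB h] _]; exists j.
- by move=> i /H/andP[_ /exists_inP[j jB h]]; exists j.
- apply/forall_inP => i iB; apply/andP; split; apply/exists_inP.
    by have [j] := H1 i iB; exists j.
  by have [j] := H2 i iB; exists j.
Qed.

(* The minimal balanced vertex sets of a partial injection are the vertex sets
   of its cycles. *)
Definition cyc s := #|[set B | minset (balanced s) B]|.

(** Serves the case T = 0: a graph in which every vertex is a head contains a cycle, hence carries a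
    power of c/2 = 0. *)
Lemma balanced_setT s : hds s = setT -> tls s = setT -> 0 < #|T| -> balanced s setT.
Proof.
move=> hs ts T0; apply/balancedP; split.
- by rewrite -card_gt0 cardsT.
- by move=> i _; have /tlsP[j h] : i \in tls s; [rewrite ts inE|exists j].
- by move=> i _; have /hdsP[j h] : i \in hds s; [rewrite hs inE|exists j].
Qed.

Lemma cyc_gt0 s B : balanced s B -> 0 < cyc s.
Proof.
move=> bB; have [A minA _] := minset_exists bB.
by apply/card_gt0P; exists A; rewrite inE.
Qed.

End Graph.

(** Monotone maps that are mutually inverse on the two families match the inclusion-minimal members.
    The transport of the cycle count along a relabelling and along a contraction are both
    instances. *)
Lemma card_minset_iso (T T' : finType) (F : pred {set T}) (F' : pred {set T'})
    (phi : {set T} -> {set T'}) (psi : {set T'} -> {set T}) :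
  (forall B, F B -> F' (phi B)) -> (forall B, F' B -> F (psi B)) ->
  (forall B, F B -> psi (phi B) = B) -> (forall B, F' B -> phi (psi B) = B) ->
  {homo phi : A B / A \subset B} -> {homo psi : A B / A \subset B} ->
  #|[set B | minset F B]| = #|[set B | minset F' B]|.
Proof.
move=> hphi hpsi K K' mphi mpsi.
rewrite -(card_in_imset (f := phi)); last first.
  move=> A B; rewrite !inE => /minsetP[FA _] /minsetP[FB _] E.
  by rewrite -(K _ FA) E K.
congr #|pred_of_set _|; apply/setP => B; rewrite inE; apply/imsetP/idP.
- case=> A; rewrite inE => /minsetP[FA mA] ->.
  apply/minsetP; split; first exact: hphi.
  move=> B' FB' /mpsi; rewrite K // => sub.
  by rewrite -(mA _ (hpsi _ FB') sub) K'.
- move=> /minsetP[FB mB]; exists (psi B); last by rewrite K'.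
  rewrite inE; apply/minsetP; split; first exact: hpsi.
  move=> A FA /mphi; rewrite K' // => sub.
  by rewrite -(mB _ (hphi _ FA) sub) K.
Qed.

(** * Invariance under injective renaming of vertices *)

Section Relabel.
Context {T T' : finType} (f : T -> T') (f_inj : injective f).
Implicit Types (I : {set T}) (s : {set T * T}).

Definition relabel s : {set T' * T'} := [set (f e.1, f e.2) | e in s].

Lemma relabel_pair_inj : injective (fun e : T * T => (f e.1, f e.2)).
Proof. by move=> [i j] [i' j'] [/f_inj-> /f_inj->]. Qed.

Lemma mem_relabel s i j : ((f i, f j) \in relabel s) = ((i, j) \in s).
Proof. exact: (mem_imset s (i, j) relabel_pair_inj). Qed.

Lemma relabelP s x y : (x, y) \in relabel s ->
  exists i j, [/\ x = f i, y = f j & (i, j) \in s].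
Proof. by case/imsetP => -[i j] h [-> ->]; exists i, j. Qed.

Lemma pinj_relabel s : pinj (relabel s) = pinj s.
Proof.
apply/pinjP/pinjP => H.
- move=> i j i' j' h h'; rewrite -(inj_eq f_inj i) -(inj_eq f_inj j).
  by apply: H; rewrite mem_relabel.
- move=> x y x' y' /relabelP[i [j [-> -> h]]] /relabelP[i' [j' [-> -> h']]].
  by rewrite !(inj_eq f_inj); apply: H.
Qed.

Lemma partial_inj_relabel I s : partial_inj (f @: I) (relabel s) = partial_inj I s.
Proof.
apply/partial_injP/partial_injP; rewrite pinj_relabel => -[ps H]; split=> //.
- move=> i j h; have := H (f i) (f j); rewrite mem_relabel => /(_ h).
  by rewrite !mem_imset.
- by move=> x y /relabelP[i [j [-> -> /H]]]; rewrite !mem_imset.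
Qed.

Lemma hds_relabel s : hds (relabel s) = f @: hds s.
Proof. by rewrite /hds /relabel -!imset_comp. Qed.

Lemma cyc_relabel s : cyc (relabel s) = cyc s.
Proof.
symmetry; apply: (card_minset_iso (phi := fun B => f @: B) (psi := fun B => f @^-1: B)).
- move=> B /balancedP[B0 H1 H2]; apply/balancedP; split.
  + by rewrite imset_eq0.
  + by move=> x /imsetP[i /H1[j jB h] ->]; exists (f j); rewrite ?mem_relabel ?imset_f.
  + by move=> x /imsetP[i /H2[j jB h] ->]; exists (f j); rewrite ?mem_relabel ?imset_f.
- move=> B /balancedP[B0 H1 H2]; apply/balancedP; split.
  + have [x xB] := set0Pn _ B0; have [y _ /relabelP[i [j [E _ _]]]] := H1 x xB.
    by apply/set0Pn; exists i; rewrite inE -E.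
  + move=> i; rewrite inE => /H1[y yB h]; have [i' [j [E1 E2 h']]] := relabelP h.
    by exists j; rewrite ?inE -?E2 //; rewrite (f_inj E1).
  + move=> i; rewrite inE => /H2[y yB h]; have [i' [j [E1 E2 h']]] := relabelP h.
    by exists i'; rewrite ?inE -?E1 //; rewrite (f_inj E2).
- by move=> B _; apply/setP => i; rewrite inE mem_imset.
- move=> B /balancedP[B0 H1 H2]; apply/setP => x; apply/imsetP/idP.
    by case=> i; rewrite inE => h ->.
  move=> xB; have [y _ /relabelP[i [j [E _ _]]]] := H1 x xB.
  by exists i; rewrite ?inE -?E.
- by move=> A B AB; apply: imsetS.
- by move=> A B AB; apply: preimsetS.
Qed.

Lemma relabel_preim I (s' : {set T' * T'}) : partial_inj (f @: I) s' ->
  relabel [set e | (f e.1, f e.2) \in s'] = s'.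
Proof.
move=> ps; apply/setP => -[x y]; apply/idP/idP.
  by move=> /relabelP[i [j [-> ->]]]; rewrite inE.
move=> h; have [/imsetP[i iI E1] /imsetP[j jI E2]] := partial_inj_mem ps h.
by rewrite E1 E2 mem_relabel inE /= -E1 -E2.
Qed.

Lemma sum_relabel (V : nmodType) I (P : pred {set T' * T'}) (F : {set T' * T'} -> V) :
  (\sum_(s | partial_inj (f @: I) s && P s) F s =
   \sum_(s | partial_inj I s && P (relabel s)) F (relabel s))%R.
Proof.
rewrite (reindex_onto relabel (fun s' : {set T' * T'} => [set e | (f e.1, f e.2) \in s'])); last first.
  by move=> s' /andP[ps _]; apply: relabel_preim ps.
apply: eq_bigl => s; rewrite partial_inj_relabel.
have -> : [set e | (f e.1, f e.2) \in relabel s] == s.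
  by apply/eqP/setP => -[i j]; rewrite inE /= mem_relabel.
by rewrite andbT.
Qed.

Lemma prod_relabel (V : comPzSemiRingType) s (w : T' * T' -> V) :
  (\prod_(e in relabel s) w e = \prod_(e in s) w (f e.1, f e.2))%R.
Proof. by rewrite big_imset //= => e e' _ _; apply: relabel_pair_inj. Qed.

End Relabel.

(** * Adding a disjoint cycle *)

Section AddCycle.
Context {T : finType}.
Implicit Types (s t : {set T * T}) (A B I : {set T}).

(** A balanced set of [s] misses [B], since no edge of [s] touches [B]. A balanced set of the union
    that meets [B] meets it in a balanced set of [t], hence contains [B]. So the minimal balanced
    sets of the union are those of [s] together with [B]. *)
Lemma cyc_add s t B : (forall i j, (i, j) \in s -> i \notin B /\ j \notin B) ->
  balanced t B -> (forall B', balanced t B' -> B \subset B') ->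
  (forall i j, (i, j) \in t -> i \in B /\ j \in B) ->
  cyc (s :|: t) = (cyc s).+1.
Proof.
move=> sB bB minB tB.
have bB' : balanced (s :|: t) B.
  move/balancedP: bB => [B0 H1 H2]; apply/balancedP; split=> // i iB.
    by have [j jB h] := H1 i iB; exists j; rewrite // inE h orbT.
  by have [j jB h] := H2 i iB; exists j; rewrite // inE h orbT.
have disj A : balanced s A -> [disjoint A & B].
  move=> /balancedP[_ H _]; apply/pred0P => i /=; apply/negP => /andP[/H[j _ /sB[]]].
  by move=> /negP h _.
have old A : [disjoint A & B] -> balanced (s :|: t) A -> balanced s A.
  move=> dAB /balancedP[A0 H1 H2]; apply/balancedP; split=> // i iA.
    have [j jA] := H1 i iA; rewrite inE => /orP[h|/tB[iB _]]; first by exists j.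
    by have := disjointFr dAB iA; rewrite iB.
  have [j jA] := H2 i iA; rewrite inE => /orP[h|/tB[_ iB]]; first by exists j.
  by have := disjointFr dAB iA; rewrite iB.
have new A : balanced s A -> balanced (s :|: t) A.
  move/balancedP => [A0 H1 H2]; apply/balancedP; split=> // i iA.
    by have [j jA h] := H1 i iA; exists j; rewrite // inE h.
  by have [j jA h] := H2 i iA; exists j; rewrite // inE h.
have meets A : ~~ [disjoint A & B] -> balanced (s :|: t) A -> B \subset A.
  move=> nd /balancedP[A0 H1 H2]; apply: subset_trans (subsetIl A B).
  apply: minB; apply/balancedP; split; first by rewrite setI_eq0.
  - move=> i; rewrite inE => /andP[iA iB]; have [j jA] := H1 i iA.
    rewrite inE => /orP[/sB[/negP]//|h]; exists j => //.
    by rewrite inE jA; case: (tB _ _ h).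
  - move=> i; rewrite inE => /andP[iA iB]; have [j jA] := H2 i iA.
    rewrite inE => /orP[/sB[_ /negP]//|h]; exists j => //.
    by rewrite inE jA; case: (tB _ _ h).
rewrite /cyc -(add1n #|_|) -(cards1 B) -cardsUI.
have -> : [set B] :&: [set A | minset (balanced s) A] = set0.
  apply/setP => A; rewrite !inE; apply/negP => /andP[/eqP-> /minsetP[/disj]].
  rewrite -setI_eq0 setIid => /eqP E; move/balancedP: bB => [].
  by rewrite E eqxx.
rewrite cards0 addn0; congr #|pred_of_set _|; apply/setP => A; rewrite !inE.
apply/idP/idP.
- move=> /minsetP[bA mA]; case: (boolP [disjoint A & B]) => dAB.
    apply/orP; right; apply/minsetP; split; first exact: old.
    by move=> A' /new bA'; apply: mA.
  by apply/orP; left; rewrite (mA B bB' (meets A dAB bA)).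
- case/orP => [/eqP->|/minsetP[bA mA]]; apply/minsetP; split=> //.
  + move=> A' bA sA; apply/eqP; rewrite eqEsubset sA meets //.
    rewrite -setI_eq0 (setIidPl sA); by case/balancedP: bA.
  + exact: new.
  + move=> A' bA' sA'; apply: mA => //; apply: old => //.
    exact: disjointWl sA' (disj A bA).
Qed.

Lemma cyc_loop s a : (forall i j, (i, j) \in s -> i != a /\ j != a) ->
  cyc ((a, a) |: s) = (cyc s).+1.
Proof.
move=> sa; rewrite setUC; apply: (@cyc_add _ _ [set a]).
- by move=> i j /sa[]; rewrite !inE.
- apply/balancedP; split.
  + by apply/set0Pn; exists a; rewrite inE.
  + by move=> i; rewrite inE => /eqP->; exists a; rewrite inE.
  + by move=> i; rewrite inE => /eqP->; exists a; rewrite inE.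
- move=> B /balancedP[/set0Pn[i iB] H _]; rewrite sub1set.
  have [j jB] := H i iB; rewrite inE => /eqP[_ ja]; by rewrite -ja.
- by move=> i j; rewrite !inE => /eqP[-> ->]; rewrite eqxx.
Qed.

Lemma cyc_loop2 s a b : (forall i j, (i, j) \in s ->
    (i != a /\ i != b) /\ (j != a /\ j != b)) ->
  cyc ((a, b) |: ((b, a) |: s)) = (cyc s).+1.
Proof.
move=> sab; rewrite setUA setUC; apply: (@cyc_add _ _ [set a; b]).
- by move=> i j /sab[[h1 h2] [h3 h4]]; rewrite !inE !negb_or h1 h2 h3 h4.
- apply/balancedP; split.
  + by apply/set0Pn; exists a; rewrite !inE eqxx.
  + move=> i; rewrite !inE => /orP[] /eqP->.
      by exists b; rewrite !inE eqxx ?orbT.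
    by exists a; rewrite !inE eqxx ?orbT.
  + move=> i; rewrite !inE => /orP[] /eqP->.
      by exists b; rewrite !inE eqxx ?orbT.
    by exists a; rewrite !inE eqxx ?orbT.
- move=> B /balancedP[/set0Pn[i iB] H _]; apply/subsetP.
  have ab j k : j \in B -> (j, k) \in [set (a, b); (b, a)] -> (j == a) && (k == b) || (j == b) && (k == a).
    by rewrite !inE.
  have aB : (a \in B) && (b \in B).
    have [j jB h] := H i iB; move: (ab _ _ iB h).
    by case/orP => /andP[/eqP E1 /eqP E2]; rewrite -E1 -E2 iB jB.
  by move=> j; rewrite !inE; case/andP: aB => h1 h2 /orP[] /eqP->.
- move=> i j; rewrite !inE => /orP[] /eqP[-> ->]; by rewrite !eqxx ?orbT.
Qed.

End AddCycle.

(** * Weighted sums over partial injections, and contraction of an edge *)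

Section GraphSum.
Context {T : finType} (K : comNzRingType).
Implicit Types (s t : {set T * T}) (B I J : {set T}).
Local Open Scope ring_scope.

Definition weight (al : K) (w : T -> T -> K) s : K :=
  al ^+ cyc s * \prod_(e in s) w e.1 e.2.

(** [ga] stands for the correlator of [vartheta] on the vertices that are not heads. It stays
    abstract, so the identities below are purely combinatorial. *)
Definition graph_sum (al : K) (w : T -> T -> K) (ga : {set T} -> K)
    (P : pred {set T * T}) I : K :=
  \sum_(s | partial_inj I s && P s) weight al w s * ga (I :\: hds s).

Context (al : K) (w : T -> T -> K) (ga : {set T} -> K).

(** A loop takes up both the ingoing and the outgoing slot of [a], so the rest of the graph lives on
    the other vertices; [al] is the factor of the removed cycle. *)
Lemma graph_sum_loop I a : a \in I ->
  graph_sum al w ga (fun s => (a, a) \in s) I =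
  al * w a a * graph_sum al w ga predT (I :\ a).
Proof.
move=> aI; rewrite /graph_sum (reindex_onto (fun t => (a, a) |: t) (fun s => s :\ (a, a))); last first.
  by move=> s /andP[_ h]; rewrite setD1K.
have E t : (partial_inj I ((a, a) |: t) && ((a, a) \in (a, a) |: t) && (((a, a) |: t) :\ (a, a) == t))
    = partial_inj (I :\ a) t && predT t.
  rewrite setU11 !andbT; apply/andP/idP.
  - case=> /partial_injP[ps H] /eqP h.
    have at_ : (a, a) \notin t by rewrite -h !inE eqxx.
    apply/partial_injP; split; first by apply: pinj_sub ps; apply: subsetUr.
    move=> i j ij; have ij' : (i, j) \in (a, a) |: t by rewrite inE ij orbT.
    have [iI jI] := H i j ij'; have aa : (a, a) \in (a, a) |: t by rewrite setU11.
    rewrite !inE iI jI !andbT; split; apply/eqP => E; subst.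
      by have E := pinj_fun ps ij' aa; subst; rewrite ij in at_.
    by have E := pinj_inj ps ij' aa; subst; rewrite ij in at_.
  - case/partial_injP => ps H.
    have at_ : (a, a) \notin t by apply/negP => /H[]; rewrite !inE eqxx.
    split; last by rewrite setU1K.
    apply/partial_injP; split; last first.
      by move=> i j; rewrite !inE => /orP[/eqP[-> ->] //|/H[]]; rewrite !inE => /andP[_ ->] /andP[_ ->].
    apply/pinjP => i j i' j'; rewrite !inE => /orP[/eqP[-> ->]|h] /orP[/eqP[-> ->]|h'].
    + by rewrite !eqxx.
    + by have [] := H _ _ h'; rewrite !inE ![a == _]eq_sym => /andP[/negPf-> _] /andP[/negPf-> _].
    + by have [] := H _ _ h; rewrite !inE => /andP[/negPf-> _] /andP[/negPf-> _].
    + by move/pinjP: ps => ps; apply: ps.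
rewrite (eq_bigl _ _ E) big_distrr /=; apply: eq_bigr => t; rewrite andbT => /partial_injP[ps H].
have at_ : (a, a) \notin t by apply/negP => /H[]; rewrite !inE eqxx.
have -> : I :\: hds ((a, a) |: t) = I :\ a :\: hds t.
  by rewrite /hds imsetU1 /= setDDl.
rewrite /weight cyc_loop ?big_setU1 //=; last first.
  by move=> i j /H[]; rewrite !inE => /andP[-> _] /andP[-> _].
rewrite exprS; move: (al ^+ _) (\prod_(_ in _) _) (ga _) => x y z; ring.
Qed.

(** As for a loop: the 2-cycle saturates both of its vertices. *)
Lemma graph_sum_loop2 I a b : a \in I -> b \in I -> a != b ->
  graph_sum al w ga (fun s => ((a, b) \in s) && ((b, a) \in s)) I =
  al * w a b * w b a * graph_sum al w ga predT (I :\ a :\ b).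
Proof.
move=> aI bI ab; have ba : b != a by rewrite eq_sym.
have nab : (a, b) != (b, a) by rewrite xpair_eqE negb_and ab.
rewrite /graph_sum (reindex_onto (fun t => (a, b) |: ((b, a) |: t))
   (fun s => s :\ (a, b) :\ (b, a))); last first.
  move=> s /andP[_ /andP[h1 h2]].
  by rewrite [(b, a) |: _]setD1K ?setD1K // !inE h2 andbT eq_sym.
have E t : (partial_inj I ((a, b) |: ((b, a) |: t)) &&
      (((a, b) \in (a, b) |: ((b, a) |: t)) && ((b, a) \in (a, b) |: ((b, a) |: t))) &&
      (((a, b) |: ((b, a) |: t)) :\ (a, b) :\ (b, a) == t))
    = partial_inj (I :\ a :\ b) t && predT t.
  rewrite setU11 setU1r ?setU11 // !andbT; apply/andP/idP.
  - case=> /partial_injP[ps H] /eqP h.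
    have at_ : (a, b) \notin t by rewrite -h !inE eqxx andbF.
    have bt_ : (b, a) \notin t by rewrite -h !inE eqxx.
    apply/partial_injP; split.
      by apply: pinj_sub ps; apply: subset_trans (subsetUr _ _) (subsetUr _ _).
    move=> i j ij; have ij' : (i, j) \in (a, b) |: ((b, a) |: t) by rewrite !inE ij !orbT.
    have [iI jI] := H i j ij'.
    have hab : (a, b) \in (a, b) |: ((b, a) |: t) by rewrite setU11.
    have hba : (b, a) \in (a, b) |: ((b, a) |: t) by rewrite setU1r // setU11.
    rewrite !inE iI jI !andbT; split; apply/andP; split; apply/eqP => E; subst.
    + by have E := pinj_fun ps ij' hba; subst; rewrite ij in bt_.
    + by have E := pinj_fun ps ij' hab; subst; rewrite ij in at_.
    + by have E := pinj_inj ps ij' hab; subst; rewrite ij in at_.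
    + by have E := pinj_inj ps ij' hba; subst; rewrite ij in bt_.
  - case/partial_injP => ps H.
    have at_ : (a, b) \notin t by apply/negP => /H[]; rewrite !inE eqxx /= ?andbF.
    have bt_ : (b, a) \notin t by apply/negP => /H[]; rewrite !inE eqxx /= ?andbF.
    split; last by rewrite !setU1K // !inE negb_or nab at_.
    apply/partial_injP; split; last first.
      move=> i j; rewrite !inE => /orP[/eqP[-> ->] //|/orP[/eqP[-> ->] //|/H[]]].
      by rewrite !inE => /andP[_ /andP[_ ->]] /andP[_ /andP[_ ->]].
    have Hn i j : (i, j) \in t -> [/\ i != a, i != b, j != a & j != b].
      by move=> /H[]; rewrite !inE => /andP[-> /andP[-> _]] /andP[-> /andP[-> _]].
    apply/pinjP => i j i' j'; rewrite !inE.
    case/orP=> [/eqP[-> ->]|/orP[/eqP[-> ->]|h]]; case/orP=> [/eqP[-> ->]|/orP[/eqP[-> ->]|h']];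
      rewrite ?eqxx ?(negPf ab) ?(negPf ba) //.
    + by have [/negPf h1 /negPf h2 /negPf h3 /negPf h4] := Hn _ _ h'; rewrite ![_ == i']eq_sym ![_ == j']eq_sym h1 h4.
    + by have [/negPf h1 /negPf h2 /negPf h3 /negPf h4] := Hn _ _ h'; rewrite ![_ == i']eq_sym ![_ == j']eq_sym h2 h3.
    + by have [/negPf h1 /negPf h2 /negPf h3 /negPf h4] := Hn _ _ h; rewrite h1 h4.
    + by have [/negPf h1 /negPf h2 /negPf h3 /negPf h4] := Hn _ _ h; rewrite h2 h3.
    + by move/pinjP: ps => ps; apply: ps.
rewrite (eq_bigl _ _ E) big_distrr /=; apply: eq_bigr => t; rewrite andbT => /partial_injP[ps H].
have at_ : (a, b) \notin t by apply/negP => /H[]; rewrite !inE eqxx /= ?andbF.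
have bt_ : (b, a) \notin t by apply/negP => /H[]; rewrite !inE eqxx /= ?andbF.
have -> : I :\: hds ((a, b) |: ((b, a) |: t)) = I :\ a :\ b :\: hds t.
  by rewrite /hds !imsetU1 /= !setDDl setUCA.
rewrite /weight cyc_loop2 ?big_setU1 //=; first by rewrite exprS; move: (al ^+ _) (\prod_(_ in _) _) (ga _) => x y z; ring.
  by rewrite !inE negb_or nab.
by move=> i j /H[]; rewrite !inE => /andP[-> /andP[-> _]] /andP[-> /andP[-> _]].
Qed.

Definition subst_at (b u x : T) := if x == b then u else x.

(* [t] lives on [I :\ a]; its vertex [b] stands for the pair of consecutive
   vertices [a -> b]. *)
Definition expand (a b : T) t : {set T * T} :=
  (a, b) |: [set (e.1, subst_at b a e.2) | e in t].

(** The edge into [a] becomes the edge into [b], and [a -> b] disappears. An edge [b -> a] would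
    turn into a loop at [b]; this is why the bijection with [expand] excludes [b -> a] on one side
    and the loop on the other. *)
Definition contract (a b : T) s : {set T * T} :=
  [set e | [&& e.1 != a, e.2 != a & if e.2 == b then (e.1, a) \in s else e \in s]].

Section Contraction.
Context (I : {set T}) (a b : T) (aI : a \in I) (bI : b \in I) (ab : a != b).

Let ba : (b == a) = false. Proof. by apply/negbTE; rewrite eq_sym. Qed.

Lemma mem_expand t i j : partial_inj (I :\ a) t ->
  ((i, j) \in expand a b t) =
  if j == b then i == a else if j == a then (i, b) \in t else (i, j) \in t.
Proof.
move=> pt; rewrite !inE xpair_eqE.
have Hn k l : (k, l) \in t -> k != a /\ l != a.
  by case/(partial_inj_mem pt); rewrite !inE => /andP[-> _] /andP[-> _].
case: (eqVneq j b) => [->|jb].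
  rewrite andbT; case: (eqVneq i a) => //= ia; apply/negbTE/imsetP.
  case=> -[k l] h [_]; rewrite /subst_at /=; case: eqP => [_ E|lb E]; last exact: lb.
  by move: ab; rewrite E eqxx.
rewrite andbF /=; case: (eqVneq j a) => [->|ja].
  apply/imsetP/idP => [[[k l] h [-> ]]|h].
    rewrite /subst_at /=; case: eqP => [E _|_ E]; first by rewrite -E.
    by case: (Hn _ _ h); rewrite E eqxx.
  by exists (i, b) => //; rewrite /subst_at eqxx.
apply/imsetP/idP => [[[k l] h [-> ]]|h].
  by rewrite /subst_at /=; case: eqP => [_ E|_ ->//]; case/eqP: ja.
by exists (i, j) => //; rewrite /subst_at /= (negPf jb).
Qed.

Lemma subst_at_eq j j' : j != a -> j' != a ->
  (subst_at b a j == subst_at b a j') = (j == j').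
Proof.
move=> ja j'a; rewrite /subst_at; case: (eqVneq j b) => jb; case: (eqVneq j' b) => jb'.
- by rewrite jb jb' !eqxx.
- by rewrite eq_sym (negPf j'a) jb eq_sym (negPf jb').
- by rewrite (negPf ja) jb' (negPf jb).
- by [].
Qed.

Lemma contractK s : partial_inj I s -> (a, b) \in s -> (b, a) \notin s ->
  partial_inj (I :\ a) (contract a b s) /\ expand a b (contract a b s) = s.
Proof.
move=> /partial_injP[ps Hs] hab hba.
have pt : partial_inj (I :\ a) (contract a b s).
  apply/partial_injP; split.
    have Ds i j : (i, j) \in contract a b s -> j != a /\ (i, subst_at b a j) \in s.
      by rewrite !inE /subst_at /= => /and3P[_ ->]; case: eqP.
    apply/pinjP => i j i' j' /Ds[ja h] /Ds[j'a h'].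
    by move/pinjP: ps => /(_ _ _ _ _ h h') ->; rewrite subst_at_eq.
  move=> i j; rewrite !inE /= => /and3P[ia ja]; rewrite ia ja.
  case: (eqVneq j b) => [->|jb] h; have [h1 h2] := Hs _ _ h; rewrite h1 //; split=> //.
split=> //; apply/setP => -[i j]; rewrite mem_expand //.
case: (eqVneq j b) => [->|jb].
  apply/eqP/idP => [->//|h]; exact: (pinj_inj ps) h hab.
case: (eqVneq j a) => [->|ja].
  rewrite !inE /= eqxx (eq_sym b) ab /=; case: (eqVneq i a) => [->/=|//].
  apply/esym/negbTE/negP => h; have := pinj_fun ps h hab => E.
  by move: ab; rewrite E eqxx.
rewrite !inE /= ja (negPf jb); case: (eqVneq i a) => [->/=|//].
apply/esym/negbTE/negP => h; have := pinj_fun ps h hab => E.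
by rewrite E eqxx in jb.
Qed.

Lemma expandK t : partial_inj (I :\ a) t -> (b, b) \notin t ->
  [/\ partial_inj I (expand a b t), (a, b) \in expand a b t, (b, a) \notin expand a b t
    & contract a b (expand a b t) = t].
Proof.
move=> pt bt; have /partial_injP[ps Ht] := pt.
have Hn i j : (i, j) \in t -> [/\ i != a, j != a, i \in I & j \in I].
  by case/Ht; rewrite !inE => /andP[-> ->] /andP[-> ->].
split.
- apply/partial_injP; split; last first.
    move=> i j; rewrite mem_expand //; case: (eqVneq j b) => [->/eqP->//|jb].
    by case: (eqVneq j a) => [->|ja] /Hn[].
  have D i j : (i, j) \in expand a b t -> j != b -> i != a.
    by rewrite mem_expand // => + /negPf jb; rewrite jb; case: eqP => _ /Hn[].
  have D2 i j : (i, j) \in expand a b t -> j != b -> (i, subst_at a b j) \in t.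
    by rewrite mem_expand // => + /negPf jb; rewrite jb /subst_at; case: ifP.
  have D3 i j : (i, j) \in expand a b t -> j = b -> i = a.
    by rewrite mem_expand // => + E; rewrite E eqxx => /eqP.
  apply/pinjP => i j i' j' h h'; case: (eqVneq j b) => jb; case: (eqVneq j' b) => jb'.
  + by rewrite (D3 _ _ h jb) (D3 _ _ h' jb') jb jb' !eqxx.
  + rewrite (D3 _ _ h jb) jb eq_sym (negPf (D _ _ h' jb')) eq_sym; exact/esym/negbTE.
  + by rewrite (D3 _ _ h' jb') jb' (negPf (D _ _ h jb)) (negPf jb).
  + move/pinjP: ps => /(_ _ _ _ _ (D2 _ _ h jb) (D2 _ _ h' jb')) ->.
    rewrite /subst_at; case: (eqVneq j a) => ja; case: (eqVneq j' a) => ja'.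
    * by rewrite ja ja' !eqxx.
    * by rewrite eq_sym (negPf jb') ja eq_sym (negPf ja').
    * by rewrite (negPf jb) ja' (negPf ja).
    * by [].
- by rewrite mem_expand // !eqxx.
- by rewrite mem_expand // eqxx (negPf ab).
- apply/setP => -[i j]; rewrite [LHS]in_set /= !mem_expand //.
  case: (eqVneq i a) => [->/=|ia]; first by apply/esym/negbTE/negP => /Hn[]; rewrite eqxx.
  case: (eqVneq j a) => [->/=|ja].
    by apply/esym/negbTE/negP => /Hn[_]; rewrite eqxx.
  case: (eqVneq j b) => [->/=|jb //]; by rewrite (negPf ab) eqxx.
Qed.

(** In the expanded graph [a -> b] is the only edge out of [a] and the only edge into [b], so a
    balanced set contains both vertices or neither. Dropping [a] is then a bijection on balanced
    sets. *)
Lemma cyc_expand t : partial_inj (I :\ a) t -> (b, b) \notin t ->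
  cyc (expand a b t) = cyc t.
Proof.
move=> pt bt; have [pe hab hba _] := expandK pt bt.
have /partial_injP[ps Ht] := pt; have /partial_injP[pse He] := pe.
have Hn i j : (i, j) \in t -> i != a /\ j != a.
  by case/Ht; rewrite !inE => /andP[-> _] /andP[-> _].
symmetry; apply: (card_minset_iso (phi := fun B => if b \in B then a |: B else B)
   (psi := fun B => B :\ a)).
- move=> B /balancedP[B0 H1 H2].
  have aB : a \notin B by apply/negP => /H1[j _ /Hn[]]; rewrite eqxx.
  case: (boolP (b \in B)) => bB; apply/balancedP; split.
  + by apply/set0Pn; exists a; rewrite setU11.
  + move=> i; rewrite !inE => /orP[/eqP->|iB]; first by exists b; rewrite // inE bB orbT.
    have [j jB h] := H1 i iB; case: (eqVneq j b) => jb.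
      exists a; first by rewrite setU11.
      by rewrite mem_expand // (negPf ab) eqxx -jb.
    exists j; first by rewrite inE jB orbT.
    rewrite mem_expand // (negPf jb); case: eqP => // ja.
    by rewrite ja (negPf aB) in jB.
  + move=> i; rewrite !inE => /orP[/eqP->|iB].
      have [j jB h] := H2 b bB; exists j; first by rewrite inE jB orbT.
      by rewrite mem_expand // (negPf ab) eqxx.
    case: (eqVneq i b) => ib; first by exists a; rewrite ?setU11 ?ib.
    have [j jB h] := H2 i iB; exists j; first by rewrite inE jB orbT.
    rewrite mem_expand // (negPf ib); case: eqP => // ia.
    by rewrite ia (negPf aB) in iB.
  + by [].
  + move=> i iB; have [j jB h] := H1 i iB; exists j => //.
    rewrite mem_expand //; case: (eqVneq j b) => [E|_]; first by rewrite -E jB in bB.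
    by case: eqP => // E; rewrite E (negPf aB) in jB.
  + move=> i iB; have [j jB h] := H2 i iB; exists j => //.
    rewrite mem_expand //; case: (eqVneq i b) => [E|_]; first by rewrite -E iB in bB.
    by case: eqP => // E; rewrite E (negPf aB) in iB.
- move=> B /balancedP[B0 H1 H2].
  have bB : a \in B -> b \in B.
    by move=> /H1[j jB h]; rewrite (pinj_fun pse hab h).
  have aB : b \in B -> a \in B.
    by move=> /H2[j jB h]; rewrite (pinj_inj pse hab h).
  apply/balancedP; split.
  + have [i iB] := set0Pn _ B0; case: (eqVneq i a) => ia.
      by apply/set0Pn; exists b; rewrite !inE eq_sym ab bB // -ia.
    by apply/set0Pn; exists i; rewrite !inE ia.
  + move=> i; rewrite !inE => /andP[ia iB]; have [j jB h] := H1 i iB.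
    move: h; rewrite mem_expand //; case: eqP => [_ /eqP E|_]; first by rewrite E eqxx in ia.
    case: (eqVneq j a) => ja h; last by exists j; rewrite // !inE ja.
    by exists b; rewrite // !inE eq_sym ab bB // -ja.
  + move=> i; rewrite !inE => /andP[ia iB]; case: (eqVneq i b) => ib.
      rewrite ib in iB *; have [j jB h] := H2 a (aB iB).
      move: h; rewrite mem_expand // (negPf ab) eqxx => h.
      by exists j; rewrite // !inE jB andbT; case: (Hn _ _ h).
    have [j jB h] := H2 i iB; move: h; rewrite mem_expand // (negPf ib) (negPf ia) => h.
    by exists j; rewrite // !inE jB andbT; case: (Hn _ _ h).
- move=> B /balancedP[B0 H1 H2].
  have aB : a \notin B by apply/negP => /H1[j _ /Hn[]]; rewrite eqxx.
  by case: ifP => bB; rewrite ?setU1K //; apply/setP => x; rewrite !inE; case: (eqVneq x a) => // ->; rewrite (negPf aB).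
- move=> B /balancedP[B0 H1 H2].
  have bB : a \in B -> b \in B.
    by move=> /H1[j jB h]; rewrite (pinj_fun pse hab h).
  have aB : b \in B -> a \in B.
    by move=> /H2[j jB h]; rewrite (pinj_inj pse hab h).
  rewrite !inE eq_sym ab /=; case: ifP => h; first by rewrite setD1K // aB.
  apply/setP => x; rewrite !inE; case: (eqVneq x a) => //= ->.
  by apply/esym/negbTE/negP => /bB; rewrite h.
- move=> A B /subsetP AB; apply/subsetP => x.
  case: ifP => bA; first by rewrite AB // !inE => /orP[->//|/AB->]; rewrite orbT.
  by move=> /AB xB; case: ifP => //; rewrite !inE xB orbT.
- by move=> A B; apply: setSD.
Qed.

(** [u] is the point at which the incoming edge ends, [v] the point from which the outgoing edge
    starts. Kept independent, they allow the two orientations [(a, b)] and [(b, a)] to be compared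
    with [(a, a)] and [(b, b)], where the contracted vertex is an ordinary point. *)
Definition contracted_sum (u v : T) : K :=
  \sum_(t | partial_inj (I :\ a) t && ((b, b) \notin t))
    al ^+ cyc t * (\prod_(e in t) w (subst_at b v e.1) (subst_at b u e.2)) *
    ga (subst_at b u @: (I :\ a :\: hds t)).

Lemma graph_sum_edge :
  graph_sum al w ga (fun s => ((a, b) \in s) && ((b, a) \notin s)) I =
  w a b * contracted_sum a b.
Proof.
rewrite /graph_sum /contracted_sum (reindex_onto (expand a b) (contract a b)); last first.
  by move=> s /andP[ps /andP[h1 h2]]; case: (contractK ps h1 h2).
have E t : (partial_inj I (expand a b t) && (((a, b) \in expand a b t) && ((b, a) \notin expand a b t))
    && (contract a b (expand a b t) == t)) = partial_inj (I :\ a) t && ((b, b) \notin t).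
  apply/idP/idP.
  - move=> /andP[/andP[ps /andP[h1 h2]] /eqP h].
    have [pt _] := contractK ps h1 h2; rewrite h in pt.
    by rewrite pt -h in_set /= eqxx (negPf h2) !andbF.
  - by move=> /andP[pt bt]; have [-> -> -> ->] := expandK pt bt; rewrite eqxx.
rewrite (eq_bigl _ _ E) big_distrr /=; apply: eq_bigr => t /andP[pt bt].
have /partial_injP[ps Ht] := pt.
have Hn i j : (i, j) \in t -> i != a /\ j != a.
  by case/Ht; rewrite !inE => /andP[-> _] /andP[-> _].
(* After expansion [b] is always a head, and [a] is free exactly when [b] was free in [t]. *)
have -> : I :\: hds (expand a b t) = subst_at b a @: (I :\ a :\: hds t).
  have Hh : hds (expand a b t) = b |: subst_at b a @: hds t.
    by rewrite /hds /expand imsetU1 /= -!imset_comp.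
  have ah : a \notin hds t by apply/hdsP => -[i /Hn[_]]; rewrite eqxx.
  have H0 : (a \in subst_at b a @: hds t) = (b \in hds t).
    apply/imsetP/idP => [[x xt]|bt']; last by exists b; rewrite // /subst_at eqxx.
    by rewrite /subst_at; case: eqP => [<-//|_ E']; rewrite E' xt in ah.
  have H1 x : x != a -> x != b -> (x \in subst_at b a @: hds t) = (x \in hds t).
    move=> xa xb; apply/imsetP/idP => [[y yt]|xt]; last by exists x; rewrite // /subst_at (negPf xb).
    by rewrite /subst_at; case: eqP => [_ E'|_ ->//]; rewrite E' eqxx in xa.
  apply/setP => x; rewrite Hh !inE negb_or; case: (eqVneq x b) => [->/=|xb].
    apply/esym/negbTE/imsetP => -[y _]; rewrite /subst_at; case: eqP => [_ E'|yb E'].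
      by move: ab; rewrite E' eqxx.
    by rewrite E' in yb.
  case: (eqVneq x a) => [->|xa] /=.
    rewrite H0 aI andbT; apply/idP/imsetP => [bh|[y]].
      by exists b; rewrite ?/subst_at ?eqxx // !inE bh eq_sym ab.
    rewrite !inE /subst_at; case: (eqVneq y b) => [-> /andP[]//|_ + E'].
    by rewrite -E' eqxx /= andbF.
  rewrite H1 //; apply/idP/imsetP => [xh|[y]].
    by exists x; rewrite ?/subst_at ?(negPf xb) // !inE xa.
  rewrite !inE /subst_at; case: (eqVneq y b) => [_ _ E'|_ + ->]; first by rewrite E' eqxx in xa.
  by case/and3P => -> _ ->.
rewrite /weight cyc_expand // /expand big_setU1 /=; last first.
  apply/imsetP => -[[k l] /Hn[/= ka _] [E1 _]]; by rewrite E1 eqxx in ka.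
rewrite big_imset /=; last first.
  move=> [k l] [k' l'] /Hn[_ la] /Hn[_ l'a] [<-] E'; congr (_, _).
  by apply/eqP; rewrite -subst_at_eq //; apply/eqP.
have Eb x : subst_at b b x = x by rewrite /subst_at; case: eqP.
have -> : \prod_(e in t) w (subst_at b b e.1) (subst_at b a e.2) =
    \prod_(e in t) w e.1 (subst_at b a e.2).
  by apply: eq_bigr => e _; rewrite Eb.
move: (al ^+ _) (\prod_(_ in _) _) (ga _) => x y z; ring.
Qed.

End Contraction.
End GraphSum.

End Graph.

(** * Sums over graphs *)

Module GraphSums.
Import mathcomp.boot.fintype mathcomp.boot.finset.
Import Graph.
Local Open Scope set_scope.
Local Open Scope ring_scope.

Lemma imset_setD (T T' : finType) (f : T -> T') (A B : {set T}) : injective f ->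
  f @: (A :\: B) = f @: A :\: f @: B.
Proof.
move=> fi; apply/setP => x; rewrite !inE; apply/imsetP/andP => [[y]|[xB /imsetP[y yA E]]].
  by rewrite !inE => /andP[yB yA] ->; rewrite !mem_imset.
by exists y; rewrite // !inE yA andbT; rewrite E mem_imset in xB.
Qed.

(** * Splitting a graph sum at two vertices *)

Section Decompose.
Context {T : finType} (K : comNzRingType).
Implicit Types (s t : {set T * T}) (B I J : {set T}).
Context (al : K) (w : T -> T -> K) (ga : {set T} -> K).
Local Notation Z := (graph_sum al w ga).

Lemma subst_at_id (b x : T) : subst_at b b x = x.
Proof. by rewrite /subst_at; case: eqP. Qed.

(** The transposition of [a] and [b] renames the contracted vertex. Since [u] and [v] record the
    actual end points, that name is immaterial. *)
Lemma contracted_sum_sym I a b u v : a \in I -> b \in I -> a != b ->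
  contracted_sum al w ga I b a u v = contracted_sum al w ga I a b u v.
Proof.
move=> aI bI ab; rewrite /contracted_sum; pose f := tperm a b.
have fi : injective f by apply: perm_inj.
have EI : I :\ b = f @: (I :\ a).
  apply/setP => x; rewrite -[x in RHS](tpermK a b) mem_imset //.
  rewrite !inE; case: tpermP => [->|->|/eqP-> /eqP-> //].
    by rewrite ab eq_sym ab aI bI.
  by rewrite !eqxx.
have Ef c x : x != a -> subst_at a c (f x) = subst_at b c x.
  move=> xa; rewrite /subst_at /f; case: tpermP => [E|->|/eqP h1 /eqP /negPf h2].
  - by rewrite E eqxx in xa.
  - by rewrite !eqxx.
  - by rewrite (negPf xa) h2.
rewrite EI (sum_relabel fi); apply: eq_big => [t|t /andP[pt _]].
  by congr (_ && ~~ _); rewrite -{1}(tpermR a b) -{2}(tpermR a b) mem_relabel.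
have Hn i j : (i, j) \in t -> i != a /\ j != a.
  by case/(partial_inj_mem pt); rewrite !inE => /andP[-> _] /andP[-> _].
rewrite (cyc_relabel fi) (prod_relabel fi) (hds_relabel) -(imset_setD _ _ fi) -imset_comp; congr (_ * _ * ga _).
  by apply: eq_bigr => -[i j] /Hn[/= ia ja]; rewrite !Ef.
by apply: eq_in_imset => x; rewrite !inE => /and3P[_ xa _] /=; rewrite Ef.
Qed.

(** With both ends at [b] the contracted vertex is [b] itself. The sum is therefore the full one
    without [a], minus the graphs with a loop at [b], which contraction does not produce. *)
Lemma contracted_sum_diag I a b : b \in I -> a != b ->
  contracted_sum al w ga I a b b b =
  Z predT (I :\ a) - al * w b b * Z predT (I :\ a :\ b).
Proof.
move=> bI ab; rewrite -(graph_sum_loop al w ga (a := b)); last by rewrite !inE eq_sym ab.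
rewrite /contracted_sum /graph_sum.
rewrite [X in _ = X - _](bigID (fun t => (b, b) \in t)) /=.
under [X in _ = X + _ - _]eq_bigl do rewrite andbT.
rewrite [RHS]addrC addKr; apply: eq_big => [t|t _]; first by rewrite andbT.
have -> : subst_at b b @: (I :\ a :\: hds t) = I :\ a :\: hds t.
  by rewrite (eq_imset _ (@subst_at_id b)) imset_id.
congr (_ * _ * _); by apply: eq_bigr => e _; rewrite !subst_at_id.
Qed.

Definition edge_free_sum I a b : K :=
  graph_sum al w ga (fun s => ((a, b) \notin s) && ((b, a) \notin s)) I.

Lemma graph_sumID (P Q : pred {set T * T}) I :
  Z P I = Z (fun s => P s && Q s) I + Z (fun s => P s && ~~ Q s) I.
Proof.
rewrite /graph_sum (bigID Q) /=; congr (_ + _); by apply: eq_bigl => s; rewrite andbA.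
Qed.

Lemma eq_graph_sum (P Q : pred {set T * T}) I : P =1 Q -> Z P I = Z Q I.
Proof. by move=> E; apply: eq_bigl => s; rewrite E. Qed.

(** The cases are distinguished by which of [a -> b] and [b -> a] occur. Both together form a
    2-cycle, hence the factor [al]. *)
Lemma graph_sum_split I a b : a \in I -> b \in I -> a != b ->
  Z predT I = edge_free_sum I a b + al * w a b * w b a * Z predT (I :\ a :\ b)
    + w a b * contracted_sum al w ga I a b a b
    + w b a * contracted_sum al w ga I a b b a.
Proof.
move=> aI bI ab.
rewrite -graph_sum_loop2 // -graph_sum_edge // -(contracted_sum_sym b a) //.
rewrite -graph_sum_edge //; last by rewrite eq_sym.
rewrite (graph_sumID _ (fun s => (a, b) \in s)).
rewrite (graph_sumID (fun s => predT s && _) (fun s => (b, a) \in s)).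
rewrite (graph_sumID (fun s => predT s && ~~ _) (fun s => (b, a) \in s)) /edge_free_sum.
rewrite [X in _ = _ + X](@eq_graph_sum _ (fun s => predT s && ((a, b) \notin s) && ((b, a) \in s))).
  by rewrite /=; ring.
by move=> s; rewrite /= andbC.
Qed.

(* The factors of the contracted graph [t] that depend on the point at which
   the incoming, resp. the outgoing, edge of the contracted vertex ends. *)
Definition in_factor I a b t (u : T) : K :=
  (\prod_(e in t | e.2 == b) w e.1 u) * ga (subst_at b u @: (I :\ a :\: hds t)).

Definition out_factor b t (v : T) : K :=
  \prod_(e in t | e.2 != b) w (subst_at b v e.1) e.2.

(** With the loop at [b] excluded, no edge both leaves and enters the contracted vertex, so the
    dependence on [u] and the dependence on [v] separate into two factors. *)
Lemma contracted_sumE I a b u v : contracted_sum al w ga I a b u v =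
  \sum_(t | partial_inj (I :\ a) t && ((b, b) \notin t))
    al ^+ cyc t * (in_factor I a b t u * out_factor b t v).
Proof.
apply: eq_bigr => t /andP[pt bt]; rewrite -mulrA; congr (_ * _).
rewrite /in_factor /out_factor mulrAC (bigID (fun e : T * T => e.2 == b)) /= -!mulrA.
congr (_ * _); last congr (_ * _).
  apply: eq_bigr => -[i j] /= /andP[h /eqP jb]; rewrite /subst_at jb eqxx.
  by case: eqP => // ib; move: bt; rewrite -{1}ib -jb h.
apply: eq_bigr => -[i j] /= /andP[_ /negPf jb].
by rewrite {2}/subst_at jb.
Qed.

Lemma contracted_sum_cross I a b :
  contracted_sum al w ga I a b a b + contracted_sum al w ga I a b b a
  - contracted_sum al w ga I a b a a - contracted_sum al w ga I a b b b =
  - \sum_(t | partial_inj (I :\ a) t && ((b, b) \notin t))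
      al ^+ cyc t * ((in_factor I a b t a - in_factor I a b t b) *
                     (out_factor b t a - out_factor b t b)).
Proof.
rewrite !contracted_sumE -big_split /= -!sumrB -sumrN; apply: eq_bigr => t _ /=.
move: (in_factor I a b t a) (in_factor I a b t b) (out_factor b t a) (out_factor b t b) (al ^+ _).
by move=> u u' v v' c; ring.
Qed.

End Decompose.

(** * Trading loops for a choice of isolated vertices *)

Section Loops.
Context {T : finType} (K : comNzRingType).
Implicit Types (s t G : {set T * T}) (B I J M : {set T}).
Context (al : K) (w : T -> T -> K) (ga : {set T} -> K).

Definition no_loop G := [forall i, (i, i) \notin G].

Lemma no_loopP G : reflect (forall i j, (i, j) \in G -> i != j) (no_loop G).
Proof.
apply: (iffP forallP) => [H i j h|H i]; last by apply/negP => /H; rewrite eqxx.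
by apply: contraTneq h => ->.
Qed.

Definition diagset M : {set T * T} := [set (m, m) | m in M].

Lemma mem_diagset M i j : ((i, j) \in diagset M) = (i == j) && (i \in M).
Proof.
apply/imsetP/andP => [[m mM [-> ->]]|[/eqP<- iM]]; first by rewrite eqxx.
by exists i.
Qed.

Lemma cyc_diagset G M : (forall i j, (i, j) \in G -> i \notin M /\ j \notin M) ->
  cyc (G :|: diagset M) = (cyc G + #|M|)%N.
Proof.
have [k] := ubnP #|M|; elim: k M => // k IH M Mk H.
case: (set_0Vmem M) => [->|[m mM]].
  by rewrite cards0 addn0 /diagset imset0 setU0.
have -> : G :|: diagset M = (m, m) |: (G :|: diagset (M :\ m)).
  by rewrite setUCA -[in LHS](setD1K mM) /diagset imsetU1.
rewrite cyc_loop; last first.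
  move=> i j; rewrite inE mem_diagset !inE => /orP[/H[h1 h2]|/andP[/eqP<- /andP[im _]]] //.
  by split; [apply: contraNneq h1 => ->|apply: contraNneq h2 => ->].
rewrite IH; last first.
- by move=> i j /H[h1 h2]; rewrite !inE !negb_and h1 h2 !orbT.
- by move: Mk; rewrite (cardsD1 m) mM.
by rewrite [in RHS](cardsD1 m) mM addnA addn1.
Qed.

Definition isolated G : {set T} := ~: (tls G :|: hds G).

(** A loop saturates its vertex, so the loops of a partial injection sit at vertices that are
    isolated in its loopless part [G]. For fixed [G] the sum over the loop set [M] will turn out to
    be the multilinear expansion of [T p] at the isolated vertices. *)
Lemma graph_sum_no_loop :
  graph_sum al w ga predT setT =
  \sum_(G | pinj G && no_loop G) weight al w G *
    \sum_(M : {set T} | M \subset isolated G)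
       (\prod_(m in M) (al * w m m)) * ga (~: hds G :\: M).
Proof.
rewrite /graph_sum (partition_big (fun s => s :\: diagset setT)
   (fun G => pinj G && no_loop G)) /=; last first.
  move=> s /andP[/partial_injP[ps _] _]; apply/andP; split.
    by apply: pinj_sub ps; apply: subsetDl.
  apply/no_loopP => i j; rewrite inE mem_diagset inE andbT => /andP[]; by [].
apply: eq_bigr => G /andP[pG nG]; rewrite big_distrr /=.
rewrite (reindex_onto (fun M => G :|: diagset M) (fun s => [set m | (m, m) \in s])); last first.
  move=> s /andP[_ /eqP<-]; apply/setP => -[i j]; rewrite !inE !mem_diagset !inE andbT.
  by case: (eqVneq i j) => [->|]; rewrite ?orbF.
have Hi i j M : M \subset isolated G -> (i, j) \in G -> i \notin M /\ j \notin M.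
  move=> /subsetP sM h; split; apply/negP => /sM; rewrite !inE negb_or => /andP[/negP h1 /negP h2].
    by apply: h1; apply/tlsP; exists j.
  by apply: h2; apply/hdsP; exists i.
apply: eq_big => [M|M].
- rewrite andbT; apply/idP/idP.
  + move=> /andP[/andP[/partial_injP[ps _] _] /eqP EM].
    apply/subsetP => m mM; rewrite !inE negb_or.
    have h : (m, m) \in G :|: diagset M by rewrite inE mem_diagset eqxx mM orbT.
    apply/andP; split; apply/negP.
      move=> /tlsP[j hj]; have := no_loopP _ nG _ _ hj; rewrite eq_sym => /eqP; apply.
      by apply: (pinj_fun ps) h; rewrite inE hj.
    move=> /hdsP[j hj]; have := no_loopP _ nG _ _ hj => /eqP; apply.
    by apply: (pinj_inj ps) h; rewrite inE hj.
  + move=> sM; have H i j := Hi i j M sM.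
    have E1 : [set m | (m, m) \in G :|: diagset M] = M.
      apply/setP => m; rewrite !inE mem_diagset eqxx /=.
      by have /forallP/(_ m)/negPf-> := nG.
    have E2 : (G :|: diagset M) :\: diagset setT = G.
      apply/setP => -[i j]; rewrite !inE !mem_diagset !inE andbT.
      case: (eqVneq i j) => [->|_]; rewrite ?orbF //=.
      by have /forallP/(_ j)/negPf-> := nG.
    rewrite E1 E2 !eqxx !andbT; apply/partial_injP; split; last by move=> *; rewrite !inE.
    apply/pinjP => i j i' j'; rewrite !inE !mem_diagset.
    case/orP => [h|/andP[/eqP<- iM]]; case/orP => [h'|/andP[/eqP<- iM']] //.
    * by move/pinjP: pG; apply.
    * have [h1 h2] := H _ _ h.
      rewrite (_ : (i == i') = false); last by apply: contraNF h1 => /eqP->.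
      by rewrite (_ : (j == i') = false) //; apply: contraNF h2 => /eqP->.
    * have [h1 h2] := H _ _ h'.
      rewrite (_ : (i == i') = false); last by apply: contraNF h1 => /eqP<-.
      by rewrite (_ : (i == j') = false) //; apply: contraNF h2 => /eqP<-.
- move=> /andP[/andP[/andP[/partial_injP[ps _] _] /eqP EG] /eqP EM].
  have sM : M \subset isolated G.
    apply/subsetP => m mM; rewrite !inE negb_or.
    have h : (m, m) \in G :|: diagset M by rewrite inE mem_diagset eqxx mM orbT.
    apply/andP; split; apply/negP.
      move=> /tlsP[j hj]; have := no_loopP _ nG _ _ hj; rewrite eq_sym => /eqP; apply.
      by apply: (pinj_fun ps) h; rewrite inE hj.
    move=> /hdsP[j hj]; have := no_loopP _ nG _ _ hj => /eqP; apply.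
    by apply: (pinj_inj ps) h; rewrite inE hj.
  have H i j := Hi i j M sM.
  have -> : setT :\: hds (G :|: diagset M) = ~: hds G :\: M.
    rewrite /hds imsetU /diagset -imset_comp /= imset_id.
    by rewrite setTD setCU setDE.
  rewrite /weight cyc_diagset // exprD big_split /= -prodr_const.
  rewrite (eq_bigl [predU G & diagset M]); last by move=> e; rewrite !inE.
  rewrite bigU /=; last first.
    apply/pred0P => -[i j] /=; apply/negP; rewrite mem_diagset => /and3P[h /eqP ij _].
    by have := no_loopP _ nG _ _ h; rewrite ij eqxx.
  rewrite /diagset big_imset /=; last by move=> ? ? _ _ [].
  by rewrite -!mulrA; congr (_ * _); rewrite mulrCA.
Qed.

End Loops.

(** * Comparison with the graphs of the statement *)

Section FrozenGraphs.
Context (N : nat).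
Implicit Types (G L : {set 'I_N * 'I_N}).

Lemma admissible_graphsE G : (G \in admissible_graphs N) = pinj G && no_loop G.
Proof.
rewrite inE -/(no_loop G) andbC; case: (no_loop G); rewrite ?andbF // !andbT.
apply/andP/pinjP.
- case=> /forallP H1 /forallP H2 i j i' j' h h'; apply/eqP/eqP => E.
    have /card_le1_eqP := H1 i; apply; rewrite !inE //; by rewrite E.
  have /card_le1_eqP := H2 j; apply; rewrite !inE //; by rewrite E.
- move=> /pinjP pG; split; apply/forallP => i; apply/card_le1_eqP => j j'; rewrite !inE => h h'.
    by rewrite (pinj_fun pG h h').
  by rewrite (pinj_inj pG h h').
Qed.

Lemma tailsE G : tails G = tls G.
Proof.
apply/setP => i; rewrite inE; apply/existsP/tlsP => -[j h]; by exists j.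
Qed.

Lemma headsE G : heads G = hds G.
Proof.
apply/setP => i; rewrite inE; apply/existsP/hdsP => -[j h]; by exists j.
Qed.

Lemma cycle_edges_tls (s : seq 'I_N) : tls [set (i, next s i) | i in s] = [set i in s].
Proof.
apply/setP => i; rewrite inE; apply/tlsP/idP => [[j /imsetP[k ks [-> _]] //]|is_].
by exists (next s i); apply/imsetP; exists i.
Qed.

Lemma cycle_edgesE G (s : seq 'I_N) : pinj G -> cycle (fun i j => (i, j) \in G) s ->
  [set (i, next s i) | i in s] = [set e in G | e.1 \in s].
Proof.
move=> pG cs; apply/setP => -[i j]; rewrite inE /=; apply/imsetP/andP => [[k ks [-> ->]]|[h is_]].
  by split=> //; exact: (next_cycle cs ks).
by exists i => //; rewrite (pinj_fun pG h (next_cycle cs is_)).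
Qed.

Lemma balanced_cycle G (s : seq 'I_N) : s != [::] -> cycle (fun i j => (i, j) \in G) s ->
  balanced G [set i in s].
Proof.
move=> s0 cs; apply/balancedP; split.
- case: s s0 cs => [//|x s] _ _; by apply/set0Pn; exists x; rewrite inE mem_head.
- move=> i; rewrite inE => is_; exists (next s i); last exact: (next_cycle cs is_).
  by rewrite inE mem_next.
- move=> i; rewrite inE => is_; exists (prev s i); last exact: (prev_cycle cs is_).
  by rewrite inE mem_prev.
Qed.

(** The vertex set of a cycle is minimal balanced, since following [next] from any point of a
    balanced subset runs through the whole cycle. Conversely the outgoing edges of a minimal
    balanced set form an injective self-map, and the orbit of any point is a cycle that fills the
    set. *)
Lemma nloopsE G : pinj G -> nloops G = cyc G.
Proof.
(* [tls] is injective on cycles: in a partial injection the edges of a cycle are all the edges that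
   start on it. *)
move=> pG; rewrite /nloops /cyc -(card_in_imset (f := @tls _)); last first.
  move=> L L'; rewrite !inE => /asboolP[s [_ /ucycle_cycle cs ->]] /asboolP[s' [_ /ucycle_cycle cs' ->]].
  rewrite !cycle_edges_tls !(cycle_edgesE pG) // => E.
  by apply/setP => e; rewrite !inE; move/setP/(_ e.1): E; rewrite !inE => ->.
congr #|pred_of_set _|; apply/setP => B; rewrite inE; apply/imsetP/idP.
- case=> L; rewrite inE => /asboolP[s [s0 us ->]] ->; rewrite cycle_edges_tls.
  have cs := ucycle_cycle us; have uq := ucycle_uniq us.
  apply/minsetP; split; first exact: balanced_cycle.
  move=> B' /balancedP[/set0Pn[x xB] H _] /subsetP sB.
  have xs : x \in s by have := sB x xB; rewrite inE.
  have Bn k : iter k (next s) x \in B'.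
    elim: k => //= k IH; have [j jB h] := H _ IH.
    have ks : iter k (next s) x \in s by have := sB _ IH; rewrite inE.
    by rewrite -(pinj_fun pG h (next_cycle cs ks)).
  apply/setP => y; rewrite inE; apply/idP/idP => [/sB|ys]; first by rewrite inE.
  have := in_orbit_cycle (cycle_next uq) xs ys; rewrite ys -fconnect_orbit => h.
  by rewrite -(iter_findex h).
- move=> /minsetP[bB mB]; have /balancedP[/set0Pn[x xB] H1 H2] := bB.
  (* The default value [i] only occurs where there is no outgoing edge, hence never inside [B]. *)
  pose f i := odflt i [pick j | (i, j) \in G].
  have fG i : i \in B -> (i, f i) \in G.
    move=> /H1[j jB h]; rewrite /f; case: pickP => [//|/(_ j)]; by rewrite h.
  have fB i : i \in B -> f i \in B.
    move=> iB; have [j jB h] := H1 i iB; by rewrite (pinj_fun pG (fG i iB) h).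
  have fi : {in B &, injective f}.
    move=> i j iB jB E; apply: (pinj_inj pG (fG i iB)); rewrite E; exact: fG.
  have fc := cycle_orbit_in fB fi xB.
  set s := fingraph.orbit f x in fc.
  have us : uniq s by apply: fingraph.orbit_uniq.
  have sB y : y \in s -> y \in B.
    by rewrite -fconnect_orbit => h; rewrite -(iter_findex h); elim: (findex _ _ _) => //= k; apply: fB.
  have cs : cycle (fun i j => (i, j) \in G) s.
    apply: cycle_from_next => // y ys; rewrite (nextE fc ys); exact: fG (sB y ys).
  have s0 : s != [::] by apply/eqP => E; have := fingraph.in_orbit f x; rewrite -/s E.
  exists [set (i, next s i) | i in s].
    by rewrite inE; apply/asboolP; exists s; split=> //; rewrite /ucycle cs us.
  rewrite cycle_edges_tls; apply/esym/mB; first exact: balanced_cycle.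
  by apply/subsetP => y; rewrite inE; apply: sB.
Qed.

End FrozenGraphs.
End GraphSums.

(** * The graph recursion *)

Module Recursion.
Import mathcomp.boot.fintype mathcomp.boot.finset.
Import Graph GraphSums.
Local Open Scope set_scope.

Section Gc.
Context (R : realType) (g : nat) (p : {poly Cx R}).
Local Notation C := (Cx R).
Local Notation X := (hpoint g p).
Context (al : C) (Wn : forall N, ('I_N -> X) -> C).
Context (Wn_perm : forall N (P : 'I_N -> X) (t : 'S_N), injective P ->
   Wn (fun i => P (t i)) = Wn P).

(* Loops stand for the passage from [T p] to [vartheta]: [al * wt P i i] is the
   subtracted term c/32 p'^2/p. *)
Definition wt (T : finType) (P : T -> X) (i j : T) : C :=
  if i == j then (p^`()).[xc (P i)] ^+ 2 / (16 * p.[xc (P i)])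
  else 4^-1 * edge_fun (P i) (P j).

(* [k] is only a bound for the recursion depth. *)
Fixpoint Gf (k N : nat) (P : 'I_N -> X) : C :=
  if k is k'.+1 then
    Wn P - \sum_(G : {set 'I_N * 'I_N} | pinj G && (G != set0))
      weight al (wt P) G * Gf k' (fun i : 'I_#|~: hds G| => P (enum_val i))
  else 0.

Definition Gc (N : nat) (P : 'I_N -> X) : C := Gf N.+1 P.

Lemma card_hdsC N (G : {set 'I_N * 'I_N}) : G != set0 -> (#|~: hds G| < N)%N.
Proof.
move=> /set0Pn[[i j] ij]; have hj : j \in hds G by apply/hdsP; exists i.
have := cardsC (hds G); rewrite card_ord.
have : (0 < #|hds G|)%N by apply/card_gt0P; exists j.
lia.
Qed.

Lemma Gf_fuel k k' N (P : 'I_N -> X) : (N < k)%N -> (N < k')%N -> Gf k P = Gf k' P.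
Proof.
elim: k k' N P => [//|k IH] [//|k'] N P Nk Nk' /=; congr (_ - _).
apply: eq_bigr => G /andP[_ G0]; congr (_ * _).
by have h := card_hdsC G0; apply: IH; apply: (leq_trans h); rewrite -ltnS.
Qed.

Definition GJ (T : finType) (P : T -> X) (J : {set T}) : C :=
  Gc (fun i : 'I_#|J| => P (enum_val i)).

Lemma GcE N (P : 'I_N -> X) :
  Gc P = Wn P - \sum_(G | pinj G && (G != set0)) weight al (wt P) G * GJ P (~: hds G).
Proof.
rewrite {1}/Gc /=; congr (_ - _); apply: eq_bigr => G /andP[_ G0]; congr (_ * _).
by apply: Gf_fuel => //; exact: card_hdsC.
Qed.

Lemma wt_relabel (T T' : finType) (f : T -> T') (P : T' -> X) : injective f ->
  forall i j, wt P (f i) (f j) = wt (fun i => P (f i)) i j.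
Proof. by move=> fi i j; rewrite /wt inj_eq. Qed.

Lemma weight_relabel (T T' : finType) (f : T -> T') (P : T' -> X) G : injective f ->
  weight al (wt P) (relabel f G) = weight al (wt (fun i => P (f i))) G.
Proof.
move=> fi; rewrite /weight cyc_relabel // prod_relabel //.
by congr (_ * _); apply: eq_bigr => e _; rewrite (wt_relabel P fi).
Qed.

Lemma enum_val_imset (T : finType) (J : {set T}) : enum_val @: [set: 'I_#|J|] = J.
Proof.
apply/setP => x; apply/imsetP/idP => [[i _ ->]|xJ]; first exact: enum_valP.
by exists (enum_rank_in xJ x); rewrite ?inE // enum_rankK_in.
Qed.

Lemma perm_of_image (T : finType) m (f h : 'I_m -> T) : injective f -> injective h ->
  f @: setT = h @: setT -> exists t : 'S_m, forall i, f i = h (t i).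
Proof.
move=> fi hi E.
have H i : exists j, f i == h j.
  have : f i \in h @: setT by rewrite -E imset_f.
  by case/imsetP => j _ ->; exists j.
pose t i := xchoose (H i).
have tE i : f i = h (t i) by apply/eqP; exact: (xchooseP (H i)).
have ti : injective t by move=> i j /(congr1 h); rewrite -!tE => /fi.
by exists (perm ti) => i; rewrite permE.
Qed.

Lemma image_size (T : finType) m m' (f : 'I_m -> T) (h : 'I_m' -> T) : injective f -> injective h ->
  f @: setT = h @: setT -> m = m'.
Proof.
by move=> fi hi /(congr1 (fun A : {set T} => #|A|)); rewrite !card_imset // !cardsT !card_ord.
Qed.

(** Two enumerations of the same points differ by a permutation. Applied to [Wn] and to [Gc], this
    makes the order chosen by [enum_val] irrelevant. *)
Lemma image_invariant (H : forall N, ('I_N -> X) -> C) (T : finType) m m'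
    (P : T -> X) (f : 'I_m -> T) (h : 'I_m' -> T) :
  (forall (P' : 'I_m -> X) (t : 'S_m), injective P' -> H m (fun i => P' (t i)) = H m P') ->
  injective P -> injective f -> injective h -> f @: setT = h @: setT ->
  H m (fun i => P (f i)) = H m' (fun i => P (h i)).
Proof.
move=> HP iP fi hi E; have mm := image_size fi hi E; subst m'.
have [u Hu] := perm_of_image fi hi E.
have -> : (fun i => P (f i)) = (fun i => P (h (u i))) by apply/funext => i; rewrite Hu.
by apply: (HP (fun i => P (h i))) => i j /iP /hi.
Qed.

(** Relabelling the graphs by [t] leaves the weights unchanged, and the smaller correlators see the
    same points in another order, which is the induction hypothesis. *)
Lemma Gc_perm N (P : 'I_N -> X) (t : 'S_N) : injective P -> Gc (fun i => P (t i)) = Gc P.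
Proof.
have [k] := ubnP N; elim: k N P t => // k IH N P t Nk iP.
rewrite !GcE Wn_perm //; congr (_ - _).
have ti : injective t by apply: perm_inj.
have ET : [set: 'I_N] = t @: [set: 'I_N].
  apply/setP => x; rewrite inE; apply/esym/imsetP.
  by exists (t^-1 x)%g; rewrite ?inE ?permKV.
have pT (G : {set 'I_N * 'I_N}) Q : pinj G && Q = partial_inj setT G && Q.
  rewrite /partial_inj; congr (_ && _); rewrite (_ : G \subset _) ?andbT //.
  by apply/subsetP => -[i j] _; rewrite in_setX !inE.
rewrite (eq_bigl _ _ (fun G => pT G _)) [RHS](eq_bigl _ _ (fun G => pT G _)).
rewrite [X in _ = \sum_(_ | partial_inj X _ && _) _]ET sum_relabel //.
apply: eq_big => [G|G /andP[_ G0]].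
  congr (_ && ~~ _); rewrite /relabel; apply/eqP/eqP => [->|]; first by rewrite imset0.
  by move/eqP; rewrite imset_eq0 => /eqP.
rewrite weight_relabel //; congr (_ * _).
rewrite /GJ.
pose f (i : 'I_#|~: hds G|) : 'I_N := t (enum_val i).
pose h (i : 'I_#|~: hds (relabel t G)|) : 'I_N := enum_val i.
have fi : injective f by move=> i j /ti /enum_val_inj.
have hi : injective h by exact: enum_val_inj.
have E : f @: setT = h @: setT.
  rewrite enum_val_imset /f (imset_comp t (fun i : 'I_#|~: hds G| => enum_val i)) enum_val_imset.
  by rewrite hds_relabel -!setTD (imset_setD _ _ ti) -ET.
have hk : (#|~: hds G| < k)%N by apply: (leq_trans (card_hdsC G0)); rewrite -ltnS.
by apply: (image_invariant (H := Gc) (P := P) _ iP fi hi E) => P' u; exact: IH.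
Qed.

Lemma Gc_image (T : finType) m m' (P : T -> X) (f : 'I_m -> T) (h : 'I_m' -> T) :
  injective P -> injective f -> injective h -> f @: setT = h @: setT ->
  Gc (fun i => P (f i)) = Gc (fun i => P (h i)).
Proof. by apply: (image_invariant (H := Gc)) => P' u; exact: Gc_perm. Qed.

Lemma GJ_image (T : finType) m (P : T -> X) (f : 'I_m -> T) J :
  injective P -> injective f -> f @: setT = J -> GJ P J = Gc (fun i => P (f i)).
Proof.
move=> iP fi E; apply: (Gc_image iP) => //; first exact: enum_val_inj.
by rewrite enum_val_imset.
Qed.

Lemma GJ_relabel (T T' : finType) (P : T' -> X) (f : T -> T') (J : {set T}) :
  injective P -> injective f -> GJ P (f @: J) = GJ (fun i => P (f i)) J.
Proof.
move=> iP fi; rewrite (@GJ_image _ _ _ (fun i : 'I_#|J| => f (enum_val i))) //.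
  by move=> i j /fi /enum_val_inj.
by rewrite (imset_comp f (fun i : 'I_#|J| => enum_val i)) enum_val_imset.
Qed.

Lemma weight0 (T : finType) (P : T -> X) : weight al (wt P) set0 = 1.
Proof.
rewrite /weight big_set0 mulr1 (_ : cyc _ = 0%N) ?expr0 //.
apply/eqP; rewrite cards_eq0; apply/eqP/setP => A; rewrite !inE.
apply/negbTE/negP => /minsetP[/balancedP[/set0Pn[i iA] H _] _].
by have [j _] := H i iA; rewrite inE.
Qed.

Lemma hds0 (T : finType) : hds (set0 : {set T * T}) = set0.
Proof. by rewrite /hds imset0. Qed.

Lemma GJ_setT N (P : 'I_N -> X) : injective P -> GJ P setT = Gc P.
Proof.
move=> iP; rewrite (@GJ_image _ N _ id) //.
by rewrite imset_id.
Qed.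

(** The recursion solved for [Wn]: its leading term [Gc] is the contribution of the empty graph. *)
Lemma Wn_setT N (P : 'I_N -> X) : injective P ->
  Wn P = graph_sum al (wt P) (GJ P) predT setT.
Proof.
move=> iP; rewrite /graph_sum (bigD1 set0) /=; last first.
  rewrite andbT; apply/partial_injP; split; last by move=> i j; rewrite inE.
  by apply/pinjP => i j i' j'; rewrite inE.
rewrite weight0 mul1r hds0 setD0 GJ_setT // GcE.
rewrite [X in _ - X + _](eq_bigl (fun G => partial_inj setT G && true && (G != set0))).
  under [X in _ = _ - _ + X]eq_bigr do rewrite setTD.
  by rewrite subrK.
move=> G; rewrite andbT /partial_inj (_ : G \subset _) ?andbT //.
by apply/subsetP => -[i j] _; rewrite in_setX !inE.
Qed.

Definition WJ (T : finType) (P : T -> X) (I : {set T}) : C :=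
  Wn (fun i : 'I_#|I| => P (enum_val i)).

(** The inversion formula on every subset of the points, as needed once vertices have been split
    off. *)
Lemma graph_sum_Gc (T : finType) (P : T -> X) (I : {set T}) : injective P ->
  graph_sum al (wt P) (GJ P) predT I = WJ P I.
Proof.
move=> iP; pose f (i : 'I_#|I|) : T := enum_val i.
have fi : injective f by exact: enum_val_inj.
have Pf : injective (fun i => P (f i)) by move=> i j /iP /fi.
rewrite /WJ (Wn_setT Pf) /graph_sum.
rewrite -[X in \sum_(_ | partial_inj X _ && _) _]enum_val_imset (sum_relabel fi).
apply: eq_bigr => G _; rewrite weight_relabel //; congr (_ * _).
rewrite hds_relabel -/f -{1}(enum_val_imset I) -(imset_setD _ _ fi).
by rewrite GJ_relabel.
Qed.

Lemma WJ_image (T : finType) m (P : T -> X) (f : 'I_m -> T) J :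
  injective P -> injective f -> f @: setT = J -> WJ P J = Wn (fun i => P (f i)).
Proof.
move=> iP fi E; apply: (image_invariant (H := Wn)) => //; first by move=> P' u; exact: Wn_perm.
  exact: enum_val_inj.
by rewrite enum_val_imset.
Qed.

End Gc.
End Recursion.

(** * Boundedness and second-order expansions *)

Local Open Scope classical_set_scope.
Local Open Scope ring_scope.

Section Norm.
Context {R : realType}.
Local Notation C := (Cx R).

(** Real-valued, because the norm of [Cx R] takes its values in [Cx R] itself; estimates become
    arithmetic over the ordered field [R]. *)
Definition nrm (z : C) : R := Normc.normc z.

Lemma nrmE (z : C) : `|z| = ((nrm z)%:C)%C.
Proof. by []. Qed.

Lemma nrm_ge0 (z : C) : 0 <= nrm z.
Proof. by rewrite -ler0c -nrmE normr_ge0. Qed.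

Lemma nrm0 : nrm 0 = 0. Proof. exact: Normc.normc0. Qed.
Lemma nrm1 : nrm 1 = 1. Proof. exact: Normc.normc1. Qed.

Lemma nrm_eq0 (z : C) : (nrm z == 0) = (z == 0).
Proof. by apply/eqP/eqP => [/Normc.eq0_normc|->]; rewrite ?nrm0. Qed.

Lemma nrm_gt0 (z : C) : (0 < nrm z) = (z != 0).
Proof. by rewrite lt_def nrm_ge0 andbT nrm_eq0. Qed.

Lemma nrmM (z w : C) : nrm (z * w) = nrm z * nrm w.
Proof. exact: Normc.normcM. Qed.

Lemma nrmV (z : C) : nrm z^-1 = (nrm z)^-1.
Proof. exact: Normc.normcV. Qed.

Lemma nrmN (z : C) : nrm (- z) = nrm z.
Proof. exact: normcN. Qed.

Lemma nrmX (z : C) n : nrm (z ^+ n) = nrm z ^+ n.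
Proof. by elim: n => [|n IH]; rewrite ?expr0 ?nrm1 // !exprS nrmM IH. Qed.

Lemma nrmD (z w : C) : nrm (z + w) <= nrm z + nrm w.
Proof. exact: le_normcD. Qed.

Lemma nrmB (z w : C) : nrm (z - w) <= nrm z + nrm w.
Proof. by rewrite -(nrmN w) nrmD. Qed.

Lemma nrm_sub (z w : C) : nrm (z - w) = nrm (w - z).
Proof. by rewrite -nrmN opprB. Qed.

Lemma nrm_rtri (z w : C) : nrm z - nrm w <= nrm (z - w).
Proof. by have := nrmD (z - w) w; rewrite subrK; lra. Qed.

Lemma nrm_prod (I : Type) (r : seq I) (F : I -> C) :
  nrm (\prod_(i <- r) F i) = \prod_(i <- r) nrm (F i).
Proof. by elim/big_rec2: _ => [|i y1 y2 _ <-]; rewrite ?nrm1 ?nrmM. Qed.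

Lemma nrm_real (a : R) : nrm (a%:C)%C = `|a|.
Proof. by rewrite /nrm /= expr0n /= addr0 sqrtr_sqr. Qed.

Lemma nrm_nat n : nrm n%:R = n%:R.
Proof. by rewrite -(rmorph_nat (real_complex R)) nrm_real normr_nat. Qed.

#[global] Instance Cx_nbhs_filter (a : C) : Filter (nbhs a).
Proof. exact: nbhs_filter. Qed.

#[global] Instance Cx_dnbhs_filter (a : C) : Filter a^'.
Proof. exact: dnbhs_filter. Qed.

Lemma nbhs_nrmP (a : C) (A : set C) :
  nbhs a A <-> exists2 d : R, 0 < d & forall w, nrm (w - a) < d -> A w.
Proof.
split=> [/nbhs_ballP[e /= e0 sub]|[d d0 sub]].
  have [er ee] : exists r : R, e = (r%:C)%C.
    by exists (complex.Re e); rewrite RRe_real // gtr0_real.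
  exists er; first by move: e0; rewrite ee ltcR.
  move=> w wd; apply: sub; rewrite /ball /= /ball_ /= distrC nrmE ee.
  by rewrite ltcR.
apply/nbhs_ballP; exists (d%:C)%C; first by rewrite /= ltcR.
move=> w; rewrite /ball /= /ball_ /= distrC nrmE ltcR; exact: sub.
Qed.

Lemma near_nrm_lt (a : C) (d : R) : 0 < d -> \forall w \near a, nrm (w - a) < d.
Proof. by move=> d0; apply/nbhs_nrmP; exists d. Qed.

Lemma dnbhs_nrmP (a : C) (A : set C) :
  (a^' A) <-> exists2 d : R, 0 < d &
    forall w, w != a -> nrm (w - a) < d -> A w.
Proof.
split=> [/nbhs_nrmP[d d0 H]|[d d0 H]]; [exists d|apply/nbhs_nrmP; exists d] => //.
- by move=> w wa wd; apply: (H w wd).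
- by move=> w wd wa; apply: (H w wa wd).
Qed.

Lemma cvg_nrmP (T : Type) (F : set_system T) {FF : Filter F} (f : T -> C) (l : C) :
  (f @ F --> l) <-> (forall e : R, 0 < e -> \forall t \near F, nrm (f t - l) < e).
Proof.
split=> [cv e e0|H].
  have := cv _ (near_nrm_lt l e0); exact.
move=> A /nbhs_nrmP[d d0 H2]; have := H d d0.
by rewrite /= nbhs_nearE; apply: filterS => t; exact: H2.
Qed.

End Norm.

Section Bounded.
Context {R : realType}.
Local Notation C := (Cx R).

(** The relation O(1) along a filter. It is used at a point, at a punctured point, at infinity, and
    for the points of the surface lying over such a filter. *)
Definition Bdd (T : Type) (F : set_system T) (f : T -> C) :=
  exists K : R, \forall t \near F, nrm (f t) <= K.

Section Bdd_theory.
Context (T : Type) (F : set_system T) {FF : Filter F}.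
Implicit Types f g : T -> C.

Lemma Bdd_pos f : Bdd F f -> exists2 K : R, 0 < K & \forall t \near F, nrm (f t) <= K.
Proof.
case=> K HK; exists (`|K| + 1); first by rewrite ltr_wpDl.
by apply: filterS HK => t /le_trans; apply; have := ler_norm K; lra.
Qed.

Lemma Bdd_cst (c : C) : Bdd F (fun=> c).
Proof. by exists (nrm c); apply: filterE. Qed.

Lemma BddD f g : Bdd F f -> Bdd F g -> Bdd F (fun t => f t + g t).
Proof.
case=> K HK [L HL]; exists (K + L); apply: filterS2 HK HL => t h1 h2.
by rewrite (le_trans (nrmD _ _)) // lerD.
Qed.

Lemma BddN f : Bdd F f -> Bdd F (fun t => - f t).
Proof. by case=> K HK; exists K; apply: filterS HK => t; rewrite nrmN. Qed.

Lemma BddB f g : Bdd F f -> Bdd F g -> Bdd F (fun t => f t - g t).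
Proof. by move=> Hf Hg; apply: BddD => //; apply: BddN. Qed.

Lemma BddM f g : Bdd F f -> Bdd F g -> Bdd F (fun t => f t * g t).
Proof.
case=> K HK [L HL]; exists (K * L); apply: filterS2 HK HL => t h1 h2.
by rewrite nrmM ler_pM ?nrm_ge0.
Qed.

Lemma BddX f n : Bdd F f -> Bdd F (fun t => f t ^+ n).
Proof.
move=> Hf; elim: n => [|n IH]; first exact: Bdd_cst.
by have := BddM Hf IH; under eq_fun do rewrite -exprS.
Qed.

Lemma Bdd_sum (I : Type) (r : seq I) (P : pred I) (f : I -> T -> C) :
  (forall i, P i -> Bdd F (f i)) -> Bdd F (fun t => \sum_(i <- r | P i) f i t).
Proof.
move=> H; elim: r => [|i r IH].
  by under eq_fun do rewrite big_nil; apply: Bdd_cst.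
under eq_fun do rewrite big_cons.
by case: (boolP (P i)) => Pi; [apply: BddD => //; apply: H|apply: IH].
Qed.

Lemma Bdd_prod (I : Type) (r : seq I) (P : pred I) (f : I -> T -> C) :
  (forall i, P i -> Bdd F (f i)) -> Bdd F (fun t => \prod_(i <- r | P i) f i t).
Proof.
move=> H; elim: r => [|i r IH].
  by under eq_fun do rewrite big_nil; apply: Bdd_cst.
under eq_fun do rewrite big_cons.
by case: (boolP (P i)) => Pi; [apply: BddM => //; apply: H|apply: IH].
Qed.

Lemma Bdd_near f g : (\forall t \near F, f t = g t) -> Bdd F f -> Bdd F g.
Proof. by move=> E [K HK]; exists K; apply: filterS2 E HK => t ->. Qed.

Lemma Bdd_horner (p : {poly C}) f : Bdd F f -> Bdd F (fun t => p.[f t]).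
Proof.
move=> Hf; under eq_fun do rewrite horner_coef.
by apply: Bdd_sum => i _; apply: BddM; [exact: Bdd_cst|exact: BddX].
Qed.

Lemma Bdd_cvg f (l : C) : f @ F --> l -> Bdd F f.
Proof.
move=> /cvg_nrmP/(_ 1 ltr01) H; exists (nrm l + 1); apply: filterS H => t H.
by have := nrm_rtri (f t) l; lra.
Qed.

Lemma BddV f (l : C) : f @ F --> l -> l != 0 -> Bdd F (fun t => (f t)^-1).
Proof.
move=> /cvg_nrmP H l0; have l0' : 0 < nrm l by rewrite nrm_gt0.
have := H (nrm l / 2); rewrite divr_gt0 // => /(_ isT) {}H.
exists (2 / nrm l); apply: filterS H => t H; rewrite nrmV.
have h : nrm l / 2 <= nrm (f t) by have := nrm_rtri l (f t); rewrite nrm_sub; lra.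
rewrite -[X in _ <= X]invrK invf_div lef_pV2 ?posrE //; last by rewrite divr_gt0.
by apply: lt_le_trans h; rewrite divr_gt0.
Qed.

Lemma cvg0_Bdd f g : f @ F --> (0 : C) -> Bdd F g -> (fun t => f t * g t) @ F --> (0 : C).
Proof.
move=> /cvg_nrmP Hf /Bdd_pos[K K0 HK]; apply/cvg_nrmP => e e0.
have := Hf (e / K); rewrite divr_gt0 // => /(_ isT) {}Hf.
apply: filterS2 Hf HK => t; rewrite !subr0 nrmM => h1 h2.
apply: (@le_lt_trans _ _ (nrm (f t) * K)); first by rewrite ler_wpM2l ?nrm_ge0.
by rewrite -ltr_pdivlMr.
Qed.

End Bdd_theory.

Lemma Bdd_id (a : C) : Bdd (nbhs a) id.
Proof.
exists (nrm a + 1); apply: filterS (near_nrm_lt a (@ltr01 R)) => w h.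
by have := nrm_rtri w a; lra.
Qed.

Lemma Bdd_dnbhs (a : C) f : Bdd (nbhs a) f -> Bdd a^' f.
Proof. by case=> K HK; exists K; apply: nbhs_dnbhs. Qed.

Lemma Bdd_shift a : Bdd (nbhs a) (fun w => w - a : C).
Proof. by apply: BddB; [exact: Bdd_id|exact: Bdd_cst]. Qed.

End Bounded.

Ltac bdd := repeat match goal with
  | H : Bdd ?F ?f |- Bdd ?F ?f => exact H
  | |- Bdd _ (fun _ => ?c) => exact: Bdd_cst
  | |- Bdd _ (fun w => w - _) => exact: Bdd_shift
  | |- Bdd _ (fun w => @?f w + @?g w) => refine (@BddD _ _ _ _ f g _ _)
  | |- Bdd _ (fun w => - @?f w) => refine (@BddN _ _ _ _ f _)
  | |- Bdd _ (fun w => @?f w * @?g w) => refine (@BddM _ _ _ _ f g _ _)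
  | |- Bdd _ (fun w => @?f w ^+ ?n) => refine (@BddX _ _ _ _ f n _)
  end.

Section Taylor.
Context {R : realType}.
Local Notation C := (Cx R).

(** The substitute for holomorphy. The mean over a small cross kills the linear and the quadratic
    term, and a remainder of order three is smaller than the gain of order two on which the maximum
    argument rests. *)
Definition T2 (f : C -> C) (a : C) :=
  exists b c (r : C -> C), Bdd (nbhs a) r /\
   \forall w \near a, f w = f a + b * (w - a) + c * (w - a) ^+ 2 + (w - a) ^+ 3 * r w.

Lemma T2I (f : C -> C) (a d b c : C) (r : C -> C) : Bdd (nbhs a) r ->
  (\forall w \near a, f w = d + b * (w - a) + c * (w - a) ^+ 2 + (w - a) ^+ 3 * r w) ->
  T2 f a.
Proof.
move=> Br H; exists b, c, r; split=> //.
have -> : f a = d by have := nbhs_singleton H => ->; ring.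
by [].
Qed.

Lemma T2_Bdd f a : T2 f a -> Bdd (nbhs a) f.
Proof.
move=> [b [c [r [Br H]]]].
apply: (@Bdd_near _ _ _ _ (fun w => f a + b * (w - a) + c * (w - a) ^+ 2 + (w - a) ^+ 3 * r w)).
  by apply: filterS H => w ->.
by bdd.
Qed.

Lemma near_cvgP (f : C -> C) (a l : C) :
  f @ nbhs a --> l <-> (forall e : R, 0 < e -> \forall w \near nbhs a, nrm (f w - l) < e).
Proof. exact: (@cvg_nrmP _ _ (nbhs a) (nbhs_filter a)). Qed.

Lemma shift_cvg0 a : (fun w => w - a) @ a --> (0 : C).
Proof.
apply/near_cvgP => e e0.
by apply: (@filterS _ (nbhs a) _ _ _ _ (near_nrm_lt a e0)) => w; rewrite subr0.
Qed.

Lemma T2_lip f a : T2 f a ->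
  exists2 r, Bdd (nbhs a) r & \forall w \near a, f w - f a = (w - a) * r w.
Proof.
move=> [b [c [r [Br H]]]].
exists (fun w => b + c * (w - a) + (w - a) ^+ 2 * r w).
  by bdd.
by apply: filterS H => w ->; ring.
Qed.

Lemma T2_cvg f a : T2 f a -> f @ a --> f a.
Proof.
move=> /T2_lip[r Br H]; have c0 := @cvg0_Bdd R C (nbhs a) (nbhs_filter a) _ _ (shift_cvg0 a) Br.
move/near_cvgP in c0.
apply/near_cvgP => e e0; apply: filterS2 (c0 e e0) H => w.
by rewrite subr0 => + ->.
Qed.

Lemma T2_cst (c a : C) : T2 (fun=> c) a.
Proof.
apply: (@T2I _ a c 0 0 (fun=> 0)); first exact: Bdd_cst.
by apply: filterE => w; ring.
Qed.

Lemma T2_id (a : C) : T2 id a.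
Proof.
apply: (@T2I _ a a 1 0 (fun=> 0)); first exact: Bdd_cst.
by apply: filterE => w /=; ring.
Qed.

Lemma T2D f g a : T2 f a -> T2 g a -> T2 (fun w => f w + g w) a.
Proof.
move=> [b [c [r [Br H]]]] [b' [c' [r' [Br' H']]]].
apply: (@T2I _ a (f a + g a) (b + b') (c + c') (fun w => r w + r' w)); first exact: BddD.
by apply: filterS2 H H' => w -> ->; ring.
Qed.

Lemma T2M f g a : T2 f a -> T2 g a -> T2 (fun w => f w * g w) a.
Proof.
move=> Tf Tg; have Bg := T2_Bdd Tg.
move: Tf Tg => [b [c [r [Br H]]]] [b' [c' [r' [Br' H']]]].
apply: (@T2I _ a (f a * g a) (f a * b' + b * g a) (f a * c' + b * b' + c * g a)
  (fun w => f a * r' w + b * (c' + (w - a) * r' w) +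
            c * (b' + c' * (w - a) + (w - a) ^+ 2 * r' w) + r w * g w)).
  by bdd.
by apply: filterS2 H H' => w E1 E2; rewrite {1}E1 mulrDl {1}E2 E2; ring.
Qed.

Lemma T2N f a : T2 f a -> T2 (fun w => - f w) a.
Proof.
move=> H; have := T2M (T2_cst (-1) a) H.
by under eq_fun do rewrite mulN1r.
Qed.

Lemma T2B f g a : T2 f a -> T2 g a -> T2 (fun w => f w - g w) a.
Proof. by move=> H1 H2; apply: T2D => //; apply: T2N. Qed.

Lemma T2X f a n : T2 f a -> T2 (fun w => f w ^+ n) a.
Proof.
move=> Hf; elim: n => [|n IH]; first exact: T2_cst.
by have := T2M Hf IH; under eq_fun do rewrite -exprS.
Qed.

Lemma T2_near f g a : (\forall w \near a, f w = g w) -> T2 f a -> T2 g a.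
Proof.
move=> E [b [c [r [Br H]]]]; exists b, c, r; split=> //.
have <- := nbhs_singleton E.
by apply: filterS2 E H => w <-.
Qed.

Lemma T2_sum (I : Type) (s : seq I) (P : pred I) (f : I -> C -> C) a :
  (forall i, P i -> T2 (f i) a) -> T2 (fun t => \sum_(i <- s | P i) f i t) a.
Proof.
move=> H; elim: s => [|i s IH].
  by under eq_fun do rewrite big_nil; apply: T2_cst.
under eq_fun do rewrite big_cons.
by case: (boolP (P i)) => Pi; [apply: T2D => //; apply: H|apply: IH].
Qed.

Lemma T2_prod (I : Type) (s : seq I) (P : pred I) (f : I -> C -> C) a :
  (forall i, P i -> T2 (f i) a) -> T2 (fun t => \prod_(i <- s | P i) f i t) a.
Proof.
move=> H; elim: s => [|i s IH].
  by under eq_fun do rewrite big_nil; apply: T2_cst.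
under eq_fun do rewrite big_cons.
by case: (boolP (P i)) => Pi; [apply: T2M => //; apply: H|apply: IH].
Qed.

Lemma T2_horner (p : {poly C}) f a : T2 f a -> T2 (fun w => p.[f w]) a.
Proof.
move=> Hf; under eq_fun do rewrite horner_coef.
by apply: T2_sum => i _; apply: T2M; [exact: T2_cst|exact: T2X].
Qed.

Lemma T2_poly (p : {poly C}) a : T2 (fun w => p.[w]) a.
Proof. exact: T2_horner (T2_id a). Qed.

Lemma near_neq0 (f : C -> C) a : f @ a --> f a -> f a != 0 -> \forall w \near a, f w != 0.
Proof.
move=> /near_cvgP H l0; have l0' : 0 < nrm (f a) by rewrite nrm_gt0.
apply: filterS (H _ l0') => w h; rewrite -nrm_gt0.
by have := nrm_rtri (f a) (f w); rewrite nrm_sub; lra.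
Qed.

Lemma T2V f a : T2 f a -> f a != 0 -> T2 (fun w => (f w)^-1) a.
Proof.
move=> Tf f0; have cf := T2_cvg Tf; have nf := near_neq0 cf f0.
have Bi : Bdd (nbhs a) (fun w => (f w)^-1) by exact: (BddV cf f0).
move: Tf => [b [c [r [Br H]]]].
set u := (f a)^-1.
have uE : u * f a = 1 by rewrite mulVf.
(* The coefficients of the inverse power series up to order two, with [u] its value at [a]; the
   remainder is what makes the product with [f] equal to 1. *)
apply: (@T2I _ a u (- u ^+ 2 * b) (u ^+ 3 * b ^+ 2 - u ^+ 2 * c)
  (fun w => (f w)^-1 * (- u * r w
     + u ^+ 2 * b * (c + (w - a) * r w)
     - (u ^+ 3 * b ^+ 2 - u ^+ 2 * c) * (b + c * (w - a) + (w - a) ^+ 2 * r w)))).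
  by bdd.
apply: filterS2 H nf => w E fw0; apply: (mulfI fw0).
have Ea : f w * (f w)^-1 = 1 by rewrite divff.
rewrite Ea [RHS]mulrDr [f w * (_ ^+ 3 * _)]mulrCA [f w * (_ * _)]mulrA Ea mul1r E.
have -> : f a = u^-1 by rewrite invrK.
have u0 : u != 0 by rewrite invr_eq0.
by field.
Qed.

End Taylor.

(** * A Liouville theorem *)

Section Liouville.
Context {R : realType}.
Local Notation C := (Cx R).
Local Notation Re := complex.Re.
Local Notation Im := complex.Im.

Lemma Re_le_nrm (z : C) : `|Re z| <= nrm z.
Proof. by rewrite -lecR -nrmE normc_ge_Re. Qed.

Lemma nrm_sqr (z : C) : nrm z ^+ 2 = Re z ^+ 2 + Im z ^+ 2.
Proof. by case: z => a b /=; rewrite /nrm /= sqr_sqrtr // addr_ge0 ?sqr_ge0. Qed.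

Lemma Im_le_nrm (z : C) : `|Im z| <= nrm z.
Proof.
rewrite -(@ler_pXn2r _ 2) ?nnegrE ?normr_ge0 ?nrm_ge0 // real_normK ?num_real //.
by rewrite nrm_sqr lerDr sqr_ge0.
Qed.

Lemma nrm_le_ReIm (z : C) : nrm z <= `|Re z| + `|Im z|.
Proof.
rewrite -(@ler_pXn2r _ 2) ?nnegrE ?nrm_ge0 ?addr_ge0 ?normr_ge0 // nrm_sqr.
rewrite sqrrD !real_normK ?num_real //.
by have := mulr_ge0 (normr_ge0 (Re z)) (normr_ge0 (Im z)); lra.
Qed.

Lemma max_on_square (psi : C -> R) (r : R) : 0 < r ->
  (forall a e, 0 < e -> \forall w \near a, `|psi w - psi a| < e) ->
  exists2 a : C, `|Re a| <= r /\ `|Im a| <= r &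
    forall x : C, `|Re x| <= r -> `|Im x| <= r -> psi x <= psi a.
Proof.
move=> r0 cpsi.
pose toC (t : R * R) : C := (t.1 +i* t.2)%C.
pose A := (`[(- r), r] `*` `[(- r), r] : set (R * R)).
have cA : compact A by apply: compact_setX; apply: segment_compact.
have A0 : A !=set0.
  by exists (0, 0); split; rewrite /= in_itv /= oppr_le0 ltW.
have cf : {within A, continuous (psi \o toC)}.
  apply: continuous_subspaceT => t; apply/cvgrPdist_lt => e e0.
  have /nbhs_nrmP[d d0 H] := cpsi (toC t) e e0.
  have d2 : 0 < d / 2 by rewrite divr_gt0.
  exists (ball t.1 (d / 2), ball t.2 (d / 2)).
    by split; apply: nbhsx_ballx.
  move=> [u v] [/= hu hv]; rewrite /= distrC; apply: H.
  apply: (le_lt_trans (nrm_le_ReIm _)) => /=.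
  by move: hu hv; rewrite /ball /= (distrC u) (distrC v); lra.
have [t tA Ht] := compact_EVT_max A0 cA cf.
exists (toC t).
  by move: tA; rewrite inE => -[]; rewrite /= !in_itv /= -!ler_norml.
move=> x h1 h2; have := Ht (Re x, Im x); rewrite /= /toC /=.
have -> : (Re x +i* Im x)%C = x by case: (x).
by apply; rewrite inE; split; rewrite /= in_itv /= -ler_norml.
Qed.

(** The four directions sum to zero, and so do their squares, hence [4 * Phi a] is the sum of the
    four values up to the remainders. Squares enter through the tangent bound x^2 >= 2 N x - N^2
    with N the modulus of [Phi a]. *)
Lemma sq_mean_ge (Phi : C -> C) (a b c : C) (K h : R) : 0 <= h ->
  (forall w : C, nrm (w - a) = h ->
    nrm (Phi w - (Phi a + b * (w - a) + c * (w - a) ^+ 2)) <= K * h ^+ 3) ->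
  forall hc : C, hc = (h%:C)%C ->
  4 * nrm (Phi a) ^+ 2 - 8 * nrm (Phi a) * (K * h ^+ 3) <=
  nrm (Phi (a + hc)) ^+ 2 + nrm (Phi (a - hc)) ^+ 2 +
  nrm (Phi (a + hc * 'i%C)) ^+ 2 + nrm (Phi (a - hc * 'i%C)) ^+ 2.
Proof.
move=> h0 H hc hcE.
have nh : nrm hc = h by rewrite hcE nrm_real ger0_norm.
have ni : nrm ('i%C : C) = 1 by rewrite /nrm /= expr0n /= add0r expr1n sqrtr1.
have H1 := H (a + hc); have H2 := H (a - hc).
have H3 := H (a + hc * 'i%C); have H4 := H (a - hc * 'i%C).
have e1 u : a + u - a = u by ring.
rewrite !e1 ?nrmN ?nrmM ?ni ?mulr1 in H1 H2 H3 H4.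
move: (H1 nh) (H2 nh) (H3 nh) (H4 nh) => {}H1 {}H2 {}H3 {}H4.
set P1 := Phi (a + hc) in H1 *; set P2 := Phi (a - hc) in H2 *.
set P3 := Phi (a + hc * 'i%C) in H3 *; set P4 := Phi (a - hc * 'i%C) in H4 *.
have i2 : ('i%C : C) ^+ 2 = -1 by exact: sqr_i.
set r1 := P1 - _ in H1; set r2 := P2 - _ in H2.
set r3 := P3 - _ in H3; set r4 := P4 - _ in H4.
have E : 4 * Phi a = P1 + P2 + P3 + P4 - (r1 + r2 + r3 + r4).
  rewrite /r1 /r2 /r3 /r4 !sqrrN !exprMn i2; ring.
have N : 4 * nrm (Phi a) <= nrm P1 + nrm P2 + nrm P3 + nrm P4 + 4 * (K * h ^+ 3).
  have -> : 4 * nrm (Phi a) = nrm (4 * Phi a) by rewrite nrmM nrm_nat.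
  rewrite E.
  have t1 := nrmB (P1 + P2 + P3 + P4) (r1 + r2 + r3 + r4).
  have t2 := nrmD (P1 + P2 + P3) P4; have t3 := nrmD (P1 + P2) P3.
  have t4 := nrmD P1 P2; have t5 := nrmD (r1 + r2 + r3) r4.
  have t6 := nrmD (r1 + r2) r3; have t7 := nrmD r1 r2.
  by lra.
have n0 := nrm_ge0 (Phi a).
have S x : 2 * nrm (Phi a) * nrm x - nrm (Phi a) ^+ 2 <= nrm x ^+ 2.
  have := sqr_ge0 (nrm x - nrm (Phi a)); rewrite sqrrB; lra.
have := S P1; have := S P2; have := S P3; have := S P4.
have : 2 * nrm (Phi a) * (4 * nrm (Phi a)) <= 2 * nrm (Phi a) * (nrm P1 + nrm P2 + nrm P3 + nrm P4 + 4 * (K * h ^+ 3)).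
  by apply: ler_wpM2l => //; rewrite mulr_ge0.
rewrite expr2; lra.
Qed.

Lemma nrm_sq_cross (a : C) (h : R) : forall hc : C, hc = (h%:C)%C ->
  nrm (a + hc) ^+ 2 + nrm (a - hc) ^+ 2 + nrm (a + hc * 'i%C) ^+ 2 + nrm (a - hc * 'i%C) ^+ 2
  = 4 * nrm a ^+ 2 + 4 * h ^+ 2.
Proof. by move=> hc ->; case: a => x y; rewrite !nrm_sqr /=; ring. Qed.

(* At an interior maximum of [nrm Phi ^+ 2 + e * nrm x ^+ 2] the mean over a
   small cross kills the first and second order terms of [Phi], while the mean
   of [e * nrm x ^+ 2] grows by [e * h ^+ 2]. *)
Lemma no_local_max (Phi : C -> C) (e : R) (a : C) : 0 < e -> T2 Phi a ->
  ~ (\forall w \near a,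
       nrm (Phi w) ^+ 2 + e * nrm w ^+ 2 <= nrm (Phi a) ^+ 2 + e * nrm a ^+ 2).
Proof.
move=> e0 [b [c [r [/Bdd_pos[K K0 HK] H]]]] Hm.
have [d d0 D] := (nbhs_nrmP _ _).1 (filterI (filterI H HK) Hm).
set N := nrm (Phi a); have N0 : 0 <= N := nrm_ge0 _.
(* The step is so small that the error 8 N K h^3 of the mean stays below the gain 4 e h^2. *)
have [h h0 [hd hs]] : exists2 h : R, 0 < h & h < d /\ 2 * N * K * h < e.
  have q0 : 0 < e / (2 * N * K + 1).
    by rewrite divr_gt0 // ltr_wpDl // mulr_ge0 ?(ltW K0) // mulr_ge0.
  have m0 : 0 < Num.min d (e / (2 * N * K + 1)) by rewrite lt_min d0 q0.
  exists (Num.min d (e / (2 * N * K + 1)) / 2); first by rewrite divr_gt0.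
  set m := Num.min _ _ in m0 *.
  have m1 : m <= d by rewrite ge_min lexx.
  have m2 : m <= e / (2 * N * K + 1) by rewrite ge_min lexx orbT.
  split; first by lra.
  have P0 : 0 < 2 * N * K + 1 by rewrite ltr_wpDl // mulr_ge0 ?(ltW K0) // mulr_ge0.
  move: m2; rewrite ler_pdivlMr // => m2.
  have : 0 <= N * K * m by rewrite !mulr_ge0 ?(ltW K0) ?(ltW m0).
  lra.
have nearh w : nrm (w - a) = h -> nrm (w - a) < d by move=> ->.
have HT w : nrm (w - a) = h ->
    nrm (Phi w - (Phi a + b * (w - a) + c * (w - a) ^+ 2)) <= K * h ^+ 3.
  move=> wh; have [[-> B] _] := D w (nearh w wh).
  have -> : forall A B : C, A + B - A = B by move=> *; ring.
  by rewrite nrmM nrmX wh mulrC ler_wpM2r // exprn_ge0 // ltW.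
have M := sq_mean_ge (ltW h0) HT (erefl _).
have X := nrm_sq_cross a (erefl (h%:C)%C).
have nh : nrm ((h%:C)%C : C) = h by rewrite nrm_real gtr0_norm.
have ni : nrm ('i%C : C) = 1 by rewrite /nrm /= expr0n /= add0r expr1n sqrtr1.
have e1 u : a + u - a = u by ring.
have U u : nrm u = h -> nrm (Phi (a + u)) ^+ 2 + e * nrm (a + u) ^+ 2 <= N ^+ 2 + e * nrm a ^+ 2.
  by move=> uh; have [_] := D (a + u) (nearh _ (etrans (congr1 nrm (e1 u)) uh)).
have U1 := U (h%:C)%C nh.
have U2 := U (- (h%:C)%C) (etrans (nrmN _) nh).
have nhi : nrm ((h%:C)%C * 'i%C : C) = h by rewrite nrmM ni nh mulr1.
have U3 := U _ nhi.
have U4 := U _ (etrans (nrmN _) nhi).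
have : e * (4 * nrm a ^+ 2 + 4 * h ^+ 2) <= 4 * e * nrm a ^+ 2 + 8 * N * (K * h ^+ 3).
  rewrite -X; rewrite -/N in M; lra.
move=> F; have : 4 * h ^+ 2 * e <= 4 * h ^+ 2 * (2 * N * K * h).
  by rewrite exprS in F; rewrite ?exprS expr0 in F *; lra.
by rewrite ler_pM2l ?mulr_gt0 // ?exprn_gt0 // leNgt hs.
Qed.

Definition inftyC : set_system C :=
  [set A | exists M : R, forall x, M < nrm x -> A x].

#[global] Instance inftyC_filter : Filter inftyC.
Proof.
split; first by exists 0.
- move=> A B [M HM] [N HN]; exists (Num.max M N) => x.
  by rewrite gt_max => /andP[/HM ? /HN ?].
- by move=> A B AB [M HM]; exists M => x /HM /AB.
Qed.

Lemma near_infty (M : R) : \forall x \near inftyC, M < nrm x.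
Proof. by exists M. Qed.

Lemma near_infty_neq0 : \forall x \near inftyC, x != 0.
Proof. by exists 0 => x; rewrite nrm_gt0. Qed.

Lemma inv_cvg_infty : (fun x : C => x^-1) @ inftyC --> (0 : C).
Proof.
apply/(@cvg_nrmP _ _ inftyC inftyC_filter) => e e0; exists e^-1 => x h.
have x0 : 0 < nrm x by apply: lt_trans h; rewrite invr_gt0.
by rewrite subr0 nrmV -[ltRHS]invrK ltf_pV2 ?posrE ?invr_gt0.
Qed.

Lemma Bdd_inv_infty : Bdd inftyC (fun x : C => x^-1).
Proof. exact: (Bdd_cvg inv_cvg_infty). Qed.

Lemma Bdd_poly_infty (L : {poly C}) D : (size L <= D.+1)%N ->
  Bdd inftyC (fun x => L.[x] / x ^+ D).
Proof.
move=> sL.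
apply: (@Bdd_near _ _ _ _ (fun x : C => \sum_(i < size L) L`_i * x^-1 ^+ (D - i))).
  apply: filterS near_infty_neq0 => x x0.
  rewrite horner_coef mulr_suml; apply: eq_bigr => i _.
  rewrite -mulrA; congr (_ * _).
  have iD : (i <= D)%N by rewrite -ltnS (leq_trans (ltn_ord i)).
  by rewrite exprVn -{2}(subnK iD) exprD; field; rewrite !expf_neq0.
by apply: Bdd_sum => i _; apply: BddM; [exact: Bdd_cst|apply: BddX; exact: Bdd_inv_infty].
Qed.

(** Maximum principle for an auxiliary function that is continuous everywhere, vanishes on [Z] and
    tends to zero at infinity: a nonzero value at [b] produces a maximum outside [Z], which
    [no_local_max] forbids. [Q] itself is never extended across [Z]. *)
Lemma liouville0 (Z : seq C) (Q : C -> C) :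
  (forall a, a \notin Z -> T2 Q a) -> (forall z, z \in Z -> Bdd z^' Q) ->
  Bdd inftyC (fun x => Q x * x) ->
  forall b, b \notin Z -> Q b = 0.
Proof.
move=> T2Q BZ [K [M HM']] b bZ.
have HM x : M < nrm x -> nrm (Q x) * nrm x <= K by rewrite -nrmM; exact: HM'.
pose m := size Z; pose P (x : C) := \prod_(z <- Z) (x - z).
(* With m exceptional points, the power of [Q] decays like x^-(m+1) while [P] grows like x^m. On [Z]
   the factor [P] makes [Phi] vanish continuously, whatever values [Q] takes there. *)
pose Phi x := Q x ^+ m.+1 * P x.
have T2P a : T2 P a.
  by apply: T2_prod => z _; apply: T2B; [exact: T2_id|exact: T2_cst].
have PZ z : z \in Z -> P z = 0.
  move=> zZ; apply/eqP; rewrite /P prodf_seq_eq0; apply/hasP; exists z => //=.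
  by rewrite subrr.
have P0 x : x \notin Z -> P x != 0.
  move=> xZ; rewrite /P prodf_seq_eq0; apply/hasPn => z zZ /=.
  by rewrite subr_eq0; apply: contraNneq xZ => ->.
have T2Phi a : a \notin Z -> T2 Phi a.
  by move=> aZ; apply: T2M => //; apply: T2X; apply: T2Q.
have cPhi a : Phi @ nbhs a --> Phi a.
  case: (boolP (a \in Z)) => aZ; last exact: T2_cvg (T2Phi _ aZ).
  have E : Phi a = 0 by rewrite /Phi PZ // mulr0.
  rewrite E; apply/near_cvgP => e e0.
  have c0 : P @ a^' --> (0 : C).
    apply/(@cvg_nrmP _ _ a^' (Cx_dnbhs_filter a)) => e' e'0.
    have := (near_cvgP _ _ _).1 (T2_cvg (T2P a)) e' e'0.
    by rewrite PZ //; apply: nbhs_dnbhs.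
  have c1 : (fun t => P t * (Q t ^+ m.+1)) @ a^' --> (0 : C).
    by apply: cvg0_Bdd => //; apply: BddX; exact: BZ.
  have := (@cvg_nrmP _ _ a^' (Cx_dnbhs_filter a) _ _).1 c1 e e0.
  rewrite /prop_near1 /= => /dnbhs_nrmP[d d0 D].
  apply/nbhs_nrmP; exists d => // w wd; case: (eqVneq w a) => [->|wa].
    by rewrite E subrr nrm0.
  by have := D w wa wd; rewrite /Phi mulrC.
apply/eqP/negPn/negP => Qb.
have Phib : 0 < nrm (Phi b) ^+ 2.
  by rewrite exprn_gt0 // nrm_gt0 mulf_neq0 ?P0 // expf_neq0.
set eta := nrm (Phi b) ^+ 2 in Phib.
have [S S0 HS] : exists2 S : R, 0 < S &
   forall x, S <= nrm x -> nrm (Phi x) ^+ 2 < eta / 4.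
  pose B := \sum_(z <- Z) nrm z.
  have B0 : 0 <= B by apply: sumr_ge0 => z _; apply: nrm_ge0.
  have zB z : z \in Z -> nrm z <= B.
    move=> zZ; rewrite /B (perm_big _ (perm_to_rem zZ)) big_cons /= lerDl.
    by apply: sumr_ge0 => w _; apply: nrm_ge0.
  pose K' := `|K| + 1; have K'0 : 0 < K' by rewrite ltr_wpDl.
  pose cst := K' ^+ m.+1 * 2 ^+ m.
  have cst0 : 0 < cst by rewrite mulr_gt0 ?exprn_gt0.
  have nb0 : 0 < nrm (Phi b) by move: Phib; rewrite /eta exprn_even_gt0 //= lt_def nrm_ge0 andbT.
  exists (`|M| + 1 + B + 4 * cst / nrm (Phi b)).
    have := divr_ge0 (ltW (mulr_gt0 (ltr0n R 4) cst0)) (nrm_ge0 (Phi b)).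
    by have := normr_ge0 M; lra.
  move=> x; set q := 4 * cst / _ => hx.
  have q0 : 0 < q by rewrite divr_gt0 // mulr_gt0.
  have x0 : 0 < nrm x by have := normr_ge0 M; lra.
  have hP : nrm (P x) <= (2 * nrm x) ^+ m.
    rewrite /P nrm_prod /m -count_predT -iter_mulr_1 -big_const_seq big_seq [leRHS]big_seq.
    apply: ler_prod => z zZ; rewrite nrm_ge0 /=.
    by have := nrmB x z; have := zB z zZ; have := normr_ge0 M; lra.
  have hQ : nrm (Q x) <= K' / nrm x.
    rewrite ler_pdivlMr //; apply: le_trans (HM x _) _; last first.
      by rewrite /K'; have := ler_norm K; lra.
    by have := ler_norm M; lra.
  have : nrm (Phi x) <= cst / nrm x.
    rewrite nrmM nrmX.
    apply: (@le_trans _ _ ((K' / nrm x) ^+ m.+1 * (2 * nrm x) ^+ m)).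
      by apply: ler_pM; rewrite ?exprn_ge0 ?nrm_ge0 // lerXn2r ?nnegrE ?nrm_ge0 // ltW // divr_gt0.
    rewrite /cst !exprMn exprVn le_eqVlt; apply/orP; left; apply/eqP.
    have nx : nrm x != 0 by rewrite gt_eqF.
    by rewrite [_ ^+ m.+1]exprS [nrm x ^+ m.+1]exprS; field; rewrite nx expf_neq0.
  have : cst / nrm x < nrm (Phi b) / 2.
    rewrite ltr_pdivrMr //; have : q <= nrm x by have := normr_ge0 M; lra.
    rewrite /q ler_pdivrMr // => h; have := mulr_gt0 nb0 x0; lra.
  move=> h1 h2; rewrite /eta; have : nrm (Phi x) < nrm (Phi b) / 2 by lra.
  move=> h3; rewrite -[ltRHS](_ : (nrm (Phi b) / 2) ^+ 2 = _); last by field.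
  by rewrite ltrXn2r ?nrm_ge0.
pose S' := S + nrm b.
have S'0 : 0 < S' by rewrite ltr_wpDr ?nrm_ge0.
(* On the square of half side [S'] one has |x|^2 <= 2 S'^2, so the perturbation is at most
   [eta / 4]. Outside radius [S] the main term is below [eta / 4] too, which keeps the maximum in
   the open disc of radius [S], inside the square. *)
pose e := eta / (8 * S' ^+ 2).
have eE : e * (2 * S' ^+ 2) = eta / 4.
  by rewrite /e; field; rewrite gt_eqF.
have e0 : 0 < e by rewrite divr_gt0 // mulr_gt0 // exprn_gt0.
pose psi w := nrm (Phi w) ^+ 2 + e * nrm w ^+ 2.
have cn (f : C -> C) (a : C) : f @ nbhs a --> f a -> (fun w => nrm (f w)) @ nbhs a --> nrm (f a).
  move=> /near_cvgP cf; apply/cvgrPdist_lt => d d0.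
  apply: filterS (cf d d0) => w; apply: le_lt_trans.
  have := nrm_rtri (f a) (f w); have := nrm_rtri (f w) (f a).
  by rewrite (nrm_sub (f a)) ler_norml; lra.
have cpsi (a : C) d : 0 < d -> \forall w \near a, `|psi w - psi a| < d.
  have : psi @ nbhs a --> psi a.
    apply: cvgD; first by apply: (@cvgM _ _ _ _ (fun w => nrm (Phi w))); apply: cn.
    apply: cvgM; first exact: cvg_cst.
    by apply: (@cvgM _ _ _ _ (fun w => nrm w)); apply: (@cn id); exact: T2_cvg (T2_id a).
  by move=> /cvgrPdist_lt H d0; apply: filterS (H d d0) => w; rewrite distrC.
have [a [a1 a2] amax] := max_on_square S'0 cpsi.
have nbS : nrm b <= S' by rewrite /S' lerDr ltW.
have psib : eta <= psi a.
  apply: (@le_trans _ _ (psi b)).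
    by rewrite /psi -/eta lerDl mulr_ge0 ?exprn_ge0 ?nrm_ge0 // ltW.
  apply: amax; first exact: le_trans (Re_le_nrm _) _.
  exact: le_trans (Im_le_nrm _) _.
have ea : e * nrm a ^+ 2 <= eta / 4.
  rewrite -eE; apply: ler_wpM2l; first exact: ltW.
  rewrite nrm_sqr -(real_normK (num_real (Re a))) -(real_normK (num_real (Im a))).
  have h1 := lerXn2r 2 (normr_ge0 (Re a)) (ltW S'0) a1.
  have h2 := lerXn2r 2 (normr_ge0 (Im a)) (ltW S'0) a2.
  lra.
have aS : nrm a < S.
  by rewrite ltNge; apply/negP => /HS; move: psib; rewrite /psi; lra.
have aZ : a \notin Z.
  apply/negP => aZ; move: psib; rewrite /psi /Phi PZ // mulr0 nrm0 expr0n /=; lra.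
apply: (no_local_max e0 (T2Phi a aZ)).
have d0 : 0 < S - nrm a by lra.
apply: filterS (near_nrm_lt a d0) => w wd; apply: amax.
  by apply: le_trans (Re_le_nrm _) _; rewrite /S'; have := nrm_rtri w a; have := nrm_ge0 b; lra.
by apply: le_trans (Im_le_nrm _) _; rewrite /S'; have := nrm_rtri w a; have := nrm_ge0 b; lra.
Qed.

Lemma fresh_point (Z : seq C) : exists x : C, x \notin Z.
Proof.
exists ((1 + \sum_(z <- Z) nrm z)%:C)%C; apply/negP => xZ.
have s0 : 0 <= \sum_(z <- Z) nrm z by apply: sumr_ge0 => w _; apply: nrm_ge0.
have : nrm ((1 + \sum_(z <- Z) nrm z)%:C)%C <= \sum_(z <- Z) nrm z.
  rewrite [leRHS](perm_big _ (perm_to_rem xZ)) big_cons /= lerDl.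
  by apply: sumr_ge0 => w _; apply: nrm_ge0.
by rewrite nrm_real ger0_norm; lra.
Qed.

Lemma fresh_points (Z : seq C) n : exists s : seq C,
  [/\ uniq s, size s = n & forall x, x \in s -> x \notin Z].
Proof.
elim: n => [|n [s [us ss sZ]]]; first by exists [::].
have [x] := fresh_point (s ++ Z); rewrite mem_cat negb_or => /andP[xs xZ].
exists (x :: s); split; rewrite /= ?xs ?ss // => y; rewrite inE => /orP[/eqP->|/sZ] //.
Qed.

Lemma interpolation (F : C -> C) (s : seq C) : uniq s ->
  exists2 L : {poly C}, (size L <= size s)%N & forall a, a \in s -> L.[a] = F a.
Proof.
elim: s => [|a s IH] /=; first by exists 0; rewrite ?size_poly0.
move=> /andP[as_ us]; have [L sL HL] := IH us.
pose P := \prod_(z <- s) ('X - z%:P).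
have Pa : P.[a] != 0.
  rewrite horner_prod prodf_seq_neq0; apply/allP => z zs.
  by rewrite !hornerE subr_eq0; apply: contraNneq as_ => ->.
exists (L + ((F a - L.[a]) / P.[a]) *: P).
  apply: leq_trans (size_polyD _ _) _; rewrite geq_max (leq_trans sL) //=.
  by apply: leq_trans (size_scale_leq _ _) _; rewrite size_prod_XsubC.
move=> b; rewrite inE => /orP[/eqP->|bs]; rewrite !hornerE.
  by rewrite mulfVK //; ring.
have -> : P.[b] = 0.
  apply/eqP; rewrite horner_prod prodf_seq_eq0; apply/hasP; exists b => //=.
  by rewrite !hornerE subrr.
by rewrite mulr0 addr0 HL.
Qed.

(** Subtract the interpolant at [D + 1] fresh nodes and divide by the nodal polynomial of degree
    [D + 1]. The quotient is bounded at the nodes, where the numerator vanishes, and O(1/x) at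
    infinity, so it is zero by [liouville0]. *)
Lemma polynomial_of_growth (Z : seq C) (F : C -> C) (D : nat) :
  (forall a, a \notin Z -> T2 F a) -> (forall z, z \in Z -> Bdd z^' F) ->
  Bdd inftyC (fun x => F x / x ^+ D) ->
  exists2 L : {poly C}, (size L <= D.+1)%N & forall x, x \notin Z -> F x = L.[x].
Proof.
move=> T2F BZ Binf.
have [s [us ss sZ]] := fresh_points Z D.+1.
have [L sL HL] := interpolation F us; rewrite ss in sL.
exists L => // x xZ.
pose P (x : C) := \prod_(z <- s) (x - z).
have T2P a : T2 P a.
  by apply: T2_prod => z _; apply: T2B; [exact: T2_id|exact: T2_cst].
have P0 y : y \notin s -> P y != 0.
  move=> ys; rewrite /P prodf_seq_eq0; apply/hasPn => z zs /=.
  by rewrite subr_eq0; apply: contraNneq ys => ->.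
case: (boolP (x \in s)) => xs; first by rewrite HL.
pose Q w := (F w - L.[w]) / P w.
suff : Q x = 0.
  by move/eqP; rewrite mulf_eq0 invr_eq0 (negPf (P0 x xs)) orbF subr_eq0 => /eqP.
apply: (@liouville0 (Z ++ s)); last by rewrite mem_cat negb_or xZ.
- move=> a; rewrite mem_cat negb_or => /andP[aZ as_].
  apply: T2M; last by apply: T2V => //; apply: P0.
  by apply: T2B; [exact: T2F|exact: T2_poly].
- move=> z; rewrite mem_cat; case: (boolP (z \in s)) => [zs _|zs]; last first.
    rewrite orbF => zZ; apply: BddM; last first.
      by apply: Bdd_dnbhs; apply: T2_Bdd; apply: T2V => //; apply: P0.
    by apply: BddB; [exact: BZ|apply: Bdd_dnbhs; apply: T2_Bdd; exact: T2_poly].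
  have [r Br Hr] := T2_lip (T2B (T2F z (sZ z zs)) (T2_poly L z)).
  pose P' (w : C) := \prod_(y <- rem z s) (w - y).
  have P'0 : P' z != 0.
    rewrite /P' prodf_seq_eq0; apply/hasPn => y ys /=.
    rewrite subr_eq0; apply/eqP => zy; move: ys; rewrite -zy.
    by rewrite mem_rem_uniq // inE eqxx.
  have T2P' : T2 (fun w => (P' w)^-1) z.
    by apply: T2V => //; apply: T2_prod => y _; apply: T2B; [exact: T2_id|exact: T2_cst].
  apply: (@Bdd_near _ _ _ _ (fun w => r w * (P' w)^-1)); last first.
    by apply: BddM; apply: Bdd_dnbhs => //; exact: T2_Bdd.
  have Hr' : \forall w \near z^', F w - L.[w] = (w - z) * r w.
    by apply: nbhs_dnbhs; apply: filterS Hr => w <-; rewrite (HL z zs) subrr subr0.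
  have Hn : \forall w \near z^', w != z by apply: nbhs_dnbhs_neq.
  apply: filterS2 Hr' Hn => w E wz.
  rewrite /Q E /P (perm_big _ (perm_to_rem zs)) big_cons /= -/(P' w).
  have wz' : w - z != 0 by rewrite subr_eq0.
  by rewrite -mulf_div divff // mul1r.
- pose U (x : C) := \prod_(z <- s) (1 - z / x).
  apply: (@Bdd_near _ _ _ _ (fun x => (F x / x ^+ D - L.[x] / x ^+ D) * (U x)^-1)).
    apply: filterS near_infty_neq0 => y y0.
    have -> : U y = P y / y ^+ D.+1.
      rewrite -ss -count_predT -iter_mulr_1 -big_const_seq /P -prodf_div.
      by apply: eq_bigr => z _; field.
    rewrite /Q invf_div exprS -mulrBl; move: (P y)^-1 => q.
    by field; rewrite expf_neq0.
  apply: BddM; first by apply: BddB => //; apply: Bdd_poly_infty.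
  have cU : U @ inftyC --> (\prod_(z <- s) (1 - z * 0) : C).
    have TU : T2 (fun u : C => \prod_(z <- s) (1 - z * u)) 0.
      by apply: T2_prod => z _; apply: T2B; [|apply: T2M; [|exact: T2_id]]; exact: T2_cst.
    exact: (cvg_comp _ _ inv_cvg_infty (T2_cvg TU)).
  apply: BddV cU _; rewrite big1 ?oner_eq0 // => z _; by rewrite mulr0 subr0.
Qed.

End Liouville.

(** * Laurent expansions and N-point functions *)

Section LaurentSeries.
Context {R : realType}.
Local Notation C := (Cx R).

Lemma cvg_seq_nrmP (u : nat -> C) (l : C) :
  u @ \oo --> l <-> (forall e : R, 0 < e -> exists N, forall n, (N <= n)%N -> nrm (u n - l) < e).
Proof.
split=> [cu e e0|H].
  have [N _ HN] := cu _ (near_nrm_lt l e0).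
  by exists N => n Nn; apply: HN.
move=> A /nbhs_nrmP[d d0 HA]; have [N HN] := H d d0.
by exists N => // n /= Nn; apply: HA; apply: HN.
Qed.

Lemma cvg_seq_mull (u : nat -> C) (c l : C) :
  u @ \oo --> l -> (fun n => c * u n) @ \oo --> c * l.
Proof.
move=> cu; apply: ((cvg_seq_nrmP _ _).2 _) => e e0.
have c0 : 0 < nrm c + 1 by rewrite ltr_wpDl ?nrm_ge0.
have [N HN] := (cvg_seq_nrmP _ _).1 cu (e / (nrm c + 1)) (divr_gt0 e0 c0).
exists N => n /HN; rewrite -mulrBr nrmM ltr_pdivlMr // mulrDr mulr1 mulrC.
by have := nrm_ge0 (u n - l); lra.
Qed.

Lemma punctured_near (z : C) (A : set C) : z^' A -> exists2 w, w != z & A w.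
Proof.
move=> /dnbhs_nrmP[d d0 H]; exists (z + ((d / 2)%:C)%C).
  rewrite -subr_eq0 addrAC subrr add0r -nrm_eq0 nrm_real.
  by rewrite gt_eqF // normr_gt0 gt_eqF // divr_gt0.
apply: H.
  rewrite -subr_eq0 addrAC subrr add0r -nrm_eq0 nrm_real.
  by rewrite gt_eqF // normr_gt0 gt_eqF // divr_gt0.
by rewrite addrAC subrr add0r nrm_real gtr0_norm ?divr_gt0 //; lra.
Qed.

Lemma power_tail (b : nat -> C) (rho K : R) n (h : C) L : 0 < rho -> 0 <= K ->
  (forall k, nrm (b k) * rho ^+ k <= K) -> nrm h <= rho / 2 ->
  nrm (\sum_(n <= k < n + L) b k * h ^+ k) <= 2 * K / rho ^+ n * nrm h ^+ n.
Proof.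
move=> r0 K0 HK hh; have hn := nrm_ge0 h.
have rn : 0 < rho ^+ n by rewrite exprn_gt0.
(* Comparison with a geometric series of ratio 1/2; its partial sum 2 - 2 (1/2)^L is a bound that
   the induction on [L] can carry. *)
suff : nrm (\sum_(n <= k < n + L) b k * h ^+ k) <=
    K / rho ^+ n * nrm h ^+ n * (2 - 2 * (1 / 2) ^+ L).
  move/le_trans; apply.
  have -> : 2 * K / rho ^+ n * nrm h ^+ n = K / rho ^+ n * nrm h ^+ n * 2 by field; rewrite gt_eqF.
  rewrite ler_wpM2l //; first by rewrite mulr_ge0 ?exprn_ge0 // divr_ge0 // ltW.
  by rewrite gerBl mulr_ge0 // exprn_ge0.
elim: L => [|L IH].
  by rewrite addn0 big_geq // nrm0 expr0 mulr1 subrr mulr0.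
rewrite addnS big_nat_recr ?leq_addr //=.
apply: le_trans (nrmD _ _) _; rewrite nrmM nrmX.
have : nrm (b (n + L)%N) * nrm h ^+ (n + L) <= K / rho ^+ n * nrm h ^+ n * (1 / 2) ^+ L.
  rewrite exprD.
  have h1 : nrm h ^+ L <= (rho * (1 / 2)) ^+ L.
    by apply: lerXn2r; rewrite ?nnegrE //; lra.
  rewrite exprMn in h1.
  have h2 : nrm (b (n + L)%N) <= K / rho ^+ (n + L) by rewrite ler_pdivlMr ?exprn_gt0.
  apply: (@le_trans _ _ (K / rho ^+ (n + L) * (nrm h ^+ n * (rho ^+ L * (1 / 2) ^+ L)))).
    apply: ler_pM => //; rewrite ?mulr_ge0 ?exprn_ge0 ?nrm_ge0 //.
    by rewrite ler_wpM2l // exprn_ge0.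
  by rewrite le_eqVlt; apply/orP; left; apply/eqP; rewrite exprD; field; rewrite !expf_neq0 // gt_eqF.
have E (A q : R) : A * (2 - 2 * (1 / 2 * q)) = A * (2 - 2 * q) + A * q by field.
by move=> h1; rewrite exprS E; apply: lerD.
Qed.

(** Abel's argument: convergence at a single point [w1] bounds the terms there, so the tail from
    index [n] on is O(|w - z|^n) in the disc of half that radius. Pointwise convergence in the OPE
    thus yields a uniform remainder. *)
Lemma laurent_expansion (z : C) (F : C -> C) (M : int) (b : nat -> C) :
  (\forall w \near z^', series (fun k : nat => (w - z) ^ (M + k%:Z) * b k) @ \oo --> F w) ->
  forall n, exists2 r : C -> C, Bdd z^' r &
    \forall w \near z^', F w = (w - z) ^ M * (\sum_(k < n) b k * (w - z) ^+ k + (w - z) ^+ n * r w).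
Proof.
move=> H n.
have pow w k : w != z -> (w - z) ^ (M + k%:Z) = (w - z) ^ M * (w - z) ^+ k.
  by move=> wz; rewrite expfzDr ?subr_eq0.
have H' : \forall w \near z^', w != z /\
   (fun L => \sum_(0 <= k < L) b k * (w - z) ^+ k) @ \oo --> (w - z) ^ (- M) * F w.
  have [d d0 D] := (dnbhs_nrmP _ _).1 H.
  apply: ((dnbhs_nrmP z _).2 _).
  exists d; first exact: d0.
  move=> w wz wd.
  have cF := D w wz wd.
  split; first exact: wz.
  have nz : w - z != 0 by rewrite subr_eq0.
  have -> : (fun L => \sum_(0 <= k < L) b k * (w - z) ^+ k) =
      (fun L => (w - z) ^ (- M) * series (fun k : nat => (w - z) ^ (M + k%:Z) * b k) L).
    apply/funext => L; rewrite /series /= big_distrr /=; apply: eq_bigr => k _.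
    by rewrite pow // !mulrA -expfzDr // addNr expr0z mul1r mulrC.
  exact: cvg_seq_mull.
have [w1 w1z [_ c1]] := punctured_near H'.
pose rho := nrm (w1 - z); have rho0 : 0 < rho by rewrite nrm_gt0 subr_eq0.
have [K K0 HK] : exists2 K, 0 <= K & forall k, nrm (b k) * rho ^+ k <= K.
  have [N HN] := (cvg_seq_nrmP _ _).1 c1 1 ltr01.
  (* Beyond [N] two consecutive partial sums lie within 1 of the limit, so a term is at most 2; the
     sum covers the first [N] terms. *)
  exists (2 + \sum_(k < N) nrm (b k) * rho ^+ k).
    by rewrite addr_ge0 // sumr_ge0 // => i _; rewrite mulr_ge0 ?exprn_ge0 ?nrm_ge0.
  move=> k; case: (ltnP k N) => kN.
    rewrite (bigD1 (Ordinal kN)) //= addrCA lerDl addr_ge0 // sumr_ge0 // => i _.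
    by rewrite mulr_ge0 ?exprn_ge0 ?nrm_ge0.
  apply: (@le_trans _ _ 2); last first.
    by rewrite lerDl sumr_ge0 // => i _; rewrite mulr_ge0 ?exprn_ge0 ?nrm_ge0.
  have h1 := HN k kN; have h2 := HN k.+1 (leqW kN).
  have -> : nrm (b k) * rho ^+ k = nrm (b k * (w1 - z) ^+ k) by rewrite nrmM nrmX.
  move: h2; rewrite big_nat_recr //=; set l := _ * F _ in h1 *; set S := \sum_(_ <= _ < _) _ in h1 *.
  set t := _ * _ => h2; have -> : t = (S + t - l) - (S - l) by ring.
  by have := nrmB (S + t - l) (S - l); lra.
exists (fun w => ((w - z) ^ (- M) * F w - \sum_(k < n) b k * (w - z) ^+ k) / (w - z) ^+ n).
  exists (2 * K / rho ^+ n).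
  have Hd : \forall w \near z^', nrm (w - z) < rho / 2.
    by apply: nbhs_dnbhs; apply: near_nrm_lt; rewrite divr_gt0.
  apply: filterS2 H' Hd => w [wz cw] wd.
  have nz : 0 < nrm (w - z) by rewrite nrm_gt0 subr_eq0.
  rewrite nrmM nrmV nrmX ler_pdivrMr ?exprn_gt0 //.
  apply/ler_addgt0Pr => e e0; have [N HN] := (cvg_seq_nrmP _ _).1 cw e e0.
  have := HN (n + N)%N (leq_addl _ _).
  rewrite (big_cat_nat (leq0n n) (leq_addr _ _)) /= big_mkord.
  have := power_tail n N rho0 K0 HK (ltW wd).
  set S1 := \sum_(k < n) _; set S2 := \sum_(_ <= _ < _) _; set l := _ * F w.
  have -> : l - S1 = S2 - (S1 + S2 - l) by ring.
  by have := nrmB S2 (S1 + S2 - l); lra.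
have Hn : \forall w \near z^', w != z by apply: nbhs_dnbhs_neq.
apply: filterS Hn => w wz; have nz : w - z != 0 by rewrite subr_eq0.
rewrite [_ ^+ n * _]mulrC mulfVK ?expf_neq0 //.
set S := \sum_(_ < _) _; have -> : S + ((w - z) ^ (- M) * F w - S) = (w - z) ^ (- M) * F w by ring.
by rewrite mulrA -expfzDr // subrr expr0z mul1r.
Qed.

Lemma laurent_shift (h : C) (beta : int -> C) (m0 : int) d (l : C) :
  (forall m : int, m < m0 + d%:Z -> beta m = 0) ->
  series (fun k : nat => h ^ (m0 + k%:Z) * beta (m0 + k%:Z)) @ \oo --> l <->
  series (fun k : nat => h ^ (m0 + d%:Z + k%:Z) * beta (m0 + d%:Z + k%:Z)) @ \oo --> l.
Proof.
move=> H.
have E L : series (fun k : nat => h ^ (m0 + k%:Z) * beta (m0 + k%:Z)) (d + L)%N =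
  series (fun k : nat => h ^ (m0 + d%:Z + k%:Z) * beta (m0 + d%:Z + k%:Z)) L.
  rewrite /series /= (big_cat_nat (leq0n d) (leq_addr _ _)) /= big_nat big1 ?add0r; last first.
    by move=> k /andP[_ kd]; rewrite H ?mulr0 // ltrD2l ltz_nat.
  rewrite -[X in \sum_(X <= _ < _) _]add0n big_addn addKn; apply: eq_bigr => k _.
  by rewrite PoszD [(k%:Z + _)]addrC addrA.
split=> /cvg_seq_nrmP H'; apply/cvg_seq_nrmP => e e0; have [N HN] := H' e e0.
  by exists N => n Nn; rewrite -E; apply: HN; rewrite (leq_trans Nn) // leq_addl.
by exists (d + N)%N => n Nn; rewrite -(subnKC (leq_trans (leq_addr N d) Nn)) E; apply: HN; lia.
Qed.

(** The OPE of a state starts at some index [m0], while [M] is the pole order known from the fields.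
    Either may be the smaller one; the coefficients between them vanish. *)
Lemma laurent_expansion_int (z : C) (F : C -> C) (m0 M : int) (beta : int -> C) :
  (forall m, m < m0 -> beta m = 0) -> (forall m, m < M -> beta m = 0) ->
  (\forall w \near z^', series (fun k : nat => (w - z) ^ (m0 + k%:Z) * beta (m0 + k%:Z)) @ \oo --> F w) ->
  forall n, exists2 r : C -> C, Bdd z^' r &
    \forall w \near z^', F w = (w - z) ^ M *
       (\sum_(k < n) beta (M + k%:Z) * (w - z) ^+ k + (w - z) ^+ n * r w).
Proof.
move=> H0 HM H; apply: (@laurent_expansion _ _ _ (fun k : nat => beta (M + k%:Z))).
have [d d0 D] := (dnbhs_nrmP _ _).1 H; apply: ((dnbhs_nrmP z _).2 _).
exists d; first exact: d0.
move=> w wz wd; have {D} := D w wz wd.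
case: (leP m0 M) => mM.
  have [e dE] : exists e : nat, M = m0 + e%:Z.
    by exists `|M - m0|%N; lia.
  by rewrite dE in HM *; case: (laurent_shift (w - z) (F w) HM) => h _; exact: h.
have [e dE] : exists e : nat, m0 = M + e%:Z.
  by exists `|m0 - M|%N; lia.
by rewrite dE in H0 *; case: (laurent_shift (w - z) (F w) H0) => _ h; exact: h.
Qed.

End LaurentSeries.

Lemma cvg_dnbhs (R : realType) (f : Cx R -> Cx R) (a l : Cx R) :
  f @ nbhs a --> l -> f @ a^' --> l.
Proof.
move=> cf; apply: ((@cvg_nrmP _ _ a^' (Cx_dnbhs_filter a) _ _).2 _) => e e0.
by apply: nbhs_dnbhs; exact: ((near_cvgP _ _ _).1 cf e e0).
Qed.

Lemma cvg_dnbhs_unique (R : realType) (f h : Cx R -> Cx R) (a l l' : Cx R) :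
  f @ a^' --> l -> h @ a^' --> l' -> (\forall w \near a^', f w = h w) -> l = l'.
Proof.
move=> cf ch E; apply/eqP; rewrite -subr_eq0 -nrm_eq0; apply/negPn/negP => n0.
have e0 : 0 < nrm (l - l') / 2 by rewrite divr_gt0 // lt_def n0 nrm_ge0.
have Hf := (@cvg_nrmP _ _ a^' (Cx_dnbhs_filter a) _ _).1 cf _ e0.
have Hh := (@cvg_nrmP _ _ a^' (Cx_dnbhs_filter a) _ _).1 ch _ e0.
have [w _ [[h1 h2] h3]] := punctured_near (filterI (filterI Hf Hh) E).
rewrite h3 in h1; have := nrmB (h w - l') (h w - l).
by have -> : h w - l' - (h w - l) = l - l'; [ring|lra].
Qed.

(** * Tuples with a distinguished first entry *)

Section Fcons.
Context (A : Type) (n : nat).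
Implicit Types (a : A) (f : 'I_n -> A).

Lemma fcons0 a f : fcons a f ord0 = a.
Proof. by rewrite /fcons unlift_none. Qed.

Lemma fconsS a f i : fcons a f (lift ord0 i) = f i.
Proof. by rewrite /fcons liftK. Qed.

Lemma fcons_eq a f (h : 'I_n.+1 -> A) :
  h ord0 = a -> (forall i, h (lift ord0 i) = f i) -> h = fcons a f.
Proof.
move=> h0 hS; apply/funext => i; case: (unliftP ord0 i) => [j ->|->].
  by rewrite fconsS.
by rewrite fcons0.
Qed.

End Fcons.

Section Fcons2.
Context (A : Type) (n : nat).
Implicit Types (a : A) (f : 'I_n -> A).

Lemma fcons_map (A' : Type) (k : A -> A') a f : (fun i => k (fcons a f i)) = fcons (k a) (fun i => k (f i)).
Proof. by apply: fcons_eq => [|i]; rewrite ?fcons0 ?fconsS. Qed.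

Lemma fcons_inj_seq a f : injective (fcons a f) <-> (forall i, f i <> a) /\ injective f.
Proof.
split=> [inj|[fa fi] i j].
  split=> [i fia|i j fij].
    by have := inj (lift ord0 i) ord0; rewrite fconsS fcons0 => /(_ fia) /eqP; rewrite eq_sym (negPf (neq_lift _ _)).
  by apply: (@lift_inj _ ord0); apply: inj; rewrite !fconsS.
case: (unliftP ord0 i) => [i' ->|->]; case: (unliftP ord0 j) => [j' ->|->]; rewrite ?fconsS ?fcons0 //.
- by move=> /fi ->.
- by move=> /fa.
- by move=> /esym/fa.
Qed.

End Fcons2.

(** * N-point functions of one moving point *)

Section NPoint.
Context (R : realType) (V : meromorphicCFT R) (g : nat) (p : {poly Cx R}).
Context (B : field_bundle V g p).
Local Notation C := (Cx R).
Local Notation X := (hpoint g p).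
Local Notation T := (virT V).
Local Notation one := (one_field V).

Lemma admissible_cons N (c : chart g p) (cs : 'I_N -> chart g p) z zs :
  admissible (fcons c cs) (fcons z zs) <->
  [/\ dom c z, (forall i, cs i (zs i) <> c z) & admissible cs zs].
Proof.
have E : (fun i => (fcons c cs i) (fcons z zs i)) = fcons (c z) (fun i => cs i (zs i)).
  by apply: fcons_eq => [|i]; rewrite ?fcons0 ?fconsS.
rewrite /admissible E fcons_inj_seq; split=> [[D [H I]]|[D H [D' I]]].
  split=> //; first by have := D ord0; rewrite !fcons0.
  by split=> // i; have := D (lift ord0 i); rewrite !fconsS.
split=> // i; case: (unliftP ord0 i) => [j ->|->]; by rewrite ?fconsS ?fcons0.
Qed.

Lemma dom_nbhs (c : chart g p) z : dom c z -> \forall w \near z, dom c w.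
Proof. by move=> dz; apply: open_nbhs_nbhs; split=> //; exact: dom_open. Qed.

(** A chart is injective, so each of the other points has at most one coordinate in it, and that
    coordinate lies at positive distance from [z]. *)
Lemma near_admissible N (c : chart g p) (cs : 'I_N -> chart g p) z zs :
  admissible (fcons c cs) (fcons z zs) ->
  \forall w \near z, admissible (fcons c cs) (fcons w zs).
Proof.
move=> /admissible_cons[dz H ad].
have : \forall w \near z, forall i, dom c w -> cs i (zs i) <> c w.
  apply: (@filter_forall _ _ (fun i w => dom c w -> cs i (zs i) <> c w) (nbhs z)) => i.
  have [[w0 [d0 E]]|ne] := pselect (exists w0, dom c w0 /\ cs i (zs i) = c w0); last first.
    by apply: filterE => w dw E; apply: ne; exists w.
  have w0z : 0 < nrm (w0 - z).
    by rewrite nrm_gt0 subr_eq0; apply/eqP => w0z; apply: (H i); rewrite -w0z.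
  apply: filterS (near_nrm_lt z w0z) => w hw dw E'.
  by move: hw; rewrite (param_inj d0 dw) ?ltxx // -E.
move=> H'; apply: filterS2 H' (dom_nbhs dz) => w h dw.
by apply/admissible_cons; split=> // i; apply: h.
Qed.

Section Corr.
Context (s : correlator B).

Lemma corr_linear_at N (P : 'I_N -> X) v v1 v2 (i : 'I_N) a : injective P ->
  (forall j, j != i -> v j = v1 j) -> (forall j, j != i -> v2 j = v1 j) ->
  v i = a *: v1 i + v2 i ->
  s N P v = a * s N P v1 + s N P v2.
Proof.
move=> iP h1 h2 hv.
have E (w : forall j, fib B (P j)) : (forall j, j != i -> w j = v1 j) -> w = dfwith v1 i (w i).
  move=> hw; apply: functional_extensionality_dep => j; case: (eqVneq i j) => [ij|ij].
    by subst; rewrite dfwithin.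
  by rewrite dfwithout // hw // eq_sym.
rewrite (E v h1) hv corr_linear // -(E v1) //; congr (_ + _).
by rewrite -(E v2).
Qed.

Lemma npoint_linear N (c : chart g p) (cs : 'I_N -> chart g p) phis z zs a u v :
  admissible (fcons c cs) (fcons z zs) ->
  npoint s (fcons c cs) (fcons (a *: u + v) phis) (fcons z zs) =
  a * npoint s (fcons c cs) (fcons u phis) (fcons z zs) +
  npoint s (fcons c cs) (fcons v phis) (fcons z zs).
Proof.
move=> [D I]; apply: (@corr_linear_at _ _ _ _ _ ord0 a) => //.
- by move=> j; case: (unliftP ord0 j) => [j' ->|->]; rewrite ?fconsS ?eqxx.
- by move=> j; case: (unliftP ord0 j) => [j' ->|->]; rewrite ?fconsS ?eqxx.
- rewrite (fcons0 (a *: u + v) phis) (fcons0 u phis) (fcons0 v phis).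
  exact: (triv_linear B (D ord0) a u v).
Qed.

Lemma npoint_zero N (c : chart g p) (cs : 'I_N -> chart g p) phis z zs :
  admissible (fcons c cs) (fcons z zs) ->
  npoint s (fcons c cs) (fcons 0 phis) (fcons z zs) = 0.
Proof.
move=> ad; have := npoint_linear phis 1 0 0 ad.
rewrite scaler0 addr0 mul1r => /eqP; rewrite -subr_eq0 opprD addrA subrr sub0r oppr_eq0.
by move/eqP.
Qed.

Lemma npoint_scale N (c : chart g p) (cs : 'I_N -> chart g p) phis z zs a u :
  admissible (fcons c cs) (fcons z zs) ->
  npoint s (fcons c cs) (fcons (a *: u) phis) (fcons z zs) =
  a * npoint s (fcons c cs) (fcons u phis) (fcons z zs).
Proof.
by move=> ad; rewrite -[a *: u]addr0 npoint_linear // npoint_zero // addr0.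
Qed.

Lemma npoint_perm N (c : 'I_N -> chart g p) phi z (t : 'S_N) : admissible c z ->
  npoint s (fun i => c (t i)) (fun i => phi (t i)) (fun i => z (t i)) = npoint s c phi z.
Proof.
move=> [_ inj].
exact: (@corr_sym _ _ _ _ _ s N (fun i => c i (z i)) (fun i => triv B (c i) (c i (z i)) (phi i)) t inj).
Qed.

Lemma fcons_swap (A : Type) n (a b : A) (f : 'I_n -> A) :
  (fun i => fcons a (fcons b f) (tperm ord0 (lift ord0 ord0) i)) = fcons b (fcons a f).
Proof.
apply: fcons_eq; first by rewrite tpermL fconsS fcons0.
move=> i; case: (unliftP ord0 i) => [j ->|->]; last by rewrite tpermR !fcons0.
by rewrite tpermD ?fconsS // ?neq_lift // (inj_eq lift_inj) neq_lift.
Qed.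

Lemma npoint_swap N c1 c2 (cs : 'I_N -> chart g p) u1 u2 phis z1 z2 zs :
  admissible (fcons c1 (fcons c2 cs)) (fcons z1 (fcons z2 zs)) ->
  npoint s (fcons c2 (fcons c1 cs)) (fcons u2 (fcons u1 phis)) (fcons z2 (fcons z1 zs)) =
  npoint s (fcons c1 (fcons c2 cs)) (fcons u1 (fcons u2 phis)) (fcons z1 (fcons z2 zs)).
Proof.
move=> ad; have := npoint_perm (fcons u1 (fcons u2 phis)) (tperm ord0 (lift ord0 ord0)) ad.
by rewrite !fcons_swap.
Qed.

End Corr.

Section State.
Context (s : state B).

Lemma admissible_swap N c1 c2 (cs : 'I_N -> chart g p) z1 z2 zs :
  admissible (fcons c1 (fcons c2 cs)) (fcons z1 (fcons z2 zs)) ->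
  admissible (fcons c2 (fcons c1 cs)) (fcons z2 (fcons z1 zs)).
Proof.
move=> /admissible_cons[d1 H1 /admissible_cons[d2 H2 ad]].
have H0 := H1 ord0; rewrite !fcons0 in H0.
have HS i := H1 (lift ord0 i).
apply/admissible_cons; split=> //.
  move=> i; case: (unliftP ord0 i) => [j ->|->]; rewrite ?fconsS ?fcons0 //.
  by move=> E; apply: H0.
by apply/admissible_cons; split=> // i; have := HS i; rewrite !fconsS.
Qed.

Lemma near_admissible2 N (c : chart g p) (cs : 'I_N -> chart g p) z zs :
  admissible (fcons c cs) (fcons z zs) ->
  \forall w \near z^', admissible (fcons c (fcons c cs)) (fcons w (fcons z zs)).
Proof.
move=> ad; have [d d0 D] := (nbhs_nrmP _ _).1 (near_admissible ad).
apply: ((dnbhs_nrmP z _).2 _); exists d => // w wz wd.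
have /admissible_cons[dw H _] := D w wd.
have /admissible_cons[dz _ _] := ad.
apply/admissible_cons; split=> // i.
case: (unliftP ord0 i) => [j ->|->]; rewrite ?fconsS ?fcons0 //.
by move=> E; move: wz; rewrite (param_inj dz dw E) eqxx.
Qed.

Lemma npoint_cvg N (c : chart g p) (cs : 'I_N -> chart g p) phi phis z zs :
  admissible (fcons c cs) (fcons z zs) ->
  (fun w => npoint s (fcons c cs) (fcons phi phis) (fcons w zs)) @ nbhs z -->
  npoint s (fcons c cs) (fcons phi phis) (fcons z zs).
Proof.
move=> ad; have := state_der s phi phis ad.
case=> /derivable1_diffP/differentiable_continuous; exact.
Qed.

(** The OPE with the identity field, inserted at [z] and then omitted. As N_m(phi, 1) = 0 for m < 0,
    it is a Taylor expansion of the N-point function, with linear coefficient given by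
    [fder phi]. *)
Lemma npoint_expansion N (c : chart g p) (cs : 'I_N -> chart g p) phi phis z zs :
  admissible (fcons c cs) (fcons z zs) ->
  let F w := npoint s (fcons c cs) (fcons phi phis) (fcons w zs) in
  exists c2 r, Bdd (nbhs z) r /\ \forall w \near z,
    F w = F z + npoint s (fcons c cs) (fcons (fder phi) phis) (fcons z zs) * (w - z)
      + c2 * (w - z) ^+ 2 + (w - z) ^+ 3 * r w.
Proof.
move=> ad F.
pose be (m : int) := npoint s (fcons c cs) (fcons (opeN m phi one) phis) (fcons z zs).
have [m0 [H0 H]] := state_ope s phi one phis ad.
have bm m : m < m0 -> be m = 0 by move=> mm; rewrite /be H0 // npoint_zero.
have b0 m : m < 0 -> be m = 0 by move=> mm; rewrite /be opeN_one // npoint_zero.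
have H' : \forall w \near z^', series (fun k : nat => (w - z) ^ (m0 + k%:Z) * be (m0 + k%:Z)) @ \oo --> F w.
  have [d1 d10 D1] := (dnbhs_nrmP _ _).1 H.
  have [d2 d20 D2] := (dnbhs_nrmP _ _).1 (near_admissible2 ad).
  apply: ((dnbhs_nrmP z _).2 _); exists (Num.min d1 d2); first by rewrite lt_min d10 d20.
  move=> w wz; rewrite lt_min => /andP[w1 w2].
  have E : npoint s (fcons c (fcons c cs)) (fcons phi (fcons one phis)) (fcons w (fcons z zs)) = F w.
    have ad2 := D2 w wz w2.
    rewrite -npoint_swap // state_one //; exact: admissible_swap.
  by have := D1 w wz w1; rewrite E.
have [r Br Hr] := laurent_expansion_int bm b0 H' 3.
have [d d0 D] := (dnbhs_nrmP _ _).1 Hr.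
(* The constant coefficient comes from N_0(phi, 1); continuity of the N-point function identifies it
   with the value at [z]. *)
have E0 : F z = be 0.
  have Tb : (fun w => be 0 + (w - z) * (be 1 + be 2 * (w - z) + (w - z) ^+ 2 * r w)) @ z^' --> be 0.
    rewrite -[X in _ --> X]addr0; apply: cvgD; first exact: cvg_cst.
    apply: cvg0_Bdd; first exact: cvg_dnbhs (shift_cvg0 z).
    have Bs := Bdd_dnbhs (Bdd_shift z); bdd.
  have TF : F @ z^' --> F z.
    exact: (@cvg_dnbhs R F z (F z) (npoint_cvg ad)).
  apply: cvg_dnbhs_unique TF Tb _; apply: filterS Hr => w ->.
  by rewrite expr0z mul1r !big_ord_recr big_ord0 /= !add0r expr0 expr1 mulr1; ring.
(* [r] is controlled only off [z]; the value 0 at [z] makes it bounded on a full neighbourhood. *)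
exists (be 2), (fun w => if w == z then 0 else r w); split.
  have [K K0 HK] := Bdd_pos Br; have [d' d'0 D'] := (dnbhs_nrmP _ _).1 HK.
  exists K; apply: ((nbhs_nrmP z _).2 _); exists d' => // w wd; case: eqVneq => wz.
    by rewrite nrm0 ltW.
  exact: D'.
apply: ((nbhs_nrmP z _).2 _); exists d => // w wd; case: (eqVneq w z) => [->|wz].
  by rewrite subrr !mulr0 expr0n /= !addr0 mulr0 ?addr0.
rewrite (D w wz wd) E0 expr0z mul1r !big_ord_recr big_ord0 /= !add0r expr0 expr1 mulr1.
by rewrite -[npoint _ _ (fcons (fder _) _) _]/(be 1); ring.
Qed.

Lemma T2_npoint N (c : chart g p) (cs : 'I_N -> chart g p) phi phis z zs :
  admissible (fcons c cs) (fcons z zs) ->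
  T2 (fun w => npoint s (fcons c cs) (fcons phi phis) (fcons w zs)) z.
Proof.
move=> ad; have [c2 [r [Br H]]] := npoint_expansion phi phis ad.
by exists (npoint s (fcons c cs) (fcons (fder phi) phis) (fcons z zs)), c2, r.
Qed.

(** The coefficients of order -4 to -1 are prescribed by the theory. Replacing 2 F(z)/h^2 + F'(z)/h,
    with h = w - z, by (F(w) + F(z))/h^2 costs only bounded terms, by the expansion of [F]. *)
Lemma npoint_virasoro_ope N (c : chart g p) (cs : 'I_N -> chart g p) phis z zs :
  admissible (fcons c cs) (fcons z zs) ->
  let F w := npoint s (fcons c cs) (fcons T phis) (fcons w zs) in
  exists2 r, Bdd z^' r & \forall w \near z^',
    npoint s (fcons c (fcons c cs)) (fcons T (fcons T phis)) (fcons w (fcons z zs)) =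
    central_charge V / 2 / (w - z) ^+ 4 * npoint s cs phis zs +
    (F w + F z) / (w - z) ^+ 2 + r w.
Proof.
move=> ad F.
pose be (m : int) := npoint s (fcons c cs) (fcons (opeN m T T) phis) (fcons z zs).
have [m0 [H0 H]] := state_ope s T T phis ad.
have bm m : m < m0 -> be m = 0 by move=> mm; rewrite /be H0 // npoint_zero.
have b4 m : m < -4 -> be m = 0 by move=> mm; rewrite /be virT_ope_lt // npoint_zero.
have [r Br Hr] := laurent_expansion_int bm b4 H 4.
have [c2 [r2 [Br2 Hr2]]] := npoint_expansion T phis ad.
rewrite -/(F z) in Hr2.
exists (fun w => r w - c2 - (w - z) * r2 w).
  have Bs := Bdd_dnbhs (Bdd_shift z); have Br2' := Bdd_dnbhs Br2; bdd.
have [d1 d10 D1] := (dnbhs_nrmP _ _).1 Hr.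
have [d2 d20 D2] := (nbhs_nrmP _ _).1 Hr2.
apply: ((dnbhs_nrmP z _).2 _); exists (Num.min d1 d2); first by rewrite lt_min d10 d20.
move=> w wz; rewrite lt_min => /andP[w1 w2].
have h0 : w - z != 0 by rewrite subr_eq0.
have e0 : be (-4 + 0%:Z) = central_charge V / 2 * npoint s cs phis zs.
  by rewrite /be addr0 virT_ope4 npoint_scale // state_one.
have e1 : be (-4 + 1%:Z) = 0 by rewrite /be virT_ope3 npoint_zero.
have e2 : be (-4 + 2%:Z) = 2 * F z by rewrite /be virT_ope2 npoint_scale.
have e3 : be (-4 + 3%:Z) = npoint s (fcons c cs) (fcons (fder T) phis) (fcons z zs).
  by rewrite /be virT_ope1.
rewrite (D1 w wz w1) !big_ord_recr big_ord0 /= e0 e1 e2 e3.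
have -> : F w = _ := D2 w w2; rewrite -/(F z).
have -> (h : C) : h ^ (-4 : int) = (h ^+ 4)^-1 by [].
move: (npoint s (fcons c cs) (fcons (fder T) phis) (fcons z zs)) (npoint s cs phis zs) => D W.
move: (F z) (r w) (r2 w) (central_charge V) h0 => Fz rw r2w cc.
by move: (w - z) => h h0; field.
Qed.

End State.
End NPoint.

(** * Charts of the hyperelliptic curve *)

Section LocalInverse.
Context {R : realType}.
Local Notation C := (Cx R).

Lemma cvg_nbhs_near (f : C -> C) (a l : C) (P : C -> Prop) :
  f @ nbhs a --> l -> (\forall w \near l, P w) -> \forall w \near a, P (f w).
Proof. by move=> cf; exact: cf. Qed.

Lemma T2_comp (f h : C -> C) a : T2 f a -> T2 h (f a) -> T2 (fun w => h (f w)) a.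
Proof.
move=> Tf [b [c [r [Br H]]]].
have [l Bl Hl] := T2_lip Tf.
have cf := T2_cvg Tf.
have Br' : Bdd (nbhs a) (fun w => r (f w)).
  by case: Br => K HK; exists K; apply: cvg_nbhs_near cf HK.
have H' := cvg_nbhs_near cf H.
move: Tf => [b' [c' [r' [Br2 H2]]]].
apply: (@T2I _ _ a (h (f a)) (b * b') (b * c' + c * b' ^+ 2)
  (fun w => b * r' w + c * (b' * (c' + (w - a) * r' w) + (c' + (w - a) * r' w) * l w) + (l w) ^+ 3 * r (f w))).
  by bdd.
apply: filterS2 (filterI H2 H2) (filterI H' Hl) => w [E _] [E' El].
case: (eqVneq w a) => [->|wa]; first by rewrite subrr expr0n /= expr0n /= !mulr0 mul0r !addr0.
have E2 : l w = b' + (w - a) * (c' + (w - a) * r' w).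
  have wa' : w - a != 0 by rewrite subr_eq0.
  by apply: (mulfI wa'); rewrite -El E; ring.
rewrite E' El; move: (h (f a)) (l w) (r (f w)) (r' w) (w - a) E2 => u lw rf rw d E2.
by rewrite E2; ring.
Qed.

Lemma T2_derivable (f : C -> C) a : T2 f a -> derivable f a 1.
Proof.
move=> [b [c [r [Br H]]]]; apply/cvg_ex; exists b.
have [K K0 HK] := Bdd_pos Br.
have [d d0 D] := (nbhs_nrmP _ _).1 (filterI H HK).
apply: ((@cvg_nrmP _ _ _ (Cx_dnbhs_filter 0) _ _).2 _) => e e0.
have q0 : 0 < nrm c + K + 1 by have := nrm_ge0 c; lra.
apply: ((dnbhs_nrmP 0 _).2 _); exists (Num.min (Num.min d 1) (e / (nrm c + K + 1))).
  by rewrite !lt_min d0 ltr01 divr_gt0.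
move=> h h0; rewrite subr0 !lt_min => /andP[/andP[hd h1] he].
have eh : h *: 1 + a - a = h by rewrite addrK -[RHS]mulr1.
have [] := D (h *: 1 + a); first by rewrite eh.
rewrite eh => E Hr; rewrite /= E.
have -> : h^-1 *: (f a + b * h + c * h ^+ 2 + h ^+ 3 * r (h *: 1 + a) - f a) - b =
    h * (c + h * r (h *: 1 + a)).
  rewrite -[_ *: _]/(h^-1 * _); move: (r _) (f a) => u v; by field.
rewrite nrmM; have hn : 0 < nrm h by rewrite nrm_gt0.
move: he; rewrite ltr_pdivlMr // => he.
apply: le_lt_trans he; apply: ler_wpM2l; first exact: ltW.
apply: le_trans (nrmD _ _) _; rewrite nrmM.
have : nrm h * nrm (r (h *: 1 + a)) <= 1 * K by apply: ler_pM; rewrite ?nrm_ge0 // ltW.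
lra.
Qed.

Lemma derivable_lip (f : C -> C) a : derivable f a 1 ->
  exists2 K : R, 0 < K & \forall w \near a, nrm (f w - f a) <= K * nrm (w - a).
Proof.
move=> /cvg_ex[l Hl]; exists (nrm l + 1); first by have := nrm_ge0 l; lra.
have := (@cvg_nrmP _ _ _ (Cx_dnbhs_filter 0) _ _).1 Hl 1 ltr01.
move=> /dnbhs_nrmP[d d0 D]; apply: ((nbhs_nrmP a _).2 _); exists d => // w wd.
case: (eqVneq w a) => [->|wa]; first by rewrite !subrr nrm0 mulr0.
have h0 : w - a != 0 by rewrite subr_eq0.
have := D (w - a) h0; rewrite subr0 => /(_ wd) /=.
have -> : (w - a) *: 1 + a = w :> C by rewrite -[_ *: 1]/((w - a) * 1) mulr1 subrK.
rewrite -[_ *: _]/((w - a)^-1 * _) => h.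
have -> : f w - f a = ((w - a)^-1 * (f w - f a) - l + l) * (w - a).
  move: (f w) (f a) h0 => u v h0; rewrite subrK mulrC mulrA divff // mul1r. by [].
rewrite nrmM; apply: ler_wpM2r; first exact: nrm_ge0.
by apply: le_trans (nrmD _ _) _; lra.
Qed.

Lemma derivable_cvg (f : C -> C) a : derivable f a 1 -> f @ nbhs a --> f a.
Proof. by move/derivable1_diffP/differentiable_continuous; exact. Qed.

(** Strict differentiability, uniform in both arguments near [e]. It gives the lower Lipschitz bound
    that makes a polynomial with nonzero derivative injective there. *)
Lemma poly_strict (q : {poly C}) e (eps : R) : 0 < eps ->
  exists2 rho : R, 0 < rho & forall x y, nrm (x - e) < rho -> nrm (y - e) < rho ->
    nrm (q.[x] - q.[y] - q^`().[e] * (x - y)) <= eps * nrm (x - y).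
Proof.
elim/poly_ind: q eps => [|q c IH] eps e0.
  exists 1 => // x y _ _; rewrite deriv0 !horner0 mul0r !subr0 nrm0.
  by rewrite mulr_ge0 ?nrm_ge0 // ltW.
have ne : 0 < nrm e + 1 by have := nrm_ge0 e; lra.
have nd : 0 < nrm q^`().[e] + 1 by have := nrm_ge0 q^`().[e]; lra.
have [r1 r10 H1] := IH (eps / 3 / (nrm e + 1)) (divr_gt0 (divr_gt0 e0 (ltr0n _ 3)) ne).
have e3 : 0 < eps / 3 by rewrite divr_gt0.
have [r2 r20 H2] := (nbhs_nrmP _ _).1 ((near_cvgP _ _ _).1 (T2_cvg (T2_poly q e)) (eps / 3) e3).
exists (Num.min (Num.min r1 r2) (Num.min 1 (eps / 3 / (nrm q^`().[e] + 1)))).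
  by rewrite !lt_min r10 r20 ltr01 divr_gt0.
move=> x y; rewrite !lt_min => /andP[/andP[x1 x2] /andP[x3 x4]] /andP[/andP[y1 y2] _].
rewrite derivD derivM derivX derivC addr0 mulr1 !hornerE.
have -> : q.[x] * x + c - (q.[y] * y + c) - (q^`().[e] * e + q.[e]) * (x - y) =
  x * (q.[x] - q.[y] - q^`().[e] * (x - y)) + (x - e) * q^`().[e] * (x - y) + (q.[y] - q.[e]) * (x - y).
  by move: (q.[x]) (q.[y]) (q.[e]) (q^`().[e]) => u v t d; ring.
have n0 := nrm_ge0 (x - y).
have t1 : nrm (x * (q.[x] - q.[y] - q^`().[e] * (x - y))) <= eps / 3 * nrm (x - y).
  rewrite nrmM; apply: (@le_trans _ _ ((nrm e + 1) * (eps / 3 / (nrm e + 1) * nrm (x - y)))).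
    apply: ler_pM; rewrite ?nrm_ge0 //; last exact: H1.
    by have := nrm_rtri x e; lra.
  by rewrite mulrA [X in X * _]mulrC divfK ?gt_eqF.
have t2 : nrm ((x - e) * q^`().[e] * (x - y)) <= eps / 3 * nrm (x - y).
  rewrite !nrmM; apply: ler_wpM2r => //; move: x4; rewrite ltr_pdivlMr // mulrDr mulr1.
  by have := nrm_ge0 (x - e); lra.
have t3 : nrm ((q.[y] - q.[e]) * (x - y)) <= eps / 3 * nrm (x - y).
  by rewrite nrmM; apply: ler_wpM2r => //; apply: ltW; apply: H2.
apply: le_trans (nrmD _ _) _; have := nrmD (x * (q.[x] - q.[y] - q^`().[e] * (x - y))) ((x - e) * q^`().[e] * (x - y)).
lra.
Qed.

(** If all roots of q - t were at distance at least [rho] from [e], the factorisation into linear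
    factors would give |q(e) - t| >= |lead| rho^deg. *)
Lemma poly_near_root (q : {poly C}) e (rho : R) : 0 < rho -> (1 < size q)%N ->
  exists2 del : R, 0 < del & forall t, nrm (t - q.[e]) < del ->
    exists2 x, nrm (x - e) < rho & q.[x] = t.
Proof.
move=> r0 sq; have l0 : 0 < nrm (lead_coef q) by rewrite nrm_gt0 lead_coef_eq0 -size_poly_gt0 ltnW.
exists (nrm (lead_coef q) * rho ^+ (size q).-1); first by rewrite mulr_gt0 // exprn_gt0.
move=> t ht; apply: contrapT => no.
have sqt : (size (- t%:P) < size q)%N.
  by rewrite size_polyN (leq_ltn_trans (size_polyC_leq1 _)).
have [rs Ers] := closed_field_poly_normal (q - t%:P).
rewrite lead_coefDl // in Ers.
have srs : size rs = (size q).-1.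
  have : size (q - t%:P) = size q by rewrite size_polyDl.
  rewrite Ers size_scale ?lead_coef_eq0 -?size_poly_gt0 ?(ltnW sq) //.
  by rewrite size_prod_XsubC => <-.
have far x : x \in rs -> rho <= nrm (e - x).
  move=> xr; rewrite leNgt; apply/negP => h; apply: no; exists x; first by rewrite nrm_sub.
  apply/eqP; rewrite -subr_eq0 -(hornerC t x) -hornerN -hornerD Ers hornerZ horner_prod.
  rewrite mulf_eq0; apply/orP; right; rewrite prodf_seq_eq0; apply/hasP; exists x => //=.
  by rewrite !hornerE subrr.
have : nrm (lead_coef q) * rho ^+ (size q).-1 <= nrm (t - q.[e]).
  rewrite nrm_sub -(hornerC t e) -hornerN -hornerD Ers hornerZ horner_prod nrmM nrm_prod.
  apply: ler_wpM2l; first exact: nrm_ge0.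
  rewrite -srs -count_predT -iter_mulr_1 -big_const_seq big_seq [leRHS]big_seq.
  by apply: ler_prod => x xr; rewrite (ltW r0) /= !hornerE; exact: far.
by rewrite leNgt ht.
Qed.

(** Inverse function theorem for polynomials: preimages come from [poly_near_root], injectivity from
    [poly_strict], and the expansion of the inverse from reverting that of [q]. *)
Lemma local_inverse (q : {poly C}) e : q^`().[e] != 0 ->
  exists rho del : R, exists phi : C -> C, [/\ 0 < rho /\ 0 < del,
    forall t, nrm (t - q.[e]) < del -> nrm (phi t - e) < rho /\ q.[phi t] = t,
    forall x y, nrm (x - e) < rho -> nrm (y - e) < rho -> q.[x] = q.[y] -> x = y,
    forall t, nrm (t - q.[e]) < del -> T2 phi t &
    forall x, nrm (x - e) < rho -> q^`().[x] != 0].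
Proof.
move=> q'; have n' : 0 < nrm q^`().[e] / 2 by rewrite divr_gt0 // nrm_gt0.
have sq : (1 < size q)%N.
  rewrite ltnNge; apply/negP => s1; move: q'; rewrite (size1_polyC s1) derivC horner0.
  by rewrite eqxx.
have [r1 r10 H1] := poly_strict q e n'.
have [r2 r20 H2] := (nbhs_nrmP _ _).1 (near_neq0 (T2_cvg (T2_poly q^`() e)) q').
pose rho := Num.min r1 r2; have r0 : 0 < rho by rewrite lt_min r10 r20.
have lip x y : nrm (x - e) < rho -> nrm (y - e) < rho ->
    nrm q^`().[e] / 2 * nrm (x - y) <= nrm (q.[x] - q.[y]).
  rewrite !lt_min => /andP[x1 _] /andP[y1 _]; have := H1 x y x1 y1.
  have := nrm_rtri (q^`().[e] * (x - y)) (q.[x] - q.[y]).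
  by rewrite nrmM nrm_sub; lra.
have [del d0 D] := poly_near_root e r0 sq.
have [phi Hphi] : {phi : C -> C & forall t, nrm (t - q.[e]) < del -> nrm (phi t - e) < rho /\ q.[phi t] = t}.
  apply: (@choice _ _ (fun t x => nrm (t - q.[e]) < del -> nrm (x - e) < rho /\ q.[x] = t)) => t.
  have [h|h] := pselect (nrm (t - q.[e]) < del); last by exists 0.
  by have [x x1 x2] := D t h; exists x.
exists rho, del, phi; split=> //.
- move=> x y xr yr E; have := lip x y xr yr; rewrite E subrr nrm0 => h.
  apply/eqP; rewrite -subr_eq0 -nrm_eq0; apply/eqP.
  have : nrm (x - y) <= 0 by rewrite -(pmulr_rle0 _ n').
  by have := nrm_ge0 (x - y); lra.
- move=> t0 ht0; have [x1 x2] := Hphi t0 ht0; set x0 := phi t0 in x1 x2.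
  have near_t : \forall t \near t0, nrm (t - q.[e]) < del.
    have dd : 0 < del - nrm (t0 - q.[e]) by lra.
    apply: filterS (near_nrm_lt t0 dd) => t; have := nrmD (t - t0) (t0 - q.[e]).
    by rewrite addrA subrK; lra.
  have bound : \forall t \near t0, nrm (phi t - x0) <= 2 / nrm q^`().[e] * nrm (t - t0).
    apply: filterS near_t => t ht; have [y1 y2] := Hphi t ht.
    have := lip _ _ y1 x1; rewrite y2 x2 => h.
    rewrite mulrC mulrA ler_pdivlMr ?nrm_gt0 //; lra.
  have cphi : phi @ nbhs t0 --> x0.
    have c0 : (fun t => (t - t0) * ((2 / nrm q^`().[e])%:C)%C) @ nbhs t0 --> (0 : C).
      by apply: cvg0_Bdd; [exact: shift_cvg0|exact: Bdd_cst].
    apply: ((near_cvgP _ _ _).2 _) => ep ep0; have := (near_cvgP _ _ _).1 c0 ep ep0.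
    apply: filterS2 bound => t h; rewrite subr0 nrmM nrm_real ger0_norm; last first.
      by rewrite divr_ge0 // nrm_ge0.
    by apply: le_lt_trans; rewrite mulrC.
  (* The difference quotient of [phi], set to 0 at [t0]. It is bounded, and the remainders below are
     all expressed through it. *)
  pose l t := if t == t0 then 0 else (phi t - x0) / (t - t0).
  have Bl : Bdd (nbhs t0) l.
    exists (2 / nrm q^`().[e]); apply: filterS bound => t h; rewrite /l.
    case: eqVneq => tt; first by rewrite nrm0 divr_ge0 // nrm_ge0.
    by rewrite nrmM nrmV ler_pdivrMr // nrm_gt0 subr_eq0.
  have [b [c [r [Br Hr]]]] := T2_poly q x0.
  have Br' : Bdd (nbhs t0) (fun t => r (phi t)).
    by case: Br => K HK; exists K; apply: cvg_nbhs_near cphi HK.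
  have lE t : phi t - x0 = (t - t0) * l t.
    rewrite /l; case: eqVneq => [->|tt]; first by rewrite -/x0 subrr mulr0.
    by rewrite mulrC divfK // subr_eq0.
  have key : \forall t \near t0, t - t0 = b * ((t - t0) * l t) + c * ((t - t0) * l t) ^+ 2 + ((t - t0) * l t) ^+ 3 * r (phi t).
    apply: filterS2 near_t (cvg_nbhs_near cphi Hr) => t ht; have [_ y2] := Hphi t ht.
    rewrite y2 x2 lE => {1}->; by move: (r _) => u; ring.
  (* If the linear coefficient of [q] at [x0] were zero, dividing [key] by t - t0 would give 1 = O(t
     - t0). *)
  have b0 : b != 0.
    apply/eqP => b0.
    have c1 : (fun t => (t - t0) * (c * l t ^+ 2 + (t - t0) * l t ^+ 3 * r (phi t))) @ t0^' --> (0 : C).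
      by apply: cvg_dnbhs; apply: cvg0_Bdd; [exact: shift_cvg0|bdd].
    have c2 : (fun t : C => 1 : C) @ t0^' --> (1 : C) by exact: cvg_cst.
    have : (1 : C) = 0.
      apply: (cvg_dnbhs_unique c2 c1).
      apply: filterS2 (nbhs_dnbhs_neq t0) (nbhs_dnbhs key) => t tt E.
      have tt' : t - t0 != 0 by rewrite subr_eq0.
      apply: (mulfI tt'); rewrite mulr1 {1}E b0; by move: (r _) => u; ring.
    by move/eqP; rewrite oner_eq0.
  (* Reversion of tau = b s + c s^2 + ..., which gives s = tau/b - c tau^2/b^3 + ... *)
  apply: (@T2I _ _ t0 x0 b^-1 (- c / b ^+ 3)
    (fun t => - b^-1 * (r (phi t) * l t ^+ 3) + c / b ^+ 2 * (c * l t ^+ 2 + (t - t0) * (l t ^+ 3 * r (phi t))) * (l t + b^-1))).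
    by bdd.
  apply: filterS key => t; have := lE t; move: (r (phi t)) => rt.
  case: (eqVneq t t0) => [-> _ _|tt].
    by rewrite -/x0 subrr !expr0n /= mulr0 mulr0 mul0r !addr0.
  have tt' : t - t0 != 0 by rewrite subr_eq0.
  move/eqP; rewrite subr_eq => /eqP ->.
  move: (l t) (t - t0) tt' => lt tau tau0 E.
  have S : tau ^+ 2 * (lt ^+ 3 * rt) = 1 - b * lt - c * tau * lt ^+ 2.
    apply: (mulfI tau0).
    have -> : tau * (1 - b * lt - c * tau * lt ^+ 2) = tau - (b * (tau * lt) + c * (tau * lt) ^+ 2) by ring.
    have /= -> := congr1 (fun v => v - (b * (tau * lt) + c * (tau * lt) ^+ 2)) E.
    by ring.
  have -> : tau ^+ 3 * (- b^-1 * (rt * lt ^+ 3) + c / b ^+ 2 * (c * lt ^+ 2 + tau * (lt ^+ 3 * rt)) * (lt + b^-1)) =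
     tau * (- b^-1 * (tau ^+ 2 * (lt ^+ 3 * rt)) + c / b ^+ 2 * tau * (c * tau * lt ^+ 2 + tau ^+ 2 * (lt ^+ 3 * rt)) * (lt + b^-1)).
    by move: (b^-1) (c / b ^+ 2) => u v; ring.
  by rewrite S; field.
- by move=> x; rewrite lt_min => /andP[_]; apply: H2.
Qed.

End LocalInverse.

(** * Charts at finite points and at infinity *)

Section Curve.
Context (R : realType) (g : nat) (p : {poly Cx R}).
Local Notation C := (Cx R).
Local Notation X := (hpoint g p).

Lemma finite_eq (P Q : X) : is_finite P -> is_finite Q -> xc P = xc Q -> yc P = yc Q -> P = Q.
Proof.
case: P => [x y e|//]; case: Q => [x' y' e'|//] _ _ /= E1 E2; subst.
by rewrite (bool_irrelevance e e').
Qed.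

Lemma curve_eq (P : X) : is_finite P -> yc P ^+ 2 = p.[xc P].
Proof. by case: P => // x y e _; exact: (eqP e). Qed.

Definition base_pt : X := @Finite R g p 0 (sqrtC p.[0]) (introT eqP (sqrtCK _)).

(** Total in [x] and [y]: off the curve the value is the dummy [base_pt]. *)
Definition fin_pt (x y : C) : X :=
  if pselect (y ^+ 2 = p.[x]) is left e then @Finite R g p x y (introT eqP e) else base_pt.

Lemma is_finite_fin_pt x y : is_finite (fin_pt x y).
Proof. by rewrite /fin_pt; case: pselect. Qed.

Lemma xc_fin_pt x y : y ^+ 2 = p.[x] -> xc (fin_pt x y) = x.
Proof. by rewrite /fin_pt; case: pselect. Qed.

Lemma yc_fin_pt x y : y ^+ 2 = p.[x] -> yc (fin_pt x y) = y.
Proof. by rewrite /fin_pt; case: pselect. Qed.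

Lemma fin_pt_coord (P : X) : is_finite P -> fin_pt (xc P) (yc P) = P.
Proof.
move=> fP; have E := curve_eq fP.
by apply: finite_eq => //; rewrite ?is_finite_fin_pt ?xc_fin_pt ?yc_fin_pt.
Qed.

Definition inf_pt (v : C) : X :=
  if pselect (v ^+ 2 = p`_(2 * g + 2)) is left e
  then @Infinite R g p v (introT eqP e) else base_pt.

Lemma inf_ptE v : v ^+ 2 = p`_(2 * g + 2) ->
  exists e, inf_pt v = @Infinite R g p v e.
Proof. by rewrite /inf_pt; case: pselect => // e _; eexists. Qed.

(** The points at which [x] is a local coordinate. *)
Definition good (P : X) : Prop := is_finite P /\ p.[xc P] != 0.

Lemma good_yc P : good P -> yc P != 0.
Proof.
by move=> [fP nP]; rewrite -sqrf_eq0 curve_eq.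
Qed.

Lemma open_nrm_lt (f : C -> C) (l : C) (d : R) : (forall a, f @ nbhs a --> f a) ->
  open [set a | nrm (f a - l) < d].
Proof.
move=> cf; rewrite openE => a /= ha.
have d0 : 0 < d - nrm (f a - l) by lra.
have := (near_cvgP _ _ _).1 (cf a) _ d0; apply: filterS => w /= h.
by have := nrmD (f w - f a) (f a - l); rewrite addrA subrK; lra.
Qed.

Lemma two_neq0 : (2 : C) != 0. Proof. by rewrite pnatr_eq0. Qed.

Lemma local_sqrt (y0 : C) : y0 != 0 ->
  exists rho del : R, exists phi : C -> C, [/\ 0 < rho /\ 0 < del,
    forall t, nrm (t - y0 ^+ 2) < del -> nrm (phi t - y0) < rho /\ phi t ^+ 2 = t,
    forall x y, nrm (x - y0) < rho -> nrm (y - y0) < rho -> x ^+ 2 = y ^+ 2 -> x = y &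
    forall t, nrm (t - y0 ^+ 2) < del -> T2 phi t].
Proof.
move=> y00; have q' : (('X ^+ 2 : {poly C})^`()).[y0] != 0.
  by rewrite derivXn hornerMn hornerXn expr1 mulrn_eq0.
have [rho [del [phi [[r0 d0] H1 H2 H3 _]]]] := local_inverse q'.
exists rho, del, phi; rewrite !hornerXn in H1 H3; split=> //.
- by move=> t /H1; rewrite hornerXn.
- by move=> x y xr yr E; apply: H2 => //; rewrite !hornerXn.
Qed.

Lemma x_chart_exists (P : X) : good P ->
  exists c : chart g p, [/\ x_chart c, dom c (xc P), c (xc P) = P &
     forall z, dom c z -> T2 (fun w => yc (c w)) z].
Proof.
move=> gP; have [fP nP] := gP; have y0 := good_yc gP; have E0 := curve_eq fP.
have [rho [del [phi [[r0 d0] H1 H2 H3]]]] := local_sqrt y0.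
rewrite E0 in H1 H3.
pose D := [set a : C | nrm (p.[a] - p.[xc P]) < del].
have oD : open D by apply: open_nrm_lt => a; exact: T2_cvg (T2_poly p a).
pose f (w : C) := fin_pt w (phi p.[w]).
have sq w : D w -> phi p.[w] ^+ 2 = p.[w] by move=> /H1[].
have xf w : D w -> xc (f w) = w by move=> /sq /xc_fin_pt.
have yf w : D w -> yc (f w) = phi p.[w] by move=> /sq /yc_fin_pt.
have nD z : D z -> \forall w \near z, D w by move=> Dz; apply: open_nbhs_nbhs.
have Ty z : D z -> T2 (fun w => yc (f w)) z.
  move=> Dz; apply: (@T2_near _ (fun w => phi p.[w])).
    by apply: filterS (nD z Dz) => w /yf.
  by apply: (@T2_comp _ (fun w => p.[w]) phi); [exact: T2_poly|exact: H3].
have inj z w : D z -> D w -> f z = f w -> z = w.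
  by move=> Dz Dw E; rewrite -(xf z Dz) E xf.
have holo z : D z -> holo_at f z.
  move=> Dz; left; split.
  - by apply: filterE => w; exact: is_finite_fin_pt.
  - apply: T2_derivable; apply: (@T2_near _ id); last exact: T2_id.
    by apply: filterS (nD z Dz) => w /xf.
  - exact: T2_derivable (Ty z Dz).
have DP : D (xc P) by rewrite /D /= subrr nrm0.
exists (Chart oD inj holo); split=> //=.
- by move=> z Dz; split; [exact: is_finite_fin_pt|exact: xf].
- rewrite -[RHS]fin_pt_coord // /f; congr fin_pt.
  have [h1 h2] := H1 _ DP; apply: H2 => //; first by rewrite subrr nrm0.
  by rewrite h2 E0.
Qed.

(** At a simple zero [p] is locally invertible, so x is a function of y^2 and y parametrises the
    curve. *)
Lemma y_chart_exists (e : C) : p.[e] = 0 -> p^`().[e] != 0 ->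
  exists c : chart g p, [/\ dom c 0, (forall z, dom c z -> is_finite (c z) /\ yc (c z) = z)
   & exists2 d : R, 0 < d & forall P : X, is_finite P -> nrm (xc P - e) < d ->
      dom c (yc P) /\ c (yc P) = P].
Proof.
move=> pe pe'; have [rho [del [phi [[r0 d0] H1 H2 H3 _]]]] := local_inverse pe'.
rewrite pe in H1 H3.
pose D := [set a : C | nrm (a ^+ 2 - 0) < del].
have oD : open D.
  by apply: open_nrm_lt => a; exact: T2_cvg (T2X 2 (T2_id a)).
pose f (y : C) := fin_pt (phi (y ^+ 2)) y.
have sq y : D y -> y ^+ 2 = p.[phi (y ^+ 2)] by move=> /H1[].
have xf y : D y -> xc (f y) = phi (y ^+ 2) by move=> /sq /xc_fin_pt.
have yf y : D y -> yc (f y) = y by move=> /sq /yc_fin_pt.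
have nD z : D z -> \forall w \near z, D w by move=> Dz; apply: open_nbhs_nbhs.
have inj z w : D z -> D w -> f z = f w -> z = w.
  by move=> Dz Dw E; rewrite -(yf z Dz) E yf.
have holo z : D z -> holo_at f z.
  move=> Dz; left; split.
  - by apply: filterE => w; exact: is_finite_fin_pt.
  - apply: T2_derivable; apply: (@T2_near _ (fun w => phi (w ^+ 2))).
      by apply: filterS (nD z Dz) => w /xf.
    by apply: (@T2_comp _ (fun w => w ^+ 2) phi); [exact: T2X (T2_id z)|exact: H3].
  - apply: T2_derivable; apply: (@T2_near _ id); last exact: T2_id.
    by apply: filterS (nD z Dz) => w /yf.
exists (Chart oD inj holo); split=> /=.
- by rewrite /D /mkset exprS mul0r subrr nrm0.
- by move=> z Dz; split; [exact: is_finite_fin_pt|exact: yf].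
have [r1 r10 Hr1] := (nbhs_nrmP _ _).1 ((near_cvgP _ _ _).1 (T2_cvg (T2_poly p e)) del d0).
exists (Num.min rho r1); first by rewrite lt_min r0 r10.
move=> P fP; rewrite lt_min => /andP[x1 x2].
have E := curve_eq fP.
have DP : D (yc P) by rewrite /D /= E; have := Hr1 _ x2; rewrite pe.
split=> //; rewrite -[RHS]fin_pt_coord // /f; congr fin_pt.
have [h1 h2] := H1 _ DP; apply: H2 => //.
by rewrite h2 E.
Qed.

(** u^(2g+2) p(1/u): near infinity the curve is v^2 = [rev_poly](u) with u = 1/x and v =
    y/x^(g+1). *)
Definition rev_poly : {poly C} := \poly_(k < (2 * g + 2).+1) p`_(2 * g + 2 - k).

Lemma rev_polyE (u : C) : (size p <= (2 * g + 2).+1)%N -> u != 0 ->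
  rev_poly.[u] = u ^+ (2 * g + 2) * p.[u^-1].
Proof.
move=> sp u0; rewrite horner_poly (horner_coef_wide _ sp) mulr_sumr.
rewrite (reindex_inj rev_ord_inj) /=; apply: eq_bigr => k _.
have kn : (k <= 2 * g + 2)%N by rewrite -ltnS.
rewrite subSS subKn // mulrCA; congr (_ * _).
have -> : u ^+ (2 * g + 2) = u ^+ (2 * g + 2 - k) * u ^+ k by rewrite -exprD subnK.
by rewrite exprVn mulfK // expf_neq0.
Qed.

Lemma rev_poly0 : rev_poly.[0] = p`_(2 * g + 2).
Proof. by rewrite horner_coef0 coef_poly subn0. Qed.

Lemma rev_poly_deriv0 : rev_poly^`().[0] = p`_(2 * g + 1).
Proof.
rewrite horner_coef0 coef_deriv coef_poly mulr1n.
by rewrite ltnS addn2 /=; congr (p`_ _); lia.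
Qed.

Lemma vsq (P : X) : (size p <= (2 * g + 2).+1)%N -> is_finite P -> xc P != 0 ->
  (yc P / xc P ^+ g.+1) ^+ 2 = rev_poly.[(xc P)^-1].
Proof.
move=> sp fP x0; rewrite rev_polyE ?invr_eq0 // invrK exprVn expr_div_n curve_eq //.
by rewrite mulrC -exprM; congr (_^-1 * _); congr (_ ^+ _); lia.
Qed.

(** [u] and [v] are functions of the chart coordinate, so one construction serves both parities of
    the degree: the coordinate is u in the even case and v in the odd case. *)
Lemma infinity_chart (u v : C -> C) (D : set C) :
  (size p <= (2 * g + 2).+1)%N -> open D ->
  (forall z, D z -> v z ^+ 2 = rev_poly.[u z]) ->
  (forall z w, D z -> D w -> u z = u w -> v z = v w -> z = w) ->
  (forall z, D z -> T2 u z) -> (forall z, D z -> T2 v z) ->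
  exists c : chart g p, [/\ dom c = D, forall z, D z -> u z = 0 -> ~~ is_finite (c z) &
    forall P : X, is_finite P -> xc P != 0 -> forall z, D z ->
     u z = (xc P)^-1 -> v z = yc P / xc P ^+ g.+1 -> c z = P].
Proof.
move=> sp oD sq inj0 Tu Tv.
pose f z := if u z == 0 then inf_pt (v z) else fin_pt (u z)^-1 (v z / u z ^+ g.+1).
have sqf z : D z -> u z != 0 -> (v z / u z ^+ g.+1) ^+ 2 = p.[(u z)^-1].
  move=> Dz u0; rewrite expr_div_n sq // rev_polyE //.
  rewrite -exprM mulrC mulrA (_ : (g.+1 * 2 = 2 * g + 2)%N) ?mulVf ?mul1r ?expf_neq0 //; lia.
have sqi z : D z -> u z = 0 -> v z ^+ 2 = p`_(2 * g + 2).
  by move=> Dz u0; rewrite sq // u0 rev_poly0.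
have uf z : D z -> uc (f z) = u z.
  move=> Dz; rewrite /f; case: eqVneq => u0.
    by have [e ->] := inf_ptE (sqi z Dz u0).
  have := xc_fin_pt (sqf z Dz u0); have := is_finite_fin_pt (u z)^-1 (v z / u z ^+ g.+1).
  by case: fin_pt => //= x y _ _ ->; rewrite invrK.
have vf z : D z -> vc (f z) = v z.
  move=> Dz; rewrite /f; case: eqVneq => u0.
    by have [e ->] := inf_ptE (sqi z Dz u0).
  have := xc_fin_pt (sqf z Dz u0); have := yc_fin_pt (sqf z Dz u0).
  have := is_finite_fin_pt (u z)^-1 (v z / u z ^+ g.+1).
  case: fin_pt => //= x y _ _ -> ->; rewrite exprVn invrK divfK // expf_neq0 //.
have nD z : D z -> \forall w \near z, D w by move=> Dz; apply: open_nbhs_nbhs.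
have inj z w : D z -> D w -> f z = f w -> z = w.
  move=> Dz Dw E; apply: inj0 => //.
    by rewrite -(uf z Dz) -(uf w Dw) E.
  by rewrite -(vf z Dz) -(vf w Dw) E.
have holo z : D z -> holo_at f z.
  move=> Dz; right; split.
  - apply: filterS (nD z Dz) => w Dw; rewrite /f; case: eqVneq => u0 fw.
      by have [e E] := inf_ptE (sqi w Dw u0); rewrite E in fw.
    by rewrite xc_fin_pt ?invr_eq0 // sqf.
  - apply: T2_derivable; apply: (@T2_near _ u); last exact: Tu.
    by apply: filterS (nD z Dz) => w /uf.
  - apply: T2_derivable; apply: (@T2_near _ v); last exact: Tv.
    by apply: filterS (nD z Dz) => w /vf.
exists (Chart oD inj holo); split=> // [z Dz u0|P fP x0 z Dz Eu Ev] /=.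
  by rewrite /f u0 eqxx; have [e ->] := inf_ptE (sqi z Dz u0).
rewrite /f Eu invr_eq0 (negPf x0) Ev invrK -[RHS]fin_pt_coord //.
by congr fin_pt; rewrite exprVn invrK divfK // expf_neq0.
Qed.

Definition vcoord (P : X) : C := yc P / xc P ^+ g.+1.

Lemma inv_near_infty (A : set C) : nbhs (0 : C) A -> \forall x \near inftyC, A x^-1.
Proof. by move=> nA; have := @inv_cvg_infty R A nA. Qed.

Lemma rev_poly_near0 (d : R) : 0 < d ->
  \forall x \near inftyC, nrm (rev_poly.[x^-1] - rev_poly.[0]) < d.
Proof.
move=> d0; apply: (@inv_near_infty (fun u => nrm (rev_poly.[u] - rev_poly.[0]) < d)).
exact: ((near_cvgP _ _ _).1 (T2_cvg (T2_poly rev_poly 0)) d d0).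
Qed.

Lemma infinity_chart_even (v0 : C) : (size p <= (2 * g + 2).+1)%N ->
  v0 ^+ 2 = p`_(2 * g + 2) -> v0 != 0 ->
  exists c : chart g p, (dom c 0 /\ ~~ is_finite (c 0)) /\ exists2 rho : R, 0 < rho & exists M : R,
   forall P : X, is_finite P -> M < nrm (xc P) -> nrm (vcoord P - v0) < rho ->
     dom c (xc P)^-1 /\ c (xc P)^-1 = P.
Proof.
move=> sp E0 v00; have [rho [del [phi [[r0 d0] H1 H2 H3]]]] := local_sqrt v00.
rewrite E0 -rev_poly0 in H1 H3.
pose D := [set a : C | nrm (rev_poly.[a] - rev_poly.[0]) < del].
have oD : open D by apply: open_nrm_lt => a; exact: T2_cvg (T2_poly _ a).
have [|//||z Dz|c [dc c0 Hc]] := @infinity_chart id (fun u => phi rev_poly.[u]) D sp oD.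
- by move=> z /H1[].
- by move=> z _; exact: T2_id.
- by apply: (@T2_comp _ (fun w => rev_poly.[w]) phi); [exact: T2_poly|exact: H3].
have D0 : D 0 by rewrite /D /= subrr nrm0.
exists c; rewrite dc; split; first by split=> //; apply: c0.
exists rho => //.
have [M HM] := filterI near_infty_neq0 (rev_poly_near0 d0).
exists M => P fP /HM[x0 Dx] hv; split=> //.
apply: Hc => //; have [h1 h2] := H1 _ Dx; apply: H2 => //.
by rewrite h2 vsq.
Qed.

(** The product (v - v0)(v + v0) = v^2 - v0^2 tends to zero at infinity, so one factor is small: a
    point far out is close to one of the two points at infinity. *)
Lemma vcoord_dichotomy (v0 : C) (rho : R) : (size p <= (2 * g + 2).+1)%N ->
  v0 ^+ 2 = p`_(2 * g + 2) -> 0 < rho -> exists M : R,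
  forall P : X, is_finite P -> M < nrm (xc P) ->
    nrm (vcoord P - v0) < rho \/ nrm (vcoord P - (- v0)) < rho.
Proof.
move=> sp E0 r0; have [M HM] := filterI near_infty_neq0 (rev_poly_near0 (mulr_gt0 r0 r0)).
exists M => P fP /HM[x0]; rewrite -vsq // rev_poly0 -E0 opprK subr_sqr nrmM => h.
have [|h1] := ltP (nrm (vcoord P - v0)) rho; first by left.
have [|h2] := ltP (nrm (vcoord P + v0)) rho; first by right.
by move: h; rewrite ltNge ler_pM // ltW.
Qed.

(** Here [rev_poly] has a simple zero at 0, so near infinity u is a function of v^2 and v is a
    coordinate. *)
Lemma infinity_chart_odd : (size p <= (2 * g + 2).+1)%N ->
  p`_(2 * g + 2) = 0 -> p`_(2 * g + 1) != 0 ->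
  exists c : chart g p, (dom c 0 /\ ~~ is_finite (c 0)) /\ exists M : R,
   forall P : X, is_finite P -> M < nrm (xc P) ->
     dom c (vcoord P) /\ c (vcoord P) = P.
Proof.
move=> sp E0; rewrite -rev_poly_deriv0 => q'.
have [rho [del [phi [[r0 d0] H1 H2 H3 _]]]] := local_inverse q'.
rewrite rev_poly0 E0 in H1 H3.
pose D := [set a : C | nrm (a ^+ 2 - 0) < del].
have oD : open D by apply: open_nrm_lt => a; exact: T2_cvg (T2X 2 (T2_id a)).
have [|//|z Dz|z _|c [dc c0 Hc]] := @infinity_chart (fun v => phi (v ^+ 2)) id D sp oD.
- by move=> z /H1[].
- by apply: (@T2_comp _ (fun w => w ^+ 2) phi); [exact: T2X (T2_id z)|exact: H3].
- exact: T2_id.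
have D0 : D 0 by rewrite /D /mkset exprS mul0r subrr nrm0.
exists c; rewrite dc; split.
  split=> //; apply: c0 => //; have [h1 h2] := H1 _ D0; apply: H2 => //.
    by rewrite subrr nrm0.
  by rewrite h2 rev_poly0 E0 exprS mul0r.
have near_rho : \forall x \near inftyC, nrm (x^-1 - 0) < rho.
  by apply: (@inv_near_infty (fun u => nrm (u - 0) < rho)); exact: near_nrm_lt.
have [M HM] := filterI (filterI near_infty_neq0 near_rho) (rev_poly_near0 d0).
exists M => P fP /HM[[x0 xr]]; rewrite rev_poly0 E0 => hd.
have Dv : D (vcoord P) by rewrite /D /= vsq.
split=> //; apply: Hc => //; have [h1 h2] := H1 _ Dv; apply: H2 => //.
by rewrite h2 vsq.
Qed.

End Curve.

(** * The Virasoro field at branch points and at infinity *)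

Section Schwarz.
Context {R : realType}.
Local Notation C := (Cx R).

Lemma is_derive_inv (f : C -> C) (x df : C) : f x != 0 -> is_derive x 1 f df ->
  is_derive x 1 (fun w => (f w)^-1) (- df / f x ^+ 2).
Proof.
move=> f0 [der Edf]; split; first exact: derivableV.
by rewrite deriveV // Edf -[_ *: _]/(_ * _) !mulNr mulrC.
Qed.

Lemma is_derive_prod (f h : C -> C) (x df dh : C) : is_derive x 1 f df -> is_derive x 1 h dh ->
  is_derive x 1 (fun w => f w * h w) (f x * dh + df * h x).
Proof.
move=> df_ dh_; have := @is_deriveM _ _ f h x 1 df dh df_ dh_.
by rewrite -![_ *: _]/(_ * _) [h x * df]mulrC.
Qed.

Lemma is_derive_add (f h : C -> C) (x df dh : C) : is_derive x 1 f df -> is_derive x 1 h dh ->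
  is_derive x 1 (fun w => f w + h w) (df + dh).
Proof. exact: (@is_deriveD _ _ _ f h x 1 df dh). Qed.

Lemma is_derive_horner (q : {poly C}) (x : C) : is_derive x 1 (fun w => q.[w]) q^`().[x].
Proof.
elim/poly_ind: q => [|q c IH].
  have -> : (fun w : C => (0 : {poly C}).[w]) = cst 0 by apply/funext => w; rewrite horner0.
  by rewrite deriv0 horner0; exact: is_derive_cst.
have -> : (fun w => (q * 'X + c%:P).[w]) = (fun w : C => q.[w] * w + c).
  by apply/funext => w; rewrite !hornerE.
have := is_derive_add (is_derive_prod IH (is_derive_id x 1)) (is_derive_cst c x 1).
by rewrite derivD derivM derivX derivC addr0 mulr1 !hornerE addrC.
Qed.

Lemma is_derive_unique (f : C -> C) (x d d' : C) : is_derive x 1 f d -> is_derive x 1 f d' -> d = d'.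
Proof. by move=> [_ <-] [_ <-]. Qed.

Lemma is_derive_near (f h : C -> C) (x d : C) : (\forall w \near x, f w = h w) ->
  is_derive x 1 f d -> is_derive x 1 h d.
Proof. by move=> E; apply: near_eq_is_derive => //; exact: oner_neq0. Qed.

Lemma derive1n_step (U : set C) (f h h' : C -> C) k : open U ->
  (forall w, U w -> derive1n k f w = h w) ->
  (forall w, U w -> is_derive w 1 h (h' w)) ->
  forall w, U w -> derive1n k.+1 f w = h' w.
Proof.
move=> oU E H w Uw; rewrite derive1nS derive1E.
have : is_derive w 1 (derive1n k f) (h' w).
  apply: is_derive_near (H w Uw); have : \forall v \near w, U v by apply: open_nbhs_nbhs.
  by apply: filterS => v /E ->.
by case.
Qed.

(** The chain rule S(h o ph) = S(h)(ph) ph'^2 + S(ph), for h the square root with S(h)(t) = 3/(8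
    t^2). Multiplied by c/12, the term with 3/8 is the origin of the c/32 in [vartheta]. *)
Lemma schwarzian_sqrt (U : set C) (f ph ph1 ph2 ph3 : C -> C) (z : C) : open U -> U z ->
  (forall w, U w -> derivable f w 1) ->
  (forall w, U w -> f w ^+ 2 = ph w) -> (forall w, U w -> ph w != 0) ->
  (forall w, U w -> is_derive w 1 ph (ph1 w)) ->
  (forall w, U w -> is_derive w 1 ph1 (ph2 w)) ->
  (forall w, U w -> is_derive w 1 ph2 (ph3 w)) -> ph1 z != 0 ->
  (derive1 f z) ^+ 2 = ph1 z ^+ 2 / (4 * ph z) /\
  schwarzian f z = ph3 z / ph1 z - 3 / 2 * (ph2 z / ph1 z) ^+ 2 + 3 / 8 * (ph1 z / ph z) ^+ 2.
Proof.
move=> oU Uz df sq ph0 D1 D2 D3 ph10.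
have f0 w : U w -> f w != 0 by move=> Uw; rewrite -sqrf_eq0 sq // ph0.
have two : (2 : C) != 0 by rewrite pnatr_eq0.
have Df w : U w -> is_derive w 1 f (ph1 w / (2 * f w)).
  move=> Uw; have dfw := derivableP (df w Uw).
  have E : ph1 w = f w * 'D_1 f w + 'D_1 f w * f w.
    apply: (@is_derive_unique ph w); first exact: D1.
    apply: is_derive_near (is_derive_prod dfw dfw).
    have : \forall v \near w, U v by apply: open_nbhs_nbhs.
    by apply: filterS => v /sq <-; rewrite expr2.
  suff -> : ph1 w / (2 * f w) = 'D_1 f w by [].
  by rewrite E; have := f0 w Uw; move: ('D_1 f w) (f w) => d v v0; field.
(* All derivatives of [f] are written as polynomials in 1/f and the derivatives of [ph]; below, [j]
   is ph'/f^3, and 1/f has derivative -j/2. *)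
pose i w := (f w)^-1.
have Dc (c : C) (u : C -> C) (u' w : C) : is_derive w 1 u u' -> is_derive w 1 (fun v => c * u v) (c * u').
  by move=> Du; have := is_derive_prod (is_derive_cst c w 1) Du; rewrite mul0r addr0.
pose j w := ph1 w * (i w * (i w * i w)).
have Di w : U w -> is_derive w 1 i (- 2^-1 * j w).
  move=> Uw; have := is_derive_inv (f0 w Uw) (Df w Uw); rewrite /j /i.
  suff -> : - (ph1 w / (2 * f w)) / f w ^+ 2 = - 2^-1 * (ph1 w * ((f w)^-1 * ((f w)^-1 * (f w)^-1))) by [].
  by have := f0 w Uw; move: (f w) (ph1 w) => v q v0; field.
pose h1 w := 2^-1 * (ph1 w * i w).
pose h2 w := 2^-1 * (ph1 w * (- 2^-1 * j w) + ph2 w * i w).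
pose i' w := - 2^-1 * j w.
pose j' w := ph1 w * (i w * (i w * i' w + i' w * i w) + i' w * (i w * i w)) + ph2 w * (i w * (i w * i w)).
pose h3 w := 2^-1 * (ph1 w * (- 2^-1 * j' w) + ph2 w * (- 2^-1 * j w) + (ph2 w * i' w + ph3 w * i w)).
have E1 w : U w -> derive1n 1 f w = h1 w.
  move=> Uw; rewrite derive1n1 derive1E; case: (Df w Uw) => _ ->.
  by rewrite /h1 /i; have := f0 w Uw; move: (f w) (ph1 w) => v q v0; field.
have Dh1 w : U w -> is_derive w 1 h1 (h2 w).
  by move=> Uw; apply: (Dc); exact: is_derive_prod (D2 w Uw) (Di w Uw).
have E2 := derive1n_step oU E1 Dh1.
have Dj w : U w -> is_derive w 1 j (j' w).
  move=> Uw; apply: is_derive_prod (D2 w Uw) _.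
  by apply: is_derive_prod (Di w Uw) _; exact: is_derive_prod (Di w Uw) (Di w Uw).
have Dh2 w : U w -> is_derive w 1 h2 (h3 w).
  move=> Uw; apply: (Dc); have A1 := is_derive_prod (D2 w Uw) (Dc (- 2^-1) j (j' w) w (Dj w Uw)).
  exact: is_derive_add A1 (is_derive_prod (D3 w Uw) (Di w Uw)).
have E3 := derive1n_step oU E2 Dh2.
have v0 := f0 z Uz; have Ev := sq z Uz.
have -> : derive1 f z = h1 z by rewrite -derive1n1 E1.
rewrite /schwarzian E2 // E3 // -derive1n1 E1 // -Ev.
rewrite /h3 /h2 /h1 /j' /i' /j /i.
move: (f z) (ph1 z) (ph2 z) (ph3 z) v0 ph10 => v q q2 q3 v0 q0.
by split; field; rewrite ?v0 ?q0.
Qed.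

End Schwarz.

(** * Limits over the x-line, and x-charts *)

Section AtX.
Context (R : realType) (g : nat) (p : {poly Cx R}).
Local Notation C := (Cx R).
Local Notation X := (hpoint g p).
Local Notation good := (@good R g p).

(** A limit in x taken on all sheets at once: what holds near it holds at every good point over the
    x in question, so bounds are uniform over the two sheets. *)
Definition at_x (G : set_system C) : set_system X :=
  [set A | G [set x | forall P, good P -> xc P = x -> A P]].

#[global] Instance at_x_filter G : Filter G -> Filter (at_x G).
Proof.
move=> FG; split; first by apply: (@filterS _ G FG setT _ _ filterT).
- move=> A B hA hB; apply: (@filterS2 _ G FG _ _ _ _ hA hB) => x a b P gP Px.
  by split; [exact: a|exact: b].
- move=> A B AB; apply: (@filterS _ G FG) => x a P gP Px; apply: AB; exact: a.
Qed.

Lemma at_x_near (G : set_system C) {FG : Filter G} (A : C -> Prop) :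
  (\forall x \near G, A x) -> \forall P \near at_x G, A (xc P).
Proof. by move=> H; apply: (@filterS _ G FG _ _ _ H) => x ax P _ ->. Qed.

Lemma at_x_good (G : set_system C) {FG : Filter G} : \forall P \near at_x G, good P.
Proof. by apply: (@filterS _ G FG setT _ _ filterT) => x _ P. Qed.

Lemma Bdd_at_x (G : set_system C) {FG : Filter G} (f : C -> C) : Bdd G f -> Bdd (at_x G) (fun P => f (xc P)).
Proof. by case=> K HK; exists K; apply: at_x_near HK. Qed.

Context (p_simple : forall a : C, (mup a p <= 1)%N) (p_neq0 : p != 0).

Lemma simple_root (a : C) : p.[a] = 0 -> p^`().[a] != 0.
Proof.
move=> pa; apply/eqP => pa'.
have /factor_theorem[r Er] : root p a by apply/eqP.
have : (2 <= mup a p)%N.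
  rewrite mup_geq // Er.
  have ra : r.[a] = 0.
    by move: pa'; rewrite Er derivM derivXsubC mulr1 !hornerE subrr mulr0 add0r.
  have [r' Er'] : exists r', r = r' * ('X - a%:P) by apply/factor_theorem/eqP.
  by rewrite Er' -mulrA -expr2 dvdp_mulIr.
by rewrite leqNgt ltnS p_simple.
Qed.

Lemma x_chart_yc_derivable (c : chart g p) z : x_chart c -> dom c z ->
  derivable (fun w => yc (c w)) z 1.
Proof.
move=> xch dz; have [[//]|[Hx _ Hv]] := param_holo dz.
have nd := dom_nbhs dz.
have Hy : \forall w \near z, vc (c w) * w ^+ g.+1 = yc (c w).
  apply: filterS2 nd Hx => w dw hw; have [fw xw] := xch w dw.
  have := hw fw; move: xw fw; case: (c w) => //= x y _ -> _ w0.
  by rewrite divfK // expf_neq0.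
have Dv := derivableP Hv.
have Dp : is_derive z 1 (fun w : C => w ^+ g.+1) ('X^(g.+1) : {poly C})^`().[z].
  apply: is_derive_near (is_derive_horner _ z).
  by apply: filterE => w; rewrite hornerXn.
by case: (is_derive_near Hy (is_derive_prod Dv Dp)).
Qed.

Lemma x_chart_yc_cvg (c : chart g p) z : x_chart c -> dom c z ->
  (fun w => yc (c w)) @ nbhs z --> yc (c z).
Proof. by move=> xch dz; exact: derivable_cvg (x_chart_yc_derivable xch dz). Qed.

(** At a zero of [p] the function y would be differentiable in x with value 0, so p = y^2 would
    vanish to second order, against simplicity of the zero. *)
Lemma x_chart_neq0 (c : chart g p) z : x_chart c -> dom c z -> p.[z] != 0.
Proof.
move=> xch dz; apply/eqP => pz.
have [fz xz] := xch z dz.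
have yz : yc (c z) = 0 by apply/eqP; rewrite -sqrf_eq0 curve_eq // xz pz.
have [K K0 HK] := derivable_lip (x_chart_yc_derivable xch dz).
have n0 : 0 < nrm p^`().[z] by rewrite nrm_gt0 simple_root.
have [rho r0 Hr] := poly_strict p z (divr_gt0 n0 (ltr0n R 2)).
have h0 : 0 < nrm p^`().[z] / 2 / K ^+ 2 by rewrite !divr_gt0 // exprn_gt0.
have [w wz [[h1 dw] [h2 h3]]] := punctured_near (nbhs_dnbhs (filterI (filterI HK (dom_nbhs dz)) (filterI (near_nrm_lt z r0) (near_nrm_lt z h0)))).
have [fw xw] := xch w dw.
have := Hr w z h2; rewrite subrr nrm0 pz subr0 => /(_ r0) h4.
have h5 := nrm_rtri (p^`().[z] * (w - z)) p.[w]; rewrite nrm_sub nrmM in h5.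
have h6 : nrm p.[w] <= (K * nrm (w - z)) ^+ 2.
  rewrite -{1}xw -curve_eq // nrmX; apply: lerXn2r; rewrite ?nnegrE ?nrm_ge0 //.
    by rewrite mulr_ge0 ?nrm_ge0 // ltW.
  by move: h1; rewrite yz subr0.
have hn : 0 < nrm (w - z) by rewrite nrm_gt0 subr_eq0.
have h7 : nrm p^`().[z] / 2 * nrm (w - z) <= (K * nrm (w - z)) ^+ 2 by lra.
move: h3; rewrite ltr_pdivlMr ?exprn_gt0 // => h3.
have : nrm (w - z) * K ^+ 2 * nrm (w - z) < nrm p^`().[z] / 2 * nrm (w - z) by rewrite ltr_pM2r.
by rewrite exprMn in h7; rewrite (_ : nrm (w - z) * K ^+ 2 * nrm (w - z) = K ^+ 2 * nrm (w - z) ^+ 2); [lra|ring].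
Qed.

Lemma x_chart_good (c : chart g p) z : x_chart c -> dom c z -> good (c z).
Proof. by move=> xch dz; have [fz xz] := xch z dz; split; rewrite ?xz ?(x_chart_neq0 xch dz). Qed.

(** Two values of y over the same x agree up to sign; near [z] both are close to the same nonzero
    number, which fixes the sign. *)
Lemma x_charts_agree (c c' : chart g p) z : x_chart c -> x_chart c' -> dom c z -> dom c' z ->
  c z = c' z -> \forall w \near z, c w = c' w.
Proof.
move=> xch xch' dz dz' E; have gz := x_chart_good xch dz.
have y0 : 0 < nrm (yc (c z)) by rewrite nrm_gt0 good_yc.
have c1 := (near_cvgP _ _ _).1 (x_chart_yc_cvg xch dz) _ y0.
have c2 := (near_cvgP _ _ _).1 (x_chart_yc_cvg xch' dz') _ y0.
apply: filterS2 (filterI c1 (dom_nbhs dz)) (filterI c2 (dom_nbhs dz')) => w [h1 dw] [h2 dw'].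
have [fw xw] := xch w dw; have [fw' xw'] := xch' w dw'.
apply: finite_eq => //; first by rewrite xw xw'.
have : (yc (c w) - yc (c' w)) * (yc (c w) + yc (c' w)) = 0.
  by rewrite -subr_sqr !curve_eq // xw xw' subrr.
move/eqP; rewrite mulf_eq0 => /orP[|/eqP h]; first by rewrite subr_eq0 => /eqP.
exfalso; rewrite -E in h2; have := nrmB (yc (c w) - yc (c z)) (- (yc (c' w) - yc (c z))).
rewrite nrmN.
have -> : yc (c w) - yc (c z) - - (yc (c' w) - yc (c z)) = - (2 * yc (c z)).
  by move/eqP: h; rewrite addr_eq0 => /eqP ->; ring.
by rewrite nrmN nrmM nrm_nat; move: h1 h2; clear; lra.
Qed.

End AtX.

Section Virasoro.
Context (R : realType) (g n : nat) (p : {poly Cx R}).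
Context (n_deg : n = (2 * g + 1)%N \/ n = (2 * g + 2)%N) (p_deg : size p = n.+1).
Context (p_simple : forall a : Cx R, (mup a p <= 1)%N).
Context (V : meromorphicCFT R) (B : field_bundle V g p).
Local Notation C := (Cx R).
Local Notation X := (hpoint g p).
Local Notation good := (@good R g p).
Local Notation T := (virT V).
Local Notation atx G := (@at_x R g p G).
Local Notation cc := (central_charge V).

Let p_neq0 : p != 0. Proof. by rewrite -size_poly_gt0 p_deg. Qed.
Let size_p : (size p <= (2 * g + 2).+1)%N.
Proof. by rewrite p_deg; case: n_deg => ->; rewrite ltnS // leq_add2l. Qed.

(* The field phi at P, trivialised by the coordinate x. *)
Definition at_pt (phi : V) (P : X) : fib B P :=
  if pselect (exists c : chart g p, [/\ x_chart c, dom c (xc P) & c (xc P) = P]) is left h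
  then triv B (projT1 (cid h)) P phi else 0.

Lemma at_ptE (c : chart g p) z phi : x_chart c -> dom c z ->
  triv B c (c z) phi = at_pt phi (c z).
Proof.
move=> xch dz; have [fz xz] := xch z dz.
rewrite /at_pt; case: pselect => [h|[]]; last by exists c; rewrite xz.
case: (cid h) => c' [xch' dz' E'] /=; rewrite xz in dz' E'.
by apply: triv_local => //; apply: (x_charts_agree p_simple p_neq0).
Qed.

Definition Nst (s : correlator B) N (P : 'I_N -> X) : C := s N P (fun i => at_pt T (P i)).

Lemma Nst_npoint (s : correlator B) N (cs : 'I_N -> chart g p) zs :
  (forall i, x_chart (cs i)) -> (forall i, dom (cs i) (zs i)) ->
  npoint s cs (fun=> T) zs = Nst s (fun i => cs i (zs i)).
Proof.
move=> xch D; rewrite /npoint /Nst; congr (s N _ _).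
by apply: functional_extensionality_dep => i; apply: at_ptE.
Qed.

Lemma Nst_perm (s : correlator B) N (P : 'I_N -> X) (t : 'S_N) : injective P ->
  Nst s (fun i => P (t i)) = Nst s P.
Proof. by move=> inj; rewrite /Nst (corr_sym s (fun i => at_pt T (P i)) t inj). Qed.

Lemma x_charts_of N (P : 'I_N -> X) : (forall i, good (P i)) ->
  exists cs : 'I_N -> chart g p, forall i,
    [/\ x_chart (cs i), dom (cs i) (xc (P i)) & cs i (xc (P i)) = P i].
Proof.
move=> gP; suff /choice[cs Hcs] : forall i, exists c : chart g p,
    [/\ x_chart c, dom c (xc (P i)) & c (xc (P i)) = P i] by exists cs.
by move=> i; have [c [h1 h2 h3 _]] := x_chart_exists (gP i); exists c.
Qed.

Context (hT : virasoro_covariant B) (s : state B).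
Context (N : nat) (Q : 'I_N -> X) (gQ : forall i, good (Q i)) (iQ : injective Q).
Context (cs : 'I_N -> chart g p) (csP : forall i,
    [/\ x_chart (cs i), dom (cs i) (xc (Q i)) & cs i (xc (Q i)) = Q i]).
Let zs i := xc (Q i).

Lemma admissible_rest : admissible cs zs.
Proof.
split=> [i|i j]; first by case: (csP i).
by case: (csP i) => _ _ ->; case: (csP j) => _ _ ->; exact: iQ.
Qed.

Lemma admissible_Q (c : chart g p) z : dom c z -> (forall i, Q i <> c z) ->
  admissible (fcons c cs) (fcons z zs).
Proof.
move=> dz H; apply/admissible_cons; split=> // [i|]; last exact: admissible_rest.
by case: (csP i) => _ _ ->.
Qed.

Lemma Nst_Q : npoint s cs (fun=> T) zs = Nst s Q.
Proof.
rewrite Nst_npoint; [|by move=> i; case: (csP i)..].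
by congr (Nst s _); apply/funext => i; case: (csP i).
Qed.

Lemma Nst_fcons (c : chart g p) z : x_chart c -> dom c z ->
  npoint s (fcons c cs) (fcons T (fun=> T)) (fcons z zs) = Nst s (fcons (c z) Q).
Proof.
move=> xch dz.
have -> : fcons T (fun _ : 'I_N => T) = fun=> T.
  by apply/funext => i; case: (unliftP ord0 i) => [j ->|->]; rewrite ?fconsS ?fcons0.
rewrite Nst_npoint.
- congr (Nst s _); apply: fcons_eq => [|i]; rewrite ?fcons0 ?fconsS //.
  by case: (csP i).
- by move=> i; case: (unliftP ord0 i) => [j ->|->]; rewrite ?fconsS ?fcons0 //; case: (csP j).
- by move=> i; case: (unliftP ord0 i) => [j ->|->]; rewrite ?fconsS ?fcons0 //; case: (csP j).
Qed.

(** The multiple of 1 that is subtracted in [vartheta]. *)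
Definition anomaly (P : X) : C := cc / 32 * (p^`()).[xc P] ^+ 2 / p.[xc P].

Lemma virasoro_change (c c' : chart g p) (f : C -> C) z : x_chart c -> dom c z ->
  (forall i, Q i <> c z) -> (\forall w \near z, dom c' (f w) /\ c' (f w) = c w) ->
  Nst s (fcons (c z) Q) =
  npoint s (fcons c' cs) (fcons T (fun=> T)) (fcons (f z) zs) * (derive1 f z) ^+ 2
  + cc / 12 * schwarzian f z * Nst s Q.
Proof.
move=> xch dz Qz H; have ad := admissible_Q dz Qz.
have E := hT s (fun=> T) ad H.
rewrite (state_one s (fun=> T) ad) Nst_Q (Nst_fcons xch dz) in E.
by rewrite E subrK.
Qed.

Lemma not_in_Q (G : set_system C) {FG : Filter G} :
  (forall i, \forall x \near G, x != xc (Q i)) -> \forall P \near atx G, forall i, Q i <> P :> X.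
Proof.
move=> H; apply: (@filterS _ G FG _ _ _ (filter_forall FG H)) => x hx P gP Px i E.
by have := hx i; rewrite -Px E eqxx.
Qed.

Lemma yc_near_branch (e : C) (d : R) : p.[e] = 0 -> 0 < d ->
  \forall P \near atx e^', nrm (yc P) < d.
Proof.
move=> pe d0; have := (near_cvgP _ _ _).1 (T2_cvg (T2_poly p e)) _ (exprn_gt0 2 d0).
rewrite pe => /nbhs_dnbhs H.
apply: (@filterS _ e^' _ _ _ _ H) => x hx P [fP _] Px.
rewrite -(@ltr_pXn2r _ 2) ?nnegrE ?nrm_ge0 ?(ltW d0) //.
by rewrite -nrmX curve_eq // Px; move: hx; rewrite subr0.
Qed.

(** In the coordinate y the N-point function is regular at the branch point. Back in x, p (dy/dx)^2
    = p'^2/4 is bounded, and so is (c/12) p S(y) apart from its term (c/12)(3/8) p'^2/p, which is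
    [anomaly]. *)
Lemma Nst_branch (e : C) : p.[e] = 0 ->
  Bdd (atx e^') (fun P : X => p.[xc P] * Nst s (fcons P Q) - anomaly P * Nst s Q).
Proof.
move=> pe; have pe' := simple_root p_simple p_neq0 pe.
have [c' [d0' Hc' [d d0 Hd]]] := y_chart_exists g pe pe'.
pose r y := npoint s (fcons c' cs) (fcons T (fun=> T)) (fcons y zs).
have c'0 i : Q i <> c' 0.
  move=> E; have [fc yc0] := Hc' 0 d0'; have := good_yc (gQ i).
  by rewrite E yc0 eqxx.
have [K HK] : Bdd (nbhs (0 : C)) r by exact: T2_Bdd (T2_npoint s _ _ (admissible_Q d0' c'0)).
have [d1 d10 Hd1] := (nbhs_nrmP _ _).1 HK.
have Br : Bdd (atx e^') (fun P => r (yc P)).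
  exists K; apply: filterS (yc_near_branch pe d10) => P h; apply: Hd1; by rewrite subr0.
have T2V' : T2 (fun w => (p^`().[w])^-1) e by apply: T2V => //; exact: T2_poly.
have Bp q : Bdd (atx e^') (fun P : X => (q : {poly C}).[xc P]).
  by apply: (@Bdd_at_x _ _ _ e^'); apply: Bdd_dnbhs; exact: T2_Bdd (T2_poly q e).
have Bi : Bdd (atx e^') (fun P : X => (p^`().[xc P])^-1).
  by apply: (@Bdd_at_x _ _ _ e^' _ (fun w => (p^`().[w])^-1)); apply: Bdd_dnbhs; exact: T2_Bdd T2V'.
apply: (@Bdd_near _ _ _ _ (fun P : X => r (yc P) * p^`().[xc P] ^+ 2 * 4^-1 +
   cc / 12 * p.[xc P] * (p^`()^`()^`().[xc P] * (p^`().[xc P])^-1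
      - 3 / 2 * (p^`()^`().[xc P] * (p^`().[xc P])^-1) ^+ 2) * Nst s Q)); last first.
  by have := Bp p; have := Bp p^`(); have := Bp p^`()^`(); have := Bp p^`()^`()^`() => ? ? ? ?; bdd.
have nQ : \forall P \near atx e^', forall i, Q i <> P :> X.
  apply: (@not_in_Q e^') => i; apply: nbhs_dnbhs.
  have xe : 0 < nrm (xc (Q i) - e).
    by rewrite nrm_gt0 subr_eq0; apply/eqP => E; have [_] := gQ i; rewrite E pe eqxx.
  by apply: filterS (near_nrm_lt e xe) => x h; apply/eqP => E; move: h; rewrite E ltxx.
have nd : \forall P \near atx e^', nrm (xc P - e) < d.
  by apply: (@at_x_near _ _ _ e^' _ (fun x => nrm (x - e) < d)); apply: nbhs_dnbhs; exact: near_nrm_lt.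
have np : \forall P \near atx e^', p^`().[xc P] != 0.
  apply: (@at_x_near _ _ _ e^' _ (fun x => p^`().[x] != 0)); apply: nbhs_dnbhs.
  exact: near_neq0 (T2_cvg (T2_poly p^`() e)) pe'.
apply: filterS2 (filterI (@at_x_good R g p e^' _) np) (filterI nQ nd) => P [gP pP'] [QP dP].
have [c [xch dz EP _]] := x_chart_exists gP.
set z := xc P in dz EP dP pP' *.
pose f w := yc (c w).
have Hf : \forall w \near z, dom c' (f w) /\ c' (f w) = c w.
  have dd : 0 < d - nrm (z - e) by lra.
  apply: filterS2 (dom_nbhs dz) (near_nrm_lt z dd) => w dw hw.
  have [fw xw] := xch w dw; apply: Hd => //; rewrite xw.
  by have := nrmD (w - z) (z - e); rewrite addrA subrK; lra.
rewrite -EP in QP *; rewrite (virasoro_change xch dz QP Hf).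
have [||||||E1 E2] := @schwarzian_sqrt _ (dom c) f (fun w => p.[w]) (fun w => p^`().[w])
    (fun w => p^`()^`().[w]) (fun w => p^`()^`()^`().[w]) z (@dom_open _ _ _ c) dz _ _ _ _ _ _ pP'.
- by move=> w dw; exact: x_chart_yc_derivable.
- by move=> w dw; have [fw xw] := xch w dw; rewrite /f curve_eq // xw.
- by move=> w dw; exact: (x_chart_neq0 p_simple p_neq0 xch dw).
- by move=> w _; exact: is_derive_horner.
- by move=> w _; exact: is_derive_horner.
- by move=> w _; exact: is_derive_horner.
rewrite E1 E2 /anomaly EP -/z.
have pz := x_chart_neq0 p_simple p_neq0 xch dz.
rewrite -/(f z) -[npoint _ _ _ _]/(r (f z)).
have -> : yc P = f z by rewrite /f EP.
move: (r (f z)) (Nst s Q) (p^`()^`()^`().[z]) (p^`()^`().[z]) (p^`().[z]) (p.[z]) cc pP' pz.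
by move=> a b q3 q2 q1 q0 k q10 q00; field; rewrite q10 q00.
Qed.

(** The operator on polynomials in u = 1/x that corresponds to d/dx. *)
Definition dinv (q : {poly C}) : {poly C} := - 'X^2 * q^`().

Lemma deriv_dinv h : (dinv h)^`() = - ('X * h^`() *+ 2 + 'X^2 * h^`()^`()).
Proof. by rewrite /dinv mulNr derivN derivM derivXn expr1 mulrnAl. Qed.

Lemma deriv2_dinv h :
  (dinv h)^`()^`() = - (h^`() *+ 2 + 'X * h^`()^`() *+ 4 + 'X^2 * h^`()^`()^`()).
Proof.
rewrite deriv_dinv derivN derivD derivMn (derivM 'X) (derivM 'X^2) derivX derivXn expr1 mul1r.
by rewrite mulrnDl mulrnAl -!addrA; congr (- (_ + _)); rewrite addrA -mulrnDr.
Qed.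

Lemma is_derive_horner_inv (q : {poly C}) (x : C) : x != 0 ->
  is_derive x 1 (fun w => q.[w^-1]) (dinv q).[x^-1].
Proof.
move=> x0; rewrite /dinv hornerM hornerN hornerXn.
have Di : is_derive x 1 (fun w : C => w^-1) (- x^-1 ^+ 2).
  have := is_derive_inv x0 (is_derive_id x 1); by rewrite mulNr div1r exprVn.
elim/poly_ind: q => [|q c IH].
  have -> : (fun w : C => (0 : {poly C}).[w^-1]) = cst 0 by apply/funext => w; rewrite horner0.
  by rewrite deriv0 horner0 mulr0; exact: is_derive_cst.
have -> : (fun w => (q * 'X + c%:P).[w^-1]) = (fun w : C => q.[w^-1] * w^-1 + c).
  by apply/funext => w; rewrite !hornerE.
have D := is_derive_add (is_derive_prod IH Di) (is_derive_cst c x 1).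
have -> : - x^-1 ^+ 2 * (q * 'X + c%:P)^`().[x^-1] =
    q.[x^-1] * - x^-1 ^+ 2 + - x^-1 ^+ 2 * q^`().[x^-1] * x^-1 + 0.
  rewrite derivD derivM derivX derivC addr0 mulr1 hornerD hornerM hornerX.
  by move: (q^`().[x^-1]) (q.[x^-1]) (x^-1) => a b i; ring.
exact: D.
Qed.

Lemma Bdd_inv_infty_comp (f : C -> C) : Bdd (nbhs (0 : C)) f -> Bdd inftyC (fun x => f x^-1).
Proof. by case=> K HK; exists K; exact: (@inv_near_infty R (fun u => nrm (f u) <= K)). Qed.

Lemma open_neq0 : open [set w : C | w != 0].
Proof.
rewrite openE => a /= a0; have n0 : 0 < nrm a by rewrite nrm_gt0.
apply: filterS (near_nrm_lt a n0) => w h /=; apply/eqP => w0; move: h.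
by rewrite w0 sub0r nrmN ltxx.
Qed.

Lemma schwarzian_inv (z : C) : z != 0 ->
  derive1 (fun w : C => w^-1) z ^+ 2 = z^-1 ^+ 4 /\ schwarzian (fun w : C => w^-1) z = 0.
Proof.
move=> z0; pose U := [set w : C | w != 0]; have Uz : U z by [].
have E0 w : U w -> derive1n 0 (fun w : C => w^-1) w = ('X : {poly C}).[w^-1].
  by rewrite hornerX.
have D k (q : {poly C}) : (forall w, U w -> derive1n k (fun w : C => w^-1) w = q.[w^-1]) ->
    forall w, U w -> derive1n k.+1 (fun w : C => w^-1) w = (dinv q).[w^-1].
  by move=> E; apply: (derive1n_step open_neq0 E) => w Uw; exact: is_derive_horner_inv.
have E1 := D _ _ E0; have E2 := D _ _ E1; have E3 := D _ _ E2.
have e1 : derive1 (fun w : C => w^-1) z = - z^-1 ^+ 2.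
  by rewrite -derive1n1 E1 // /dinv derivX mulr1 hornerN hornerXn.
have d1 : dinv 'X = - 'X^2 by rewrite /dinv derivX mulr1.
have d2 : dinv (- 'X^2) = 'X^3 *+ 2.
  by rewrite /dinv derivN derivXn /= mulrN mulNr opprK mulrnAr -exprSr.
have d3 : dinv ('X^3 *+ 2) = - ('X^4 *+ 6).
  by rewrite /dinv derivMn derivXn /= -mulrnA mulNr mulrnAr -exprD.
rewrite /schwarzian e1 E2 // E3 // d1 d2 d3 !(hornerN, hornerMn, hornerXn).
split; first by rewrite sqrrN -exprM.
have i0 : z^-1 != 0 by rewrite invr_eq0.
by move: (z^-1) i0 => i i0; field.
Qed.

Lemma near_inf_gt (M : R) (z : C) : M < nrm z -> \forall w \near z, M < nrm w.
Proof.
move=> h; have d0 : 0 < nrm z - M by lra.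
by apply: filterS (near_nrm_lt z d0) => w; have := nrm_rtri z w; rewrite nrm_sub; lra.
Qed.

Lemma inf_not_in_Q : \forall P \near atx inftyC, forall i, Q i <> P :> X.
Proof.
apply: not_in_Q => i; exists (nrm (xc (Q i))) => x h; apply/eqP => E.
by move: h; rewrite E ltxx.
Qed.

Lemma near_at_inf (A : C -> Prop) : (\forall x \near inftyC, A x) ->
  \forall P \near atx inftyC, A (xc P).
Proof. exact: at_x_near. Qed.

Lemma good_at_inf : \forall P \near atx inftyC, good P.
Proof. exact: at_x_good. Qed.

Lemma virT_bounded (c : chart g p) : dom c 0 -> (forall i, Q i <> c 0) ->
  exists2 K : R, 0 < K & exists2 d : R, 0 < d &
   forall z, nrm z < d -> nrm (npoint s (fcons c cs) (fcons T (fun=> T)) (fcons z zs)) <= K.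
Proof.
move=> d0 Q0; have := T2_Bdd (T2_npoint s T (fun=> T) (admissible_Q d0 Q0)).
move=> /Bdd_pos[K K0 HK]; have [d dd D] := (nbhs_nrmP _ _).1 HK.
by exists K => //; exists d => // z zd; apply: D; rewrite subr0.
Qed.

Lemma vcoord_cvg (c : chart g p) z : x_chart c -> dom c z -> z != 0 ->
  (fun w => vcoord (c w)) @ nbhs z --> vcoord (c z).
Proof.
move=> xch dz z0; have cy := x_chart_yc_cvg xch dz.
have T2i : T2 (fun w : C => (w ^+ g.+1)^-1) z.
  by apply: T2V; [exact: T2X (T2_id z)|rewrite expf_neq0].
have -> : vcoord (c z) = yc (c z) * (z ^+ g.+1)^-1 by rewrite /vcoord (xch z dz).2.
have c1 : (fun w => yc (c w) * (w ^+ g.+1)^-1) @ nbhs z --> yc (c z) * (z ^+ g.+1)^-1.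
  have H := derivable_lip (x_chart_yc_derivable xch dz).
  have B1 := T2_Bdd T2i; have c2 := T2_cvg T2i.
  apply: ((near_cvgP _ _ _).2 _) => e e0.
  have s1 : (fun w => (yc (c w) - yc (c z)) * (w ^+ g.+1)^-1) @ nbhs z --> (0 : C).
    apply: cvg0_Bdd; last exact: B1.
    apply: ((near_cvgP _ _ _).2 _) => e' e'0.
    by apply: filterS ((near_cvgP _ _ _).1 cy e' e'0) => w; rewrite subr0.
  have s2 : (fun w => ((w ^+ g.+1)^-1 - (z ^+ g.+1)^-1) * yc (c z)) @ nbhs z --> (0 : C).
    apply: cvg0_Bdd; last exact: Bdd_cst.
    apply: ((near_cvgP _ _ _).2 _) => e' e'0.
    by apply: filterS ((near_cvgP _ _ _).1 c2 e' e'0) => w; rewrite subr0.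
  have e2 : 0 < e / 2 by rewrite divr_gt0.
  apply: filterS2 ((near_cvgP _ _ _).1 s1 _ e2) ((near_cvgP _ _ _).1 s2 _ e2) => w.
  rewrite !subr0 => h1 h2.
  have -> : yc (c w) / w ^+ g.+1 - yc (c z) / z ^+ g.+1 =
    (yc (c w) - yc (c z)) * (w ^+ g.+1)^-1 + ((w ^+ g.+1)^-1 - (z ^+ g.+1)^-1) * yc (c z) by ring.
  by apply: le_lt_trans (nrmD _ _) _; rewrite [ltRHS]splitr; apply: ltrD.
apply: ((near_cvgP _ _ _).2 _) => e e0.
apply: filterS2 (dom_nbhs dz) ((near_cvgP _ _ _).1 c1 e e0) => w dw.
by rewrite /vcoord (xch w dw).2.
Qed.

(** For even degree the coordinate 1/x is a Moebius map: its Schwarzian is zero and T acquires the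
    factor x^-4. For odd degree the coordinate is a square root of [rev_poly] at 1/x, and
    [schwarzian_sqrt] gives an explicit expression, bounded because the zero of [rev_poly] at 0 is
    simple. *)
Lemma Nst_infinity : Bdd (atx inftyC) (fun P : X => Nst s (fcons P Q)).
Proof.
case: (eqVneq p`_(2 * g + 2) 0) => [pe0|pe0]; last first.
- pose v0 : C := sqrtC p`_(2 * g + 2).
  have E0 : v0 ^+ 2 = p`_(2 * g + 2) by exact: sqrtCK.
  have v00 : v0 != 0 by rewrite -sqrf_eq0 E0.
  have E0' : (- v0) ^+ 2 = p`_(2 * g + 2) by rewrite sqrrN.
  have v00' : - v0 != 0 by rewrite oppr_eq0.
  have key v : v ^+ 2 = p`_(2 * g + 2) -> v != 0 -> exists2 K : R, 0 < K &
      exists2 rho : R, 0 < rho & \forall P \near atx inftyC,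
       nrm (vcoord P - v) < rho -> nrm (Nst s (fcons P Q)) <= K.
    move=> Ev vn0; have [c' [[d0 nf] [rho r0 [M HM]]]] := infinity_chart_even size_p Ev vn0.
    have Q0 i : Q i <> c' 0 by move=> E; move: nf; rewrite -E (gQ i).1.
    have [K K0 [d dd HK]] := virT_bounded d0 Q0.
    exists K => //; exists rho => //.
    have nd : \forall x \near inftyC, nrm (x^-1 : C) < d.
      apply: (@inv_near_infty R (fun u => nrm u < d)).
      by apply: filterS (near_nrm_lt 0 dd) => w; rewrite subr0.
    have n1 : \forall x \near inftyC, nrm (x^-1 : C) < 1.
      apply: (@inv_near_infty R (fun u => nrm u < 1)).
      by apply: filterS (near_nrm_lt 0 ltr01) => w; rewrite subr0.
    have nx : \forall x \near inftyC, (M < nrm x /\ x != 0) /\ (nrm (x^-1 : C) < d /\ nrm (x^-1 : C) < 1).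
      exact: filterI (filterI (near_infty M) near_infty_neq0) (filterI nd n1).
    have nP := near_at_inf nx.
    apply: filterS2 (filterI good_at_inf inf_not_in_Q) nP => P [gP QP] [[PM P0] [Pd P1]] hv.
    have [c [xch dz EP _]] := x_chart_exists gP.
    set z := xc P in dz EP PM P0 Pd P1 *.
    have Hf : \forall w \near z, dom c' w^-1 /\ c' w^-1 = c w.
      have cv := vcoord_cvg xch dz P0; rewrite EP in cv.
      have dv : 0 < rho - nrm (vcoord P - v) by lra.
      apply: filterS2 (filterI (dom_nbhs dz) (near_inf_gt PM)) ((near_cvgP _ _ _).1 cv _ dv) => w [dw wM] hw.
      have [fw xw] := xch w dw.
      have HM' := HM (c w) fw; rewrite xw in HM'; apply: HM' => //.
      have := nrmD (vcoord (c w) - vcoord P) (vcoord P - v).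
      by rewrite addrA subrK; lra.
    rewrite -EP in QP *; rewrite (virasoro_change xch dz QP Hf).
    have [-> ->] := schwarzian_inv P0.
    rewrite mulr0 mul0r addr0 nrmM nrmX -[leRHS]mulr1.
    apply: ler_pM; rewrite ?nrm_ge0 ?exprn_ge0 ?nrm_ge0 //; first exact: HK.
    by rewrite exprn_ile1 ?nrm_ge0 // ltW.
  have [K1 K10 [r1 r10 H1]] := key v0 E0 v00.
  have [K2 K20 [r2 r20 H2]] := key (- v0) E0' v00'.
  have m0 : 0 < Num.min r1 r2 by rewrite lt_min r10 r20.
  have [M HM] := vcoord_dichotomy size_p E0 m0.
  exists (K1 + K2).
  have nP := near_at_inf (near_infty M).
  apply: filterS2 (filterI H1 H2) (filterI good_at_inf nP) => P [h1 h2] [[fP _] PM].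
  have [] := HM P fP PM; rewrite lt_min => /andP[a1 a2].
    by have := h1 a1; lra.
  by have := h2 a2; lra.
have pe1 : p`_(2 * g + 1) != 0.
  have : lead_coef p != 0 by rewrite lead_coef_eq0.
  rewrite lead_coefE p_deg /=; case: n_deg => -> //; by rewrite pe0 eqxx.
have [c' [[d0 nf] [M HM]]] := infinity_chart_odd size_p pe0 pe1.
have Q0 i : Q i <> c' 0 by move=> E; move: nf; rewrite -E (gQ i).1.
have [K K0 [d dd HK]] := virT_bounded d0 Q0.
pose q := rev_poly g p; pose q1 := q^`(); pose q2 := q1^`(); pose q3 := q2^`().
have q0 : q.[0] = 0 by rewrite rev_poly0.
have q10 : q1.[0] != 0 by rewrite rev_poly_deriv0.
(* With the zero divided out, q = u qt and qt(0) <> 0, so the logarithmic derivative of q(1/x) in x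
   is -u q'/qt and stays bounded. *)
have [qt Eq] : exists qt, q = qt * 'X.
  have /factor_theorem[qt Eqt] : root q 0 by apply/eqP.
  by exists qt; rewrite Eqt subr0.
have qt0 : qt.[0] != 0.
  by move: q10; rewrite /q1 Eq derivM derivX mulr1 !hornerE.
pose r (P : X) := npoint s (fcons c' cs) (fcons T (fun=> T)) (fcons (vcoord P) zs).
have Br : Bdd (atx inftyC) r.
  exists K; have d2 : 0 < d ^+ 2 by rewrite exprn_gt0.
  have nx : \forall x \near inftyC, x != 0 /\ nrm ((rev_poly g p).[x^-1] - (rev_poly g p).[0]) < d ^+ 2.
    exact: filterI near_infty_neq0 (rev_poly_near0 g p d2).
  have nP := near_at_inf nx.
  apply: filterS2 nP good_at_inf => P [P0 Pq] [fP _]; apply: HK.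
  rewrite -(@ltr_pXn2r _ 2) ?nnegrE ?nrm_ge0 ?(ltW dd) // -nrmX vsq //.
  by move: Pq; rewrite -/q q0 subr0.
have Bu (h : C -> C) : T2 h 0 -> Bdd (atx inftyC) (fun P : X => h (xc P)^-1).
  move=> Th; apply: (@Bdd_at_x _ _ _ inftyC _ (fun x => h x^-1)).
  by apply: Bdd_inv_infty_comp; exact: T2_Bdd.
have B1 : Bdd (atx inftyC) (fun P : X => (xc P)^-1) := Bu id (T2_id 0).
have Bq (h : {poly C}) := Bu _ (T2_poly h 0).
have Bi1 := Bu _ (T2V (T2_poly q1 0) q10).
have Bit := Bu _ (T2V (T2_poly qt 0) qt0).
apply: (@Bdd_near _ _ _ _ (fun P : X => let u := (xc P)^-1 in
  r P * (u ^+ 3 * q1.[u] ^+ 2 * 4^-1 * qt.[u]^-1) + cc / 12 *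
   (6 * u ^+ 2 + 6 * u ^+ 3 * (q2.[u] * q1.[u]^-1) + u ^+ 4 * (q3.[u] * q1.[u]^-1)
     - 3 / 2 * (2 * u + u ^+ 2 * (q2.[u] * q1.[u]^-1)) ^+ 2
     + 3 / 8 * (u * q1.[u] * qt.[u]^-1) ^+ 2) * Nst s Q)); last first.
  by have := Bq q1; have := Bq q2; have := Bq q3 => ? ? ? /=; bdd.
have n1 : \forall x \near inftyC, q1.[(x : C)^-1] != 0.
  by apply: (@inv_near_infty R (fun u => q1.[u] != 0)); exact: near_neq0 (T2_cvg (T2_poly q1 0)) q10.
have nt : \forall x \near inftyC, qt.[(x : C)^-1] != 0.
  by apply: (@inv_near_infty R (fun u => qt.[u] != 0)); exact: near_neq0 (T2_cvg (T2_poly qt 0)) qt0.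
have nx : \forall x \near inftyC, (M < nrm x /\ x != 0) /\ (q1.[(x : C)^-1] != 0 /\ qt.[(x : C)^-1] != 0).
  exact: filterI (filterI (near_infty M) near_infty_neq0) (filterI n1 nt).
have nP := near_at_inf nx.
apply: filterS2 (filterI good_at_inf inf_not_in_Q) nP => P [gP QP] [[PM P0] [Pq1 Pqt]].
have [c [xch dz EP _]] := x_chart_exists gP.
set z := xc P in dz EP PM P0 Pq1 Pqt *.
pose f w := vcoord (c w).
pose U := dom c `&` [set w : C | w != 0].
have oU : open U by apply: openI; [exact: dom_open|exact: open_neq0].
have Uz : U z by [].
have Hf : \forall w \near z, dom c' (f w) /\ c' (f w) = c w.
  apply: filterS2 (dom_nbhs dz) (near_inf_gt PM) => w dw wM.
  have [fw xw] := xch w dw; by apply: HM; rewrite ?xw.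
rewrite -EP in QP *; rewrite (virasoro_change xch dz QP Hf).
have iz : z^-1 != 0 by rewrite invr_eq0.
have hd1 : (dinv q).[z^-1] != 0.
  by rewrite /dinv hornerM hornerN hornerXn mulf_neq0 // oppr_eq0 expf_neq0.
have [||||||E1 E2] := @schwarzian_sqrt _ U f (fun w => q.[w^-1]) (fun w => (dinv q).[w^-1])
    (fun w => (dinv (dinv q)).[w^-1]) (fun w => (dinv (dinv (dinv q))).[w^-1]) z oU Uz _ _ _ _ _ _ hd1.
- move=> w [dw w0].
  have Dy := derivableP (x_chart_yc_derivable xch dw).
  have T2i : T2 (fun v : C => (v ^+ g.+1)^-1) w.
    by apply: T2V; [exact: T2X (T2_id w)|rewrite expf_neq0].
  have Di := derivableP (T2_derivable T2i).
  have E : \forall v \near w, yc (c v) * (v ^+ g.+1)^-1 = f v.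
    by apply: filterS (dom_nbhs dw) => v dv; rewrite /f /vcoord (xch v dv).2.
  by case: (is_derive_near E (is_derive_prod Dy Di)).
- move=> w [dw w0]; have [fw xw] := xch w dw.
  by rewrite /f vsq // xw.
- move=> w [dw w0]; have [fw xw] := xch w dw; rewrite /q rev_polyE ?invr_eq0 // invrK.
  by rewrite mulf_neq0 ?expf_neq0 ?invr_eq0 // (x_chart_neq0 p_simple p_neq0 xch dw).
- by move=> w [_ w0]; exact: is_derive_horner_inv.
- by move=> w [_ w0]; exact: is_derive_horner_inv.
- by move=> w [_ w0]; exact: is_derive_horner_inv.
rewrite E1 E2 EP -/z /= -/(f z) (_ : r P = npoint s (fcons c' cs) (fcons T (fun=> T)) (fcons (f z) zs)); last first.
  by rewrite /r /f EP.
have Hd1 : (dinv q).[z^-1] = - z^-1 ^+ 2 * q1.[z^-1].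
  by rewrite /dinv hornerM hornerN hornerXn.
have dinvE (h : {poly C}) u : (dinv h).[u] = - u ^+ 2 * h^`().[u].
  by rewrite /dinv hornerM hornerN hornerXn.
have Hd2 : (dinv (dinv q)).[z^-1] = 2 * z^-1 ^+ 3 * q1.[z^-1] + z^-1 ^+ 4 * q2.[z^-1].
  rewrite dinvE deriv_dinv !(hornerD, hornerN, hornerM, hornerMn, hornerX, hornerXn) -/q1 -/q2.
  by move: (z^-1) (q1.[_]) (q2.[_]) => u a b; ring.
have Hd3 : (dinv (dinv (dinv q))).[z^-1] =
    - 6 * z^-1 ^+ 4 * q1.[z^-1] - 6 * z^-1 ^+ 5 * q2.[z^-1] - z^-1 ^+ 6 * q3.[z^-1].
  rewrite dinvE (deriv_dinv (dinv q)) !(hornerD, hornerN, hornerM, hornerMn, hornerX, hornerXn).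
  rewrite deriv2_dinv deriv_dinv !(hornerD, hornerN, hornerM, hornerMn, hornerX, hornerXn) -/q1 -/q2 -/q3.
  by move: (z^-1) (q1.[_]) (q2.[_]) (q3.[_]) => u a b e; ring.
rewrite Hd1 Hd2 Hd3 Eq hornerM hornerX.
move: (npoint _ _ _ _) (Nst s Q) (q1.[z^-1]) (q2.[z^-1]) (q3.[z^-1]) (qt.[z^-1]) (z^-1) cc Pq1 Pqt iz.
by move=> a b c1 c2 c3 ct i k c10 ct0 i0; field; rewrite c10 ct0 i0.
Qed.

End Virasoro.

(** * Polynomial dependence on one point *)

Lemma poly_taylor2 (R : realType) (q : {poly Cx R}) (z : Cx R) : exists r : {poly Cx R}, forall w,
  q.[w] = q.[z] + q^`().[z] * (w - z) + q^`()^`().[z] / 2 * (w - z) ^+ 2 + (w - z) ^+ 3 * r.[w].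
Proof.
elim/poly_ind: q => [|q c [r IH]].
  by exists 0 => w; rewrite !deriv0 !horner0; ring.
exists (r * 'X + (q^`()^`().[z] / 2)%:P) => w.
have -> : (q * 'X + c%:P)^`() = q^`() * 'X + q by rewrite derivMXaddC addrC.
have -> : (q^`() * 'X + q)^`() = q^`()^`() * 'X + q^`() *+ 2.
  by rewrite derivD derivM derivX mulr1 mulr2n addrA.
rewrite !(hornerD, hornerM, hornerC, hornerX, hornerMn) (IH w).
move: (q.[z]) (q^`().[z]) (q^`()^`().[z]) (r.[w]) => a b d e.
by field.
Qed.

Lemma poly_finite_zeros (R : realType) (p : {poly Cx R}) : p != 0 ->
  exists s : seq (Cx R), forall a, (p.[a] == 0) = (a \in s).
Proof.
move=> p0; have [s Es] := closed_field_poly_normal p; exists s => a.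
have : root p a = root (lead_coef p *: \prod_(z <- s) ('X - z%:P)) a by rewrite -Es.
by rewrite rootZ ?lead_coef_eq0 // root_prod_XsubC.
Qed.

Lemma poly_dnbhs_neq0 (R : realType) (p : {poly Cx R}) z : p != 0 ->
  \forall w \near z^', p.[w] != 0.
Proof.
move=> p0; have [s Es] := poly_finite_zeros p0.
have H : \forall w \near z^', forall a : seq_sub s, w != ssval a.
  apply: (@filter_forall _ _ _ z^') => -[a /= _]; case: (eqVneq a z) => [->|az].
    by apply: ((dnbhs_nrmP _ _).2 _); exists 1.
  have d : 0 < nrm (a - z) by rewrite nrm_gt0 subr_eq0.
  apply: nbhs_dnbhs; apply: filterS (near_nrm_lt z d) => w wd.
  by apply/eqP => E; rewrite E ltxx in wd.
apply: (@filterS _ z^' _ _ _ _ H) => w hw; rewrite Es; apply/negP => ws.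
by have := hw (SeqSub ws); rewrite eqxx.
Qed.

Lemma poly_infty_neq0 (R : realType) (p : {poly Cx R}) : p != 0 ->
  \forall w \near inftyC, p.[w] != 0.
Proof.
move=> p0; have [s Es] := poly_finite_zeros p0.
exists (\sum_(a <- s) nrm a) => w hw; rewrite Es; apply/negP => ws.
move: hw; rewrite (big_rem w ws) /= ltNge lerDl sumr_ge0 // => a _; exact: nrm_ge0.
Qed.

Lemma Bdd_poly_inv_infty (R : realType) (p : {poly Cx R}) : p != 0 ->
  Bdd inftyC (fun x => p.[x]^-1).
Proof.
move=> p0; have [s Es] := closed_field_poly_normal p.
have -> : (fun x => p.[x]^-1) = (fun x => (lead_coef p)^-1 * \prod_(a <- s) (x - a)^-1).
  apply/funext => x; rewrite {1}Es hornerZ invfM horner_prod prodfV.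
  by congr (_ * _^-1); apply: eq_bigr => a _; rewrite hornerXsubC.
apply: BddM; first exact: Bdd_cst.
apply: Bdd_prod => a _; exists 1.
apply: filterS (near_infty (nrm a + 1)) => x hx; rewrite nrmV.
by rewrite invf_le1; have := nrm_rtri x a; lra.
Qed.

(** * Edge weights and the two sheets *)

Section EdgeFun.
Context (R : realType) (g : nat) (p : {poly Cx R}).
Context (p_simple : forall a : Cx R, (mup a p <= 1)%N) (p_neq0 : p != 0).
Local Notation C := (Cx R).
Local Notation X := (hpoint g p).
Local Notation good := (@good R g p).

Lemma x_chart_T2 (c : chart g p) z : x_chart c -> dom c z -> T2 (fun w => yc (c w)) z.
Proof.
move=> xch dz; have gz := x_chart_good p_simple p_neq0 xch dz.
have [c' [xch' dz' E T2c]] := x_chart_exists gz.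
rewrite (xch z dz).2 in dz' E.
apply: T2_near (T2c z dz').
have := x_charts_agree p_simple p_neq0 xch' xch dz' dz E.
by apply: filterS => w ->.
Qed.

Lemma edge_funC (P Q : X) : edge_fun P Q = edge_fun Q P.
Proof.
rewrite /edge_fun eq_sym; case: eqP => [->|_].
  by rewrite !exprMn !exprVn -[in RHS](sqrrN (yc Q - yc P)) opprB.
by rewrite !exprMn !exprVn -[in RHS](sqrrN (xc Q - xc P)) opprB addrC.
Qed.

Lemma T2_edge_fun (c : chart g p) z (Q : X) : x_chart c -> dom c z -> good Q -> Q <> c z ->
  T2 (fun w => edge_fun (c w) Q) z.
Proof.
move=> xch dz gQ Qz; have T2y := x_chart_T2 xch dz.
have [fz xz] := xch z dz.
case: (eqVneq z (xc Q)) => [zQ|zQ].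
  (* At the point over the same x on the other sheet the quotient is 0/0. Writing p - p(x_Q) = q (x
     - x_Q) turns it into q/(y - y_Q), whose denominator is -2 y_Q at [z]. *)
  have /factor_theorem[q Eq] : root (p - (p.[xc Q])%:P) (xc Q).
    by rewrite /root !hornerE subrr.
  have yz : yc (c z) = - yc Q.
    have : (yc (c z) - yc Q) * (yc (c z) + yc Q) = 0.
      by rewrite -subr_sqr !curve_eq ?gQ.1 // xz zQ subrr.
    move/eqP; rewrite mulf_eq0 subr_eq0 addr_eq0 => /orP[|/eqP //].
    move=> /eqP E; case: Qz; apply: finite_eq => //; first exact: gQ.1.
    by rewrite xz.
  have y0 : yc (c z) - yc Q != 0.
    by rewrite yz -opprD oppr_eq0 -mulr2n -mulr_natl mulf_neq0 ?two_neq0 // good_yc.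
  have Ty : T2 (fun w => yc (c w) - yc Q) z by apply: T2B => //; exact: T2_cst.
  apply: (@T2_near _ (fun w => (q.[w] * (yc (c w) - yc Q)^-1) ^+ 2)); last first.
    apply: T2X; apply: T2M; [exact: T2_poly|exact: T2V].
  have ny := near_neq0 (T2_cvg Ty) y0.
  apply: filterS2 (dom_nbhs dz) ny => w dw yw; have [fw xw] := xch w dw.
  have Ep v : p.[v] - p.[xc Q] = q.[v] * (v - xc Q).
    by have := congr1 (horner_eval v) Eq; rewrite /horner_eval /= !hornerE.
  rewrite /edge_fun xw; case: eqP => [wQ|/eqP wQ]; congr (_ ^+ 2).
    congr (_ / _); have := congr1 deriv Eq.
    rewrite derivB derivC subr0 derivM derivXsubC mulr1 => ->.
    by rewrite wQ !hornerE subrr mulr0 add0r.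
  have w0 : w - xc Q != 0 by rewrite subr_eq0.
  have e : yc (c w) ^+ 2 - yc Q ^+ 2 = q.[w] * (w - xc Q).
    by rewrite !curve_eq ?gQ.1 // xw Ep.
  by apply/eqP; rewrite eqr_div // -e subr_sqr mulrC.
have zQ0 : z - xc Q != 0 by rewrite subr_eq0.
have Tx : T2 (fun w => w - xc Q) z by apply: T2B; [exact: T2_id|exact: T2_cst].
apply: (@T2_near _ (fun w => ((yc (c w) + yc Q) * (w - xc Q)^-1) ^+ 2)); last first.
  apply: T2X; apply: T2M; last exact: T2V.
  by apply: T2D => //; exact: T2_cst.
apply: filterS2 (dom_nbhs dz) (near_neq0 (T2_cvg Tx) zQ0) => w dw w0.
by rewrite /edge_fun (xch w dw).2 -subr_eq0 (negPf w0).
Qed.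

Lemma two_sheets z : p.[z] != 0 -> exists c c' : chart g p,
  [/\ x_chart c, x_chart c', dom c z, dom c' z &
    \forall w \near z, [/\ dom c w, dom c' w & yc (c' w) = - yc (c w)]].
Proof.
move=> pz; have Es : sqrtC p.[z] ^+ 2 = p.[z] := sqrtCK _.
have Es' : (- sqrtC p.[z]) ^+ 2 = p.[z] by rewrite sqrrN.
have key y : y ^+ 2 = p.[z] -> exists c : chart g p, [/\ x_chart c, dom c z & yc (c z) = y].
  move=> Ey; have gP : good (fin_pt g p z y) by split; rewrite ?is_finite_fin_pt ?xc_fin_pt.
  have [c [xch dz Ec _]] := x_chart_exists gP; rewrite xc_fin_pt // in dz Ec.
  by exists c; split=> //; rewrite Ec yc_fin_pt.
have [c [xch dz E1]] := key _ Es; have [c' [xch' dz' E2]] := key _ Es'.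
exists c, c'; split=> //.
have s0 : 0 < nrm (sqrtC p.[z]) by rewrite nrm_gt0 sqrtC_eq0.
have n1 := (near_cvgP _ _ _).1 (x_chart_yc_cvg xch dz) _ s0.
have n2 := (near_cvgP _ _ _).1 (x_chart_yc_cvg xch' dz') _ s0.
rewrite E1 in n1; rewrite E2 in n2.
apply: filterS2 (filterI (dom_nbhs dz) (dom_nbhs dz')) (filterI n1 n2) => w [dw dw'] [h1 h2].
split=> //; have [fw xw] := xch w dw; have [fw' xw'] := xch' w dw'.
have : (yc (c' w) - yc (c w)) * (yc (c' w) + yc (c w)) = 0.
  by rewrite -subr_sqr !curve_eq // xw xw' subrr.
move/eqP; rewrite mulf_eq0 subr_eq0 addr_eq0 => /orP[|/eqP //].
move=> /eqP E; exfalso; rewrite E in h2.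
have := nrmB (yc (c w) - - sqrtC p.[z]) (yc (c w) - sqrtC p.[z]).
have -> : yc (c w) - - sqrtC p.[z] - (yc (c w) - sqrtC p.[z]) = 2 * sqrtC p.[z] by ring.
by rewrite nrmM nrm_nat; move: h1 h2; lra.
Qed.

Lemma on_sheet (c : chart g p) w (P : X) : x_chart c -> dom c w -> is_finite P -> xc P = w ->
  yc P = yc (c w) \/ yc P = - yc (c w).
Proof.
move=> xch dw fP xP; have [fw xw] := xch w dw.
have : (yc P - yc (c w)) * (yc P + yc (c w)) = 0.
  by rewrite -subr_sqr !curve_eq // xw xP subrr.
by move/eqP; rewrite mulf_eq0 subr_eq0 addr_eq0 => /orP[/eqP|/eqP]; [left|right].
Qed.

Lemma Bdd_two_charts (u : X -> C) z : p.[z] != 0 ->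
  (forall c : chart g p, x_chart c -> dom c z -> Bdd z^' (fun w => u (c w))) ->
  Bdd (at_x z^') u.
Proof.
move=> pz H; have [c [c' [xch xch' dz dz' nd]]] := two_sheets pz.
have [K HK] := H c xch dz; have [K' HK'] := H c' xch' dz'.
exists (Num.max K K'); rewrite /at_x.
apply: (@filterS2 _ z^' _ _ _ _ _ (nbhs_dnbhs nd) (filterI HK HK')) => w [dw dw' yy] [k1 k2] P [fP nP] xP.
have [fw xw] := xch w dw; have [fw' xw'] := xch' w dw'.
rewrite le_max; have [E|E] := on_sheet xch dw fP xP.
  by rewrite (_ : P = c w) ?k1 //; apply: finite_eq; rewrite // xP.
by rewrite (_ : P = c' w) ?k2 ?orbT //; apply: finite_eq; rewrite // ?xP // yy.
Qed.

(** The trace to the x-line; being symmetric in the two roots, it does not depend on the one chosen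
    by [sqrtC]. *)
Definition sheet_sum (u : X -> C) (x : C) : C :=
  u (fin_pt g p x (sqrtC p.[x])) + u (fin_pt g p x (- sqrtC p.[x])).

Lemma sheet_sumE u (P P' : X) : is_finite P -> is_finite P' -> xc P' = xc P -> yc P' = - yc P ->
  sheet_sum u (xc P) = u P + u P'.
Proof.
move=> fP fP' Ex Ey; rewrite /sheet_sum.
have E : sqrtC p.[xc P] ^+ 2 = yc P ^+ 2 by rewrite sqrtCK curve_eq.
have /eqP := E; rewrite eqf_sqr => /orP[/eqP->|/eqP->].
  by rewrite fin_pt_coord // -Ey -Ex fin_pt_coord.
by rewrite opprK fin_pt_coord // -Ey -{1}Ex fin_pt_coord // addrC.
Qed.

(** Locally the trace is the sum of [u] in two charts with opposite y, so expansions and bounds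
    descend from the surface to the x-line, where [polynomial_of_growth] applies. *)
Lemma sheet_sum_poly (u : X -> C) (Z : seq C) D :
  (forall a, p.[a] = 0 -> a \in Z) ->
  (forall (c : chart g p) z, x_chart c -> dom c z -> z \notin Z -> T2 (fun w => u (c w)) z) ->
  (forall z, z \in Z -> Bdd (at_x z^') u) ->
  Bdd (at_x inftyC) (fun P => u P / xc P ^+ D) ->
  exists2 L : {poly C}, (size L <= D.+1)%N & forall x, x \notin Z -> sheet_sum u x = L.[x].
Proof.
move=> HZ HT HB [K HK]; apply: polynomial_of_growth.
- move=> a aZ; have pa : p.[a] != 0 by apply: contraNneq aZ; exact: HZ.
  have [c [c' [xch xch' da da' nd]]] := two_sheets pa.
  apply: (@T2_near _ (fun w => u (c w) + u (c' w))); last by apply: T2D; exact: HT.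
  apply: filterS nd => w [dw dw' yy].
  have [fw xw] := xch w dw; have [fw' xw'] := xch' w dw'.
  by rewrite -{3}xw; apply/esym/sheet_sumE; rewrite // xw.
- move=> z /HB[K' HK'].
  have np : \forall w \near z^', p.[w] != 0.
    by apply: filterS (poly_dnbhs_neq0 z p_neq0).
  exists (K' + K').
  apply: (@filterS2 _ z^' _ _ _ _ _ HK' np) => x H px.
  apply: le_trans (nrmD _ _) _; apply: lerD; apply: H;
    rewrite /good ?is_finite_fin_pt ?xc_fin_pt ?sqrrN ?sqrtCK //.
- exists (K + K).
  apply: (@filterS2 _ inftyC _ _ _ _ _ HK (poly_infty_neq0 p_neq0)) => x H px.
  rewrite /sheet_sum mulrDl; apply: le_trans (nrmD _ _) _; apply: lerD.
    have := H (fin_pt g p x (sqrtC p.[x])); rewrite /good is_finite_fin_pt xc_fin_pt ?sqrtCK //; exact.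
  have := H (fin_pt g p x (- sqrtC p.[x])); rewrite /good is_finite_fin_pt xc_fin_pt ?sqrrN ?sqrtCK //; exact.
Qed.

End EdgeFun.

(** * Induction on the number of points *)

Module Affine.
Import mathcomp.boot.fintype mathcomp.boot.finset.
Import Graph GraphSums Recursion.

Section Affine.
Context (R : realType) (g n : nat) (p : {poly Cx R}).
Context (n_deg : n = (2 * g + 1)%N \/ n = (2 * g + 2)%N) (p_deg : size p = n.+1).
Context (p_simple : forall a : Cx R, (mup a p <= 1)%N).
Context (V : meromorphicCFT R) (B : field_bundle V g p).
Context (hT : virasoro_covariant B) (s : state B).
Local Notation C := (Cx R).
Local Notation X := (hpoint g p).
Local Notation good := (@good R g p).
Local Notation cc := (central_charge V).
Local Notation al := (cc / 2).

Let p_neq0 : p != 0. Proof. by rewrite -size_poly_gt0 p_deg. Qed.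

Definition Wn N (P : 'I_N -> X) : C := (\prod_i p.[xc (P i)]) * Nst s P.

Lemma Wn_perm N (P : 'I_N -> X) (t : 'S_N) : injective P -> Wn (fun i => P (t i)) = Wn P.
Proof.
move=> iP; rewrite /Wn Nst_perm //; congr (_ * _).
by rewrite [RHS](reindex_inj (@perm_inj _ t)).
Qed.

Local Notation Gc := (Recursion.Gc al Wn).
Local Notation GJ := (Recursion.GJ al Wn).
Local Notation WJ := (Recursion.WJ Wn).

Lemma Wn_fcons N (Q : 'I_N -> X) P :
  Wn (fcons P Q) = p.[xc P] * (\prod_i p.[xc (Q i)]) * Nst s (fcons P Q).
Proof.
rewrite /Wn big_ord_recl fcons0; congr (_ * _ * _).
by apply: eq_bigr => i _; rewrite fconsS.
Qed.

(** [D] comes before [Q]: the degree bound depends on the number of points only, as the later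
    interpolation in several points requires. *)
Definition affine M D := forall Q : 'I_M -> X, (forall i, good (Q i)) -> injective Q ->
  exists a b : {poly C}, [/\ (size a <= D)%N, (size b <= D)%N &
    forall P, good P -> (forall i, Q i <> P) -> Gc (fcons P Q) = a.[xc P] + yc P * b.[xc P]].

Lemma affine_mono M D D' : (D <= D')%N -> affine M D -> affine M D'.
Proof.
move=> DD H Q gQ iQ; have [a [b [sa sb E]]] := H Q gQ iQ; exists a, b.
by split=> //; [apply: leq_trans sa _|apply: leq_trans sb _].
Qed.

Lemma affine_uniform k : (forall M, (M < k)%N -> exists D, affine M D) ->
  exists D, forall M, (M < k)%N -> affine M D.
Proof.
elim: k => [_|k IH H]; first by exists 0%N.
have [D HD] := IH (fun M Mk => H M (ltnW Mk)); have [D' HD'] := H k (ltnSn k).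
exists (maxn D D') => M; rewrite ltnS leq_eqVlt => /orP[/eqP->|Mk].
  exact: affine_mono (leq_maxr _ _) HD'.
exact: affine_mono (leq_maxl _ _) (HD M Mk).
Qed.

Lemma GJ_fcons_notin N (Q : 'I_N -> X) (J : {set 'I_N.+1}) P P' : ord0 \notin J ->
  GJ (fcons P Q) J = GJ (fcons P' Q) J.
Proof.
move=> J0; congr (Recursion.Gc _ _ _); apply/funext => i; have := enum_valP i.
case: (unliftP ord0 (enum_val i)) => [j ->|->]; first by rewrite !fconsS.
by rewrite (negPf J0).
Qed.

Lemma GJ_fcons_in N (Q : 'I_N -> X) (J : {set 'I_N.+1}) : ord0 \in J ->
  exists M (f : 'I_M -> 'I_N), [/\ M.+1 = #|J|, injective f &
    forall P, injective (fcons P Q) -> GJ (fcons P Q) J = Gc (fcons P (fun i => Q (f i)))].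
Proof.
move=> J0; pose J' := [set i | lift ord0 i \in J]%SET.
pose f (i : 'I_#|J'|) : 'I_N := enum_val i; have fi : injective f by exact: enum_val_inj.
pose h := fcons ord0 (fun i => lift ord0 (f i)).
have hi : injective h.
  by apply/fcons_inj_seq; split=> [i /eqP|i j /lift_inj /fi //]; rewrite eq_sym (negPf (neq_lift _ _)).
have hJ : (h @: setT)%SET = J.
  apply/setP => x; apply/imsetP/idP => [[i _ ->]|xJ].
    rewrite /h; case: (unliftP ord0 i) => [j ->|->]; rewrite ?fconsS ?fcons0 //.
    by have := enum_valP j; rewrite inE.
  case: (unliftP ord0 x) xJ => [j ->|->] xJ; last by exists ord0; rewrite // /h fcons0.
  have jJ : j \in J' by rewrite inE.
  by exists (lift ord0 (enum_rank_in jJ j)); rewrite // /h fconsS /f enum_rankK_in.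
exists #|J'|, f; split=> // [|P iP].
  by rewrite -hJ card_imset // cardsT card_ord.
rewrite (GJ_image _ Wn_perm iP hi hJ); congr (Recursion.Gc _ _ _).
rewrite /h fcons_map fcons0; congr (fcons _ _).
by apply/funext => i; rewrite fconsS.
Qed.

Lemma fcons_pt_inj N (Q : 'I_N -> X) P : injective Q -> (forall i, Q i <> P) -> injective (fcons P Q).
Proof. by move=> iQ QP; apply/fcons_inj_seq. Qed.

(** The bound is [D.+1] because a subset without the first point gives a constant, possibly of size
    1 when [D] is 0. *)
Lemma GJ_affine N (Q : 'I_N -> X) (J : {set 'I_N.+1}) D :
  (forall M, (M < #|J|)%N -> affine M D) -> (forall i, good (Q i)) -> injective Q ->
  exists a b : {poly C}, [/\ (size a <= D.+1)%N, (size b <= D.+1)%N &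
    forall P, good P -> (forall i, Q i <> P) -> GJ (fcons P Q) J = a.[xc P] + yc P * b.[xc P]].
Proof.
move=> H gQ iQ; case: (boolP (ord0 \in J)) => J0.
  have [M [f [sM fi E]]] := GJ_fcons_in Q J0.
  have MJ : (M < #|J|)%N by rewrite -sM.
  have [a [b [sa sb Eab]]] := H M MJ (fun i => Q (f i)) (fun i => gQ (f i)) (fun i j h => fi _ _ (iQ _ _ h)).
  exists a, b; split=> [||P gP QP]; [exact: leqW|exact: leqW|].
  by rewrite E ?Eab //; exact: fcons_pt_inj.
pose P0 : X := base_pt g p.
exists (GJ (fcons P0 Q) J)%:P, 0; split=> [||P gP QP].
- by rewrite (leq_trans (size_polyC_leq1 _)).
- by rewrite size_poly0.
- by rewrite hornerC horner0 mulr0 addr0; exact: GJ_fcons_notin.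
Qed.

Section At_chart.
Context (N : nat) (Q : 'I_N -> X) (gQ : forall i, good (Q i)) (iQ : injective Q).
Context (c : chart g p) (z : C) (xch : x_chart c) (dz : dom c z) (Qz : forall i, Q i <> c z).

Lemma near_not_in : \forall w \near z, forall i, Q i <> c w.
Proof.
have [cs csP] := x_charts_of gQ.
have := near_admissible (admissible_Q iQ csP dz Qz).
apply: filterS => w /admissible_cons[_ H _] i.
by case: (csP i) => _ _ E; have := H i; rewrite E.
Qed.

Lemma T2_xc (f : C -> C) : T2 f z -> T2 (fun w => f (xc (c w))) z.
Proof. by apply: T2_near; apply: filterS (dom_nbhs dz) => w dw; rewrite (xch dw).2. Qed.

Lemma T2_wt i j : T2 (fun w => wt (fcons (c w) Q) i j) z.
Proof.
rewrite /wt; case: eqP => ij.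
  case: (unliftP ord0 i) ij => [i' ->|->] _.
    by under eq_fun do rewrite fconsS; exact: T2_cst.
  under eq_fun do rewrite fcons0.
  apply: (@T2_xc (fun w => p^`().[w] ^+ 2 / (16 * p.[w]))).
  apply: T2M; first by apply: T2X; exact: T2_poly.
  apply: T2V; first by apply: T2M; [exact: T2_cst|exact: T2_poly].
  by rewrite mulf_neq0 ?pnatr_eq0 // (x_chart_neq0 p_simple p_neq0 xch dz).
apply: T2M; first exact: T2_cst.
case: (unliftP ord0 i) ij => [i' ->|->]; case: (unliftP ord0 j) => [j' ->|->] // _.
- by under eq_fun do rewrite !fconsS; exact: T2_cst.
- under eq_fun do rewrite fconsS fcons0 edge_funC.
  exact: (T2_edge_fun p_simple p_neq0).
- under eq_fun do rewrite fconsS fcons0.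
  exact: (T2_edge_fun p_simple p_neq0).
Qed.

Lemma T2_affine (u : X -> C) (a b : {poly C}) :
  (forall P, good P -> (forall i, Q i <> P) -> u P = a.[xc P] + yc P * b.[xc P]) ->
  T2 (fun w => u (c w)) z.
Proof.
move=> E; apply: (@T2_near _ (fun w => a.[xc (c w)] + yc (c w) * b.[xc (c w)])).
  apply: filterS2 near_not_in (dom_nbhs dz) => w Qw dw.
  by rewrite E //; exact: (x_chart_good p_simple p_neq0).
apply: T2D; first exact: T2_xc (T2_poly a z).
by apply: T2M; [exact: (x_chart_T2 p_simple p_neq0)|exact: T2_xc (T2_poly b z)].
Qed.

Lemma T2_GJ (J : {set 'I_N.+1}) D : (forall M, (M < #|J|)%N -> affine M D) ->
  T2 (fun w => GJ (fcons (c w) Q) J) z.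
Proof.
move=> H; have [a [b [_ _ E]]] := GJ_affine H gQ iQ.
exact: (T2_affine E).
Qed.

Lemma T2_Nst : T2 (fun w => Nst s (fcons (c w) Q)) z.
Proof.
have [cs csP] := x_charts_of gQ.
apply: T2_near (T2_npoint s (virT V) (fun=> virT V) (admissible_Q iQ csP dz Qz)).
by apply: filterS (dom_nbhs dz) => w dw; rewrite (Nst_fcons p_deg p_simple).
Qed.

Lemma T2_Wn : T2 (fun w => Wn (fcons (c w) Q)) z.
Proof.
under eq_fun do rewrite Wn_fcons.
apply: T2M T2_Nst; apply: T2M; last exact: T2_cst.
exact: T2_xc (T2_poly p z).
Qed.

Lemma card_hdsC_lt (G : {set 'I_N.+1 * 'I_N.+1}) M : (G != set0)%SET -> (M < #|~: hds G|)%N -> (M < N)%N.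
Proof. by move=> G0 h; have := leq_trans h (card_hdsC G0). Qed.

Lemma T2_Gc D : (forall M, (M < N)%N -> affine M D) -> T2 (fun w => Gc (fcons (c w) Q)) z.
Proof.
move=> H; under eq_fun do rewrite GcE.
apply: T2B; first exact: T2_Wn.
apply: T2_sum => G /andP[_ G0]; apply: T2M.
  by apply: T2M; [exact: T2_cst|apply: T2_prod => e _; exact: T2_wt].
by apply: T2_GJ => M h; apply: H; apply: card_hdsC_lt h.
Qed.

End At_chart.
(** The graphs with a loop at the first point sum to [anomaly] times the correlator of the rest.
    Subtracting them leaves only weights that are bounded near branch points. *)
Lemma Wn_sub_anomaly N (Q : 'I_N -> X) P : injective Q -> (forall i, Q i <> P) ->
  Wn (fcons P Q) - anomaly V P * Wn Q = Gc (fcons P Q) +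
   \sum_(G : {set 'I_N.+1 * 'I_N.+1} | [&& pinj G, G != set0 & (ord0, ord0) \notin G]%SET)
     weight al (wt (fcons P Q)) G * GJ (fcons P Q) (~: hds G)%SET.
Proof.
move=> iQ QP; have iP := fcons_pt_inj iQ QP.
have Ef (G : {set 'I_N.+1 * 'I_N.+1}) (b : bool) : partial_inj setT G && b = pinj G && b.
  rewrite /partial_inj; case: (pinj G) => //=; rewrite (_ : _ \subset _) //.
  by apply/subsetP => -[i j] _; rewrite in_setX !inE.
have -> : anomaly V P * Wn Q = graph_sum al (wt (fcons P Q)) (GJ (fcons P Q))
    (fun G => (ord0, ord0) \in G) setT.
  rewrite graph_sum_loop ?inE // (graph_sum_Gc _ Wn_perm) //.
  rewrite (@WJ_image _ _ _ _ Wn_perm _ _ _ (lift ord0)) //; last first.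
  - apply/setP => x; rewrite !inE andbT; case: (unliftP ord0 x) => [j ->|->].
      by rewrite eq_sym neq_lift; apply/imsetP; exists j.
    by rewrite eqxx; apply/negbTE/imsetP => -[j _ /eqP]; rewrite (negPf (neq_lift _ _)).
  - exact: lift_inj.
  have -> : (fun i => fcons P Q (lift ord0 i)) = Q by apply/funext => i; rewrite fconsS.
  congr (_ * _); rewrite /wt eqxx fcons0 /anomaly invfM.
  by move: (p.[_]^-1) (p^`().[_]) cc => a b k; field.
rewrite (Wn_setT al Wn_perm iP) (graph_sumID _ _ _ predT (fun G => (ord0, ord0) \in G)).
rewrite [X in X + _ - _](@eq_graph_sum _ _ _ _ _ _ (fun G => (ord0, ord0) \in G)); last by [].
rewrite addrC addKr /graph_sum (bigD1 set0) /=; last first.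
  by rewrite inE Ef andbT; apply/pinjP => i j i' j'; rewrite inE.
rewrite weight0 mul1r hds0 setD0 GJ_setT //; last exact: Wn_perm.
congr (_ + _); apply: eq_big => [G|G _]; last by rewrite setTD.
by rewrite Ef -andbA [_ && (G != _)]andbC.
Qed.

Lemma Bdd_yc (F : set_system C) {FF : Filter F} : Bdd F (fun x => p.[x]) ->
  Bdd (at_x F) (fun P : X => yc P).
Proof.
move=> [K HK]; exists (1 + K); apply: filterS2 (@at_x_near _ _ _ F _ _ HK) (@at_x_good _ _ _ F _) => P h [fP _].
move: h; rewrite -curve_eq // nrmX; have := nrm_ge0 (yc P); nra.
Qed.

Lemma Bdd_affine (F : set_system C) {FF : Filter F} N (Q : 'I_N -> X) (u : X -> C) (a b : {poly C}) :
  (forall i, \forall x \near F, x != xc (Q i)) -> Bdd F id ->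
  (forall P, good P -> (forall i, Q i <> P) -> u P = a.[xc P] + yc P * b.[xc P]) ->
  Bdd (at_x F) u.
Proof.
move=> QF Bid E.
have Bp q : Bdd (at_x F) (fun P : X => (q : {poly C}).[xc P]).
  by apply: (@Bdd_at_x _ _ _ F _ (fun x => q.[x])); exact: Bdd_horner.
have By := @Bdd_yc F FF (@Bdd_horner _ _ F FF p id Bid).
apply: (@Bdd_near _ _ _ _ (fun P => a.[xc P] + yc P * b.[xc P])); last first.
  by have Ba := Bp a; have Bb := Bp b; bdd.
have nQ := @not_in_Q _ _ _ _ Q F FF QF.
by apply: filterS2 nQ (@at_x_good _ _ _ F FF) => P QP gP; rewrite E.
Qed.

(** [Wn_sub_anomaly] is solved for [Gc]. Its left side is bounded by [Nst_branch], the remaining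
    weights contain no 1/p at the moving point, and the smaller correlators are polynomial in x and
    y by induction. *)
Lemma Gc_branch N D (Q : 'I_N -> X) e : (forall M, (M < N)%N -> affine M D) ->
  (forall i, good (Q i)) -> injective Q -> p.[e] = 0 -> Bdd (at_x e^') (fun P => Gc (fcons P Q)).
Proof.
move=> HD gQ iQ pe; have [cs csP] := x_charts_of gQ.
have Qe i : xc (Q i) - e != 0.
  by rewrite subr_eq0; apply/eqP => E; have [_] := gQ i; rewrite E pe eqxx.
have QF i : \forall x \near e^', x != xc (Q i).
  have Qi : 0 < nrm (xc (Q i) - e) by rewrite nrm_gt0.
  apply: nbhs_dnbhs; apply: filterS (near_nrm_lt e Qi) => w wd.
  by apply/eqP => E; rewrite E ltxx in wd.
have Bid : Bdd e^' id by exact: Bdd_dnbhs (Bdd_id e).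
have By := @Bdd_yc e^' (Cx_dnbhs_filter e) (@Bdd_horner _ _ e^' (Cx_dnbhs_filter e) p id Bid).
have Bwt i j : (i, j) != (ord0, ord0) -> Bdd (at_x e^') (fun P => wt (fcons P Q) i j).
  have Bedge l : Bdd (at_x e^') (fun P => edge_fun P (Q l)).
    have Te : T2 (fun w => (w - xc (Q l))^-1) e.
      by apply: T2V; [apply: T2B; [exact: T2_id|exact: T2_cst]|rewrite -opprB oppr_eq0].
    have Bi := @Bdd_at_x _ g p e^' (Cx_dnbhs_filter e) _ (Bdd_dnbhs (T2_Bdd Te)).
    apply: (@Bdd_near _ _ _ _ (fun P => ((yc P + yc (Q l)) * (xc P - xc (Q l))^-1) ^+ 2)).
      by apply: filterS (@at_x_near _ _ _ e^' _ _ (QF l)) => P h; rewrite /edge_fun (negPf h).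
    by bdd.
  case: (unliftP ord0 i) => [i' ->|->]; case: (unliftP ord0 j) => [j' ->|->] ij; rewrite /wt.
  - by under eq_fun do rewrite !fconsS; exact: Bdd_cst.
  - rewrite eq_sym (negPf (neq_lift _ _)).
    under eq_fun do rewrite fconsS fcons0 edge_funC; by have := Bedge i' => ?; bdd.
  - rewrite (negPf (neq_lift _ _)).
    under eq_fun do rewrite fconsS fcons0; by have := Bedge j' => ?; bdd.
  - by rewrite eqxx in ij.
have nQ := @not_in_Q _ _ _ _ Q e^' (Cx_dnbhs_filter e) QF.
apply: (@Bdd_near _ _ _ _ (fun P => (\prod_i p.[xc (Q i)]) *
     (p.[xc P] * Nst s (fcons P Q) - anomaly V P * Nst s Q) -
   \sum_(G : {set 'I_N.+1 * 'I_N.+1} | [&& pinj G, G != set0 & (ord0, ord0) \notin G]%SET)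
     weight al (wt (fcons P Q)) G * GJ (fcons P Q) (~: hds G)%SET)).
  apply: filterS nQ => P QP; have := Wn_sub_anomaly iQ QP.
  rewrite Wn_fcons /Wn => E.
  rewrite (canRL (addrK _) (esym E)); congr (_ - _).
  by move: (\prod_i _) (Nst _ _) (Nst _ _) (anomaly _ _) (p.[_]) => a b k d f; ring.
apply: BddB.
  apply: BddM; first exact: Bdd_cst.
  exact: (Nst_branch p_deg p_simple hT s gQ iQ csP pe).
apply: Bdd_sum => G /and3P[_ G0 h0]; apply: BddM.
  rewrite /weight; apply: BddM; first exact: Bdd_cst.
  (* The loop at the moving point does not occur in [G]; giving it the value 0 leaves a product of
     bounded factors. *)
  have -> : (fun P : X => \prod_(e in G) wt (fcons P Q) e.1 e.2)
     = (fun P : X => \prod_(e in G) (if e == (ord0, ord0) then 0 else wt (fcons P Q) e.1 e.2)).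
    apply/funext => P; apply: eq_bigr => -[i j] ij; case: eqP => // E.
    by rewrite E in ij; rewrite ij in h0.
  by apply: Bdd_prod => -[i j] _; case: (eqVneq (i, j)) => [_|/Bwt //]; exact: Bdd_cst.
have [M0|a [b [_ _ E]]] := @GJ_affine N Q (~: hds G)%SET D _ gQ iQ.
  by move=> h; apply: HD; apply: card_hdsC_lt h.
exact: (@Bdd_affine e^' _ N Q _ a b QF Bid E).
Qed.

Definition growth D (u : X -> C) := Bdd (at_x inftyC) (fun P => u P / xc P ^+ D).

Lemma near_growth D u v : (\forall P \near at_x inftyC, u P = v P) -> growth D u -> growth D v.
Proof.
move=> E [K HK]; exists K; apply: filterS2 E HK => P -> ; exact.
Qed.

Lemma growthM D D' u v : growth D u -> growth D' v -> growth (D + D') (fun P => u P * v P).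
Proof.
move=> hu hv; have := BddM hu hv.
by case=> K HK; exists K; apply: filterS HK => P; rewrite exprD invfM mulrACA.
Qed.

Lemma growth_mono D D' u : (D <= D')%N -> growth D u -> growth D' u.
Proof.
move=> DD hu.
have hi : Bdd (at_x inftyC) (fun P : X => (xc P)^-1 ^+ (D' - D)).
  apply: BddX; exact: (@Bdd_at_x _ g p inftyC inftyC_filter _ (@Bdd_inv_infty R)).
case: (BddM hu hi) => K HK; exists K; apply: filterS HK => P.
by rewrite exprVn -mulrA -invfM -exprD subnKC.
Qed.

Lemma growth_add D u v : growth D u -> growth D v -> growth D (fun P => u P + v P).
Proof.
by move=> hu hv; case: (BddD hu hv) => K HK; exists K; apply: filterS HK => P; rewrite mulrDl.
Qed.

Lemma growth0 u : Bdd (at_x inftyC) u -> growth 0 u.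
Proof. by case=> K HK; exists K; apply: filterS HK => P; rewrite expr0 divr1. Qed.

Lemma growth_poly D (a : {poly C}) : (size a <= D.+1)%N -> growth D (fun P => a.[xc P]).
Proof.
move=> sa; exact: (@Bdd_at_x _ g p inftyC inftyC_filter _ (Bdd_poly_infty sa)).
Qed.

(** A crude exponent, from y^2 = p = O(x^n) and n <= 2n. *)
Lemma growth_yc : growth n (fun P => yc P).
Proof.
have sp : (size p <= (n + n).+1)%N by rewrite p_deg ltnS leq_addr.
have [K HK] := growth_poly sp.
exists (1 + K); apply: filterS2 HK (@at_x_good _ _ _ inftyC inftyC_filter) => P h [fP _].
move: h; rewrite -curve_eq // exprD -expr2 -expr_div_n nrmX.
by have := nrm_ge0 (yc P / xc P ^+ n); nra.
Qed.

Lemma growth_cst D c : growth D (fun=> c).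
Proof. by apply: (@growth_mono 0) => //; apply: growth0; exact: Bdd_cst. Qed.

Lemma near_infty_neq (a : C) : \forall x \near inftyC, x != a.
Proof. by exists (nrm a) => x h; apply: contraTneq h => ->; rewrite ltxx. Qed.

Lemma growth_wt N (Q : 'I_N -> X) i j : growth (n + n) (fun P => wt (fcons P Q) i j).
Proof.
have ge l : growth (n + n) (fun P => edge_fun P (Q l)).
  have gy := growth_add growth_yc (growth_cst n (yc (Q l))).
  have gi : growth 0 (fun P => (xc P - xc (Q l))^-1).
    have qn0 : ('X - (xc (Q l))%:P : {poly C}) != 0 by rewrite polyXsubC_eq0.
    apply: growth0; apply: (@Bdd_near _ _ _ _ (fun P : X => ('X - (xc (Q l))%:P).[xc P]^-1)).
      by apply: filterE => P; rewrite hornerXsubC.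
    exact: (@Bdd_at_x _ g p inftyC inftyC_filter _ (Bdd_poly_inv_infty qn0)).
  have g1 := growthM gy gi; rewrite addn0 in g1.
  have := growthM g1 g1; apply: near_growth.
  apply: filterS (@at_x_near _ g p inftyC inftyC_filter _ (near_infty_neq (xc (Q l)))) => P h.
  by rewrite /edge_fun (negPf h) expr2.
rewrite /wt; case: eqP => ij.
  case: (unliftP ord0 i) ij => [i' ->|->] _.
    by under eq_fun do rewrite fconsS; exact: growth_cst.
  under eq_fun do rewrite fcons0.
  have gp' : growth n (fun P => p^`().[xc P]).
    by apply: growth_poly; rewrite -p_deg ltnW ?lt_size_deriv.
  have gi : growth 0 (fun P => (16 * p.[xc P])^-1).
    apply: growth0; apply: (@Bdd_near _ _ _ _ (fun P : X => 16^-1 * p.[xc P]^-1)).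
      by apply: filterE => P; rewrite invfM.
    apply: BddM; first exact: Bdd_cst.
    exact: (@Bdd_at_x _ g p inftyC inftyC_filter _ (Bdd_poly_inv_infty p_neq0)).
  have := growthM (growthM gp' gp') gi; rewrite addn0; apply: near_growth.
  by apply: filterE => P; rewrite expr2.
have gc := growth_cst 0 (4^-1).
case: (unliftP ord0 i) ij => [i' ->|->]; case: (unliftP ord0 j) => [j' ->|->] // _.
- by under eq_fun do rewrite !fconsS; exact: growth_cst.
- under eq_fun do rewrite fconsS fcons0 edge_funC; exact: growthM gc (ge i').
- under eq_fun do rewrite fconsS fcons0; exact: growthM gc (ge j').
Qed.

Lemma growth_prod (I : Type) (r : seq I) (F : I -> X -> C) D : (forall i, growth D (F i)) ->
  growth (size r * D) (fun P => \prod_(i <- r) F i P).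
Proof.
move=> H; elim: r => [|i r IH].
  by under eq_fun do rewrite big_nil; exact: growth_cst.
by under eq_fun do rewrite big_cons; exact: growthM.
Qed.

Lemma growth_sum (I : Type) (r : seq I) (S : pred I) (F : I -> X -> C) D : (forall i, S i -> growth D (F i)) ->
  growth D (fun P => \sum_(i <- r | S i) F i P).
Proof.
move=> H; elim: r => [|i r IH].
  by under eq_fun do rewrite big_nil; exact: growth_cst.
under eq_fun do rewrite big_cons; case: (boolP (S i)) => // Si.
by apply: growth_add => //; exact: H.
Qed.

(** Origin of the exponent: [n] covers p times the N-point function; there are at most (N+1)^2
    edges, each growing at most like x^(2n); a smaller correlator a + y b contributes [D + n]. *)
Lemma growth_Gc N D (Q : 'I_N -> X) : (forall M, (M < N)%N -> affine M D) ->
  (forall i, good (Q i)) -> injective Q ->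
  growth (n + ((N.+1 * N.+1) * (n + n) + (D + n))) (fun P => Gc (fcons P Q)).
Proof.
move=> HD gQ iQ; have [cs csP] := x_charts_of gQ.
under eq_fun do rewrite GcE; apply: growth_add.
  apply: (@growth_mono n); first by rewrite leq_addr.
  under eq_fun do rewrite Wn_fcons.
  have gp : growth n (fun P => p.[xc P]) by apply: growth_poly; rewrite p_deg.
  have := growthM gp (growthM (growth_cst 0 (\prod_i p.[xc (Q i)]))
    (growth0 (Nst_infinity n_deg p_deg p_simple hT s gQ iQ csP))).
  by rewrite !addn0; apply: near_growth; apply: filterE => P; rewrite mulrA.
have gN D' u : growth D' u -> growth D' (fun P => - u P).
  move=> gu; have := growthM (growth_cst 0 (-1)) gu; rewrite add0n.
  by apply: near_growth; apply: filterE => P; rewrite mulN1r.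
apply: gN; apply: (@growth_mono ((N.+1 * N.+1) * (n + n) + (D + n))); first by rewrite leq_addl.
apply: growth_sum => G /andP[_ G0]; apply: growthM.
  rewrite /weight; apply: (@growth_mono (#|G| * (n + n))).
    have := max_card (mem G); rewrite card_prod !card_ord => h.
    by rewrite leq_mul2r h orbT.
  under eq_fun do rewrite -big_enum /=; rewrite cardE -[(_ * _)%N]add0n.
  apply: growthM; first exact: growth_cst.
  by apply: growth_prod => e; exact: growth_wt.
have [M|a [b [sa sb E]]] := @GJ_affine N Q (~: hds G)%SET D _ gQ iQ.
  by move=> h; apply: HD; apply: card_hdsC_lt h.
have ga := growth_poly sa; have gb := growthM (growth_poly sb) growth_yc.
have := growth_add (growth_mono (leq_addr n D) ga) gb; apply: near_growth.
have nQ := @not_in_Q _ _ _ _ Q inftyC inftyC_filter (fun i => near_infty_neq _).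
apply: filterS2 nQ (@at_x_good _ _ _ inftyC inftyC_filter) => P QP gP.
by rewrite E // [yc P * _]mulrC.
Qed.

(* [h = w - z], [y1] and [y2] are the values of [y] at [w] and [z], and [de], [m], [tau]
   the remainders of [y], of [p] and of the trapezoidal rule for [p]. *)
Lemma pole_identity (y1 y2 h de m tau q1 q2 : C) : h != 0 -> y1 != 0 -> y2 != 0 ->
  y1 - y2 = h * de -> y1 ^+ 2 - y2 ^+ 2 = q2 * h + h ^+ 2 * m ->
  (q1 + q2) * h - 2 * (y1 ^+ 2 - y2 ^+ 2) = h ^+ 3 * tau ->
  let om := 4^-1 * ((y1 + y2) / h) ^+ 2 in
  let be := (de ^+ 2 - m) * y2^-1 * 2^-1 in
  let al' := (h * tau * 2^-1 - y2 * be) * y1^-1 in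
  y1 ^+ 2 * y2 ^+ 2 / h ^+ 4 - om ^+ 2 +
    om * (q1 ^+ 2 / (16 * y1 ^+ 2) + q2 ^+ 2 / (16 * y2 ^+ 2)) =
  (y1 + y2) ^+ 2 * 16^-1 * (al' ^+ 2 + be ^+ 2 + 2 * de * ((tau * 2^-1 - de * al') * y2^-1))
   + de ^+ 4 * 16^-1.
Proof.
move=> h0 y10 y20 E1 E2 E3.
have Ey : y1 = y2 + h * de by rewrite -E1 addrC subrK.
have Em : m = (2 * y2 * de + h * de ^+ 2 - q2) / h.
  apply: (mulfI (expf_neq0 2 h0)); rewrite -[LHS](addKr (q2 * h)) -E2 Ey; field.
  exact: h0.
have Et : tau = ((q1 + q2) - 2 * (2 * y2 * de + h * de ^+ 2)) / h ^+ 2.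
  apply: (mulfI (expf_neq0 3 h0)); rewrite -E3 Ey; field.
  exact: h0.
move=> om be al'; rewrite /om /al' /be {om al' be} Em Et {Em Et E1 E2 E3}.
rewrite Ey in y10 *; field; by rewrite h0 y10 y20.
Qed.

(** [F1] and [F2] stand for an N-point function with T at w and at z. Once h^2 is cleared, y1 - y2
    is a factor of the numerator, and the cofactor in the second hypothesis vanishes as well when
    the points coincide. *)
Lemma pole_identity2 (y1 y2 h de rho F1 F2 : C) : h != 0 ->
  y1 - y2 = h * de ->
  y2 ^+ 2 * F2 * (3 * y1 + y2) - y1 ^+ 2 * F1 * (y1 + 3 * y2) = h * rho ->
  (F1 + F2) / h ^+ 2 * (y1 ^+ 2 * y2 ^+ 2)
   - 4^-1 * ((y1 + y2) / h) ^+ 2 * (y1 ^+ 2 * F1 + y2 ^+ 2 * F2) = de * 4^-1 * rho.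
Proof.
move=> h0 E1 E2.
have Ed : de = (y1 - y2) / h by rewrite E1 mulrC mulKf.
have Er : rho = (y2 ^+ 2 * F2 * (3 * y1 + y2) - y1 ^+ 2 * F1 * (y1 + 3 * y2)) / h.
  by rewrite E2 mulrC mulKf.
by rewrite Ed Er; field.
Qed.

(** * Cancellation of poles where two points meet *)

Section Pole.
Context (c : chart g p) (z : C) (xch : x_chart c) (dz : dom c z).

Lemma yz_neq0 : yc (c z) != 0.
Proof. exact: good_yc (x_chart_good p_simple p_neq0 xch dz). Qed.

Lemma near_pole : \forall w \near z^', [/\ dom c w, w - z != 0, yc (c w) != 0,
  edge_fun (c w) (c z) = ((yc (c w) + yc (c z)) / (w - z)) ^+ 2 &
  yc (c w) ^+ 2 = p.[w]].
Proof.
have Ty := x_chart_T2 p_simple p_neq0 xch dz.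
have [d d0 Hd] := (nbhs_nrmP _ _).1 (filterI (dom_nbhs dz) (near_neq0 (T2_cvg Ty) yz_neq0)).
apply: ((dnbhs_nrmP _ _).2 _); exists d => // w wz wd; have [dw yw] := Hd w wd.
split; rewrite ?subr_eq0 //; last by rewrite curve_eq ?(xch dw).2 ?(xch dw).1.
by rewrite /edge_fun (xch dw).2 (xch dz).2 (negPf wz).
Qed.

Lemma Bdd_pole_yc : exists2 de, Bdd z^' de &
  \forall w \near z^', yc (c w) - yc (c z) = (w - z) * de w.
Proof.
have [de Bde Hde] := T2_lip (x_chart_T2 p_simple p_neq0 xch dz).
by exists de; [exact: Bdd_dnbhs|exact: nbhs_dnbhs].
Qed.

Lemma Bdd_yc_chart : Bdd z^' (fun w => yc (c w)).
Proof. exact: Bdd_dnbhs (T2_Bdd (x_chart_T2 p_simple p_neq0 xch dz)). Qed.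

(** The fourth-order pole of the OPE against the weight of the 2-cycle. What is left of order two is
    compensated by the loop weights of the two points. *)
Lemma pole4 : Bdd z^' (fun w => p.[w] * p.[z] / (w - z) ^+ 4 - (4^-1 * edge_fun (c w) (c z)) ^+ 2
  + 4^-1 * edge_fun (c w) (c z) *
    (p^`().[w] ^+ 2 / (16 * p.[w]) + p^`().[z] ^+ 2 / (16 * p.[z]))).
Proof.
have Ty := x_chart_T2 p_simple p_neq0 xch dz.
have [de Bde Hde] := Bdd_pole_yc.
have [r Hr] := poly_taylor2 p z; have [r' Hr'] := poly_taylor2 p^`() z.
have Bpoly (q : {poly C}) : Bdd z^' (fun w => q.[w]) := Bdd_dnbhs (T2_Bdd (T2_poly q z)).
have Bh := Bdd_dnbhs (Bdd_shift z).
pose m w := p^`()^`().[z] / 2 + (w - z) * r.[w].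
have Bm : Bdd z^' m by rewrite /m; have := Bpoly r => ?; bdd.
pose tau w := p^`()^`()^`().[z] / 2 + (w - z) * r'.[w] - 2 * r.[w].
have Btau : Bdd z^' tau by rewrite /tau; have := Bpoly r; have := Bpoly r' => ? ?; bdd.
have By1 := Bdd_yc_chart.
have Bi : Bdd z^' (fun w => (yc (c w))^-1) by exact: Bdd_dnbhs (T2_Bdd (T2V Ty yz_neq0)).
apply: (@Bdd_near _ _ _ _ (fun w =>
  let y1 := yc (c w) in let y2 := yc (c z) in let h := w - z in
  let be := (de w ^+ 2 - m w) * y2^-1 * 2^-1 in
  let al' := (h * tau w * 2^-1 - y2 * be) * y1^-1 in
  (y1 + y2) ^+ 2 * 16^-1 * (al' ^+ 2 + be ^+ 2 + 2 * de w * ((tau w * 2^-1 - de w * al') * y2^-1))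
   + de w ^+ 4 * 16^-1)); last by cbv zeta; bdd.
apply: filterS2 near_pole Hde => w [dw h0 y0 Ew Ey] E1.
have Ez : yc (c z) ^+ 2 = p.[z] by rewrite curve_eq ?(xch dz).2 ?(xch dz).1.
cbv zeta; rewrite -(@pole_identity (yc (c w)) (yc (c z)) (w - z) (de w) (m w) (tau w) p^`().[w] p^`().[z] h0 y0 yz_neq0 E1); first by rewrite Ew Ey Ez.
- rewrite Ey Ez (Hr w) /m.
  by move: (p.[z]) (p^`().[z]) (p^`()^`().[z] / 2) (r.[w]) (w - z) => a b k e h; ring.
- rewrite Ey Ez (Hr w) (Hr' w) /tau.
  move: (p.[z]) (p^`().[z]) (p^`()^`().[z]) (p^`()^`()^`().[z] / 2) (r.[w]) (r'.[w]) (w - z).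
  by move=> a b k e h i j; field.
Qed.

(** The second-order pole with coefficient T(w) + T(z) against the single edges between the two
    points. *)
Lemma pole2 (F : C -> C) : T2 F z ->
  Bdd z^' (fun w => (F w + F z) / (w - z) ^+ 2 * (p.[w] * p.[z])
    - 4^-1 * edge_fun (c w) (c z) * (p.[w] * F w + p.[z] * F z)).
Proof.
move=> TF; have Ty := x_chart_T2 p_simple p_neq0 xch dz.
have [de Bde Hde] := Bdd_pole_yc.
have TG : T2 (fun w => yc (c z) ^+ 2 * F z * (3 * yc (c w) + yc (c z))
    - yc (c w) ^+ 2 * F w * (yc (c w) + 3 * yc (c z))) z.
  apply: T2B; apply: T2M.
  - exact: T2_cst.
  - by apply: T2D; [apply: T2M => //|]; exact: T2_cst.
  - by apply: T2M => //; exact: T2X.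
  - by apply: T2D => //; exact: T2_cst.
have [rho Brho Hrho] := T2_lip TG.
apply: (@Bdd_near _ _ _ _ (fun w => de w * 4^-1 * rho w)); last first.
  by have := Bdd_dnbhs Brho => ?; bdd.
apply: filterS2 (filterI near_pole Hde) (nbhs_dnbhs Hrho) => w [[dw h0 y0 Ew Ey] E1] E2.
have Ez : yc (c z) ^+ 2 = p.[z] by rewrite curve_eq ?(xch dz).2 ?(xch dz).1.
rewrite -(@pole_identity2 _ _ _ _ _ (F w) (F z) h0 E1); first by rewrite Ew Ey Ez.
rewrite -E2; move: (yc (c z)) (F z) (yc (c w)) (F w) => a b k d; ring.
Qed.

End Pole.

Section Split.
Context (M : nat) (Q : 'I_M -> X) (iQ : injective Q).
Local Notation a := (@ord0 M.+1).
Local Notation b := (lift (@ord0 M.+1) (@ord0 M)).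
Local Notation I2 := [set: 'I_M.+2]%SET.

(** Of the two approaching points [fst_map] keeps the first and [snd_map] the second, each together
    with the rest. *)
Definition fst_map : 'I_M.+1 -> 'I_M.+2 := fcons a (fun i => lift ord0 (lift ord0 i)).
Definition snd_map : 'I_M.+1 -> 'I_M.+2 := lift ord0.

Lemma fst_map_inj : injective fst_map.
Proof.
apply/fcons_inj_seq; split=> [i /eqP|i j /lift_inj /lift_inj //].
by rewrite eq_sym (negPf (neq_lift _ _)).
Qed.

Lemma snd_map_inj : injective snd_map. Proof. exact: lift_inj. Qed.

Lemma ab_neq : a != b. Proof. exact: neq_lift. Qed.

Lemma fst_map_image : (fst_map @: setT = I2 :\ b)%SET.
Proof.
apply/setP => x; rewrite !inE andbT; apply/imsetP/idP => [[i _ ->]|].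
  rewrite /fst_map; case: (unliftP ord0 i) => [j ->|->]; rewrite ?fcons0 ?neq_lift // fconsS.
  by rewrite (inj_eq lift_inj) eq_sym neq_lift.
case: (unliftP ord0 x) => [j ->|-> _]; last by exists ord0; rewrite // /fst_map fcons0.
case: (unliftP ord0 j) => [k ->|->]; last by rewrite eqxx.
by move=> _; exists (lift ord0 k); rewrite // /fst_map fconsS.
Qed.

Lemma snd_map_image : (snd_map @: setT = I2 :\ a)%SET.
Proof.
apply/setP => x; rewrite !inE andbT; apply/imsetP/idP => [[i _ ->]|].
  by rewrite eq_sym neq_lift.
by case: (unliftP ord0 x) => [j ->|->]; rewrite ?eqxx // => _; exists j.
Qed.

Lemma rest_image : ((fun i : 'I_M => snd_map (lift ord0 i)) @: setT = I2 :\ a :\ b)%SET.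
Proof.
rewrite -snd_map_image; apply/setP => x; rewrite !inE; apply/imsetP/andP => [[i _ ->]|[xb /imsetP[i _ E]]].
  by rewrite mem_imset ?inE; [rewrite (inj_eq snd_map_inj) eq_sym neq_lift|exact: snd_map_inj].
case: (unliftP ord0 i) E => [j ->|->] E; first by exists j.
by rewrite E eqxx in xb.
Qed.

Context (P P0 : X) (iP : injective (fcons P (fcons P0 Q))).
Local Notation PQ := (fcons P (fcons P0 Q)).

Lemma PQ_fst : (fun i => PQ (fst_map i)) = fcons P Q.
Proof.
rewrite /fst_map fcons_map fcons0; congr (fcons _ _).
by apply/funext => i; rewrite !fconsS.
Qed.

Lemma PQ_snd : (fun i => PQ (snd_map i)) = fcons P0 Q.
Proof. by apply/funext => i; rewrite fconsS. Qed.

Definition self_wt (P : X) : C := p^`().[xc P] ^+ 2 / (16 * p.[xc P]).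
Local Notation om := (4^-1 * edge_fun P P0).
Local Notation Z := (graph_sum al (wt PQ) (GJ PQ)).

(** [graph_sum_split] at the two approaching points, where both contracted sums carry the same edge
    weight. Their total is expressed through the two diagonal sums, which are W with one point
    dropped and without the loops at the other, plus the product of differences. *)
Lemma Gc_split :
  Gc PQ = Wn PQ - al * om ^+ 2 * Wn Q
    - om * (Wn (fcons P Q) + Wn (fcons P0 Q) - al * (self_wt P + self_wt P0) * Wn Q)
    + om * (\sum_(t | partial_inj (I2 :\ a)%SET t && ((b, b) \notin t))
       al ^+ cyc t * ((in_factor (wt PQ) (GJ PQ) I2 a b t a - in_factor (wt PQ) (GJ PQ) I2 a b t b) *
                      (out_factor (wt PQ) b t a - out_factor (wt PQ) b t b)))
    - \sum_(G : {set 'I_M.+2 * 'I_M.+2} |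
             [&& pinj G, G != set0, (a, b) \notin G & (b, a) \notin G]%SET)
        weight al (wt PQ) G * GJ PQ (~: hds G)%SET.
Proof.
have ab := ab_neq.
have w_ab : wt PQ a b = om by rewrite /wt (negPf ab) fcons0 fconsS fcons0.
have w_ba : wt PQ b a = om.
  by rewrite /wt eq_sym (negPf ab) fcons0 fconsS fcons0 edge_funC.
have w_aa : wt PQ a a = self_wt P by rewrite /wt eqxx fcons0.
have w_bb : wt PQ b b = self_wt P0 by rewrite /wt eqxx fconsS fcons0.
have ZW J m (f : 'I_m -> 'I_M.+2) : injective f -> (f @: setT = J)%SET ->
    Z predT J = Wn (fun i => PQ (f i)).
  by move=> fi E; rewrite (graph_sum_Gc _ Wn_perm) // (WJ_image Wn_perm iP fi E).
have Zr : Z predT (I2 :\ a :\ b)%SET = Wn Q.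
  rewrite (ZW _ _ _ _ rest_image); last by move=> i j /lift_inj /lift_inj.
  by congr (Wn _); apply/funext => i; rewrite !fconsS.
have Za : Z predT (I2 :\ a)%SET = Wn (fcons P0 Q) by rewrite (ZW _ _ _ snd_map_inj snd_map_image) PQ_snd.
have Zb : Z predT (I2 :\ b)%SET = Wn (fcons P Q) by rewrite (ZW _ _ _ fst_map_inj fst_map_image) PQ_fst.
have aI : a \in I2 by rewrite inE. have bI : b \in I2 by rewrite inE.
have Dbb := contracted_sum_diag al (wt PQ) (GJ PQ) bI ab.
have ba : b != a by rewrite eq_sym.
have Daa := contracted_sum_diag al (wt PQ) (GJ PQ) aI ba.
rewrite contracted_sum_sym // in Daa.
have EI : (I2 :\ b :\ a = I2 :\ a :\ b)%SET by apply/setP => x; rewrite !inE andbCA.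
rewrite Zb w_aa EI Zr in Daa; rewrite Za w_bb Zr in Dbb.
have Dx := contracted_sum_cross al (wt PQ) (GJ PQ) I2 a b.
rewrite Daa Dbb in Dx.
have D0 := graph_sum_split al (wt PQ) (GJ PQ) aI bI ab.
rewrite w_ab w_ba Zr -(Wn_setT al Wn_perm iP) in D0.
have Ef (G : {set 'I_M.+2 * 'I_M.+2}) (u : bool) : partial_inj setT G && u = pinj G && u.
  rewrite /partial_inj; case: (pinj G) => //=; rewrite (_ : _ \subset _) //.
  by apply/subsetP => -[i j] _; rewrite in_setX !inE.
have De : edge_free_sum al (wt PQ) (GJ PQ) I2 a b = Gc PQ +
    \sum_(G : {set 'I_M.+2 * 'I_M.+2} |
             [&& pinj G, G != set0, (a, b) \notin G & (b, a) \notin G]%SET)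
        weight al (wt PQ) G * GJ PQ (~: hds G)%SET.
  rewrite /edge_free_sum /graph_sum (bigD1 set0) /=; last first.
    by rewrite !inE Ef andbT; apply/pinjP => i j i' j'; rewrite inE.
  rewrite weight0 mul1r hds0 setD0 GJ_setT //; last exact: Wn_perm.
  congr (_ + _); apply: eq_big => [G|G _]; last by rewrite setTD.
  by rewrite Ef -andbA [_ && (G != _)]andbC.
rewrite D0 De; move: Dx.
move: (contracted_sum _ _ _ _ _ _ _ _) (contracted_sum _ _ _ _ _ _ _ _) => A1 A2.
move: (\sum_(t | _) _) (\sum_(G | _) _) (Gc PQ) (Wn (fcons P Q)) (Wn (fcons P0 Q)) (Wn Q) => S1 S2 k f h i.
move: (self_wt P) (self_wt P0) => u v Dx.
have -> : A1 = - S2 - A2 + (f - al * u * i) + (h - al * v * i) by rewrite -Dx; ring.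
ring.
Qed.

End Split.

Section LocalFactors.
Context (M : nat) (Q : 'I_M -> X) (t : {set 'I_M.+1 * 'I_M.+1}) (t0 : (ord0, ord0) \notin t).
Local Notation a := (@ord0 M.+1).
Local Notation b := (lift (@ord0 M.+1) (@ord0 M)).
Local Notation I2 := [set: 'I_M.+2]%SET.
Local Notation snd_map := (@snd_map M).

(** [t] lives on the contracted vertex set: the contracted vertex is [ord0], and its position is the
    single variable [P]. *)
Definition in_loc (P : X) : C :=
  (\prod_(e in t | e.2 == ord0) wt (fcons P Q) e.1 e.2) * GJ (fcons P Q) (~: hds t)%SET.

Definition out_loc (P : X) : C := \prod_(e in t | e.2 != ord0) wt (fcons P Q) e.1 e.2.

(** The factors at the two approaching points are values of one function of a point, so their
    difference is governed by the local expansion of that function. *)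
Lemma local_factors (PQ : 'I_M.+2 -> X) (P : X) (f : 'I_M.+1 -> 'I_M.+2) (u : 'I_M.+2) :
  injective PQ -> injective f -> f ord0 = u -> (forall i, f (lift ord0 i) = snd_map (lift ord0 i)) ->
  (fun i => PQ (f i)) = fcons P Q ->
  in_factor (wt PQ) (GJ PQ) I2 a b (relabel snd_map t) u = in_loc P /\
  out_factor (wt PQ) b (relabel snd_map t) u = out_loc P.
Proof.
move=> iP fi f0 fS EP.
have Es x : subst_at b u (snd_map x) = f x.
  rewrite /subst_at; case: (unliftP ord0 x) => [j ->|->]; last by rewrite /snd_map eqxx.
  by rewrite /snd_map (inj_eq lift_inj) eq_sym (negPf (neq_lift _ _)) fS.
have Ef x : x != ord0 -> snd_map x = f x.
  by case: (unliftP ord0 x) => [j ->|->]; rewrite ?eqxx // fS.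
have Ew i j : wt PQ (f i) (f j) = wt (fcons P Q) i j by rewrite (wt_relabel PQ fi) EP.
have Eb (x : 'I_M.+1) : (snd_map x == b) = (x == ord0) by rewrite /snd_map (inj_eq lift_inj).
split.
- rewrite /in_factor /in_loc; congr (_ * _).
    rewrite /relabel big_imset_cond /=; last by move=> ? ? _ _; apply: relabel_pair_inj; exact: snd_map_inj.
    under eq_bigl do rewrite Eb; apply: eq_bigr => -[i j] /= /andP[ij /eqP j0].
    rewrite -f0 -[in LHS]j0 -Ew Ef //; apply: contraNneq t0 => i0.
    by rewrite -{1}i0 -j0.
  rewrite hds_relabel -snd_map_image -(imset_setD _ _ (@snd_map_inj M)) -imset_comp.
  rewrite (eq_imset _ (g := f)); last by move=> x /=; rewrite Es.
  by rewrite setTD (GJ_relabel _ Wn_perm) // EP.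
- rewrite /out_factor /out_loc /relabel big_imset_cond /=; last first.
    by move=> ? ? _ _; apply: relabel_pair_inj; exact: snd_map_inj.
  under eq_bigl do rewrite Eb; apply: eq_bigr => -[i j] /= /andP[ij j0].
  by rewrite Es Ef // Ew.
Qed.

End LocalFactors.

Section GcPole.
Context (M D : nat) (Q : 'I_M -> X) (gQ : forall i, good (Q i)) (iQ : injective Q).
Context (c : chart g p) (z : C) (xch : x_chart c) (dz : dom c z) (Qz : forall i, Q i <> c z).
Context (HD : forall k, (k < M.+1)%N -> affine k D).
Local Notation a := (@ord0 M.+1).
Local Notation b := (lift (@ord0 M.+1) (@ord0 M)).
Local Notation I2 := [set: 'I_M.+2]%SET.
Local Notation PQ w := (fcons (c w) (fcons (c z) Q)).
Local Notation om w := (4^-1 * edge_fun (c w) (c z)).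

Let gQ2 i : good (fcons (c z) Q i).
Proof.
case: (unliftP ord0 i) => [j ->|->]; rewrite ?fconsS ?fcons0 //.
exact: (x_chart_good p_simple p_neq0 xch dz).
Qed.

Let iQ2 : injective (fcons (c z) Q). Proof. exact: fcons_pt_inj. Qed.

Lemma near_PQ_inj : \forall w \near z^', (forall i, fcons (c z) Q i <> c w) /\ injective (PQ w).
Proof.
have [d d0 Hd] := (nbhs_nrmP _ _).1 (filterI (dom_nbhs dz) (near_not_in gQ iQ dz Qz)).
apply: ((dnbhs_nrmP _ _).2 _); exists d => // w wz wd; have [dw Qw] := Hd w wd.
suff H i : fcons (c z) Q i <> c w by split=> //; exact: fcons_pt_inj.
case: (unliftP ord0 i) => [j ->|->]; rewrite ?fconsS ?fcons0 // => E.
by move: wz; rewrite (param_inj dz dw E) eqxx.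
Qed.

(** Every weight involves at most one of the two approaching points. The smaller correlator may
    involve both, but by induction it is polynomial in x and y of the moving point, hence bounded as
    the points meet. *)
Lemma Bdd_edge_free (G : {set 'I_M.+2 * 'I_M.+2}) :
  [&& pinj G, G != set0, (a, b) \notin G & (b, a) \notin G]%SET ->
  Bdd z^' (fun w => weight al (wt (PQ w)) G * GJ (PQ w) (~: hds G)%SET).
Proof.
move=> /and4P[_ G0 Gab Gba]; apply: BddM.
  rewrite /weight; apply: BddM; first exact: Bdd_cst.
  have Bwt i j : (i, j) != (a, b) -> (i, j) != (b, a) -> Bdd z^' (fun w => wt (PQ w) i j).
    move=> ijab ijba.
    have fst_case i' j' : Bdd z^' (fun w => wt (PQ w) (fst_map i') (fst_map j')).
      have E w : wt (PQ w) (fst_map i') (fst_map j') = wt (fcons (c w) Q) i' j'.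
        by rewrite (wt_relabel _ (@fst_map_inj M)) PQ_fst.
      by under eq_fun do rewrite E; exact: Bdd_dnbhs (T2_Bdd (T2_wt gQ xch dz Qz _ _)).
    have fst0 : a = fst_map ord0 by rewrite /fst_map fcons0.
    have fstS k : lift ord0 (lift ord0 k) = fst_map (lift ord0 k) by rewrite /fst_map fconsS.
    case: (unliftP ord0 i) ijab ijba => [i' ->|->]; case: (unliftP ord0 j) => [j' ->|->].
    - by move=> _ _; rewrite /wt; under eq_fun do rewrite !fconsS; exact: Bdd_cst.
    - case: (unliftP ord0 i') => [i'' ->|->]; rewrite ?eqxx // => _ _.
      by rewrite fstS fst0; exact: fst_case.
    - case: (unliftP ord0 j') => [j'' ->|->]; rewrite ?eqxx // => _ _.
      by rewrite fstS fst0; exact: fst_case.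
    - by move=> _ _; rewrite fst0; exact: fst_case.
  have -> : (fun w => \prod_(e in G) wt (PQ w) e.1 e.2) =
     (fun w => \prod_(e in G) (if (e == (a, b)) || (e == (b, a)) then 0 else wt (PQ w) e.1 e.2)).
    apply/funext => w; apply: eq_bigr => e eG; case: ifP => // /orP[/eqP E|/eqP E].
      by rewrite E in eG; rewrite eG in Gab.
    by rewrite E in eG; rewrite eG in Gba.
  apply: Bdd_prod => -[i j] _.
  case: (boolP (((i, j) == (a, b)) || ((i, j) == (b, a)))) => h; first exact: Bdd_cst.
  by move: h; rewrite negb_or => /andP[h1 h2]; exact: Bwt.
have [k|u [v [_ _ E]]] := @GJ_affine _ (fcons (c z) Q) (~: hds G)%SET D _ gQ2 iQ2.
  by move=> h; apply: HD; apply: card_hdsC_lt h.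
have T2p (q : {poly C}) := T2_poly q z.
have Ty := x_chart_T2 p_simple p_neq0 xch dz.
have Buv : Bdd z^' (fun w => u.[w] + yc (c w) * v.[w]).
  exact: Bdd_dnbhs (T2_Bdd (T2D (T2p u) (T2M Ty (T2p v)))).
apply: (@Bdd_near _ _ _ _ (fun w => u.[w] + yc (c w) * v.[w])) => //.
apply: filterS2 near_PQ_inj (nbhs_dnbhs (dom_nbhs dz)) => w [Qw _] dw.
by rewrite E ?(xch dw).2 //; exact: (x_chart_good p_simple p_neq0 xch dw).
Qed.

(** Both differences are O(w - z), and together they absorb the double pole of the edge weight. *)
Lemma Bdd_cross (t : {set 'I_M.+2 * 'I_M.+2}) : partial_inj (I2 :\ a)%SET t -> (b, b) \notin t ->
  Bdd z^' (fun w => om w * (al ^+ cyc t *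
      ((in_factor (wt (PQ w)) (GJ (PQ w)) I2 a b t a - in_factor (wt (PQ w)) (GJ (PQ w)) I2 a b t b) *
       (out_factor (wt (PQ w)) b t a - out_factor (wt (PQ w)) b t b)))).
Proof.
rewrite -snd_map_image => pt; rewrite -(relabel_preim (@snd_map_inj M) pt).
move: [set e | _]%SET => t'; rewrite mem_relabel //; last exact: snd_map_inj.
move=> t0.
have Tin : T2 (fun w => in_loc Q t' (c w)) z.
  apply: T2M; first by apply: T2_prod => e _; exact: T2_wt.
  apply: (@T2_GJ _ _ gQ iQ _ _ xch dz Qz _ D) => k kt; apply: HD; apply: leq_trans kt _.
  by rewrite -[X in (_ <= X)%N]card_ord max_card.
have Tout : T2 (fun w => out_loc Q t' (c w)) z.
  by apply: T2_prod => e _; exact: T2_wt.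
have [ri Bri Hri] := T2_lip Tin; have [ro Bro Hro] := T2_lip Tout.
apply: (@Bdd_near _ _ _ _ (fun w => 4^-1 * (yc (c w) + yc (c z)) ^+ 2 *
    (al ^+ cyc (relabel (@snd_map M) t') * (ri w * ro w)))); last first.
  by have := Bdd_dnbhs Bri; have := Bdd_dnbhs Bro; have := Bdd_yc_chart xch dz => ? ? ?; bdd.
apply: filterS2 (filterI (near_pole xch dz) near_PQ_inj) (nbhs_dnbhs (filterI Hri Hro)).
move=> w [[dw h0 _ Ew _] [_ iP]] [Ei Eo].
have f0 : fst_map ord0 = a by rewrite /fst_map fcons0.
have fS i : fst_map (lift ord0 i) = @snd_map M (lift ord0 i) by rewrite /fst_map fconsS.
have [-> ->] := local_factors t0 iP (@fst_map_inj M) f0 fS (PQ_fst Q (c w) (c z)).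
have [-> ->] := local_factors t0 iP (@snd_map_inj M) (erefl b) (fun=> erefl) (PQ_snd Q (c w) (c z)).
rewrite Ei Eo Ew; move: (ri w) (ro w) (al ^+ _) (yc (c w)) (yc (c z)) (w - z) h0.
by move=> e f k y1 y2 h h0; field.
Qed.

Lemma Gc_pole : Bdd z^' (fun w => Gc (PQ w)).
Proof.
have [cs csP] := x_charts_of gQ.
have ad := admissible_Q iQ csP dz Qz.
have [r Br Hr] := npoint_virasoro_ope s (fun=> virT V) ad.
pose F w := Nst s (fcons (c w) Q).
have TF : T2 F z by exact: T2_Nst.
pose pi := \prod_i p.[xc (Q i)].
have Bpw : Bdd z^' (fun w => p.[w]) := Bdd_dnbhs (T2_Bdd (T2_poly p z)).
(* [Gc_split] regrouped so that each pole of the OPE stands next to the graph contribution that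
   cancels it. *)
apply: (@Bdd_near _ _ _ _ (fun w =>
  al * (pi * Nst s Q) * (p.[w] * p.[z] / (w - z) ^+ 4 - om w ^+ 2 + om w *
    (p^`().[w] ^+ 2 / (16 * p.[w]) + p^`().[z] ^+ 2 / (16 * p.[z])))
  + pi * ((F w + F z) / (w - z) ^+ 2 * (p.[w] * p.[z]) - om w * (p.[w] * F w + p.[z] * F z))
  + p.[w] * p.[z] * pi * r w
  + \sum_(t | partial_inj (I2 :\ a)%SET t && ((b, b) \notin t)) om w *
      (al ^+ cyc t * ((in_factor (wt (PQ w)) (GJ (PQ w)) I2 a b t a - in_factor (wt (PQ w)) (GJ (PQ w)) I2 a b t b) *
       (out_factor (wt (PQ w)) b t a - out_factor (wt (PQ w)) b t b)))
  - \sum_(G : {set 'I_M.+2 * 'I_M.+2} |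
             [&& pinj G, G != set0, (a, b) \notin G & (b, a) \notin G]%SET)
        weight al (wt (PQ w)) G * GJ (PQ w) (~: hds G)%SET)); last first.
  apply: BddB; last by apply: Bdd_sum => G hG; exact: Bdd_edge_free.
  apply: BddD; last by apply: Bdd_sum => t /andP[pt bt]; exact: Bdd_cross.
  have B4 := pole4 xch dz; have B2 := pole2 xch dz TF; bdd.
apply: filterS2 (filterI Hr near_PQ_inj) (nbhs_dnbhs (dom_nbhs dz)) => w [E [Qw iP]] dw.
rewrite (Gc_split iP) -mulr_sumr.
rewrite (_ : Wn (PQ w) = p.[w] * (p.[z] * pi) * (al / (w - z) ^+ 4 * Nst s Q + (F w + F z) / (w - z) ^+ 2 + r w)).
  rewrite !Wn_fcons /Wn /self_wt -/pi -/(F w) -/(F z) !(xch dw).2 !(xch dz).2.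
  move: (\sum_(t | _) _) (\sum_(G | _) _) (F w) (F z) (r w) (Nst s Q) (edge_fun _ _) => S1 S2 f1 f2 k nu e.
  move: (p.[w]) (p.[z]) (p^`().[w] ^+ 2 / _) (p^`().[z] ^+ 2 / _) (w - z) al => p1 p2 s1 s2 h l.
  move: (h ^+ 4)^-1 (h ^+ 2)^-1 => i4 i2; ring.
rewrite Wn_fcons big_ord_recl fcons0 (xch dw).2 (xch dz).2; congr (_ * _ * _).
  by congr (_ * _); apply: eq_bigr => i _; rewrite fconsS.
have csP2 i : [/\ x_chart (fcons c cs i), dom (fcons c cs i) (xc (fcons (c z) Q i)) &
    fcons c cs i (xc (fcons (c z) Q i)) = fcons (c z) Q i].
  by case: (unliftP ord0 i) => [j ->|->]; rewrite ?fconsS ?fcons0 // (xch dz).2.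
rewrite -(Nst_fcons p_deg p_simple s csP2 xch dw).
have -> : (fun i => xc (fcons (c z) Q i)) = fcons z (fun i => xc (Q i)).
  by rewrite fcons_map (xch dz).2.
have ET m : fcons (virT V) (fun _ : 'I_m => virT V) = fun=> virT V.
  by apply/funext => i; case: (unliftP ord0 i) => [j ->|->]; rewrite ?fconsS ?fcons0.
move: E; rewrite (Nst_Q p_deg p_simple s csP) !(Nst_fcons p_deg p_simple s csP) // !ET => ->.
by rewrite -/(F w) -/(F z); ring.
Qed.

End GcPole.

Lemma near_notin_seq (Z : seq C) z : \forall w \near z^', w \notin Z.
Proof.
have q0 : (\prod_(a <- Z) ('X - a%:P) : {poly C}) != 0 by rewrite monic_neq0 // monic_prod_XsubC.
by apply: filterS (poly_dnbhs_neq0 z q0) => w; rewrite -root_prod_XsubC.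
Qed.

(** Brings the [l]-th point next to the moving one, where [Gc_pole] expects it. *)
Lemma Gc_swap M (Q : 'I_M.+1 -> X) (l : 'I_M.+1) P : injective Q -> (forall i, Q i <> P) ->
  Gc (fcons P Q) = Gc (fcons P (fcons (Q l) (fun i => Q (tperm ord0 l (lift ord0 i))))).
Proof.
move=> iQ QP; pose t := tperm ord0 l; have ti : injective t by exact: perm_inj.
pose f := fcons ord0 (fun i => lift ord0 (t i)).
have fi : injective f.
  by apply/fcons_inj_seq; split=> [i /eqP|i j /lift_inj /ti //]; rewrite eq_sym (negPf (neq_lift _ _)).
have iP := fcons_pt_inj iQ QP.
have fT : (f @: setT = setT)%SET.
  by apply/eqP; rewrite eqEcard subsetT card_imset ?leqnn.
have -> : Gc (fcons P Q) = Gc (fun i => fcons P Q (f i)).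
  rewrite -(GJ_setT al Wn_perm iP); apply: (GJ_image al Wn_perm iP fi); exact: fT.
congr (Recursion.Gc _ _ _); rewrite /f fcons_map fcons0; congr (fcons _ _).
apply: fcons_eq => [|i]; rewrite fconsS // /t tpermL //.
Qed.

Lemma Gc_regular N D (Q : 'I_N -> X) z : (forall M, (M < N)%N -> affine M D) ->
  (forall i, good (Q i)) -> injective Q -> p.[z] != 0 -> Bdd (at_x z^') (fun P => Gc (fcons P Q)).
Proof.
move=> HD gQ iQ pz; apply: Bdd_two_charts => // c xch dz.
have [[l El]|Qz] := pselect (exists l, Q l = c z); last first.
  have Qz' i : Q i <> c z by move=> E; apply: Qz; exists i.
  exact: Bdd_dnbhs (T2_Bdd (T2_Gc gQ iQ xch dz Qz' HD)).
case: N Q HD gQ iQ l El => [Q _ _ _ []//|M] Q HD gQ iQ l El.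
pose Q' i := Q (tperm ord0 l (lift ord0 i)).
have gQ' i : good (Q' i) by exact: gQ.
have iQ' : injective Q' by move=> i j /iQ /perm_inj /lift_inj.
have Qz' i : Q' i <> c z.
  rewrite -El => /iQ /(congr1 (tperm ord0 l)); rewrite tpermK tpermR => /eqP.
  by rewrite eq_sym (negPf (neq_lift _ _)).
have BP := Gc_pole gQ' iQ' xch dz Qz' HD.
apply: Bdd_near BP.
apply: filterS (near_PQ_inj gQ' iQ' dz Qz') => w [Qw _].
rewrite (@Gc_swap _ Q l (c w) iQ) ?El // => i E.
case: (unliftP ord0 (tperm ord0 l i)) => [j Ej|Ej].
  by have := Qw (lift ord0 j); rewrite fconsS /Q' -Ej tpermK.
have il : i = l by rewrite -(tpermK ord0 l i) Ej tpermL.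
by have := Qw ord0; rewrite fcons0 -El -il.
Qed.

(** The traces of h and of y h are polynomials A and L. At a branch point h is bounded and y tends
    to 0, so L vanishes at the zeros of p; these are simple, hence p divides L, and h = A/2 + y
    (L/p)/2. *)
Lemma affine_step N : (forall M, (M < N)%N -> exists D, affine M D) -> exists D, affine N D.
Proof.
move=> H; have [D HD] := affine_uniform H.
pose DA := (n + ((N.+1 * N.+1) * (n + n) + (D + n)))%N.
exists (n + DA).+1 => Q gQ iQ.
have [sz Hsz] := poly_finite_zeros p_neq0.
pose Z := sz ++ [seq xc (Q i) | i <- enum 'I_N].
have pZ a : p.[a] = 0 -> a \in Z by move=> pa; rewrite mem_cat -Hsz pa eqxx.
have QZ i : xc (Q i) \in Z by rewrite mem_cat map_f ?orbT ?mem_enum.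
pose h P := Gc (fcons P Q).
have Th (c : chart g p) z : x_chart c -> dom c z -> (forall i, Q i <> c z) -> T2 (fun w => h (c w)) z.
  by move=> xch dz Qz; exact: (T2_Gc gQ iQ xch dz Qz HD).
have notQ (c : chart g p) z : x_chart c -> dom c z -> z \notin Z -> forall i, Q i <> c z.
  by move=> xch dz zZ i E; have := QZ i; rewrite E (xch z dz).2 (negPf zZ).
have Bh z : Bdd (at_x z^') h.
  case: (eqVneq p.[z] 0) => pz; first exact: (Gc_branch HD gQ iQ pz).
  exact: (Gc_regular HD gQ iQ pz).
have gh : growth DA h := growth_Gc HD gQ iQ.
have [A sA EA] := sheet_sum_poly p_neq0 pZ
  (fun c z xch dz zZ => Th c z xch dz (notQ c z xch dz zZ)) (fun z _ => Bh z) gh.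
have Byh z : z \in Z -> Bdd (at_x z^') (fun P => yc P * h P).
  move=> _; have Bid : Bdd z^' id by exact: Bdd_dnbhs (Bdd_id z).
  by apply: BddM => //; exact: (@Bdd_yc z^' (Cx_dnbhs_filter z) (@Bdd_horner _ _ z^' (Cx_dnbhs_filter z) p id Bid)).
have [L sL EL] := sheet_sum_poly p_neq0 pZ
  (fun c z xch dz zZ => T2M (x_chart_T2 p_simple p_neq0 xch dz) (Th c z xch dz (notQ c z xch dz zZ)))
  Byh (growthM growth_yc gh).
have L0 e : p.[e] = 0 -> L.[e] = 0.
  move=> pe; have cL : (fun w => L.[w]) @ e^' --> L.[e] by exact: cvg_dnbhs (T2_cvg (T2_poly L e)).
  apply: (cvg_dnbhs_unique cL (h := fun w => sheet_sum (fun P => yc P * h P) w)); last first.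
    by apply: filterS (near_notin_seq Z e) => w wZ; rewrite EL.
  have [K K0 HK] := @Bdd_pos _ _ _ (@at_x_filter R g p e^' (Cx_dnbhs_filter e)) _ (Bh e).
  apply: ((@cvg_nrmP _ _ e^' (Cx_dnbhs_filter e) _ _).2 _) => d d0.
  have d1 : 0 < d / (2 * K) by rewrite divr_gt0 // mulr_gt0.
  have n1 : \forall w \near e^', forall P : X, good P -> xc P = w -> nrm (h P) <= K := HK.
  have n2 : \forall w \near e^', forall P : X, good P -> xc P = w -> nrm (yc P) < d / (2 * K) :=
    yc_near_branch g pe d1.
  apply: (@filterS2 _ e^' _ _ _ _ _ (filterI n1 n2) (poly_dnbhs_neq0 e p_neq0)) => w [h1 h2] pw.
  have key y : y ^+ 2 = p.[w] -> nrm (yc (fin_pt g p w y) * h (fin_pt g p w y)) < d / 2.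
    move=> Ey; have gP : good (fin_pt g p w y) by split; rewrite ?is_finite_fin_pt ?xc_fin_pt.
    have {}h1 := h1 _ gP (xc_fin_pt g Ey); have {}h2 := h2 _ gP (xc_fin_pt g Ey).
    rewrite nrmM; apply: le_lt_trans (ler_wpM2l (nrm_ge0 _) h1) _.
    rewrite -ltr_pdivlMr //; apply: lt_le_trans h2 _.
    by rewrite invfM mulrA.
  have k1 := key _ (sqrtCK _); have := key (- sqrtC p.[w]); rewrite sqrrN sqrtCK => /(_ erefl) k2.
  by rewrite subr0; apply: le_lt_trans (nrmD _ _) _; lra.
have pL : L = (L %/ p) * p.
  apply/eqP; rewrite -dvdp_eq.
  (* A root of p/gcd(p, L) is a root of p, hence of L and of the gcd, and so a double root of p. The
     quotient is therefore a constant. *)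
  have Ep : p = (p %/ gcdp p L) * gcdp p L by rewrite divpK // dvdp_gcdl.
  have [c c0 Ec] : exists2 c, c != 0 & p %/ gcdp p L = c%:P.
    apply/size_poly1P; apply: contraT => /closed_rootP[x xe].
    have px : root p x by rewrite Ep rootM xe.
    have xg : root (gcdp p L) x by rewrite root_gcd px; apply/eqP/L0/eqP.
    have : (2 <= mup x p)%N.
      by rewrite mup_geq // Ep expr2 dvdp_mul // dvdp_XsubCl.
    by rewrite leqNgt ltnS p_simple.
  by rewrite Ep Ec mul_polyC dvdpZl // dvdp_gcdr.
exists (2^-1 *: A), (2^-1 *: (L %/ p)); split.
- by apply: leq_trans (size_scale_leq _ _) _; apply: leq_trans sA _; rewrite ltnS leq_addl.
- by apply: leq_trans (size_scale_leq _ _) _; apply: leq_trans (leq_divp _ _) _.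
have Eh P : good P -> xc P \notin Z -> h P = (2^-1 *: A).[xc P] + yc P * (2^-1 *: (L %/ p)).[xc P].
  move=> gP PZ; have [fP pP] := gP; have y0 := good_yc gP.
  have Ey : (- yc P) ^+ 2 = p.[xc P] by rewrite sqrrN curve_eq.
  pose P' := fin_pt g p (xc P) (- yc P).
  have fP' : is_finite P' by rewrite is_finite_fin_pt.
  have xP' : xc P' = xc P by rewrite xc_fin_pt.
  have yP' : yc P' = - yc P by rewrite yc_fin_pt.
  have := EA _ PZ; rewrite (sheet_sumE _ fP fP' xP' yP') => E1.
  have E2 := EL _ PZ; rewrite (sheet_sumE _ fP fP' xP' yP') yP' pL hornerM -curve_eq // in E2.
  rewrite !hornerZ -E1.
  have -> : (L %/ p).[xc P] = (yc P * h P + - yc P * h P') / yc P ^+ 2.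
    by rewrite E2 mulfK // expf_neq0.
  by move: (h P) (h P') (yc P) y0 => u v y y0; field.
(* Over the finite set [Z] the identity is reached by continuity along a chart. *)
move=> P gP QP; case: (boolP (xc P \in Z)) => PZ; last exact: Eh.
have [c [xch dz EP _]] := x_chart_exists gP; set z := xc P in dz EP *.
rewrite -EP in QP *.
have T1 := Th c z xch dz QP.
have T2' : T2 (fun w => (2^-1 *: A).[w] + yc (c w) * (2^-1 *: (L %/ p)).[w]) z.
  by apply: T2D; [|apply: T2M; first exact: x_chart_T2]; exact: T2_poly.
apply: (cvg_dnbhs_unique (cvg_dnbhs (T2_cvg T1)) (cvg_dnbhs (T2_cvg T2'))).
apply: filterS2 (nbhs_dnbhs (dom_nbhs dz)) (near_notin_seq Z z) => w dw wZ.
have [fw xw] := xch w dw.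
by rewrite Eh ?xw //; exact: (x_chart_good p_simple p_neq0).
Qed.

Lemma affine_all N : exists D, affine N D.
Proof.
have [k] := ubnP N; elim: k N => // k IH N Nk; apply: affine_step => M MN.
by apply: IH; exact: leq_trans MN _.
Qed.

End Affine.
End Affine.

(** * Joint polynomiality *)

Lemma poly_eq_off_finite (R : realType) (Z : seq (Cx R)) (a b : {poly Cx R}) :
  (forall x, x \notin Z -> a.[x] = b.[x]) -> a = b.
Proof.
move=> H; apply/eqP; rewrite -subr_eq0; apply: contraT => ab0.
have [s [us ss sZ]] := fresh_points Z (size (a - b)).
have := max_poly_roots ab0 _ us; rewrite ss ltnn; apply.
apply/allP => x xs; rewrite /root hornerD hornerN H ?subrr //.
by have := sZ x xs.
Qed.

Section Joint.
Context (R : realType) (g : nat) (p : {poly Cx R}) (p_neq0 : p != 0).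
Local Notation C := (Cx R).
Local Notation X := (hpoint g p).
Local Notation good := (@good R g p).
Local Notation pp := ({poly C} * {poly C})%type.

Definition ev (ab : pp) (P : X) : C := ab.1.[xc P] + yc P * ab.2.[xc P].

Definition pp_size D (ab : pp) := ((size ab.1 <= D)%N && (size ab.2 <= D)%N).

Lemma ev_unique (Z : seq C) (u v : pp) :
  (forall P, good P -> xc P \notin Z -> ev u P = ev v P) -> u = v.
Proof.
move=> H; have [sz Hsz] := poly_finite_zeros p_neq0.
have key x : x \notin sz ++ Z -> u.1.[x] = v.1.[x] /\ u.2.[x] = v.2.[x].
  rewrite mem_cat negb_or -Hsz => /andP[px xZ].
  have E : sqrtC p.[x] ^+ 2 = p.[x] := sqrtCK _.
  have E' : (- sqrtC p.[x]) ^+ 2 = p.[x] by rewrite sqrrN.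
  have gP y : y ^+ 2 = p.[x] -> good (fin_pt g p x y).
    by move=> Ey; split; rewrite ?is_finite_fin_pt ?xc_fin_pt.
  have := H _ (gP _ E); have := H _ (gP _ E').
  rewrite /ev !xc_fin_pt // !yc_fin_pt // => /(_ xZ) E1 /(_ xZ) E2.
  have y0 : sqrtC p.[x] != 0 by rewrite sqrtC_eq0.
  move: (sqrtC _) y0 E1 E2 => y y0 E1 E2.
  have h1 : 2 * (u.1.[x] - v.1.[x]) = 0.
    rewrite (_ : 2 * _ = (u.1.[x] + y * u.2.[x]) + (u.1.[x] + - y * u.2.[x]) - 2 * v.1.[x]); last by ring.
    by rewrite E1 E2; ring.
  have h2 : 2 * y * (u.2.[x] - v.2.[x]) = 0.
    rewrite (_ : 2 * y * _ = (u.1.[x] + y * u.2.[x]) - (u.1.[x] + - y * u.2.[x]) - 2 * y * v.2.[x]); last by ring.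
    by rewrite E1 E2; ring.
  split; apply/eqP; rewrite -subr_eq0; [move/eqP: h1|move/eqP: h2].
    by rewrite mulf_eq0 (negPf (two_neq0 R)).
  by rewrite !mulf_eq0 (negPf (two_neq0 R)) (negPf y0).
case: u v H key => [a b] [a' b'] _ /= key; congr (_, _).
  by apply: (@poly_eq_off_finite _ (sz ++ Z)) => x /key[].
by apply: (@poly_eq_off_finite _ (sz ++ Z)) => x /key[].
Qed.

(** Lagrange interpolation on both sheets over [D] abscissae: the values at (x_j, y_j) and (x_j,
    -y_j) determine a(x_j) and b(x_j), whence the weights 1/2 and 1/(2 y_j) in [ka]. *)
Lemma nodes (Z : seq C) D : exists (N : 'I_D * bool -> X) (ka : 'I_D * bool -> pp),
  [/\ forall l, good (N l) /\ xc (N l) \notin Z, injective N &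
    forall ab, pp_size D ab -> forall P, ev ab P = \sum_l ev (ka l) P * ev ab (N l)].
Proof.
have [sz Hsz] := poly_finite_zeros p_neq0.
have [s [us ss sZ]] := fresh_points (sz ++ Z) D.
have sj (j : 'I_D) : s`_j \in s by rewrite mem_nth ?ss.
have H1 (j : 'I_D) : s`_j \notin sz /\ s`_j \notin Z.
  by have := sZ _ (sj j); rewrite mem_cat negb_or => /andP[].
have ps (j : 'I_D) : p.[s`_j] != 0 by rewrite Hsz; case: (H1 j).
have /choice[ell Hell] (j : 'I_D) : exists q : {poly C}, (size q <= D)%N /\ forall i : 'I_D, q.[s`_i] = (i == j)%:R.
  have [L sL HL] := interpolation (fun x => (x == s`_j)%:R) us.
  exists L; rewrite -{1}ss; split=> // i; by rewrite HL // nth_uniq ?ss.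
pose y (j : 'I_D) := sqrtC p.[s`_j].
have y0 j : y j != 0 by rewrite sqrtC_eq0.
pose sg (b : bool) : C := if b then 1 else -1.
have Ey j b : (sg b * y j) ^+ 2 = p.[s`_j] by rewrite /sg; case: b; rewrite ?mul1r ?mulN1r ?sqrrN sqrtCK.
pose N (l : 'I_D * bool) : X := fin_pt g p s`_(l.1) (sg l.2 * y l.1).
pose ka (l : 'I_D * bool) : pp := (2^-1 *: ell l.1, (sg l.2 / (2 * y l.1)) *: ell l.1).
have xN l : xc (N l) = s`_(l.1) by rewrite xc_fin_pt.
have yN l : yc (N l) = sg l.2 * y l.1 by rewrite yc_fin_pt.
exists N, ka; split.
- by move=> l; split; [split; rewrite ?is_finite_fin_pt ?xN|rewrite xN; case: (H1 l.1)].
- move=> [i b] [j b'] E; have := congr1 (@xc _ _ _) E; have := congr1 (@yc _ _ _) E.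
  rewrite !xN !yN /= => E2 /eqP; rewrite nth_uniq ?ss // => /eqP /val_inj ij; subst j.
  congr (_, _); move: E2 => /(mulIf (y0 i)); rewrite /sg; case: b b' {E} => [] [] // /eqP.
    by rewrite -subr_eq0 opprK (negPf (two_neq0 R)).
  by rewrite eq_sym -subr_eq0 opprK (negPf (two_neq0 R)).
- have lag (q : {poly C}) : (size q <= D)%N -> q = \sum_(j < D) q.[s`_j] *: ell j.
    move=> sq; apply/eqP; rewrite -subr_eq0; apply: contraT => d0.
    have := max_poly_roots d0 _ us; rewrite ss ltnNge => /(_ _)/negP; case.
      apply/(all_nthP 0) => e; rewrite ss => eD; pose o : 'I_D := Ordinal eD.
      rewrite -[e]/(nat_of_ord o) /root hornerD hornerN horner_sum (bigD1 o) // hornerZ.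
      rewrite (Hell o).2 eqxx mulr1 big1 => [|j jo]; first by rewrite /= addr0 subrr.
      by rewrite hornerZ (Hell j).2 eq_sym (negPf jo) mulr0.
    rewrite (leq_trans (size_polyD _ _)) // geq_max sq size_polyN.
    apply: (leq_trans (size_sum _ _ _)); apply/bigmax_leqP => j _.
    by apply: leq_trans (size_scale_leq _ _) _; case: (Hell j).
  move=> [a b] /andP[/= sa sb] P.
  rewrite -(pair_bigA _ (fun i e => ev (ka (i, e)) P * ev (a, b) (N (i, e)))) /=.
  rewrite /ev /= {1}(lag a sa) {1}(lag b sb) !horner_sum mulr_sumr -big_split /=.
  apply: eq_bigr => j _; rewrite big_bool /= !xN !yN !hornerZ /sg /=.
  move: (ell j).[xc P] (y j) (y0 j) (yc P) (a.[_]) (b.[_]) => e t t0 v a1 b1.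
  by field.
Qed.

Definition upd (T : Type) k (P : 'I_k -> T) (i : 'I_k) (x : T) : 'I_k -> T :=
  fun j => if j == i then x else P j.

Lemma upd_fcons0 (T : Type) k (Q : 'I_k -> T) x x' : upd (fcons x Q) ord0 x' = fcons x' Q.
Proof.
apply: fcons_eq => [|i]; first by rewrite /upd eqxx.
by rewrite /upd eq_sym (negPf (neq_lift _ _)) fconsS.
Qed.

Lemma upd_fconsS (T : Type) k (Q : 'I_k -> T) x i x' :
  upd (fcons x Q) (lift ord0 i) x' = fcons x (upd Q i x').
Proof.
apply: fcons_eq => [|j]; first by rewrite /upd (negPf (neq_lift _ _)) fcons0.
by rewrite /upd (inj_eq lift_inj) fconsS.
Qed.

Lemma upd_inj (T : Type) k (P : 'I_k -> T) i x : injective P -> (forall j, j != i -> P j <> x) ->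
  injective (upd P i x).
Proof.
move=> iP Px j j'; rewrite /upd; case: eqP => [->|/eqP ji]; case: eqP => [->|/eqP ji'] //.
- by move=> E; case: (Px j' ji').
- by move=> E; case: (Px j ji).
- exact: iP.
Qed.

Definition sep_affine D k (H : ('I_k -> X) -> C) :=
  forall i P, (forall j, good (P j)) -> injective P ->
  exists2 ab, pp_size D ab &
    forall Q, good Q -> (forall j, j != i -> P j <> Q) -> H (upd P i Q) = ev ab Q.

Definition joint k (H : ('I_k -> X) -> C) :=
  exists s : seq (C * ('I_k -> pp)), forall P, (forall j, good (P j)) -> injective P ->
    H P = \sum_(u <- s) u.1 * \prod_i ev (u.2 i) (P i).

Lemma fresh_good (Z : seq C) : exists P : X, good P /\ xc P \notin Z.
Proof.
have [N [_ [H _ _]]] := nodes Z 1; exists (N (ord0, true)); exact: H.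
Qed.

Lemma joint_sum (I : finType) k (H : I -> ('I_k -> X) -> C) : (forall l, joint (H l)) ->
  joint (fun P => \sum_l H l P).
Proof.
move=> /choice[s Hs]; exists (flatten [seq s l | l <- index_enum I]) => P gP iP.
by rewrite big_flatten /= big_map; apply: eq_bigr => l _; rewrite Hs.
Qed.

Lemma joint_fcons k (H : ('I_k -> X) -> C) ka : joint H ->
  joint (fun P : 'I_k.+1 -> X => ev ka (P ord0) * H (fun i => P (lift ord0 i))).
Proof.
case=> s Hs; exists [seq (u.1, fcons ka u.2) | u <- s] => P gP iP.
rewrite Hs //; last by move=> i j /iP /lift_inj.
rewrite big_map mulr_sumr; apply: eq_bigr => u _ /=.
rewrite big_ord_recl fcons0 mulrCA; congr (_ * (_ * _)).
by apply: eq_bigr => i _; rewrite fconsS.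
Qed.

Lemma joint_ext k (H H' : ('I_k -> X) -> C) :
  (forall P, (forall j, good (P j)) -> injective P -> H P = H' P) -> joint H -> joint H'.
Proof. by move=> E [s Hs]; exists s => P gP iP; rewrite -E // Hs. Qed.

Lemma fcons_good k (Q : 'I_k -> X) P : good P -> (forall i, good (Q i)) -> forall i, good (fcons P Q i).
Proof.
by move=> gP gQ i; case: (unliftP ord0 i) => [j ->|->]; rewrite ?fconsS ?fcons0.
Qed.

(** Interpolation in the first point expresses [H] through its values at fixed nodes. A node may
    coincide with one of the other points, where [H] is not controlled, so the polynomial
    continuation [Vn] replaces it. The work is to see that [Vn] is again affine in each remaining
    point. *)
Lemma joint_of_sep_affine D k (H : ('I_k -> X) -> C) : sep_affine D H -> joint H.
Proof.
elim: k H => [|k IH] H sH.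
  pose P0 : 'I_0 -> X := fun=> base_pt g p.
  exists [:: (H P0, fun=> (0, 0))] => P _ _; rewrite big_seq1 big_ord0 mulr1.
  by congr H; apply/funext => -[].
(* The pair (0, 0) is a dummy for those [Q] that are not tuples of distinct good points. *)
have /choice[ab Hab] (Q : 'I_k -> X) : exists ab, (forall i, good (Q i)) -> injective Q ->
    pp_size D ab /\ forall R0, good R0 -> (forall i, Q i <> R0) -> H (fcons R0 Q) = ev ab R0.
  case: (pselect ((forall i, good (Q i)) /\ injective Q)) => [[gQ iQ]|N]; last first.
    by exists (0, 0) => gQ iQ; case: N.
  have [P0 [gP0 P0Q]] := fresh_good [seq xc (Q i) | i <- enum 'I_k].
  have QP0 i : Q i <> P0 by move=> E; move: P0Q; rewrite -E map_f // mem_enum.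
  have iP0 : injective (fcons P0 Q) by apply/fcons_inj_seq.
  have [u su Eu] := sH ord0 (fcons P0 Q) (fcons_good gP0 gQ) iP0.
  exists u => _ _; split=> // R0 gR QR; rewrite -Eu ?upd_fcons0 // => j.
  by case: (unliftP ord0 j) => [j' ->|->]; rewrite ?eqxx // fconsS.
have [N [ka [HN iN Eka]]] := nodes [::] D.
pose Vn n Q := ev (ab Q) n.
suff sV n : good n -> joint (Vn n).
  have J := joint_sum (fun l => joint_fcons (ka l) (sV (N l) (HN l).1)).
  apply: joint_ext J => P gP iP.
  have gQ i : good (P (lift ord0 i)) by exact: gP.
  have iQ : injective (fun i => P (lift ord0 i)) by move=> i j /iP /lift_inj.
  have [sab E] := Hab _ gQ iQ.
  rewrite -Eka // -E //; last by move=> i /iP /eqP; rewrite eq_sym (negPf (neq_lift _ _)).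
  by congr H; apply/esym/fcons_eq.
move=> gn; apply: IH => j Q gQ iQ.
(* A value at [n] is interpolated from nodes away from [Q] and [n]; two disjoint
   sets of nodes together cover all positions of the [j]-th point. *)
have step (Z : seq C) : exists (u : pp) (Z' : seq C), [/\ pp_size D u, forall x, x \in Z' -> x \notin Z &
    forall Q1, good Q1 -> (forall i, i != j -> Q i <> Q1) -> xc Q1 \notin Z' ->
      Vn n (upd Q j Q1) = ev u Q1].
  have [N1 [k1 [HN1 iN1 Ek1]]] := nodes (Z ++ [seq xc (Q i) | i <- enum 'I_k]) D.
  have QN i l : Q i <> N1 l.
    move=> E; have [_] := HN1 l; rewrite mem_cat negb_or => /andP[_].
    by rewrite -E map_f // mem_enum.
  have /choice[v Hv] l : exists v, pp_size D v /\ forall Q1, good Q1 ->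
      (forall i, i != j -> Q i <> Q1) -> N1 l <> Q1 -> H (fcons (N1 l) (upd Q j Q1)) = ev v Q1.
    have iP : injective (fcons (N1 l) Q) by apply/fcons_inj_seq.
    have [v sv Ev] := sH (lift ord0 j) (fcons (N1 l) Q) (fcons_good (HN1 l).1 gQ) iP.
    exists v; split=> // Q1 gQ1 QQ1 NQ1; rewrite -Ev ?upd_fconsS // => i.
    case: (unliftP ord0 i) => [i' ->|->]; rewrite ?fconsS ?fcons0 // (inj_eq lift_inj); exact: QQ1.
  exists (\sum_l ev (k1 l) n *: (v l).1, \sum_l ev (k1 l) n *: (v l).2), [seq xc (N1 l) | l <- enum {: 'I_D * bool}].
  split=> [|x /mapP[l _ ->]|Q1 gQ1 QQ1 Q1Z].
  - have sz (w : 'I_D * bool -> {poly C}) : (forall l, size (w l) <= D)%N ->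
        (size (\sum_l ev (k1 l) n *: w l)%R <= D)%N.
      move=> sw; apply: (leq_trans (size_sum _ _ _)); apply/bigmax_leqP => l _.
      exact: leq_trans (size_scale_leq _ _) (sw l).
    by apply/andP; split; apply: sz => l; have [/andP[]] := Hv l.
  - by have [_] := HN1 l; rewrite mem_cat negb_or => /andP[].
  - have gU i : good (upd Q j Q1 i) by rewrite /upd; case: ifP.
    have iU := upd_inj iQ QQ1.
    have [sab E] := Hab _ gU iU.
    have NQ1 l : N1 l <> Q1 by move=> EN; move: Q1Z; rewrite -EN map_f // mem_enum.
    rewrite /Vn (Ek1 _ sab) /ev /= !horner_sum mulr_sumr -big_split /=.
    apply: eq_bigr => l _; rewrite -[X in _ * X]/(ev (ab (upd Q j Q1)) (N1 l)) -E.
    + rewrite (Hv l).2 // !hornerZ /ev.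
      by move: (_ + _) (v l).1.[_] (v l).2.[_] (yc Q1) => e a b y; ring.
    + exact: (HN1 l).1.
    + by move=> i; rewrite /upd; case: ifP => _ //; exact: nesym.
have [u [Z1 [su _ Eu]]] := step [::]; have [u' [Z2 [su' Z21 Eu']]] := step Z1.
have uu : u = u'.
  apply: (@ev_unique (Z1 ++ Z2 ++ [seq xc (Q i) | i <- enum 'I_k])) => P gP.
  rewrite !mem_cat !negb_or => /and3P[P1 P2 PQ].
  have QP i : i != j -> Q i <> P by move=> _ E; move: PQ; rewrite -E map_f // mem_enum.
  by rewrite -Eu // Eu'.
exists u => // Q1 gQ1 QQ1; case: (boolP (xc Q1 \in Z2)) => h; last by rewrite uu Eu'.
by rewrite Eu //; exact: Z21.
Qed.

End Joint.

(** * From products of one-point functions to polynomials in 2k variables *)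

Section Mpoly.
Context (R : realType) (m : nat).
Local Notation C := (Cx R).

Definition mpoly_fun (F : ('I_m -> C) -> C) :=
  exists Q : mpoly.mpoly m C, forall v, F v = mpoly.meval v Q.

Lemma mpoly_fun_cst c : mpoly_fun (fun=> c).
Proof. by exists (@mpoly.mpolyC m C c) => v; rewrite mpoly.mevalC. Qed.

Lemma mpoly_fun_var i : mpoly_fun (fun v => v i).
Proof. by exists (mpoly.mpolyX C (mpoly.mnm1 i)) => v; rewrite mpoly.mevalXU. Qed.

Lemma mpoly_funD F G : mpoly_fun F -> mpoly_fun G -> mpoly_fun (fun v => F v + G v).
Proof. by move=> [P HP] [Q HQ]; eexists => v; rewrite HP HQ; apply/esym/mpoly.mevalD. Qed.

Lemma mpoly_funM F G : mpoly_fun F -> mpoly_fun G -> mpoly_fun (fun v => F v * G v).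
Proof. by move=> [P HP] [Q HQ]; eexists => v; rewrite HP HQ; apply/esym/mpoly.mevalM. Qed.

Lemma mpoly_fun_sum (I : Type) (r : seq I) (F : I -> ('I_m -> C) -> C) :
  (forall i, mpoly_fun (F i)) -> mpoly_fun (fun v => \sum_(i <- r) F i v).
Proof.
move=> HF; elim: r => [|i r IH]; first by under eq_fun do rewrite big_nil; exact: mpoly_fun_cst.
by under eq_fun do rewrite big_cons; exact: mpoly_funD.
Qed.

Lemma mpoly_fun_prod (I : Type) (r : seq I) (F : I -> ('I_m -> C) -> C) :
  (forall i, mpoly_fun (F i)) -> mpoly_fun (fun v => \prod_(i <- r) F i v).
Proof.
move=> HF; elim: r => [|i r IH]; first by under eq_fun do rewrite big_nil; exact: mpoly_fun_cst.
by under eq_fun do rewrite big_cons; exact: mpoly_funM.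
Qed.

Lemma mpoly_fun_horner (q : {poly C}) i : mpoly_fun (fun v => q.[v i]).
Proof.
elim/poly_ind: q => [|q c IH]; first by under eq_fun do rewrite horner0; exact: mpoly_fun_cst.
under eq_fun do rewrite hornerMXaddC; apply: mpoly_funD; last exact: mpoly_fun_cst.
by apply: mpoly_funM => //; exact: mpoly_fun_var.
Qed.

End Mpoly.

Lemma joint_mpoly (R : realType) (g : nat) (p : {poly Cx R}) k (H : ('I_k -> hpoint g p) -> Cx R) :
  joint H -> exists Q : mpoly.mpoly (k + k) (Cx R),
    forall P, (forall j, good (P j)) -> injective P ->
    H P = mpoly.meval (fun j : 'I_(k + k) => match fintype.split j with
                        | inl i => xc (P i) | inr i => yc (P i) end) Q.
Proof.
case=> s Hs; have [Q HQ] : mpoly_fun (fun v : 'I_(k + k) -> Cx R =>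
    \sum_(u <- s) u.1 * \prod_i ((u.2 i).1.[v (lshift k i)] + v (rshift k i) * (u.2 i).2.[v (lshift k i)])).
  apply: mpoly_fun_sum => u; apply: mpoly_funM; first exact: mpoly_fun_cst.
  apply: mpoly_fun_prod => i; apply: mpoly_funD; first exact: mpoly_fun_horner.
  by apply: mpoly_funM; [exact: mpoly_fun_var|exact: mpoly_fun_horner].
exists Q => P gP iP; rewrite Hs // -HQ; apply: eq_bigr => u _; congr (_ * _).
apply: eq_bigr => i _; rewrite /ev.
by rewrite (unsplitK (inl i)) (unsplitK (inr i)).
Qed.

(** * The renormalised correlators *)

Section Functional.
Context (K : fieldType) (E : lmodType K).

Definition functional (f : E -> K) := forall a u v, f (a *: u + v) = a * f u + f v.

Lemma functional0 f : functional f -> f 0 = 0.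
Proof.
move=> hf; have := hf 1 0 0; rewrite scale1r addr0 mul1r => /eqP.
by rewrite -[X in X == _]addr0 (inj_eq (addrI _)) => /eqP.
Qed.

Lemma functional_comb f h a : functional f -> functional h -> functional (fun u => f u + a * h u).
Proof. by move=> hf hh b u v; rewrite hf hh; ring. Qed.

(* The kernel is a subspace maximal among those that do not contain [e]. *)
Lemma functional_exists (e : E) : e != 0 -> exists2 f, functional f & f e = 1.
Proof.
move=> e0.
pose sub (W : set E) := (forall a u v, W u -> W v -> W (a *: u + v)) /\ ~ W e.
have [F FS Fch|W [[Wc We] Wmax]] := @Zorn_bigcup E sub.
  split=> [a u v [A FA Au] [B FB Bv]|[A FA Ae]]; last by case: (FS A FA).
  have [AB|BA] := Fch A B FA FB.
    by exists B => //; apply: (FS B FB).1 => //; exact: AB.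
  by exists A => //; apply: (FS A FA).1 => //; exact: BA.
have W0 : W 0.
  have [[u Wu]|N] := pselect (exists u, W u).
    by have := Wc (-1) u u Wu Wu; rewrite scaleN1r addNr.
  exfalso; apply: (Wmax [set 0]).
    by split=> [x Wx|h]; [case: N; exists x|apply: N; exists 0; exact: h].
  by split=> [a u v -> ->|/esym/eqP]; rewrite ?scaler0 ?addr0 // eq_sym (negPf e0).
have WZ a u : W u -> W (a *: u) by move=> Wu; rewrite -[a *: u]addr0; exact: Wc.
have WD u v : W u -> W v -> W (u + v) by move=> Wu Wv; rewrite -[u]scale1r; exact: Wc.
have cov u : exists c, W (u - c *: e).
  have [Wu|Wu] := pselect (W u); first by exists 0; rewrite scale0r subr0.
  apply: contrapT => N; apply: (Wmax [set v | exists c w, W w /\ v = c *: u + w]).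
    split=> [v Wv|h]; first by exists 0, v; rewrite scale0r add0r.
    by apply: Wu; apply: h; exists 1, 0; rewrite scale1r addr0.
  split=> [a v v' [c [w [Ww ->]]] [c' [w' [Ww' ->]]]|[c [w [Ww Ee]]]].
    exists (a * c + c'), (a *: w + w'); split; first exact: Wc.
    by rewrite scalerDr scalerA scalerDl addrACA.
  have [c0|c0] := eqVneq c 0; first by apply: We; rewrite Ee c0 scale0r add0r.
  apply: N; exists c^-1; rewrite Ee scalerDr scalerA mulVf // scale1r opprD addrA subrr sub0r.
  by rewrite -scalerN -scaleN1r scalerA; exact: WZ.
have [f Hf] := choice cov.
have uniq u c c' : W (u - c *: e) -> W (u - c' *: e) -> c = c'.
  move=> h h'; apply/eqP; rewrite -subr_eq0; apply: contraT => cc.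
  exfalso; apply: We; have := WZ (c - c')^-1 _ (WD _ _ h' (WZ (-1) _ h)).
  have -> : u - c' *: e + -1 *: (u - c *: e) = (c - c') *: e.
    by rewrite scaleN1r opprB addrC addrA subrK scalerBl.
  by rewrite scalerA mulVf // scale1r.
exists f; last first.
  by apply: uniq (Hf e) _; rewrite scale1r subrr.
move=> a u v; apply: uniq (Hf _) _.
have := Wc a _ _ (Hf u) (Hf v); congr W.
by rewrite scalerBr scalerA scalerDl opprD addrACA.
Qed.

(** A functional that is 1 at [e1], another that is 1 at e2 - f(e2) e1, and a triangular
    correction. *)
Lemma dual_pair (e1 e2 : E) : e1 != 0 -> (forall a, e2 <> a *: e1) ->
  exists f h, [/\ functional f, functional h, f e1 = 1 /\ f e2 = 0 & h e1 = 0 /\ h e2 = 1].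
Proof.
move=> e10 e2N; have [f ff f1] := functional_exists e10.
have [|h fh h1] := @functional_exists (e2 - f e2 *: e1).
  by rewrite subr_eq0; apply/eqP/e2N.
pose k u := h u + - h e1 * f u.
have fk : functional k by exact: functional_comb.
have k1 : k e1 = 0 by rewrite /k f1; ring.
have k2 : k e2 = 1.
  have := h1; rewrite addrC -scaleNr fh => <-; rewrite /k; ring.
exists (fun u => f u + - f e2 * k u), k; split=> //; first exact: functional_comb.
by rewrite k1 k2 f1; split; ring.
Qed.

End Functional.

(** 1 and T lie in the summands of degree 0 and 2 of a direct sum. *)
Lemma virT_independent (R : realType) (V : meromorphicCFT R) : virT V <> 0 ->
  forall a, virT V <> a *: one_field V.
Proof.
move=> T0 a ET; apply: T0.
pose f (h : nat) : V := if h == 0%N then - a *: one_field V else if h == 2%N then virT V else 0.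
have Hf h : homog h (f h).
  rewrite /f; case: eqP => [->|_]; first by apply/homog_0; exists (- a).
  by case: eqP => [->|_]; [exact: virT_homog|exact: homog0].
have := @homog_direct R V 3 f Hf; rewrite !big_ord_recl big_ord0 /f /= !addr0 add0r.
by rewrite ET scaleNr addNr => /(_ erefl 2%N isT) /= .
Qed.

(** The most singular coefficient of the OPE of T with itself is c/2 times 1, and it vanishes
    together with T. *)
Lemma central_charge_virT0 (R : realType) (V : meromorphicCFT R) : virT V = 0 ->
  central_charge V = 0.
Proof.
move=> T0; have := virT_ope4 V; rewrite T0.
have -> : opeN (-4) (0 : V) 0 = 0.
  have := opeN_linearr (-4) (0 : V) 1 0 0; rewrite scale1r addr0 scale1r => /eqP.
  by rewrite -[X in X == _]addr0 (inj_eq (addrI _)) => /eqP.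
move/esym/eqP; rewrite scaler_eq0 => /orP[|/eqP /one_neq0 //].
by rewrite mulf_eq0 invr_eq0 pnatr_eq0 orbF => /eqP.
Qed.

(** * The multilinear extension and its properties *)

Module Renormalised.
Import mathcomp.boot.fintype mathcomp.boot.finset.
Import Graph GraphSums Recursion.

Section Renormalised.
Context (R : realType) (g n : nat) (p : {poly Cx R}).
Context (n_deg : n = (2 * g + 1)%N \/ n = (2 * g + 2)%N) (p_deg : size p = n.+1).
Context (p_simple : forall a : Cx R, (mup a p <= 1)%N).
Context (V : meromorphicCFT R) (B : field_bundle V g p).
Context (hT : virasoro_covariant B) (s : state B).
Local Notation C := (Cx R).
Local Notation X := (hpoint g p).
Local Notation good := (@good R g p).
Local Notation cc := (central_charge V).
Local Notation al := (cc / 2).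
Local Notation Wn := (Affine.Wn s).
Local Notation Gc := (Recursion.Gc al Wn).
Local Notation GJ := (Recursion.GJ al Wn).
Local Notation one := (one_field V).
Local Notation T := (virT V).

Let p_neq0 : p != 0. Proof. by rewrite -size_poly_gt0 p_deg. Qed.

Let Wn_perm N (P : 'I_N -> X) (t : 'S_N) : injective P -> Wn (fun i => P (t i)) = Wn P.
Proof. exact: Affine.Wn_perm. Qed.

Lemma Gc_sep_affine k : exists D, sep_affine D (@Recursion.Gc _ _ _ al Wn k).
Proof.
case: k => [|k]; first by exists 0%N => -[].
have [D HD] := Affine.affine_all n_deg p_deg p_simple hT s k.
exists D => i P gP iP; pose t := tperm ord0 i.
have iP' : injective (fun j => P (t (lift ord0 j))) by move=> j j' /iP /perm_inj /lift_inj.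
have [u [v [su sv E]]] := HD _ (fun j => gP _) iP'.
exists (u, v) => [|Q gQ PQ]; first by apply/andP.
have tS j : t (lift ord0 j) != i.
  by rewrite -(inj_eq (@perm_inj _ t)) tpermK tpermR eq_sym neq_lift.
rewrite /ev -E //= => [|j]; last exact: PQ.
rewrite -(Gc_perm _ Wn_perm t (upd_inj iP PQ)); congr (Recursion.Gc _ _ _).
apply: fcons_eq => [|j]; first by rewrite /upd tpermL eqxx.
by rewrite /upd -/t (negPf (tS j)).
Qed.

Lemma Gc_poly k : exists Q : mpoly.mpoly (k + k) C,
  forall P : 'I_k -> X, (forall j, good (P j)) -> injective P ->
    Gc P = mpoly.meval (fun j : 'I_(k + k) => match fintype.split j with
                        | inl i => xc (P i) | inr i => yc (P i) end) Q.
Proof.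
have [D HD] := Gc_sep_affine k.
exact: joint_mpoly (joint_of_sep_affine p_neq0 HD).
Qed.

Lemma at_pt_virT0 P : T = 0 -> good P -> at_pt B T P = 0.
Proof.
move=> T0 gP; have [c [xch dz E _]] := x_chart_exists gP.
rewrite -E -(at_ptE p_deg p_simple) // T0.
have := triv_linear B dz 1 0 0; rewrite scale1r addr0 scale1r => /eqP.
by rewrite -[X in X == _]addr0 (inj_eq (addrI _)) => /eqP.
Qed.

(** In the recursion W vanishes. A graph either leaves a smaller nonempty correlator, zero by
    induction, or has every vertex as a head; then it contains a cycle and carries a factor c/2 =
    0. *)
Lemma Gc_zero N (P : 'I_N -> X) : T = 0 -> (0 < N)%N -> (forall i, good (P i)) -> injective P ->
  Gc P = 0.
Proof.
move=> T0; have [k] := ubnP N; elim: k N P => // k IH N P Nk N0 gP iP.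
have al0 : al = 0 by rewrite central_charge_virT0 // mul0r.
have W0 : Wn P = 0.
  rewrite /Affine.Wn; case: N P Nk N0 gP iP => // N P _ _ gP iP.
  set v := fun i => at_pt B T (P i).
  have v0 : v ord0 = 1 *: v ord0 + v ord0 by rewrite /v at_pt_virT0 // scaler0 addr0.
  have := @corr_linear_at _ _ _ _ _ s N.+1 P v v v ord0 1 iP (fun j _ => erefl) (fun j _ => erefl) v0.
  rewrite mul1r => /eqP; rewrite -[X in X == _]addr0 (inj_eq (addrI _)) => /eqP E.
  by rewrite /Nst -/v -E mulr0.
rewrite GcE W0 sub0r big1 ?oppr0 // => G /andP[pG G0].
case: (eqVneq (~: hds G)%SET set0) => [E0|E0]; last first.
  rewrite [X in _ * X]IH ?mulr0 ?card_gt0 //.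
  - by apply: leq_trans (card_hdsC G0) _; rewrite -ltnS.
  - by move=> i j /iP /enum_val_inj.
have hT' : hds G = setT by rewrite -[hds G]setCK E0 setC0.
have tT : tls G = setT.
  apply/eqP; rewrite eqEcard subsetT /= -hT' /hds /tls !card_in_imset //.
    move=> [i j] [i' j'] h h' /= E; subst i'; by rewrite (pinj_fun pG h h').
  move=> [i j] [i' j'] h h' /= E; subst j'; by rewrite (pinj_inj pG h h').
have := cyc_gt0 (balanced_setT hT' tT _); rewrite card_ord => /(_ N0) cG.
by rewrite /weight al0 expr0n eqn0Ngt cG !mul0r.
Qed.

Definition theta (P : X) : fib B P :=
  p.[xc P] *: at_pt B T P - anomaly V P *: at_pt B one P.

(** For T <> 0 and a good point the identity and [vartheta] are independent in the fibre, and a dual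
    pair exists. Otherwise, at a point covered by a chart, only the values on the identity are
    prescribed; a point in no chart gets zero forms. *)
Lemma functionals (P : X) : exists ab : (fib B P -> C) * (fib B P -> C),
  [/\ functional ab.1, functional ab.2,
      forall (c : chart g p) z, dom c z -> c z = P ->
        ab.1 (triv B c P one) = 1 /\ ab.2 (triv B c P one) = 0 &
      T <> 0 -> good P -> ab.1 (theta P) = 0 /\ ab.2 (theta P) = 1].
Proof.
have fz : functional (fun _ : fib B P => 0 : C) by move=> a u v; rewrite mulr0 addr0.
have tz (c : chart g p) z : dom c z -> triv B c (c z) 0 = 0.
  move=> dz; have := triv_linear B dz 1 0 0; rewrite scale1r addr0 scale1r => /eqP.
  by rewrite -[X in X == _]addr0 (inj_eq (addrI _)) => /eqP.
have one0 (c : chart g p) z : dom c z -> triv B c (c z) one != 0.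
  move=> dz; apply/eqP; rewrite -(tz c z dz) => /(bij_inj (triv_bij B dz)); exact: one_neq0.
have [[T0 gP]|N] := pselect (T <> 0 /\ good P).
  have [c [xch dz E _]] := x_chart_exists gP; move: (xc P) dz E => z dz E; subst P.
  have [|f [h [ff fh [f1 f2] [h1 h2]]]] := @dual_pair _ _ (triv B c (c z) one) (theta (c z)) (one0 c z dz).
    move=> a; rewrite /theta -!(at_ptE p_deg p_simple) // => /eqP; rewrite subr_eq -scalerDl => /eqP Ea.
    have pz : p.[xc (c z)] != 0 by case: gP.
    apply: (virT_independent T0 (a := (p.[xc (c z)])^-1 * (a + anomaly V (c z)))).
    apply: (bij_inj (triv_bij B dz)).
    have tZ b u : triv B c (c z) (b *: u) = b *: triv B c (c z) u.
      by have := triv_linear B dz b u 0; rewrite addr0 tz // addr0.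
    by rewrite tZ -scalerA -Ea scalerA mulVf // scale1r.
  exists (f, h); split=> // c' z' dz' E'.
  by rewrite -(triv_one B dz dz' (esym E')).
have [[c [z [dz E]]]|N'] := pselect (exists (c : chart g p) z, dom c z /\ c z = P); last first.
  exists (fun=> 0, fun=> 0); split=> // [c z dz E|T0 gP]; last by case: N.
  by case: N'; exists c, z.
subst P; have [f ff f1] := functional_exists (one0 c z dz).
exists (f, fun=> 0); split=> // [c' z' dz' E'|T0 gP]; last by case: N.
by rewrite -(triv_one B dz dz' (esym E')).
Qed.

Definition fa (P : X) : fib B P -> C := (projT1 (cid (functionals P))).1.
Definition fb (P : X) : fib B P -> C := (projT1 (cid (functionals P))).2.

Lemma fa_lin P : functional (@fa P). Proof. by have [] := projT2 (cid (functionals P)). Qed.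
Lemma fb_lin P : functional (@fb P). Proof. by have [] := projT2 (cid (functionals P)). Qed.

Lemma fab_one (c : chart g p) z : dom c z ->
  fa (triv B c (c z) one) = 1 /\ fb (triv B c (c z) one) = 0.
Proof. by move=> dz; have [_ _ H _] := projT2 (cid (functionals (c z))); exact: (H c z dz erefl). Qed.

Lemma fa_theta P : good P -> fa (theta P) = 0.
Proof.
move=> gP; have [T0|T0] := pselect (T = 0); last first.
  by have [_ _ _ H] := projT2 (cid (functionals P)); case: (H T0 gP).
rewrite /theta at_pt_virT0 // scaler0 sub0r.
have -> : anomaly V P = 0 by rewrite /anomaly central_charge_virT0 // !mul0r.
by rewrite scale0r oppr0 functional0 //; exact: fa_lin.
Qed.

Lemma fb_theta P : T <> 0 -> good P -> fb (theta P) = 1.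
Proof. by move=> T0 gP; have [_ _ _ H] := projT2 (cid (functionals P)); case: (H T0 gP). Qed.

(** Every argument is replaced by its components along 1 ([fa]) and along [vartheta] ([fb]). [S]
    collects the arguments for which [vartheta] is taken, and [GJ] is the value prescribed for
    them. *)
Definition rcorr N (P : 'I_N -> X) (v : forall i, fib B (P i)) : C :=
  \sum_(S : {set 'I_N}) (\prod_j (if j \in S then fb (v j) else fa (v j))) * GJ P S.

Lemma rcorr_sym N (P : 'I_N -> X) v (t : 'S_N) : injective P ->
  @rcorr N (fun i => P (t i)) (fun i => v (t i)) = @rcorr N P v.
Proof.
move=> iP; rewrite /rcorr; have ti : injective t by exact: perm_inj.
have h : bijective (fun S : {set 'I_N} => (t @: S)%SET).
  exists (fun S : {set 'I_N} => (t^-1%g @: S)%SET) => S; rewrite -imset_comp -[RHS]imset_id;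
  by apply: eq_imset => x /=; rewrite ?permK ?permKV.
rewrite [RHS](reindex _ (onW_bij _ h)) /=; apply: eq_bigr => S _.
rewrite (GJ_relabel _ Wn_perm) //; congr (_ * _).
by rewrite [RHS](reindex_inj ti) /=; apply: eq_bigr => j _; rewrite mem_imset.
Qed.

Lemma rcorr_linear N (P : 'I_N -> X) v i a u w : injective P ->
  @rcorr N P (dfwith v i (a *: u + w)) =
    a * @rcorr N P (dfwith v i u) + @rcorr N P (dfwith v i w).
Proof.
move=> _; rewrite /rcorr mulr_sumr -big_split; apply: eq_bigr => S _ /=.
rewrite mulrA -mulrDl; congr (_ * _).
pose F (x : forall i, fib B (P i)) j : C := if j \in S then fb (x j) else fa (x j).
have E x : \prod_j F (dfwith v i x) j = (if i \in S then fb x else fa x) * \prod_(j | j != i) F v j.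
  rewrite (bigD1 i) //; congr (_ * _); first by rewrite /F dfwithin.
  by apply: eq_bigr => j ji; rewrite /F dfwithout // eq_sym.
have := E (a *: u + w); have := E u; have := E w; rewrite /F => -> -> ->.
rewrite mulrA -mulrDl; congr (_ * _).
by case: ifP => _; [exact: fb_lin|exact: fa_lin].
Qed.

Definition rcorrelator : correlator B := Correlator rcorr_sym rcorr_linear.

Lemma sum_drop_first N (F F' : 'I_N.+1 -> C) (G : {set 'I_N.+1} -> C) : F ord0 = 1 -> F' ord0 = 0 ->
  \sum_(S : {set 'I_N.+1}) (\prod_j (if j \in S then F' j else F j)) * G S =
  \sum_(S : {set 'I_N})
    (\prod_j (if j \in S then F' (lift ord0 j) else F (lift ord0 j))) * G (lift ord0 @: S)%SET.
Proof.
move=> F0 F'0; rewrite (bigID (fun S : {set 'I_N.+1} => ord0 \in S)) /= big1 ?add0r; last first.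
  by move=> S S0; rewrite big_ord_recl S0 F'0 !mul0r.
rewrite (reindex_onto (fun S : {set 'I_N} => lift ord0 @: S)%SET
   (fun S : {set 'I_N.+1} => [set j | lift ord0 j \in S]%SET)) /=; last first.
  move=> S S0; apply/setP => x; apply/imsetP/idP => [[j]|xS]; first by rewrite inE => jS ->.
  case: (unliftP ord0 x) xS => [j ->|->] xS; last by rewrite xS in S0.
  by exists j; rewrite ?inE.
have mem (S : {set 'I_N}) j : (lift ord0 j \in (lift ord0 @: S)%SET) = (j \in S).
  by rewrite mem_imset //; exact: lift_inj.
have mem0 (S : {set 'I_N}) : (ord0 \in (lift ord0 @: S)%SET) = false.
  by apply/negbTE/imsetP => -[j _ /eqP]; rewrite (negPf (neq_lift _ _)).
apply: eq_big => [S|S _].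
  by rewrite mem0 /=; apply/eqP/setP => j; rewrite inE mem.
rewrite big_ord_recl mem0 F0 mul1r; congr (_ * _).
by apply: eq_bigr => j _; rewrite mem.
Qed.

(** Passes to a sum over [M], the places where the identity component is taken; in the graph formula
    [M] becomes the set of loops. *)
Lemma sum_over_subset N (K : {set 'I_N}) (F F' : 'I_N -> C) (G : {set 'I_N} -> C) :
  \sum_(S : {set 'I_#|K|})
     (\prod_k (if k \in S then F' (enum_val k) else F (enum_val k))) * G (enum_val @: S)%SET =
  \sum_(M : {set 'I_N} | M \subset K) (\prod_(m in M) F m) * (\prod_(m in (K :\: M)%SET) F' m) * G (K :\: M)%SET.
Proof.
pose e (k : 'I_#|K|) : 'I_N := enum_val k.
have ei : injective e by exact: enum_val_inj.
have img (q : pred 'I_N) : (e @: [set k | q (e k)] = K :&: [set x | q x])%SET.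
  apply/setP => x; rewrite !inE; apply/imsetP/andP => [[k]|[xK qx]].
    by rewrite inE => qk ->; split=> //; exact: enum_valP.
  by exists (enum_rank_in xK x); rewrite ?inE /e enum_rankK_in.
rewrite (reindex_onto (fun M : {set 'I_N} => [set k | e k \notin M]%SET)
   (fun S : {set 'I_#|K|} => e @: ~: S)%SET) /=; last first.
  by move=> S _; apply/setP => k; rewrite inE mem_imset // inE negbK.
apply: eq_big => [M|M].
  have -> : (~: [set k | e k \notin M] = [set k | e k \in M])%SET.
    by apply/setP => k; rewrite !inE negbK.
  rewrite (img (fun x => x \in M)); apply/eqP/idP => [<-|/setIidPr E].
    exact: subsetIl.
  by rewrite -[RHS]E; congr (_ :&: _)%SET; apply/setP => x; rewrite inE.
move=> /eqP EM; have sM : M \subset K.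
  by rewrite -EM; apply/subsetP => x /imsetP[k _ ->]; exact: enum_valP.
have -> : (enum_val @: [set k | e k \notin M] = K :\: M)%SET.
  rewrite (img (fun x => x \notin M)); apply/setP => x; by rewrite !inE andbC.
congr (_ * _).
transitivity (\prod_(x in K) (if x \in M then F x else F' x)).
  rewrite [RHS]big_enum_val /=; apply: eq_bigr => k _; by rewrite inE /e if_neg.
rewrite (bigID (fun x => x \in M)) /=; congr (_ * _).
  apply: eq_big => [x|x /andP[_ ->] //].
  by case: (boolP (x \in M)) => xM; rewrite ?andbF // andbT; exact: (subsetP sM).
by apply: eq_big => [x|x /andP[_ /negPf-> //]]; rewrite !inE andbC.
Qed.

(** The values of [fb] are 1 only when T <> 0. When T = 0, either the correlator vanishes by
    [Gc_zero] or [S] is empty. *)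
Lemma prod_fb_GJ N (P : 'I_N -> X) (S : {set 'I_N}) (F : 'I_N -> C) :
  (forall i, good (P i)) -> injective P -> (forall j, j \in S -> T <> 0 -> F j = 1) ->
  (\prod_(j in S) F j) * GJ P S = GJ P S.
Proof.
move=> gP iP H; have [T0|T0] := pselect (T = 0); last first.
  by rewrite big1 ?mul1r // => j jS; exact: H.
case: (eqVneq S set0) => [->|S0]; first by rewrite big_set0 mul1r.
rewrite [GJ P S]Gc_zero ?mulr0 ?card_gt0 //.
by move=> i j /iP /enum_val_inj.
Qed.

Lemma rcorr_one N c z (cs : 'I_N -> chart g p) phis zs :
  admissible (fcons c cs) (fcons z zs) ->
  npoint rcorrelator (fcons c cs) (fcons one phis) (fcons z zs) = npoint rcorrelator cs phis zs.
Proof.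
move=> ad; have /admissible_cons[dz _ _] := ad.
pose Fa (c' : chart g p) z' phi := fa (triv B c' (c' z') phi).
pose Fb (c' : chart g p) z' phi := fb (triv B c' (c' z') phi).
rewrite /npoint /= /rcorr.
have := @sum_drop_first N (fun j => Fa (fcons c cs j) (fcons z zs j) (fcons one phis j))
  (fun j => Fb (fcons c cs j) (fcons z zs j) (fcons one phis j))
  (GJ (fun i => (fcons c cs i) (fcons z zs i))).
rewrite !fcons0 => -> //; rewrite /Fa /Fb ?(fab_one dz) //; [|by case: (fab_one dz)..].
apply: eq_bigr => S _; congr (_ * _).
  apply: eq_bigr => j _; rewrite -/(Fa _ _ _) -/(Fb _ _ _) !fconsS; by [].
rewrite (GJ_relabel _ Wn_perm S ad.2 (@lift_inj _ ord0)); congr (Recursion.GJ _ _ _ _).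
by apply/funext => i; rewrite !fconsS.
Qed.

Lemma rcorr0 (P : 'I_0 -> X) v : rcorr v = s 0%N P v.
Proof.
rewrite /rcorr (big_pred1 set0) => [|S]; last first.
  by apply/esym/eqP/setP => -[].
rewrite big_ord0 mul1r.
have e0 (Q : 'I_0 -> X) w : s 0%N Q w = s 0%N P v.
  have EQ : Q = P by apply/funext => -[].
  subst Q; congr (s _ _ _); by apply: functional_extensionality_dep => -[].
have Z : (set0 : {set 'I_0}) = setT by apply/setP => -[].
rewrite Z GJ_setT //; last by move=> [].
rewrite GcE big1 ?subr0 => [|G /andP[_ /set0Pn[[[] //]]]].
by rewrite /Affine.Wn big_ord0 mul1r /Nst.
Qed.

Lemma varthetaE (c : chart g p) x : x_chart c -> dom c x -> vartheta B c x = theta (c x).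
Proof.
by move=> xch dx; rewrite /vartheta /Tp /theta /anomaly -!(at_ptE p_deg p_simple) // (xch x dx).2.
Qed.

Section XCharts.
Context (N : nat) (c : 'I_N -> chart g p) (x : 'I_N -> C).
Context (xch : forall i, x_chart (c i)) (ad : admissible c x).
Local Notation P := (fun i => c i (x i)).

Let gP i : good (P i). Proof. exact: (x_chart_good p_simple p_neq0 (@xch i) (ad.1 i)). Qed.
Let iP : injective P. Proof. exact: ad.2. Qed.

(** [fa] vanishes on [vartheta], so only the full set [S] contributes. *)
Lemma rcorr_vartheta : rcorr (fun i => vartheta B (c i) (x i)) = Gc P.
Proof.
rewrite /rcorr (bigD1 [set: 'I_N]%SET) //= [X in _ + X]big1 ?addr0 => [|S ST].
  rewrite [X in X * _](_ : _ = \prod_(j in [set: 'I_N]%SET) fb (vartheta B (c j) (x j))); last first.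
    by apply: eq_big => [j|j _]; rewrite inE.
  rewrite prod_fb_GJ ?GJ_setT // => j _ T0.
  by rewrite varthetaE ?fb_theta //; exact: ad.1.
have [j jS] : exists j, j \notin S.
  apply/existsP; apply: contraNT ST => /existsPn H.
  by apply/eqP/setP => j; rewrite inE; exact/negPn/H.
rewrite (bigD1 j) //= (negPf jS) varthetaE ?fa_theta ?mul0r //; exact: ad.1.
Qed.

Lemma fa_Tp i : fa (Tp B (c i) (x i)) = anomaly V (P i).
Proof.
have E : Tp B (c i) (x i) = anomaly V (P i) *: triv B (c i) (c i (x i)) one + theta (P i).
  rewrite -varthetaE //; last exact: ad.1.
  by rewrite /vartheta /anomaly (xch (ad.1 i)).2 addrC subrK.
by rewrite E fa_lin fa_theta // addr0 (fab_one (ad.1 i)).1 mulr1.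
Qed.

Lemma fb_Tp i : T <> 0 -> fb (Tp B (c i) (x i)) = 1.
Proof.
move=> T0; have E : Tp B (c i) (x i) = anomaly V (P i) *: triv B (c i) (c i (x i)) one + theta (P i).
  rewrite -varthetaE //; last exact: ad.1.
  by rewrite /vartheta /anomaly (xch (ad.1 i)).2 addrC subrK.
by rewrite E fb_lin fb_theta // (fab_one (ad.1 i)).2 mulr0 add0r.
Qed.

(** At an isolated vertex T p is [anomaly] times 1 plus [vartheta], and taking the identity there
    contributes the weight [al * wt] of a loop. A tail that is not a head carries [vartheta], on
    which [fa] vanishes, so only sets [M] of isolated vertices survive. *)
Lemma graph_termE G : pinj G -> no_loop G ->
  graph_term rcorrelator c x G = weight al (wt P) G *
    \sum_(M : {set 'I_N} | M \subset isolated G)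
       (\prod_(m in M) (al * wt P m m)) * GJ P (~: hds G :\: M)%SET.
Proof.
move=> pG nG; rewrite /graph_term /=.
have EK : ((tails G :&: ~: heads G) :|: ~: (tails G :|: heads G) = ~: hds G)%SET.
  rewrite tailsE headsE; apply/setP => i; rewrite !inE.
  by case: (i \in tls G); case: (i \in hds G).
rewrite EK nloopsE // /weight; congr (_ * _ * _).
  by apply: eq_bigr => -[i j] ij /=; rewrite /wt (negPf (no_loopP _ nG _ _ ij)).
pose v m := if m \in (tails G :&: ~: heads G)%SET then vartheta B (c m) (x m) else Tp B (c m) (x m).
have fav m : fa (v m) = if (m \in tls G) && (m \notin hds G) then 0 else anomaly V (P m).
  rewrite -tailsE -headsE -in_setC -in_setI /v; case: ifP => _; [rewrite varthetaE ?fa_theta //; exact: ad.1|exact: fa_Tp].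
have fbv m : T <> 0 -> fb (v m) = 1.
  by move=> T0; rewrite /v; case: ifP => _; [rewrite varthetaE ?fb_theta //; exact: ad.1|exact: fb_Tp].
transitivity (\sum_(S : {set 'I_#|~: hds G|%SET})
   (\prod_k (if k \in S then fb (v (enum_val k)) else fa (v (enum_val k)))) * GJ P (enum_val @: S)%SET).
  rewrite /rcorr; apply: eq_bigr => S _; congr (_ * _).
  by rewrite (GJ_relabel _ Wn_perm S iP) //; exact: enum_val_inj.
rewrite (@sum_over_subset N (~: hds G)%SET (fun m => fa (v m)) (fun m => fb (v m)) (GJ P)).
rewrite (bigID (fun M : {set 'I_N} => M \subset isolated G)) /= [X in _ + X]big1 ?addr0.
  apply: eq_big => [M|M /andP[_ sM]].
    apply: andb_idl => sM; apply: subset_trans sM _.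
    by apply/subsetP => i; rewrite !inE negb_or => /andP[].
  rewrite -mulrA prod_fb_GJ //; last by move=> j _; exact: fbv.
  congr (_ * _); apply: eq_bigr => m mM; rewrite fav.
  have := subsetP sM m mM; rewrite !inE negb_or => /andP[/negPf-> _] /=.
  rewrite /anomaly /wt eqxx invfM.
  by move: (p.[_]^-1) (p^`().[_]) cc => a b k; field.
move=> M /andP[sK /subsetPn[m mM mI]].
rewrite (bigD1 m) //= fav.
have mh : m \notin hds G by have := subsetP sK m mM; rewrite !inE.
have mt : m \in tls G by move: mI; rewrite !inE negb_or mh andbT negbK.
by rewrite mt mh !mul0r.
Qed.

Lemma graph_expansion : npoint s c (fun=> T) x * (\prod_i p.[x i]) =
  \sum_(G in admissible_graphs N) graph_term rcorrelator c x G.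
Proof.
transitivity (Wn P).
  rewrite /Affine.Wn mulrC (Nst_npoint p_deg p_simple) //; last exact: ad.1.
  by congr (_ * _); apply: eq_bigr => i _; rewrite (xch (ad.1 i)).2.
rewrite (Wn_setT al Wn_perm iP) graph_sum_no_loop.
apply: eq_big => [G|G]; first by rewrite admissible_graphsE.
by move=> /andP[pG nG]; rewrite graph_termE.
Qed.

End XCharts.

End Renormalised.
End Renormalised.

Theorem theorem3 (R : realType) (g n : nat) (p : {poly Cx R})
    (g_ge1 : (1 <= g)%N)
    (n_deg : n = (2 * g + 1)%N \/ n = (2 * g + 2)%N)
    (p_deg : size p = n.+1)
    (p_simple : forall a : Cx R, (mup a p <= 1)%N)
    (V : meromorphicCFT R) (B : field_bundle V g p)
    (hT : virasoro_covariant B) (s : state B) :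
  exists r : correlator B,
    [/\ (* <1>_r = <1> *)
        (forall (P : 'I_0 -> hpoint g p) v, r 0%N P v = s 0%N P v) /\
        (forall (c : chart g p) (z : Cx R), dom c z ->
          npoint r (fun _ : 'I_1 => c) (fun _ => one_field V) (fun _ => z) =
          npoint s (fun _ : 'I_1 => c) (fun _ => one_field V) (fun _ => z)),
        (* 1., with k = N + 2 *)
        forall (N : nat) (c : chart g p) (z : Cx R) (cs : 'I_N.+1 -> chart g p)
            (phis : 'I_N.+1 -> V) (zs : 'I_N.+1 -> Cx R),
          admissible (fcons c cs) (fcons z zs) ->
          (forall i, phis i = one_field V \/ phis i = virT V) ->
          npoint r (fcons c cs) (fcons (one_field V) phis) (fcons z zs) =
          npoint r cs phis zs,
        (* 2. *)
        forall k : nat, exists Q : mpoly.mpoly (k + k) (Cx R),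
          forall (c : 'I_k -> chart g p) (x : 'I_k -> Cx R),
          (forall i, x_chart (c i)) -> admissible c x ->
          r k (fun i => c i (x i)) (fun i => vartheta B (c i) (x i)) =
          mpoly.meval (fun j : 'I_(k + k) => match fintype.split j with
                                | inl i => x i
                                | inr i => yc (c i (x i))
                                end) Q
      & (* 3. *)
        forall (N : nat) (c : 'I_N -> chart g p) (x : 'I_N -> Cx R),
          (forall i, x_chart (c i)) -> admissible c x ->
          npoint s c (fun _ => virT V) x * (\prod_i p.[x i]) =
          \sum_(G in admissible_graphs N) graph_term r c x G].

Proof.
exists (Renormalised.rcorrelator p_deg p_simple s); split.
- split=> [P v|c z dz]; first exact: Renormalised.rcorr0.
  (* A single point is the first entry of a tuple with no others, so omitting the identity leads to
     the zero-point function on both sides. *)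
  have ad : admissible (fcons c (fun _ : 'I_0 => c)) (fcons z (fun _ : 'I_0 => z)).
    by apply/admissible_cons; split=> // [[]//|]; split=> [[]|[]].
  have E (A : Type) (a : A) : fcons a (fun _ : 'I_0 => a) = fun=> a.
    by apply/esym/fcons_eq => [|[]].
  have := Renormalised.rcorr_one p_deg p_simple s (fun=> one_field V) ad.
  have := state_one s (fun=> one_field V) ad; rewrite !E => -> ->.
  exact: Renormalised.rcorr0.
- by move=> N c z cs phis zs ad _; exact: Renormalised.rcorr_one.
- move=> k; have [Q HQ] := Renormalised.Gc_poly n_deg p_deg p_simple hT s k.
  exists Q => c x xch ad; rewrite [LHS]Renormalised.rcorr_vartheta // HQ.
  + by apply: mpoly.meval_eq => j; case: fintype.split => // i; rewrite (xch i _ (ad.1 i)).2.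
  + by move=> j; apply: (x_chart_good p_simple _ (xch j) (ad.1 j)); rewrite -size_poly_gt0 p_deg.
  + exact: ad.2.
- by move=> N c x xch ad; exact: Renormalised.graph_expansion.
Qed.
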